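(* Suppose that either Assumption A or Assumptions B1--B4 hold. Let $\sigma^2=\mathrm{Var}(X_1)<\infty$ and $a(b)=\int_b^\infty P(X>u)\,du/P(X>b)$. Then, conditionally on $\{\tau_b<\infty\}$, as $b\to\infty$, $$\left(\frac{\tau_b}{a(b)},\ \left\{\frac{S_{\lfloor t\tau_b\rfloor}-t\mu\tau_b}{\sqrt{\tau_b}}\right\}_{0\le t<1},\ \frac{S_{\tau_b}-b}{a(b)}\right)\Rightarrow\left(\frac{Y_0}{|\mu|},\ \{\sigma B(t)\}_{0\le t<1},\ Y_1\right)$$ weakly in $\mathbb R\times D[0,1)\times\mathbb R$, where $\{B(t):0\le t<1\}$ is a standard Brownian motion independent of $(Y_0,Y_1)$. The joint law of the non-negative random variables $Y_0,Y_1$ is defined by $P(Y_0>y_0,Y_1>y_1)=P(Y_1>y_0+y_1)$ for $y_0,y_1\ge0$, with $Y_0\overset{d}{=}Y_1$, and: - if Assumption A holds, $P(Y_1>t)=\big(1+t/(\iota-1)\big)^{-(\iota-1)}$ for $t\ge0$; - if Assumptions B1--B4 hold, $Y_1$ is exponentially distributed with mean $1$, and consequently $Y_0$ and $Y_1$ are independent.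
   Context: $X,X_1,X_2,\dots$ are i.i.d. real random variables with distribution function $F$, $\bar F(x)=1-F(x)=P(X>x)$, and mean $\mu=EX\in(-\infty,0)$. Write $\bar F(x)=e^{-\Lambda(x)}$, where $\Lambda$ is the cumulative hazard function; $F$ has density $f(x)=\lambda(x)e^{-\Lambda(x)}$, where $\lambda$ is the hazard function. $S_0=0$, $S_n=X_1+\dots+X_n$, $\tau_b=\inf\{n\ge1:S_n>b\}$. $D[0,1)$ is the space of right-continuous functions with left limits on $[0,1)$ with the Skorokhod topology. Assumption A: $\bar F(x)=L(x)x^{-\iota}$ with $\iota>1$ and $L$ slowly varying at infinity ($\lim_{x\to\infty}L(xt)/L(x)=1$ for all $t\in(0,1]$). Assumptions B1--B4: there is $b_0>0$ such that for $x\ge b_0$: (B1) $\lim_{x\to\infty}x\lambda(x)=\infty$; (B2) there is $\beta_0\in(0,1)$ with $\lambda(x)/\Lambda(x)\le\beta_0x^{-1}$ for $x\ge b_0$; (B3) $\Lambda$ is concave (equivalently $\lambda$ is non-increasing) on $[b_0,\infty)$; (B4) $P(X>x+t/\lambda(x)\mid X>x)=e^{-t}(1+o(1))$ as $x\to\infty$, uniformly over compact sets of $t\ge0$, and for some $\alpha>1$, $P(X>x+t/\lambda(x)\mid X>x)\le t^{-\alpha}$ for all $t,x>b_0$. *)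

(* Defs.v *)
From HB Require Import structures.
From mathcomp Require Import all_boot all_order all_algebra.
From mathcomp Require Import finmap.
From mathcomp Require Import all_classical all_reals all_analysis.

Import Order.TTheory GRing.Theory Num.Theory.
Import numFieldNormedType.Exports.

Set Implicit Arguments.
Unset Strict Implicit.
Unset Printing Implicit Defensive.

Local Open Scope classical_set_scope.
Local Open Scope ring_scope.

Definition cadlag01 (R : realType) (x : R -> R) : Prop :=
  (forall t : R, 0 <= t < 1 -> x s @[s --> t^'+] --> x t) /\
  (forall t : R, 0 < t < 1 -> exists l : R, x s @[s --> t^'-] --> l).

(* Elements of D[0,1) are represented by their extension by 0 to the real line,
   so that equality in [skorokhod01 R] is equality on [0,1). *)
Record skorokhod01 (R : realType) := Skorokhod01 {
  path01 :> R -> R;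
  path01_cadlag : cadlag01 path01;
  path01_out : forall t : R, ~~ (0 <= t < 1) -> path01 t = 0
}.

HB.instance Definition _ (R : realType) := gen_eqMixin (skorokhod01 R).
HB.instance Definition _ (R : realType) := gen_choiceMixin (skorokhod01 R).

Definition restr01 (R : realType) (x : R -> R) : R -> R :=
  fun t => if 0 <= t < 1 then x t else 0.

Lemma restr01_cadlag (R : realType) (x : R -> R) :
  cadlag01 x -> cadlag01 (restr01 x).
Proof.
move=> [rx lx]; split=> t t01.
- rewrite /restr01 t01; move/andP: t01 (t01) => [t0 t1] t01.
  apply: cvg_trans (rx t t01); apply: near_eq_cvg; near=> s.
  suff -> : 0 <= s < 1 by [].
  apply/andP; split; last by near: s; exact: nbhs_right_lt.
  by apply: (le_trans t0); apply: ltW; near: s; exact: nbhs_right_gt.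
- have [l xl] := lx t t01; exists l; apply: cvg_trans xl.
  move/andP: t01 => [t0 t1]; apply: near_eq_cvg; near=> s.
  suff -> : (restr01 x) s = x s by [].
  rewrite /restr01; suff -> : 0 <= s < 1 by [].
  apply/andP; split; first by apply: ltW; near: s; exact: nbhs_left_gt.
  by apply: lt_trans t1; near: s; exact: nbhs_left_lt.
Unshelve. all: by end_near. Qed.

Lemma restr01_out (R : realType) (x : R -> R) t :
  ~~ (0 <= t < 1) -> restr01 x t = 0.
Proof. by rewrite /restr01 => /negbTE ->. Qed.

Definition to_skorokhod01 (R : realType) (x : R -> R) (cx : cadlag01 x) :
    skorokhod01 R :=
  Skorokhod01 (restr01_cadlag cx) (@restr01_out R x).

(* An increasing bijection of [0,1) is automatically a homeomorphism. *)
Definition time_change01 (R : realType) (l : R -> R) : Prop :=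
  set_bij `[0, 1[%classic `[0, 1[%classic l /\
  {in `[0, 1[ &, {homo l : s t / s < t}}.

(* Skorokhod (J1) topology on the half-open interval: the sets
   [skorokhod_ball x T e], T < 1, e > 0, form a base of neighbourhoods of x.
   Hence y_n --> x iff for every T < 1 there are time changes l_n with
   sup_{t <= T} |l_n(t) - t| --> 0 and sup_{t <= T} |y_n(l_n(t)) - x(t)| --> 0,
   the usual description of J1 convergence on D[0,oo) transported to [0,1).
   No closeness is required at the right end point. *)
Definition skorokhod_ball (R : realType) (x : skorokhod01 R) (T e : R) :
    set (skorokhod01 R) :=
  [set y | exists2 l, time_change01 l &
    forall t : R, 0 <= t <= T -> `|l t - t| < e /\ `|y (l t) - x t| < e].

Definition skorokhod_nbhs (R : realType) (x : skorokhod01 R) :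
    set_system (skorokhod01 R) :=
  [set A | exists T e : R,
    [/\ 0 <= T < 1, 0 < e & skorokhod_ball x T e `<=` A]].

HB.instance Definition _ (R : realType) :=
  hasNbhs.Build (skorokhod01 R) (@skorokhod_nbhs R).

Lemma time_change01_id (R : realType) : time_change01 (@id R).
Proof. by split=> //; split=> // x /= xI; exists x. Qed.

Lemma time_change01_in (R : realType) (l : R -> R) t :
  time_change01 l -> 0 <= t < 1 -> 0 <= l t < 1.
Proof.
move=> [[fl _ _] _] t01; have := fl t; rewrite /= !in_itv /=; exact.
Qed.

Lemma time_change01_comp (R : realType) (l m : R -> R) :
  time_change01 l -> time_change01 m -> time_change01 (m \o l).
Proof.
move=> tl tm; case: (tl) (tm) => bl hl [bm hm]; split.
  exact: (set_bij_comp bl bm).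
have lI t : t \in `[0, 1[ -> l t \in `[0, 1[.
  by rewrite !in_itv /=; exact: time_change01_in.
by move=> s t sI tI st /=; apply: hm; [exact: lI|exact: lI|exact: hl].
Qed.

Lemma skorokhod_ball_center (R : realType) (x : skorokhod01 R) (T e : R) :
  0 < e -> skorokhod_ball x T e x.
Proof.
move=> e0; exists id; first exact: time_change01_id.
by move=> t _; rewrite !subrr normr0.
Qed.

Lemma skorokhod_ballS (R : realType) (x : skorokhod01 R) (T T' e e' : R) :
  T' <= T -> e <= e' -> skorokhod_ball x T e `<=` skorokhod_ball x T' e'.
Proof.
move=> TT ee y [l tl yl]; exists l => // t /andP[t0 tT].
have [] := yl t; first by rewrite t0 (le_trans tT).
by move=> h1 h2; split; exact: lt_le_trans ee.
Qed.

Lemma skorokhod_nbhs_filter (R : realType) (x : skorokhod01 R) :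
  ProperFilter (nbhs x).
Proof.
split.
  by move=> [T [e [_ e0]]]; apply; exact: (@skorokhod_ball_center _ x T e).
split.
- by exists 0, 1; split=> //; rewrite lexx ltr01.
- move=> A B [T [e [/andP[T0 T1] e0 TA]]] [T' [e' [/andP[T'0 T'1] e'0 TB]]].
  exists (Num.max T T'), (Num.min e e'); split.
  + by rewrite le_max T0 /= gt_max T1 T'1.
  + by rewrite lt_min e0.
  + move=> y yb; split; [apply: TA|apply: TB].
      by apply: skorokhod_ballS yb; rewrite ?le_max ?ge_min lexx.
    by apply: skorokhod_ballS yb; rewrite ?le_max ?ge_min lexx orbT.
- move=> A B AB [T [e [T01 e0 TA]]]; exists T, e; split=> //.
  exact: subset_trans AB.
Qed.

Lemma skorokhod_nbhs_singleton (R : realType) (x : skorokhod01 R)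
  (A : set (skorokhod01 R)) : nbhs x A -> A x.
Proof. by move=> [T [e [_ e0]]]; apply; exact: skorokhod_ball_center. Qed.

Lemma skorokhod_nbhs_nbhs (R : realType) (x : skorokhod01 R)
  (A : set (skorokhod01 R)) : nbhs x A -> nbhs x (nbhs^~ A).
Proof.
move=> [T [e [/andP[T0 T1] e0 TA]]]; exists T, (e / 2).
split; [by rewrite T0| by rewrite divr_gt0|].
move=> y [l tl yl].
have /andP[lT0 lT1] : 0 <= l T < 1 by apply: time_change01_in => //; rewrite T0.
exists (l T), (e / 2); split; [by rewrite lT0|by rewrite divr_gt0|].
move=> z [m tm zm]; apply: TA; exists (m \o l); first exact: time_change01_comp.
move=> t /andP[t0 tT].
have t1 : t < 1 := le_lt_trans tT T1.
have [lt1 lt2] := yl t (introT andP (conj t0 tT)).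
have /andP[l0 _] : 0 <= l t < 1 by apply: time_change01_in => //; rewrite t0.
have llT : l t <= l T.
  move: tT; rewrite le_eqVlt => /orP[/eqP -> //|tT]; apply: ltW.
  by case: tl => _; apply=> //; rewrite in_itv /= ?t0 ?T0.
have [mt1 mt2] := zm (l t) (introT andP (conj l0 llT)).
split; rewrite /= [e]splitr.
  by rewrite -(subrKA (l t)); apply: le_lt_trans (ler_normD _ _) (ltrD _ _).
by rewrite -(subrKA (y (l t))); apply: le_lt_trans (ler_normD _ _) (ltrD _ _).
Qed.

HB.instance Definition _ (R : realType) :=
  @Nbhs_isNbhsTopological.Build (skorokhod01 R)
    (@skorokhod_nbhs_filter R) (@skorokhod_nbhs_singleton R)
    (@skorokhod_nbhs_nbhs R).

Definition mutually_independent d (T : measurableType d) (R : realType)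
    (P : probability T R) (I : choiceType) (X : I -> T -> R) : Prop :=
  forall (J : {fset I}) (A : I -> set R), (forall i, measurable (A i)) ->
    P (\bigcap_(i in [set` J]) (X i @^-1` A i)) =
    (\prod_(i <- J) P (X i @^-1` A i))%E.

Definition same_law d (T : measurableType d) (R : realType)
    (P : probability T R) (X Y : {RV P >-> R}) : Prop :=
  forall A : set R, measurable A -> distribution P X A = distribution P Y A.

Definition generated_by (T I : Type) (R : realType) (D : set I)
    (X : I -> T -> R) : set (set T) :=
  <<s [set E | exists i (A : set R),
         [/\ D i, measurable A & E = X i @^-1` A]] >>.

Definition independent_sigma d (T : measurableType d) (R : realType)
    (P : probability T R) (G H : set (set T)) : Prop :=
  forall A B, G A -> H B -> P (A `&` B) = (P A * P B)%E.

Definition cond_prob d (T : measurableType d) (R : realType)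
    (P : probability T R) (A C : set T) : R :=
  fine (P (A `&` C)) / fine (P C).

Definition cond_expectation d (T : measurableType d) (R : realType)
    (P : probability T R) (C : set T) (f : T -> R) : R :=
  (\int[P]_(w in C) f w) / fine (P C).

(* Weak convergence, as b tends to +oo, of the law of [Z b] given [C b] to the
   law of [Zlim]. *)
Definition cond_cvg_in_law (R : realType) d (T : measurableType d)
    (P : probability T R) (C : R -> set T) d' (T' : measurableType d')
    (P' : probability T' R) (E : topologicalType)
    (Z : R -> T -> E) (Zlim : T' -> E) : Prop :=
  forall Phi : E -> R, continuous Phi -> (exists M : R, forall z, `|Phi z| <= M) ->
    cond_expectation P (C b) (Phi \o Z b) @[b --> +oo] -->
    \int[P']_w Phi (Zlim w).

Section random_walk.
Context {d} {T : measurableType d} {R : realType}.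
Implicit Types (X : nat -> T -> R) (b : R) (w : T).

(* [X i] stands for the (i+1)-st increment. *)
Definition walk X (n : nat) w : R := \sum_(i < n) X i w.

Definition tau X b w : \bar R :=
  ereal_inf [set n%:R%:E | n in [set n : nat | (1 <= n)%N /\ b < walk X n w]].

Definition ruin X b : set T := [set w | (tau X b w < +oo)%E].

(* Both are 0 outside of [ruin X b]; every use is conditional on [ruin X b]. *)
Definition rtau X b w : R := fine (tau X b w).

Definition ntau X b w : nat := Num.truncn (rtau X b w).

Lemma rtau_ge0 X b w : 0 <= rtau X b w.
Proof.
apply: fine_ge0; apply: le_ereal_inf_tmp => _ [n _ <-].
by rewrite lee_fin ler0n.
Qed.

Definition scaled_walk X (mu b : R) w (t : R) : R :=
  (walk X (Num.truncn (t * rtau X b w)) w - t * mu * rtau X b w) /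
  Num.sqrt (rtau X b w).

Lemma truncn_right (c t : R) : 0 <= c -> 0 <= t ->
  \forall s \near t^'+, Num.truncn (s * c) = Num.truncn (t * c).
Proof.
rewrite le_eqVlt => /predU1P[<-|c0] t0.
  by near=> s; rewrite !mulr0.
have tc0 : 0 <= t * c by rewrite mulr_ge0// ltW.
near=> s; apply: truncn_def; apply/andP; split.
  apply: (@le_trans _ _ (t * c)); first by rewrite truncn_le.
  by rewrite ler_pM2r//; apply: ltW; near: s; exact: nbhs_right_gt.
rewrite -ltr_pdivlMr//; near: s; apply: nbhs_right_lt.
by rewrite ltr_pdivlMr// truncnS_gt.
Unshelve. all: by end_near. Qed.

Lemma truncn_left (c t : R) : 0 <= c -> 0 < t ->
  exists n : nat, \forall s \near t^'-, Num.truncn (s * c) = n.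
Proof.
rewrite le_eqVlt => /predU1P[<-|c0] t0.
  by exists 0%N; near=> s; rewrite mulr0 truncn0.
have tc0 : 0 < t * c by rewrite mulr_gt0.
have [n /andP[n1 n2]] : exists n : nat, n%:R < t * c <= n.+1%:R.
  have /andP[h1 h2] := truncn_itv (ltW tc0).
  have [h|h] := ltP (Num.truncn (t * c))%:R (t * c).
    by exists (Num.truncn (t * c)); rewrite h ltW.
  have e : t * c = (Num.truncn (t * c))%:R by apply/eqP; rewrite eq_le h h1.
  case: (Num.truncn (t * c)) e => [e|n e]; first by rewrite e ltxx in tc0.
  by exists n; rewrite e lexx andbT ltr_nat.
exists n; near=> s; apply: truncn_def; apply/andP; split.
  rewrite -ler_pdivrMr//; apply: ltW; near: s; apply: nbhs_left_gt.
  by rewrite ltr_pdivrMr.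
apply: lt_le_trans n2; rewrite ltr_pM2r//; near: s; exact: nbhs_left_lt.
Unshelve. all: by end_near. Qed.

Lemma scaled_walk_cadlag X mu b w : cadlag01 (scaled_walk X mu b w).
Proof.
have c0 := rtau_ge0 X b w.
have lin (n : nat) (F : set_system R) (t : R) : Filter F -> F --> t ->
    (walk X n w - s * mu * rtau X b w) / Num.sqrt (rtau X b w) @[s --> F] -->
    (walk X n w - t * mu * rtau X b w) / Num.sqrt (rtau X b w).
  move=> FF Ft; apply: cvgMr_tmp; apply: cvgB; first exact: cvg_cst.
  by apply: cvgMr_tmp; apply: cvgMr_tmp.
split=> t /andP[t0 t1].
  apply: cvg_trans (lin (Num.truncn (t * rtau X b w)) t^'+ t _ _).
    apply: near_eq_cvg; near=> s; rewrite /scaled_walk; congr ((walk X _ _ - _) / _).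
    by apply/esym; near: s; exact: truncn_right.
  by apply: cvg_at_right_filter; exact: cvg_id.
have [n nP] := truncn_left c0 t0.
exists ((walk X n w - t * mu * rtau X b w) / Num.sqrt (rtau X b w)).
apply: cvg_trans (lin n t^'- t _ _).
  apply: near_eq_cvg; near=> s; rewrite /scaled_walk; congr ((walk X _ _ - _) / _).
  by apply/esym; near: s.
by apply: cvg_at_left_filter; exact: cvg_id.
Unshelve. all: by end_near. Qed.

Definition scaled_walk_path X (mu b : R) w : skorokhod01 R :=
  to_skorokhod01 (scaled_walk_cadlag X mu b w).

End random_walk.

Record standard_BM d (T : measurableType d) (R : realType)
    (P : probability T R) (B : R -> {RV P >-> R}) : Prop := StandardBM {
  BM_start : {ae P, forall w, B 0 w = 0};
  BM_indep : forall t : nat -> R,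
    (forall i, 0 <= t i < 1) -> (forall i, t i <= t i.+1) ->
    mutually_independent P (fun i w => B (t i.+1) w - B (t i) w);
  BM_gauss : forall s t : R, 0 <= s -> s < t -> t < 1 ->
    forall A : set R, measurable A ->
    P ((fun w => B t w - B s w) @^-1` A) = normal_prob 0 (Num.sqrt (t - s)) A;
  BM_path : forall w, {within `[0, 1[, continuous (fun t => B t w)}
}.

Lemma scaled_BM_cadlag d (T : measurableType d) (R : realType)
    (P : probability T R) (B : R -> {RV P >-> R}) (hB : standard_BM B)
    (sigma : R) w :
  cadlag01 (fun t => sigma * B t w).
Proof.
have cB (t : R) : 0 <= t < 1 -> B s w @[s --> within `[0, 1[ (nbhs t)] --> B t w.
  move=> t01; have /subspace_continuousP := @BM_path _ _ _ _ _ hB w.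
  by apply; rewrite /= in_itv.
have sub (F : set_system R) (t : R) : 0 <= t < 1 -> Filter F -> F --> t ->
    (\forall s \near F, 0 <= s < 1) -> sigma * B s w @[s --> F] --> sigma * B t w.
  move=> t01 FF Ft Fin; apply: cvgMl_tmp; apply: cvg_trans (cB t t01).
  apply: cvg_app => A; rewrite /within /= => tA.
  have /= FA := Ft _ tA; near=> s.
  by (near: s; apply: filterS2 FA Fin => s /=; rewrite in_itv /=; apply).
split=> t /andP[t0 t1].
  apply: sub; first by rewrite t0.
    by apply: cvg_at_right_filter; exact: cvg_id.
  near=> s; apply/andP; split; last by near: s; exact: nbhs_right_lt.
  by apply: (le_trans t0); apply: ltW; near: s; exact: nbhs_right_gt.
exists (sigma * B t w); apply: sub; first by rewrite ltW.
  by apply: cvg_at_left_filter; exact: cvg_id.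
near=> s; apply/andP; split; first by apply: ltW; near: s; exact: nbhs_left_gt.
by apply: lt_trans t1; near: s; exact: nbhs_left_lt.
Unshelve. all: by end_near. Qed.

Definition scaled_BM_path d (T : measurableType d) (R : realType)
    (P : probability T R) (B : R -> {RV P >-> R}) (hB : standard_BM B)
    (sigma : R) w : skorokhod01 R :=
  to_skorokhod01 (scaled_BM_cadlag hB sigma w).

Section tail.
Context d (T : measurableType d) (R : realType) (P : probability T R).
Variable X : {RV P >-> R}.

Definition tail (x : R) : R := fine (ccdf X x).

Definition integrated_tail_ratio (b : R) : R :=
  (\int[lebesgue_measure]_(u in `[b, +oo[) tail u) / tail b.

Definition hazard (lambda Lambda : R -> R) : Prop :=
  [/\ forall x : R, tail x = expR (- Lambda x),
      measurable_fun setT lambda,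
      forall x : R, 0 <= lambda x &
      forall A : set R, measurable A -> distribution P X A =
        (\int[lebesgue_measure]_(x in A) (lambda x * expR (- Lambda x))%:E)%E].

Definition slowly_varying (L : R -> R) : Prop :=
  forall t : R, 0 < t <= 1 -> L (x * t) / L x @[x --> +oo] --> (1 : R).

Definition assumption_A (iota : R) : Prop :=
  1 < iota /\ exists L : R -> R,
    (forall x : R, 0 < x -> tail x = L x * x `^ (- iota)) /\ slowly_varying L.

(* [tail] is positive under [hazard], so this is a genuine conditional
   probability. *)
Definition scaled_excess (lambda : R -> R) (x t : R) : R :=
  cond_prob P [set w | X w > x + t / lambda x] [set w | X w > x].

(* Under [hazard], the other clauses force Lambda and lambda to be positive on
   ]b0, +oo[, so that the divisions by them are genuine. *)
Definition assumption_B (lambda Lambda : R -> R) : Prop :=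
  exists b0 : R, 0 < b0 /\
  [/\ x * lambda x @[x --> +oo] --> +oo,
      exists beta0 : R, 0 < beta0 < 1 /\
        forall x : R, b0 <= x -> lambda x / Lambda x <= beta0 * x^-1,
      @convex_function R R^o `[b0, +oo[ (fun x => - Lambda x),
      forall K : set R, compact K -> K `<=` `[0, +oo[ ->
        {uniform K, (fun x t => scaled_excess lambda x t / expR (- t)) @ +oo
                    --> (fun _ : R => 1 : R)} &
      exists alpha : R, 1 < alpha /\
        forall t x : R, b0 < t -> b0 < x ->
          scaled_excess lambda x t <= t `^ (- alpha)].

End tail.

Definition limit_pair d (T : measurableType d) (R : realType)
    (P : probability T R) (Y0 Y1 : {RV P >-> R}) : Prop :=
  {ae P, forall w, 0 <= Y0 w /\ 0 <= Y1 w} /\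
  forall y0 y1 : R, 0 <= y0 -> 0 <= y1 ->
    P [set w | Y0 w > y0 /\ Y1 w > y1] = P [set w | Y1 w > y0 + y1].

Definition pareto_tail d (T : measurableType d) (R : realType)
    (P : probability T R) (iota : R) (Y : {RV P >-> R}) : Prop :=
  forall t : R, 0 <= t ->
    P [set w | Y w > t] = ((1 + t / (iota - 1)) `^ (- (iota - 1)))%:E.

Definition exponential_mean1 d (T : measurableType d) (R : realType)
    (P : probability T R) (Y : {RV P >-> R}) : Prop :=
  forall A : set R, measurable A -> distribution P Y A = exponential_prob 1 A.

(* Main.v *)
(* Write m = - mu, I b = E (X - b)^+ and a b = I b / P (X > b). In both cases I
   is long tailed and I (b + a b t) / I b tends to G t = P (Y1 > t). The theorem
   follows from two one-sided estimates.

   Upper bound: limsup P (tau_b < oo) m / I b <= 1. Stop the walk when it first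
   exceeds the line R - n (m - e): by the law of large numbers for the maxima
   this happens early with small probability, and conditioning on it gives, by
   induction on the horizon N, P (max_(n <= N) S_n > b) <= C I b with a constant
   C that a second pass brings down to (1 + e) / m.

   Lower bound: liminf E [Psi; tau_b < oo] m / I b >= E Psi (limit) for every
   Psi >= 0 which is Lipschitz for the sup norm on [0, T0], T0 < 1. Keep only the
   trajectories that follow the line - n m until time n - 1 and then jump over b.
   The path before the jump is independent of the jump and Donsker's theorem
   applies to it; the sum over n of the jump probabilities over a grid of
   rectangles of side a b eta is a Riemann sum for differences of I.

   A continuous Phi >= 0 on the Skorokhod space is the increasing limit of the
   Lipschitz functionals inf_z (Phi z + k dist_k (z, .)); only the inclusion of
   uniform neighbourhoods in Skorokhod neighbourhoods is needed. Applying the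
   lower bound to Phi + M and M - Phi and the upper bound to the normalisation
   yields the convergence of the conditional expectations. *)

(* The upper bound on the ruin probability has the same constant as the total mass of the
   trajectories kept in the lower bound. What is discarded is therefore negligible without being
   estimated, and no tightness of the conditional laws is proved. The lower bound in turn uses the
   upper one, to know that the walk has not passed b before the big jump.

   No sigma-algebra is put on the space of paths. Functionals act on all functions and are Lipschitz
   for a sup norm over an interval ending before 1; such a functional of finitely many increments is
   a limit of functionals of rounded increments, hence measurable.

   The given Brownian motion supplies the Gaussian variables: the central limit theorem is a
   comparison, by exchange of increments, of the walk with B, uniform over bounded Lipschitz
   functions.

   Assumptions A and B meet in [regular_tail]. Its delicate clause is [kernel_bounded], a form of
   subexponentiality of I. Under B it rests on the fact that lowering a level u >= 2 k by k lowers
   the hazard by at most 4 + b3 Lam k with b3 < 1, so that the tail at k more than pays for the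
   loss. *)
Require Import Defs.
From mathcomp Require Import all_boot all_order all_algebra.
From mathcomp Require Import finmap ring lra.
From mathcomp Require Import all_classical all_reals all_analysis measurable_realfun.
Import Order.TTheory GRing.Theory Num.Theory.
Import numFieldNormedType.Exports.
Set Implicit Arguments.
Unset Strict Implicit.
Unset Printing Implicit Defensive.
Local Open Scope classical_set_scope.
Local Open Scope ring_scope.

(** * Independence *)

Section independence.
Context d (T : measurableType d) (R : realType) (P : probability T R).

Lemma dynkin_independent (B : set T) : measurable B ->
  dynkin [set A | measurable A /\ P (A `&` B) = (P A * P B)%E].
Proof.
move=> mB; split => /=.
- by split => //; rewrite setTI probability_setT mul1e.
- move=> A [mA AB]; split; first exact: measurableC.
  rewrite (setIC (~` A)) -setDE measureD//; last by rewrite -ge0_fin_numE ?fin_num_measure.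
  have -> : (P B - P (B `&` A) = P B - P A * P B)%E by rewrite -AB setIC.
  rewrite probability_setC// muleBl ?mul1e ?fin_num_measure//.
- move=> F tF FAB; split.
    by apply: bigcup_measurable => n _; case: (FAB n).
  rewrite setI_bigcupl measure_bigcup//; last first.
  - by apply/trivIsetP => i j _ _ ij; rewrite setIACA (trivIsetP.1 tF)// set0I.
  - by move=> n _; apply: measurableI => //; case: (FAB n).
  rewrite measure_bigcup//; last by move=> n _; case: (FAB n).
  rewrite muleC -[X in (X * _)%E]fineK ?fin_num_measure// -nneseriesZl//.
  apply: eq_eseriesr => n _; rewrite fineK ?fin_num_measure//.
  by case: (FAB n) => _ h; rewrite [LHS]h muleC.
Qed.

Lemma independent_sigma_sym G H :
  independent_sigma P G H -> independent_sigma P H G.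
Proof. by move=> GH A B HA GB; rewrite setIC muleC; exact: GH. Qed.

Lemma independent_sigma_sub (G G' H H' : set (set T)) :
  G' `<=` G -> H' `<=` H -> independent_sigma P G H -> independent_sigma P G' H'.
Proof. by move=> GG HH GH A B GA HB; apply: GH; [exact: GG|exact: HH]. Qed.

(** Only one side grows from a pi-system to its sigma-algebra, while H is any class of measurable
    sets; two uses, with the roles exchanged, give the full statement. *)
Let independent_sigma_half (G H : set (set T)) :
  setI_closed G -> G `<=` measurable -> H `<=` measurable ->
  independent_sigma P G H -> independent_sigma P <<s G >> H.
Proof.
move=> GI mG mH GH A B GA HB.
suff : [set A | measurable A /\ P (A `&` B) = (P A * P B)%E] A by case.
move: GA; rewrite -setI_closed_g_dynkin_g_sigma_algebra//.
apply: smallest_sub; first exact: dynkin_independent (mH _ HB).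
by move=> X GX; split; [exact: mG|exact: GH].
Qed.

Lemma independent_sigma_pi (G H : set (set T)) :
  setI_closed G -> setI_closed H -> G `<=` measurable -> H `<=` measurable ->
  independent_sigma P G H -> independent_sigma P <<s G >> <<s H >>.
Proof.
move=> GI HI mG mH GH; apply: independent_sigma_sym.
apply: independent_sigma_half => //.
  by apply: smallest_sub => //; exact: sigma_algebra_measurable.
by apply: independent_sigma_sym; exact: independent_sigma_half.
Qed.

Section family.
Context (I : choiceType) (X : I -> T -> R).
Hypothesis mX : forall i, measurable_fun setT (X i).

Definition generators (D : set I) : set (set T) :=
  [set E | exists i (A : set R), [/\ D i, measurable A & E = X i @^-1` A]].

Lemma generators_measurable (D : set I) : generators D `<=` measurable.
Proof. by move=> _ [i [A [_ mA ->]]]; rewrite -[X in measurable X]setTI; exact: mX. Qed.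

Lemma generated_by_measurable (D : set I) : generated_by D X `<=` measurable.
Proof.
apply: smallest_sub; first exact: sigma_algebra_measurable.
exact: generators_measurable.
Qed.

Definition rectangles (D : set I) : set (set T) :=
  [set E | exists (J : {fset I}) (A : I -> set R),
     [/\ [set` J] `<=` D, forall i, measurable (A i) &
         E = \bigcap_(i in [set` J]) (X i @^-1` A i)]].

Lemma rectangles_measurable D : rectangles D `<=` measurable.
Proof.
move=> _ [J [A [_ mA ->]]]; apply: fin_bigcap_measurable => // i _.
by rewrite -[X in measurable X]setTI; exact: mX.
Qed.

Lemma rectangles_setI D : setI_closed (rectangles D).
Proof.
move=> _ _ [J [A [JD mA ->]]] [K [B [KD mB ->]]].
(* Outside its own index set each family is padded with [setT], so that both intersections run over
   the union of J and K. *)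
exists (J `|` K)%fset, (fun i => (if i \in J then A i else setT) `&`
                                 (if i \in K then B i else setT)); split.
- by move=> i /=; rewrite in_fsetU => /orP[/JD|/KD].
- by move=> i; apply: measurableI; case: ifP.
- apply/seteqP; split => w /=.
    by move=> [h1 h2] i _ /=; split; case: ifPn => // h; [exact: h1|exact: h2].
  move=> h; split => i /= iJ; have := h i; rewrite /= in_fsetU iJ ?orbT.
    by move=> /(_ isT)[].
  by move=> /(_ isT)[].
Qed.

Lemma generated_by_rectangles D : generated_by D X `<=` <<s rectangles D >>.
Proof.
apply: smallest_sub; first exact: smallest_sigma_algebra.
move=> _ [i [A [Di mA ->]]]; apply: sub_sigma_algebra.
exists [fset i]%fset, (fun=> A); split=> //.
- by move=> j /=; rewrite inE => /eqP ->.
- apply/seteqP; split => w /=; first by move=> Aw j /=; rewrite inE => /eqP ->.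
  by move=> /(_ i); rewrite /= inE eqxx; apply.
Qed.

Lemma independent_generated (D1 D2 : set I) :
  mutually_independent P X -> D1 `&` D2 = set0 ->
  independent_sigma P (generated_by D1 X) (generated_by D2 X).
Proof.
move=> XI D12.
apply: (@independent_sigma_sub <<s rectangles D1 >> _ <<s rectangles D2 >>).
- exact: generated_by_rectangles.
- exact: generated_by_rectangles.
apply: independent_sigma_pi.
- exact: rectangles_setI.
- exact: rectangles_setI.
- exact: rectangles_measurable.
- exact: rectangles_measurable.
move=> _ _ [J [A [JD mA ->]]] [K [B [KD mB ->]]].
have JK i : i \in J -> i \in K -> False.
  by move=> /JD h1 /KD h2; have : (D1 `&` D2) i by []; rewrite D12.
(* J and K are disjoint, so the two rectangles glue into one over their union, to which mutual
   independence applies. *)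
pose C i := if i \in J then A i else B i.
have -> : (\bigcap_(i in [set` J]) (X i @^-1` A i)) `&`
    (\bigcap_(i in [set` K]) (X i @^-1` B i)) =
    \bigcap_(i in [set` (J `|` K)%fset]) (X i @^-1` C i).
  apply/seteqP; split => w /=.
    move=> [h1 h2] i /=; rewrite in_fsetU /C; case: ifP => [iJ _|_ /= iK].
      exact: h1.
    exact: h2.
  move=> h; split => i /= iJ; have := h i; rewrite /= in_fsetU iJ ?orbT /C.
    by rewrite iJ; exact.
  by case: ifP => [/JK/(_ iJ)//|_]; exact.
rewrite !XI//; last by move=> i; rewrite /C; case: ifP.
rewrite (big_fsetID _ (mem J))/=; congr (_ * _)%E.
- have -> : [fset x | x in (J `|` K)%fset & x \in J]%fset = J.
    apply/fsetP => i; rewrite !inE /=; case: (i \in J) => //=; exact: andbF.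
  by apply: eq_big_seq => i iJ; rewrite /C iJ.
- have -> : [fset x | x in (J `|` K)%fset & x \notin J]%fset = K.
    apply/fsetP => i; rewrite !inE /=; case: (boolP (i \in J)) => //= iJ.
      by apply/esym/negP => /(JK _ iJ).
    by rewrite andbT.
  by apply: eq_big_seq => i iK; rewrite /C; case: ifP => // /JK/(_ iK).
Qed.

End family.
End independence.

(** * Expectations of bounded measurable functions *)

Section bounded_measurable.
Context d (T : measurableType d) (R : realType).

(** The class in which most real integrals are computed: it is stable under sums and products and
    integrable for every probability, so that linearity and Fubini's theorem carry no further side
    conditions. *)
Definition bmf (f : T -> R) :=
  measurable_fun setT f /\ exists M, forall w, `|f w| <= M.

Lemma bmfD f g : bmf f -> bmf g -> bmf (fun w => f w + g w).
Proof.
move=> [mf [M fM]] [mg [N gN]]; split; first exact: measurable_funD.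
by exists (M + N) => w; apply: le_trans (ler_normD _ _) _; exact: lerD.
Qed.

Lemma bmfM f g : bmf f -> bmf g -> bmf (fun w => f w * g w).
Proof.
move=> [mf [M fM]] [mg [N gN]]; split; first exact: measurable_funM.
by exists (M * N) => w; rewrite normrM; exact: ler_pM.
Qed.

Lemma bmf_cst c : bmf (fun=> c).
Proof. by split; [exact: measurable_cst|exists `|c|]. Qed.

Lemma bmfN f : bmf f -> bmf (fun w => - f w).
Proof.
move=> [mf [M fM]]; split; first exact: measurableT_comp.
by exists M => w; rewrite normrN.
Qed.

Lemma bmfB f g : bmf f -> bmf g -> bmf (fun w => f w - g w).
Proof. by move=> hf hg; apply: bmfD => //; exact: bmfN. Qed.

Lemma bmf_indic (A : set T) : measurable A -> bmf (\1_A : T -> R).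
Proof.
move=> mA; split; first exact: measurable_indic.
by exists 1 => w; rewrite indicE; case: (_ \in _); rewrite ?normr1 ?normr0.
Qed.

Lemma bmf_sum n (f : nat -> T -> R) : (forall i, (i < n)%N -> bmf (f i)) ->
  bmf (fun w => \sum_(i < n) f i w).
Proof.
elim: n => [|n IH] h.
  by rewrite (_ : (fun _ => _) = fun=> 0); [exact: bmf_cst|apply/funext => w; rewrite big_ord0].
rewrite (_ : (fun _ => _) = fun w => \sum_(i < n) f i w + f n w).
  by apply: bmfD; [apply: IH => i ?; exact/h/ltnW|exact: h].
by apply/funext => w; rewrite big_ord_recr.
Qed.

Lemma bmf_norm f : bmf f -> bmf (fun w => `|f w|).
Proof.
move=> [mf [M fM]]; split; first exact: measurableT_comp.
by exists M => w; rewrite normr_id.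
Qed.

Context (P : probability T R).

Lemma bmf_integrable f : bmf f -> P.-integrable setT (EFin \o f).
Proof.
move=> [mf [M fM]].
apply: (@le_integrable _ _ _ P _ measurableT _ (cst `|M|%:E)).
- exact/measurable_EFinP.
- by move=> w _ /=; rewrite lee_fin normr_id; apply: le_trans (fM w) (ler_norm _).
- exact: finite_measure_integrable_cst.
Qed.

Local Notation E f := (\int[P]_w (f w)).

Lemma Ex_cst (c : R) : E (fun=> c) = c.
Proof. by rewrite Rintegral_cst// [X in fine X](@probability_setT _ _ _ P) mulr1. Qed.

Lemma ExD f g : bmf f -> bmf g -> E (fun w => f w + g w) = E f + E g.
Proof. by move=> hf hg; apply: RintegralD => //; exact: bmf_integrable. Qed.

Lemma ExB f g : bmf f -> bmf g -> E (fun w => f w - g w) = E f - E g.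
Proof. by move=> hf hg; apply: RintegralB => //; exact: bmf_integrable. Qed.

Lemma ExZ c f : bmf f -> E (fun w => c * f w) = c * E f.
Proof. by move=> hf; apply: RintegralZl => //; exact: bmf_integrable. Qed.

Lemma Ex_le f g : bmf f -> bmf g -> (forall w, f w <= g w) -> E f <= E g.
Proof. by move=> hf hg fg; apply: le_Rintegral => //; exact: bmf_integrable. Qed.

Lemma Ex_ge0 f : (forall w, 0 <= f w) -> 0 <= E f.
Proof. by move=> f0; exact: Rintegral_ge0. Qed.

Lemma Ex_sum n (f : nat -> T -> R) : (forall i, (i < n)%N -> bmf (f i)) ->
  E (fun w => \sum_(i < n) f i w) = \sum_(i < n) E (f i).
Proof.
elim: n => [|n IH] h.
  by rewrite big_ord0 -[RHS](Ex_cst 0); apply: eq_Rintegral => w _; rewrite big_ord0.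
rewrite big_ord_recr/= -IH; last by move=> i ?; exact/h/ltnW.
rewrite -ExD; [|by apply: bmf_sum => i ?; exact/h/ltnW|exact: h].
by apply: eq_Rintegral => w _; rewrite big_ord_recr.
Qed.

Lemma Ex_norm_le (f : T -> R) (M : R) : measurable_fun setT f -> (forall w, `|f w| <= M) ->
  `|E f| <= M.
Proof.
move=> mf fM; have hf : bmf f by split=> //; exists M.
apply: le_trans (le_normr_Rintegral measurableT (bmf_integrable hf)) _.
rewrite -[leRHS]Ex_cst; apply: Ex_le => //; [exact: bmf_norm|exact: bmf_cst].
Qed.

Lemma Ex_indic (A : set T) : measurable A -> E (\1_A : T -> R) = fine (P A).
Proof. by move=> mA; rewrite /Rintegral integral_indic// setIT. Qed.

Lemma fine_P_le (A B : set T) : measurable A -> measurable B -> A `<=` B ->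
  fine (P A) <= fine (P B).
Proof.
by move=> mA mB AB; rewrite fine_le ?fin_num_measure//; apply: le_measure => //; rewrite inE.
Qed.

Lemma fine_P_ge0 (A : set T) : 0 <= fine (P A).
Proof. exact/fine_ge0/measure_ge0. Qed.

Lemma fine_P_le1 (A : set T) : measurable A -> fine (P A) <= 1.
Proof.
by move=> mA; rewrite -lee_fin fineK ?fin_num_measure//; exact: probability_le1.
Qed.

Lemma fine_P_bigcup_le n (A : nat -> set T) : (forall i, measurable (A i)) ->
  fine (P (\bigcup_(i < n) A i)) <= \sum_(i < n) fine (P (A i)).
Proof.
move=> mA; rewrite -lee_fin fineK ?fin_num_measure//; last exact: bigcup_measurable.
have h := @Boole_inequality _ _ _ P A n (fun i _ => mA i).
rewrite bigcup_mkord; apply: (le_trans h).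
by rewrite -sumEFin lee_sum// => i _; rewrite fineK ?fin_num_measure.
Qed.

Lemma Ex_cvg (f_ : nat -> T -> R) (f : T -> R) (M : R) : (forall n, measurable_fun setT (f_ n)) ->
  (forall n w, `|f_ n w| <= M) -> (forall w, f_ n w @[n --> \oo] --> f w) ->
  E (f_ n) @[n --> \oo] --> E f.
Proof.
move=> mf fM ff.
have mf' : measurable_fun setT f by apply: (measurable_fun_cvg mf) => w _.
have bf n : bmf (f_ n) by split=> //; exists M.
have bff : bmf f.
  split=> //; exists M => w.
  have h : `|f_ n w| @[n --> \oo] --> `|f w| by apply: cvg_norm.
  by apply: (cvgr_to_le h); apply: nearW.
have ff' w : (f_ n w)%:E @[n --> \oo] --> (f w)%:E.
  by apply: cvg_EFin; [exact: nearW|exact: ff].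
have [] := @dominated_convergence _ _ _ P setT measurableT
  (fun n => EFin \o f_ n) (EFin \o f) (cst M%:E) => //.
- by move=> n; exact/measurable_EFinP.
- exact/measurable_EFinP.
- by apply: aeW => w _; exact: ff'.
- exact: finite_measure_integrable_cst.
- by apply: aeW => w n _; rewrite lee_fin.
move=> _ _ h; apply: fine_cvg.
rewrite fineK; last by apply: integrable_fin_num => //; exact: bmf_integrable.
exact: h.
Qed.

End bounded_measurable.

(** * Fubini's theorem and decoupling of independent arguments *)

Section product_integrals.
Context d1 d2 (T1 : measurableType d1) (T2 : measurableType d2) (R : realType).
Variables (P1 : probability T1 R) (P2 : probability T2 R).

Lemma bmf_slice (f : T1 * T2 -> R) x : bmf f -> bmf (fun y => f (x, y)).
Proof.
move=> [mf [M fM]]; split; last by exists M.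
exact: (measurable_fun_pair2 x mf).
Qed.

Lemma bmf_slice2 (f : T1 * T2 -> R) y : bmf f -> bmf (fun x => f (x, y)).
Proof.
move=> [mf [M fM]]; split; last by exists M.
exact: (measurable_fun_pair1 y mf).
Qed.

Lemma bmf_integral (f : T1 * T2 -> R) : bmf f ->
  bmf (fun x => \int[P2]_y f (x, y)).
Proof.
move=> bf; have [mf [M fM]] := bf; split.
  apply: (@measurableT_comp _ _ _ _ _ _ fine); first exact: fine_measurable.
  apply: (@measurable_fubini_F _ _ _ _ _ P1 P2 (EFin \o f)).
  exact: (bmf_integrable (P1 \x P2)%E bf).
by exists M => x; apply: Ex_norm_le => //; case: (bmf_slice x bf).
Qed.

Lemma bmf_integral2 (f : T1 * T2 -> R) : bmf f ->
  bmf (fun y => \int[P1]_x f (x, y)).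
Proof.
move=> bf; have [mf [M fM]] := bf; split.
  apply: (@measurableT_comp _ _ _ _ _ _ fine); first exact: fine_measurable.
  apply: (@measurable_fubini_G _ _ _ _ _ P1 P2 (EFin \o f)).
  exact: (bmf_integrable (P1 \x P2)%E bf).
by exists M => x; apply: Ex_norm_le => //; case: (bmf_slice2 x bf).
Qed.

Lemma EFin_Rintegral d (T : measurableType d) (P : probability T R) (f : T -> R) :
  bmf f -> (\int[P]_x f x)%:E = (\int[P]_x (f x)%:E)%E.
Proof.
move=> bf; rewrite fineK//; apply: integrable_fin_num => //.
exact: bmf_integrable.
Qed.

Lemma Rintegral_prod (f : T1 * T2 -> R) : bmf f ->
  \int[P1]_x (\int[P2]_y f (x, y)) = \int[(P1 \x P2)%E]_z f z.
Proof.
move=> bf; congr fine.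
rewrite -[RHS]integral12_prod_meas1; last exact: bmf_integrable.
by apply: eq_integral => x _; rewrite EFin_Rintegral//; exact: bmf_slice.
Qed.

Lemma Rintegral_swap (f : T1 * T2 -> R) : bmf f ->
  \int[P1]_x (\int[P2]_y f (x, y)) = \int[P2]_y (\int[P1]_x f (x, y)).
Proof.
move=> bf; rewrite Rintegral_prod//; congr fine.
rewrite -[LHS]integral21_prod_meas1; last exact: bmf_integrable.
by apply: eq_integral => y _; rewrite EFin_Rintegral//; exact: bmf_slice2.
Qed.

End product_integrals.

Section decoupling.
Context d d1 d2 (T : measurableType d) (T1 : measurableType d1)
  (T2 : measurableType d2) (R : realType) (P : probability T R).

Lemma Rintegral_distribution d3 (T3 : measurableType d3) (U : {mfun T >-> T3})
    (f : T3 -> R) : bmf f ->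
  \int[distribution P U]_x f x = \int[P]_w f (U w).
Proof.
move=> bf; congr fine; rewrite integral_distribution//.
  by case: bf => ? _; exact/measurable_EFinP.
apply: (@bmf_integrable _ _ _ P (f \o U)); case: bf => mf [M fM]; split.
  exact: measurableT_comp.
by exists M => w; exact: fM.
Qed.

(** The hypothesis says that the law of the pair agrees with the product of the laws on rectangles,
    hence everywhere; the rest is a change of variables and Fubini. Both integrals stay on the
    original space, with two integration variables, so that no independent copy has to be built. *)
Lemma decouple_mfun (U : {mfun T >-> T1}) (V : {mfun T >-> T2}) (f : T1 * T2 -> R) :
  (forall A B, measurable A -> measurable B ->
     P (U @^-1` A `&` V @^-1` B) = (P (U @^-1` A) * P (V @^-1` B))%E) ->
  bmf f ->
  \int[P]_w f (U w, V w) = \int[P]_w1 (\int[P]_w2 f (U w1, V w2)).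
Proof.
move=> UV bf.
have mW : measurable_fun setT (fun w => (U w, V w)).
  exact: measurable_fun_pair.
pose W : {mfun T >-> (T1 * T2)%type} := mfun_Sub (mem_set mW : _ \in mfun).
transitivity (\int[distribution P W]_z f z).
  by rewrite Rintegral_distribution.
transitivity (\int[(distribution P U \x distribution P V)%E]_z f z).
  congr fine; apply: eq_measure_integral => A mA _; apply/esym.
  by apply: product_measure_unique => // B C mB mC; exact: UV.
rewrite -Rintegral_prod// Rintegral_distribution; last first.
  exact: (bmf_integral (distribution P U)).
apply: eq_Rintegral => w _; rewrite Rintegral_distribution//.
exact: bmf_slice.
Qed.

Lemma ge0_decouple_mfun (U : {mfun T >-> T1}) (V : {mfun T >-> T2})
    (f : T1 * T2 -> \bar R) :
  (forall A B, measurable A -> measurable B ->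
     P (U @^-1` A `&` V @^-1` B) = (P (U @^-1` A) * P (V @^-1` B))%E) ->
  measurable_fun setT f -> (forall z, 0 <= f z)%E ->
  (\int[P]_w f (U w, V w) = \int[P]_w1 (\int[P]_w2 f (U w1, V w2)))%E.
Proof.
move=> UV mf f0.
have mW : measurable_fun setT (fun w => (U w, V w)).
  exact: measurable_fun_pair.
pose W : {mfun T >-> (T1 * T2)%type} := mfun_Sub (mem_set mW : _ \in mfun).
transitivity (\int[distribution P W]_z f z)%E.
  by rewrite ge0_integral_distribution.
transitivity (\int[(distribution P U \x distribution P V)%E]_z f z)%E.
  apply: eq_measure_integral => A mA _; apply/esym.
  by apply: product_measure_unique => // B C mB mC; exact: UV.
rewrite fubini_tonelli1// ge0_integral_distribution//.
- apply: eq_integral => w _; rewrite /= /fubini_F ge0_integral_distribution//.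
  exact: (measurable_fun_pair2 _ mf).
- exact: measurable_fun_fubini_tonelli_F.
- by move=> x; exact: integral_ge0.
Qed.

End decoupling.

Section decoupling_sigma.
Context d (T : measurableType d) (R : realType) (P : probability T R).

Let mid (K : set (set T)) : K `<=` @measurable _ T ->
  @measurable_fun _ _ T (g_sigma_algebraType K) setT id.
Proof.
move=> mK _ A KA; rewrite setTI; apply: (smallest_sub _ mK KA).
exact: sigma_algebra_measurable.
Qed.

(** The identity, seen as a variable with values in [T] equipped with a smaller sigma-algebra, is
    the random element to which [decouple_mfun] applies. Independence of two events classes then
    becomes independence of two arguments of f. *)
Lemma decouple (G H : set (set T)) (f : g_sigma_algebraType G * g_sigma_algebraType H -> R) :
  G `<=` @measurable _ T -> H `<=` @measurable _ T ->
  independent_sigma P <<s G >> <<s H >> ->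
  bmf f ->
  \int[P]_w f (w, w) = \int[P]_w1 (\int[P]_w2 f (w1, w2)).
Proof.
move=> mG mH GH bf.
pose U : {mfun T >-> g_sigma_algebraType G} := mfun_Sub (mem_set (mid mG) : _ \in mfun).
pose V : {mfun T >-> g_sigma_algebraType H} := mfun_Sub (mem_set (mid mH) : _ \in mfun).
exact: (@decouple_mfun _ _ _ T (g_sigma_algebraType G) (g_sigma_algebraType H)
  R P U V f GH bf).
Qed.

Lemma ge0_decouple (G H : set (set T))
    (f : g_sigma_algebraType G * g_sigma_algebraType H -> \bar R) :
  G `<=` @measurable _ T -> H `<=` @measurable _ T ->
  independent_sigma P <<s G >> <<s H >> ->
  measurable_fun setT f -> (forall z, 0 <= f z)%E ->
  (\int[P]_w f (w, w) = \int[P]_w1 (\int[P]_w2 f (w1, w2)))%E.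
Proof.
move=> mG mH GH mf f0.
pose U : {mfun T >-> g_sigma_algebraType G} := mfun_Sub (mem_set (mid mG) : _ \in mfun).
pose V : {mfun T >-> g_sigma_algebraType H} := mfun_Sub (mem_set (mid mH) : _ \in mfun).
exact: (@ge0_decouple_mfun _ _ _ T (g_sigma_algebraType G) (g_sigma_algebraType H)
  R P U V f GH mf f0).
Qed.

End decoupling_sigma.

(** * Functionals of sequences and exchange of coordinates *)

Section measurable_functionals.
Context (R : realType).
Implicit Type f : (nat -> R) -> R.

(** Quantifying over all measurable coordinates avoids a sigma-algebra on sequences and lets the
    same functional be evaluated on any space, including [T] with a smaller sigma-algebra. *)
Definition seq_measurable f := forall d (T : measurableType d) (v : nat -> T -> R),
  (forall i, measurable_fun setT (v i)) ->
  measurable_fun setT (fun w => f (fun i => v i w)).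

Definition upd (v : nat -> R) k x : nat -> R := fun i => if i == k then x else v i.

(** The tail [v] is arbitrary because the induction needs it: once the last random coordinate is
    peeled off, its value becomes part of the tail ([mixS]). *)
Definition mix T k (D : nat -> T -> R) (w : T) (v : nat -> R) : nat -> R :=
  fun i => if (i < k)%N then D i w else v i.

Lemma mixS T k (D : nat -> T -> R) w v :
  mix k.+1 D w v = mix k D w (upd v k (D k w)).
Proof.
apply/funext => i; rewrite /mix /upd ltnS leq_eqVlt.
by case: eqP => [->|] //=; rewrite ltnn.
Qed.

Lemma upd_mix T k (D : nat -> T -> R) w v x :
  upd (mix k D w v) k x = mix k D w (upd v k x).
Proof.
apply/funext => i; rewrite /mix /upd.
by case: eqP => [->|] //=; rewrite ltnn.
Qed.

Lemma seq_measurable_mix2 f d1 d2 (T1 : measurableType d1) (T2 : measurableType d2)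
   k (D : nat -> T1 -> R) (G : T2 -> R) v : seq_measurable f ->
  (exists M, forall v, `|f v| <= M) ->
  (forall i, (i < k)%N -> measurable_fun setT (D i)) -> measurable_fun setT G ->
  bmf (fun z : T1 * T2 => f (mix k D z.1 (upd v k (G z.2)))).
Proof.
move=> mf [M fM] mD mG; split; last by exists M.
apply: (mf _ _ (fun i (z : T1 * T2) => mix k D z.1 (upd v k (G z.2)) i)) => i.
rewrite /mix /upd; case: (i < k)%N (mD i) => [/(_ isT) mDi|_].
  exact: measurableT_comp.
by case: (i == k) => //; exact: measurableT_comp.
Qed.

Lemma Ex_dist_le d (T : measurableType d) (P : probability T R) (f g : T -> R) e :
  bmf f -> bmf g -> (forall w, `|f w - g w| <= e) ->
  `|\int[P]_w f w - \int[P]_w g w| <= e.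
Proof.
move=> bf bg fg; rewrite -ExB//; apply: Ex_norm_le => //.
by case: (bmfB bf bg).
Qed.

(** Independence in the sequential form that peeling the last coordinate uses; it passes easily to
    sums over consecutive blocks. *)
Definition indep_seq d (T : measurableType d) (P : probability T R)
    (D : nat -> T -> R) :=
  forall k, independent_sigma P <<s generators D [set i | (i < k)%N] >>
                                <<s generators D [set k] >>.

Lemma generators_mfun (I : choiceType) d (T : measurableType d) (D : I -> T -> R)
    (A : set I) i :
  A i -> @measurable_fun _ _ (g_sigma_algebraType (generators D A)) R setT (D i).
Proof.
move=> Ai _ B mB; rewrite setTI; apply: sub_sigma_algebra.
by exists i, B.
Qed.

Lemma indep_seq_peel d (T : measurableType d) (P : probability T R)
    (D : nat -> T -> R) f k v : (forall i, measurable_fun setT (D i)) ->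
  indep_seq P D -> seq_measurable f -> (exists M, forall v, `|f v| <= M) ->
  \int[P]_w f (mix k.+1 D w v) =
  \int[P]_w1 (\int[P]_w2 f (mix k D w1 (upd v k (D k w2)))).
Proof.
move=> mD DI mf fM.
under eq_Rintegral do rewrite mixS.
apply: (@decouple _ _ _ _ (generators D [set i | (i < k)%N]) (generators D [set k])
  (fun z => f (mix k D z.1 (upd v k (D k z.2))))).
- exact: (generators_measurable mD).
- exact: (generators_measurable mD).
- exact: DI.
- apply: (@seq_measurable_mix2 f _ _ (g_sigma_algebraType (generators D [set i | (i < k)%N]))
    (g_sigma_algebraType (generators D [set k])) k D (D k) v mf fM).
    by move=> i ik; exact: (@generators_mfun nat _ _ D [set i | (i < k)%N]).
  exact: (@generators_mfun nat _ _ D [set k]).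
Qed.

(* Lindeberg's replacement trick, one coordinate at a time. *)
Lemma indep_swap d (T : measurableType d) (P : probability T R)
    d' (T' : measurableType d') (P' : probability T' R)
    (D : nat -> T -> R) (D' : nat -> T' -> R) f m e :
  (forall i, measurable_fun setT (D i)) -> (forall i, measurable_fun setT (D' i)) ->
  indep_seq P D -> indep_seq P' D' ->
  seq_measurable f -> (exists M, forall v, `|f v| <= M) ->
  (forall k v, (k < m)%N ->
    `|\int[P]_w f (upd v k (D k w)) - \int[P']_w f (upd v k (D' k w))| <= e) ->
  forall v, `|\int[P]_w f (mix m D w v) - \int[P']_w f (mix m D' w v)| <= m%:R * e.
Proof.
move=> mD mD' DI DI' mf fM; elim: m => [|m IH] he v.
  rewrite mul0r (_ : (fun w => f (mix 0 D w v)) = fun=> f v); last first.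
    by apply/funext => w; congr f; apply/funext => i.
  rewrite (_ : (fun w => f (mix 0 D' w v)) = fun=> f v); last first.
    by apply/funext => w; congr f; apply/funext => i.
  by rewrite !Ex_cst subrr normr0.
rewrite !indep_seq_peel//.
have b1 : bmf (fun z : T * T => f (mix m D z.1 (upd v m (D m z.2)))).
  exact: (@seq_measurable_mix2 f _ _ T T m D (D m) v mf fM).
have b2 : bmf (fun z : T' * T => f (mix m D' z.1 (upd v m (D m z.2)))).
  exact: (@seq_measurable_mix2 f _ _ T' T m D' (D m) v mf fM).
have b3 : bmf (fun z : T' * T' => f (mix m D' z.1 (upd v m (D' m z.2)))).
  exact: (@seq_measurable_mix2 f _ _ T' T' m D' (D' m) v mf fM).
rewrite (Rintegral_swap P P b1)/=.
set A := (X in `|X - _|); set C := (X in `|_ - X|).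
(* The intermediate term has a prefix from [D'] and coordinate m from [D]: it differs from the first
   by the prefix, where the induction hypothesis applies, and from the second by one coordinate. *)
pose B := \int[P']_w1 (\int[P]_w2 f (mix m D' w1 (upd v m (D m w2)))).
rewrite -(subrKA B) -natr1 mulrDl mul1r.
apply: (le_trans (ler_normD _ _)); apply: lerD.
  rewrite /B (Rintegral_swap P' P b2)/=; apply: Ex_dist_le.
  - exact: (bmf_integral2 P P b1).
  - exact: (bmf_integral2 P' P b2).
  - by move=> w; apply: IH => k u km; apply: he; rewrite ltnS ltnW.
apply: Ex_dist_le.
- exact: (bmf_integral P' P b2).
- exact: (bmf_integral P' P' b3).
- move=> w; under [X in `|X - _|]eq_Rintegral do rewrite -upd_mix.
  under [X in `|_ - X|]eq_Rintegral do rewrite -upd_mix.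
  exact: he.
Qed.

End measurable_functionals.

Section blocks.
Context d (T : measurableType d) (R : realType) (P : probability T R).
Context (X : nat -> T -> R).
Hypotheses (mX : forall i, measurable_fun setT (X i)) (XI : mutually_independent P X).

Lemma generated_by_sub (I J : choiceType) (Y : I -> T -> R) (Z : J -> T -> R)
    (A : set I) (B : set J) :
  (forall j, B j -> @measurable_fun _ _ (g_sigma_algebraType (generators Y A)) R setT (Z j)) ->
  <<s generators Z B >> `<=` <<s generators Y A >>.
Proof.
move=> mZ; apply: smallest_sub; first exact: smallest_sigma_algebra.
move=> _ [j [C [Bj mC ->]]].
by have := mZ j Bj measurableT _ mC; rewrite setTI.
Qed.

Definition range_mfun (l u : nat) (Z : T -> R) :=
  @measurable_fun _ _
    (g_sigma_algebraType (generators X [set i | (l <= i < u)%N])) R setT Z.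

Lemma range_mfun_measurable l u Z : range_mfun l u Z -> measurable_fun setT Z.
Proof.
move=> mZ _ A mA; rewrite setTI.
have := mZ measurableT _ mA; rewrite setTI.
apply: smallest_sub; first exact: sigma_algebra_measurable.
exact: generators_measurable.
Qed.

Lemma range_mfunX l u i : (l <= i < u)%N -> range_mfun l u (X i).
Proof. exact: (@generators_mfun R nat _ T X [set i | (l <= i < u)%N]). Qed.

Lemma range_mfun_sum l u (c : R) p k : (forall i, (i < k)%N -> (l <= p + i < u)%N) ->
  range_mfun l u (fun w => \sum_(i < k) (X (p + i)%N w - c)).
Proof.
elim: k => [|k IH] h.
  rewrite /range_mfun (_ : (fun _ => _) = fun=> 0); first exact: measurable_cst.
  by apply/funext => w; rewrite big_ord0.
rewrite /range_mfun (_ : (fun _ => _) = fun w => \sum_(i < k) (X (p + i)%N w - c)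
  + (X (p + k)%N w - c)); last by apply/funext => w; rewrite big_ord_recr.
apply: measurable_funD; first by apply: IH => i ik; exact/h/ltnW.
apply: measurable_funB; last exact: measurable_cst.
exact: (@range_mfunX l u (p + k)%N (h k (ltnSn k))).
Qed.

Lemma range_independent l1 u1 l2 u2 (G H : set (set T)) : (u1 <= l2)%N ->
  G `<=` <<s generators X [set i | (l1 <= i < u1)%N] >> ->
  H `<=` <<s generators X [set i | (l2 <= i < u2)%N] >> ->
  independent_sigma P G H.
Proof.
move=> ul GX HX; apply: (independent_sigma_sub GX HX).
apply: (independent_generated mX XI); rewrite -subset0 => i /= [/andP[_ iu] /andP[li _]].
by have := leq_trans iu (leq_trans ul li); rewrite ltnn.
Qed.

Lemma range_mfunS l u l' u' Z : (l' <= l)%N -> (u <= u')%N ->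
  range_mfun l u Z -> range_mfun l' u' Z.
Proof.
move=> ll uu mZ _ A mA; rewrite setTI.
have := mZ measurableT _ mA; rewrite setTI.
apply: sub_sigma_algebra2 => _ [i [B [/andP[li iu] mB ->]]].
by exists i, B; split => //=; rewrite (leq_trans ll li) (leq_trans iu uu).
Qed.

Lemma indep_seq_blocks (start : nat -> nat) (Z : nat -> T -> R) :
  (forall k, (start k <= start k.+1)%N) ->
  (forall k, range_mfun (start k) (start k.+1) (Z k)) ->
  indep_seq P Z.
Proof.
move=> st mZ k.
have sth i j : (i <= j)%N -> (start i <= start j)%N.
  by move=> ij; apply: (@homo_leq _ start leq leqnn leq_trans) => //; apply: st.
apply: (@range_independent (start 0%N) (start k) (start k) (start k.+1)) => //.
  apply: generated_by_sub => i /= ik.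
  by apply: range_mfunS (mZ i); [exact: sth|exact: sth].
by apply: generated_by_sub => i /= ->; exact: mZ.
Qed.

Lemma indep_seq_shift p (g : nat -> R -> R) : (forall i, measurable_fun setT (g i)) ->
  indep_seq P (fun i w => g i (X (p + i)%N w)).
Proof.
move=> mg; apply: (@indep_seq_blocks (fun k => (p + k)%N)) => k.
  by rewrite leq_add2l.
apply: (@measurableT_comp _ _ _ _ _ _ (g k)) => //.
by apply: range_mfunX; rewrite leqnn ltn_add2l /=.
Qed.

End blocks.

(** * Integration against a density *)

Section density.
Context (R : realType).
Local Notation mu := (@lebesgue_measure R).

(** [nu] is dominated by Lebesgue measure, and its Radon-Nikodym derivative equals [p] almost
    everywhere because both have the same integrals over measurable sets. *)
Lemma ge0_integral_density (nu : probability (measurableTypeR R) R) (p : R -> R)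
    (f : R -> \bar R) (E : set R) :
  measurable_fun setT p -> (forall x, 0 <= p x) ->
  (forall A, measurable A -> nu A = (\int[mu]_(x in A) (p x)%:E)%E) ->
  measurable E -> measurable_fun setT f -> (forall x, 0 <= f x)%E ->
  (\int[nu]_(x in E) f x = \int[mu]_(x in E) (f x * (p x)%:E))%E.
Proof.
move=> mp p0 nuE mE mf f0.
have dom : nu `<< mu.
  apply/null_content_dominatesP => A mA muA0; rewrite nuE//.
  by apply: null_set_integral => //; apply/measurable_EFinP/measurable_funTS.
rewrite -(Radon_Nikodym_SigmaFinite.change_of_variables dom)//; last first.
  exact: measurable_funTS.
apply: ae_eq_integral => //.
- apply: emeasurable_funM; first exact: measurable_funTS.
  apply: (measurable_int mu); apply: (integrableS measurableT) => //.
  exact: Radon_Nikodym_SigmaFinite.f_integrable.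
- apply: emeasurable_funM; first exact: measurable_funTS.
  by apply/measurable_EFinP/measurable_funTS.
- apply: ae_eqe_mul2l; apply: integral_ae_eq => //.
  + apply: (integrableS measurableT) => //.
    exact: Radon_Nikodym_SigmaFinite.f_integrable.
  + by apply/measurable_EFinP/measurable_funTS.
  + move=> A AE mA; rewrite -nuE//.
    by rewrite -Radon_Nikodym_SigmaFinite.f_integral.
Qed.

Lemma integral_sym_derive (f F : R -> R) (n : R) : 0 < n -> continuous f ->
  (forall x : R, is_derive x (1 : R) F (f x)) ->
  (\int[mu]_(x in `[(- n)%R, n]) (f x)%:E = (F n - F (- n)%R)%:E)%E.
Proof.
move=> n0 cf dF.
have cF : continuous F.
  move=> x; have [h _] := dF x.
  by apply: differentiable_continuous; exact/derivable1_diffP.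
rewrite EFinB; apply: continuous_FTC2.
- by rewrite gtrN.
- exact: continuous_subspaceT.
- split.
  + by move=> x _; case: (dF x).
  + by apply: cvg_at_right_filter; exact: cF.
  + by apply: cvg_at_left_filter; exact: cF.
- by move=> x _; rewrite derive1E; case: (dF x).
Qed.


Lemma bigcup_sym_itv : \bigcup_n `[(- n.+1%:R)%R, (n.+1%:R : R)]%classic = [set: R].
Proof.
rewrite -subTset => x _; exists (Num.truncn `|x|) => //=.
rewrite in_itv /= -ler_norml; exact/ltW/truncnS_gt.
Qed.

Lemma cvg_integral_sym (nu : probability (measurableTypeR R) R) (f : R -> \bar R) :
  measurable_fun setT f -> (forall x, 0 <= f x)%E ->
  (\int[nu]_(x in `[(- n.+1%:R)%R, n.+1%:R]) f x @[n --> \oo] -->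
   \int[nu]_x f x)%E.
Proof.
move=> mf f0; rewrite -bigcup_sym_itv.
apply: ge0_nondecreasing_set_cvg_integral => //.
- apply/nondecreasing_seqP => n; rewrite subsetEset; apply: subset_itv;
    rewrite bnd_simp ?lerN2 ler_nat; exact: leqnSn.
- by move=> i; exact: measurable_funTS.
Qed.

(** * A central limit theorem for bounded Lipschitz functions *)

Section gaussian.
Variables (s : R) (s0 : 0 < s).

Let ph (x : R) : R := normal_peak s * expR (- (x ^+ 2 / (s ^+ 2 *+ 2))).

Let phE : ph = normal_pdf 0 s.
Proof.
apply/funext => x; rewrite normal_pdfE ?gt_eqF// /ph /normal_fun subr0.
by rewrite mulNr.
Qed.

Let ph0 x : 0 <= ph x. Proof. by rewrite phE normal_pdf_ge0. Qed.

Let dph (x : R) : is_derive x (1 : R) ph (- (x / s ^+ 2 * ph x)).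
Proof.
rewrite /ph; apply: is_derive_eq.
rewrite /GRing.scale /=; have s2 : s != 0 by rewrite gt_eqF.
by field.
Qed.

(** Primitive of ((x + c)^2 - (s^2 + c^2)) times the density: the shifted second moment over a
    symmetric interval is s^2 + c^2 times its mass plus a boundary term. The shift also yields the
    mean, by comparing c = 0 with c = 1. *)
Let G (c x : R) := - (s ^+ 2 * ((x + c *+ 2) * ph x)).
Let dG (c x : R) : is_derive x (1 : R) (G c)
  (((x + c) ^+ 2 - (s ^+ 2 + c ^+ 2)) * ph x).
Proof.
rewrite /G; move: (dph x); move: ph => p hp; apply: is_derive_eq.
rewrite /GRing.scale /=; have s2 : s != 0 by rewrite gt_eqF.
by field.
Qed.

(** The same device, expressing the fourth moment through the second. *)
Let K (x : R) := - (s ^+ 2 * (x ^+ 3 * ph x)).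
Let dK (x : R) : is_derive x (1 : R) K
  ((x ^+ 4 - s ^+ 2 * 3 * x ^+ 2) * ph x).
Proof.
rewrite /K; move: (dph x); move: ph => p hp; apply: is_derive_eq.
rewrite /GRing.scale /=; have s2 : s != 0 by rewrite gt_eqF.
by field.
Qed.


Let cph : continuous ph. Proof. by rewrite phE; apply: continuous_normal_pdf; rewrite gt_eqF. Qed.

Let nu := (normal_prob 0 s : probability (measurableTypeR R) R).

Let nuE (f : R -> R) (n : nat) : measurable_fun setT f -> (forall x, 0 <= f x) ->
  (\int[nu]_(x in `[(- n.+1%:R)%R, n.+1%:R]) (f x)%:E =
   \int[mu]_(x in `[(- n.+1%:R)%R, n.+1%:R]) (f x * ph x)%:E)%E.
Proof.
move=> mf f0; rewrite (@ge0_integral_density nu ph)//.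
- rewrite phE; exact: measurable_normal_pdf.
- by move=> A mA; rewrite phE.
- exact/measurable_EFinP.
Qed.

Let nuT (n : nat) : (nu `[(- n.+1%:R)%R, (n.+1%:R : R)]%classic =
   \int[mu]_(x in `[(- n.+1%:R)%R, n.+1%:R]) (ph x)%:E)%E.
Proof. by rewrite phE. Qed.

Let cX (c : R) k : continuous (fun x : R => (x + c) ^+ k).
Proof.
move=> x; apply: (@continuous_comp _ _ _ (fun x => x + c) (fun x => x ^+ k)).
  by apply: cvgD; [exact: cvg_id|exact: cvg_cst].
exact: exprn_continuous.
Qed.

Let integrable_sym (f : R -> R) (n : R) : continuous f ->
  mu.-integrable `[- n, n] (EFin \o f).
Proof.
move=> cf; apply: continuous_compact_integrable; first exact: segment_compact.
exact: continuous_subspaceT.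
Qed.

Let moment2n (c : R) n :
  (\int[nu]_(x in `[(- n.+1%:R)%R, n.+1%:R]) ((x + c) ^+ 2)%:E =
   (G c n.+1%:R - G c (- n.+1%:R))%:E +
   (s ^+ 2 + c ^+ 2)%:E * nu `[(- n.+1%:R)%R, (n.+1%:R : R)]%classic)%E.
Proof.
rewrite nuE; [|by apply: measurable_funX; exact: measurable_funD|by move=> x; exact: sqr_ge0].
rewrite nuT -integralZl//; last exact: integrable_sym.
have cf : continuous (fun x : R => ((x + c) ^+ 2 - (s ^+ 2 + c ^+ 2)) * ph x).
  by move=> x; apply: cvgM; [apply: cvgB; [exact: cX|exact: cvg_cst]|exact: cph].
have <- := @integral_sym_derive _ _ n.+1%:R (ltr0Sn _ n) cf (dG c).
rewrite -integralD_EFin//.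
- by apply: eq_integral => x _ /=; congr EFin; ring.
- exact: integrable_sym.
- by apply: integrable_sym => x; apply: cvgM; [exact: cvg_cst|exact: cph].
Qed.

Let moment4n n :
  (\int[nu]_(x in `[(- n.+1%:R)%R, n.+1%:R]) (x ^+ 4)%:E =
   (K n.+1%:R - K (- n.+1%:R))%:E +
   (s ^+ 2 * 3)%:E * \int[nu]_(x in `[(- n.+1%:R)%R, n.+1%:R]) (x ^+ 2)%:E)%E.
Proof.
have c2 k : continuous (fun x : R => x ^+ k * ph x).
  by move=> x; apply: cvgM; [exact: exprn_continuous|exact: cph].
rewrite nuE; [|by apply: measurable_funX|by move=> x; rewrite exprn_even_ge0].
rewrite nuE; [|by apply: measurable_funX|by move=> x; exact: sqr_ge0].
rewrite -integralZl//; last exact/integrable_sym/c2.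
have cf : continuous (fun x : R => (x ^+ 4 - s ^+ 2 * 3 * x ^+ 2) * ph x).
  move=> x; rewrite (_ : (fun x => _) = fun x => x ^+ 4 * ph x - s ^+ 2 * 3 * (x ^+ 2 * ph x)).
    by apply: cvgB; [exact: c2|apply: cvgM; [exact: cvg_cst|exact: c2]].
  by apply/funext => y; ring.
have <- := @integral_sym_derive _ _ n.+1%:R (ltr0Sn _ n) cf dK.
rewrite -integralD_EFin//.
- by apply: eq_integral => x _ /=; congr EFin; ring.
- exact: integrable_sym.
- by apply: integrable_sym => x; apply: cvgM; [exact: cvg_cst|exact: c2].
Qed.

Let phN x : ph (- x) = ph x. Proof. by rewrite /ph sqrrN. Qed.

Let nph : n.+1%:R * ph n.+1%:R @[n --> \oo] --> (0 : R).
Proof.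
pose C := normal_peak s * (s ^+ 2 *+ 2).
have C0 : 0 <= C by rewrite mulr_ge0// ?normal_peak_ge0// mulrn_wge0// sqr_ge0.
have s2 : 0 < s ^+ 2 *+ 2 by rewrite pmulrn_lgt0// exprn_gt0.
apply: (@squeeze_cvgr _ _ _ _ (cst 0) (fun n => C * n.+1%:R^-1)).
- apply: nearW => n; rewrite mulr_ge0//=.
  set N : R := n.+1%:R; have N0 : 0 < N by rewrite ltr0n.
  pose y := N ^+ 2 / (s ^+ 2 *+ 2).
  (* The factor y exp (-y) is at most 1, which leaves the bound C / N. *)
  have -> : N * ph N = C * N^-1 * (y * expR (- y)).
    rewrite /ph /C -/y; move: (expR _) => e; rewrite /y; field.
    by rewrite (gt_eqF s0) nat1r pnatr_eq0.
  apply: ler_piMr; first by rewrite mulr_ge0 ?invr_ge0// ltW.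
  rewrite expRN.
  rewrite ler_pdivrMr ?expR_gt0// mul1r.
  by apply: le_trans (expR_ge1Dx y); rewrite lerDr.
- exact: cvg_cst.
- rewrite -[X in _ --> X](mulr0 C); apply: cvgM; first exact: cvg_cst.
  exact: cvg_harmonic.
Qed.

Let moment2 (c : R) : (\int[nu]_x ((x + c) ^+ 2)%:E = (s ^+ 2 + c ^+ 2)%:E)%E.
Proof.
have mf : measurable_fun setT (fun x : R => ((x + c) ^+ 2)%:E).
  by apply/measurable_EFinP; apply: measurable_funX; exact: measurable_funD.
have f0 (x : R) : (0 <= ((x + c) ^+ 2)%:E)%E by rewrite lee_fin sqr_ge0.
suff l : (\int[nu]_(x in `[(- n.+1%:R)%R, n.+1%:R]) ((x + c) ^+ 2)%:E @[n --> \oo] -->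
    0 + (s ^+ 2 + c ^+ 2)%:E * 1)%E.
  by rewrite (cvg_unique _ (cvg_integral_sym mf f0) l)// mule1 add0e.
under eq_fun do rewrite moment2n.
apply: cvgeD => //.
- apply: cvg_EFin; first exact: nearW.
  rewrite (_ : fine \o _ = fun n => - (s ^+ 2 * 2 * (n.+1%:R * ph n.+1%:R))).
    rewrite -oppr0; apply: cvgN; rewrite -(mulr0 (s ^+ 2 * 2)).
    by apply: cvgM; [exact: cvg_cst|exact: nph].
  by apply/funext => n /=; rewrite /G phN; ring.
- apply: cvgeZl => //.
  have <- : (\int[nu]_x cst 1 x = 1)%E.
    by rewrite integral_cst// mul1e; exact: (@probability_setT _ _ _ nu).
  have e (n : nat) : (nu `[(- n.+1%:R)%R, (n.+1%:R : R)]%classic =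
      \int[nu]_(x in `[(- n.+1%:R)%R, n.+1%:R]) cst 1 x)%E.
    by rewrite integral_cst// mul1e.
  under eq_fun do rewrite e.
  exact: cvg_integral_sym.
Qed.

(** An upper bound is enough, so the boundary term, which is non-positive, is dropped instead of
    being shown to vanish. *)
Let moment4 : (\int[nu]_x (x ^+ 4)%:E <= (s ^+ 4 * 3)%:E)%E.
Proof.
have h := @cvg_integral_sym nu (fun x => (x ^+ 4)%:E).
apply: (cvge_to_le (h _ _)).
- by apply/measurable_EFinP; apply: measurable_funX.
- by move=> x; rewrite lee_fin exprn_even_ge0.
apply: nearW => n; rewrite moment4n.
apply: (@le_trans _ _ (0 + (s ^+ 2 * 3)%:E * (s ^+ 2)%:E)%E).
  apply: leeD.
    rewrite lee_fin /K phN.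
    rewrite (_ : _ - _ = - (s ^+ 2 * 2 * (n.+1%:R ^+ 3 * ph n.+1%:R))); last by ring.
    have s2 : 0 <= s ^+ 2 by exact: sqr_ge0.
    have N3 : 0 <= (n.+1%:R : R) ^+ 3 by rewrite exprn_ge0.
    rewrite oppr_le0; apply: mulr_ge0; first exact: mulr_ge0.
    by apply: mulr_ge0 => //; exact: ph0.
  apply: lee_wpmul2l; first by rewrite lee_fin mulr_ge0 ?sqr_ge0.
  rewrite -[leRHS](_ : (s ^+ 2 + 0 ^+ 2)%:E = _); last by rewrite expr0n addr0.
  rewrite -moment2; under [leRHS]eq_integral do rewrite addr0.
  apply: ge0_subset_integral => //.
    by apply/measurable_EFinP; apply: measurable_funX.
  by move=> x _; rewrite lee_fin sqr_ge0.
by rewrite -EFinM -EFinD lee_fin add0r le_eqVlt; apply/orP; left; apply/eqP; ring.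
Qed.

Section rv.
Context d (T : measurableType d) (P : probability T R) (Z : T -> R).
Hypotheses (mZ : measurable_fun setT Z)
  (ZN : forall A, measurable A -> P (Z @^-1` A) = normal_prob 0 s A).

Let ZE (f : R -> R) : measurable_fun setT f -> (forall x, 0 <= f x) ->
  (\int[P]_w (f (Z w))%:E = \int[nu]_x (f x)%:E)%E.
Proof.
move=> mf f0; have mZ' : @measurable_fun _ _ T (measurableTypeR R) setT Z by move=> mT A mA; exact: mZ.
pose ZZ : {mfun T >-> measurableTypeR R} := @mfun_Sub _ _ T (measurableTypeR R) Z (mem_set mZ').
rewrite -(@ge0_integral_distribution _ _ _ _ _ P ZZ (EFin \o f))//.
- by apply: eq_measure_integral => A mA _; exact: ZN.
- exact/measurable_EFinP.
Qed.

Lemma normal_integrable4 : P.-integrable setT (fun w => (Z w ^+ 4)%:E).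
Proof.
apply/integrableP; split.
  by apply/measurable_EFinP; apply: measurable_funX.
under eq_integral do rewrite gee0_abs ?lee_fin ?exprn_even_ge0//.
rewrite (ZE (f := fun x => x ^+ 4)); first exact: le_lt_trans moment4 (ltry _).
- exact: measurable_funX.
- by move=> x; rewrite exprn_even_ge0.
Qed.

Lemma normal_moment4 : \int[P]_w (Z w ^+ 4) <= s ^+ 4 * 3.
Proof.
rewrite -lee_fin fineK; last exact: integrable_fin_num normal_integrable4.
rewrite (ZE (f := fun x => x ^+ 4)); [exact: moment4|exact: measurable_funX|].
by move=> x; rewrite exprn_even_ge0.
Qed.

Lemma normal_moment2 c : (\int[P]_w ((Z w + c) ^+ 2)%:E = (s ^+ 2 + c ^+ 2)%:E)%E.
Proof.
rewrite (ZE (f := fun x => (x + c) ^+ 2)); first exact: moment2.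
  by apply: measurable_funX; exact: measurable_funD.
by move=> x; exact: sqr_ge0.
Qed.

End rv.

End gaussian.
End density.

(** * Smoothing by cubic splines *)

Section smooth_step.
Context (R : realType).
Implicit Types x y : R.

Definition pos x : R := Num.max x 0.

Lemma posP x : (0 <= x /\ pos x = x) \/ (x <= 0 /\ pos x = 0).
Proof. by rewrite /pos; case: (leP x 0) => h; [right|left; split=> //; exact: ltW]. Qed.

(** The distribution function of the sum of three independent uniform variables on [0, 1], a cubic
    spline rising from 0 at 0 to 1 at 3. [sstep1] is its derivative and [sstep2] half of its second
    derivative, the coefficients of its Taylor expansion. *)
Definition sstep x : R :=
  (pos x ^+ 3 - 3 * pos (x - 1) ^+ 3 + 3 * pos (x - 2) ^+ 3 - pos (x - 3) ^+ 3) / 6.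
Definition sstep1 x : R :=
  (pos x ^+ 2 - 3 * pos (x - 1) ^+ 2 + 3 * pos (x - 2) ^+ 2 - pos (x - 3) ^+ 2) / 2.
Definition sstep2 x : R :=
  (pos x - 3 * pos (x - 1) + 3 * pos (x - 2) - pos (x - 3)) / 2.

Lemma sstep_cases x :
  (x <= 0 /\ [/\ sstep x = 0, sstep1 x = 0 & sstep2 x = 0]) \/
      (0 <= x <= 1 /\ [/\ sstep x = x ^+ 3 / 6, sstep1 x = x ^+ 2 / 2 & sstep2 x = x / 2]) \/
      (1 <= x <= 2 /\ [/\ sstep x = (x ^+ 3 - 3 * (x - 1) ^+ 3) / 6,
          sstep1 x = (x ^+ 2 - 3 * (x - 1) ^+ 2) / 2 & sstep2 x = (3 - 2 * x) / 2]) \/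
      (2 <= x <= 3 /\ [/\ sstep x = 1 - (3 - x) ^+ 3 / 6, sstep1 x = (3 - x) ^+ 2 / 2 &
          sstep2 x = (x - 3) / 2]) \/
      (3 <= x /\ [/\ sstep x = 1, sstep1 x = 0 & sstep2 x = 0]).
Proof.
rewrite /sstep /sstep1 /sstep2.
case: (posP x) => -[h0 ->]; case: (posP (x - 1)) => -[h1 ->];
case: (posP (x - 2)) => -[h2 ->]; case: (posP (x - 3)) => -[h3 ->]; try (exfalso; lra).
- by do 4 right; split; [lra|split; field].
- by do 3 right; left; split; [lra|split; field].
- by do 2 right; left; split; [lra|split; field].
- by right; left; split; [lra|split; field].
- by left; split; [lra|split; field].
Qed.

Lemma sstep_itv x : 0 <= sstep x <= 1.
Proof.
have [[h [-> _ _]]|[[h [-> _ _]]|[[h [-> _ _]]|[[h [-> _ _]]|[h [-> _ _]]]]]] := sstep_cases x.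
- lra.
- have x0 : 0 <= x ^+ 3 by rewrite exprn_ge0//; lra.
  have x1 : x ^+ 3 <= 1 by rewrite exprn_ile1//; lra.
  lra.
- have [u ux] : exists u, x = 1 + u by exists (x - 1); ring.
  have u01 : 0 <= u <= 1 by lra.
  have h1 : 0 <= (1 - u) ^+ 2 * (1 + 2 * u) by rewrite mulr_ge0 ?sqr_ge0//; lra.
  have h2 : 0 <= u ^+ 2 * (3 - 2 * u) by rewrite mulr_ge0 ?sqr_ge0//; lra.
  rewrite ux (_ : _ / 6 = (1 + 3 * u + u ^+ 2 * (3 - 2 * u)) / 6); last by field.
  have -> : u ^+ 2 * (3 - 2 * u) = 1 - (1 - u) ^+ 2 * (1 + 2 * u) by ring.
  have h3 : (1 - u) ^+ 2 * (1 + 2 * u) = 1 - u ^+ 2 * (3 - 2 * u) by ring.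
  lra.
- have x0 : 0 <= (3 - x) ^+ 3 by rewrite exprn_ge0//; lra.
  have x1 : (3 - x) ^+ 3 <= 1 by rewrite exprn_ile1//; lra.
  lra.
- lra.
Qed.

Lemma sstep1_itv x : `|sstep1 x| <= 1.
Proof.
rewrite ler_norml.
have [[h [_ -> _]]|[[h [_ -> _]]|[[h [_ -> _]]|[[h [_ -> _]]|[h [_ -> _]]]]]] := sstep_cases x;
  nra.
Qed.

Lemma sstep2_itv x : `|sstep2 x| <= 1.
Proof.
rewrite ler_norml.
have [[h [_ _ ->]]|[[h [_ _ ->]]|[[h [_ _ ->]]|[[h [_ _ ->]]|[h [_ _ ->]]]]]] := sstep_cases x;
  lra.
Qed.

Lemma sstep0 x : x <= 0 -> sstep x = 0.
Proof.
move=> x0.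
have [[h [-> _ _]]|[[h [-> _ _]]|[[h [-> _ _]]|[[h [-> _ _]]|[h [-> _ _]]]]]] := sstep_cases x.
- by [].
- have -> : x = 0 by lra.
  by field.
- lra.
- lra.
- lra.
Qed.

Lemma sstep_1 x : 3 <= x -> sstep x = 1.
Proof.
move=> x3.
have [[h [-> _ _]]|[[h [-> _ _]]|[[h [-> _ _]]|[[h [-> _ _]]|[h [-> _ _]]]]]] := sstep_cases x.
- lra.
- lra.
- lra.
- have -> : x = 3 by lra.
  by field.
- by [].
Qed.

(** When x and x + y lie on the same side of 0 the remainder is y^3 or 0; a change of sign only
    makes it smaller in absolute value. *)
Lemma pos_taylor x y :
  `|pos (x + y) ^+ 3 - pos x ^+ 3 - 3 * pos x ^+ 2 * y - 3 * pos x * y ^+ 2| <= `|y| ^+ 3.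
Proof.
case: (posP x) => -[hx ->]; case: (posP (x + y)) => -[hy ->].
- rewrite (_ : _ - _ = y ^+ 3); first by rewrite normrX.
  by ring.
- have y0 : y <= 0 by lra.
  have h1 : 0 <= (- (x + y)) ^+ 3 by rewrite exprn_ge0//; lra.
  have h2 : (- (x + y)) ^+ 3 <= (- y) ^+ 3.
    by rewrite lerXn2r ?nnegrE//; lra.
  rewrite (ler0_norm y0) (_ : _ - _ = (- (x + y)) ^+ 3 - (- y) ^+ 3); last by ring.
  rewrite ler_norml; lra.
- have h1 : 0 <= (x + y) ^+ 3 by rewrite exprn_ge0//; lra.
  have h2 : (x + y) ^+ 3 <= y ^+ 3 by rewrite lerXn2r ?nnegrE//; lra.
  rewrite (_ : _ - _ = (x + y) ^+ 3); last by ring.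
  by rewrite ger0_norm// -normrX ger0_norm//; lra.
- rewrite (_ : _ - _ = 0); last by ring.
  by rewrite normr0 exprn_ge0.
Qed.

(** The Lindeberg remainder: cubic for small increments, quadratic for large ones, so that a finite
    second moment suffices. *)
Definition mcube y : R := Num.min (`|y| ^+ 3) (y ^+ 2).

Lemma mcube_ge0 y : 0 <= mcube y.
Proof. by rewrite /mcube le_min exprn_ge0//= sqr_ge0. Qed.

(** For |y| <= 1 the four truncated cubes contribute (1 + 3 + 3 + 1) / 6 times |y|^3. Beyond, the
    increment of [sstep], the linear term and the quadratic term are at most y^2 each, hence the
    constant 3. *)
Lemma sstep_taylor x y :
  `|sstep (x + y) - sstep x - sstep1 x * y - sstep2 x * y ^+ 2| <= 3 * mcube y.
Proof.
case: (leP `|y| 1) => y1.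
  have -> : mcube y = `|y| ^+ 3.
    rewrite /mcube; apply/min_idPl; rewrite -[leRHS]real_normK ?num_real//.
    by rewrite exprS ler_piMl// exprn_ge0.
  pose t z := pos (z + y) ^+ 3 - pos z ^+ 3 - 3 * pos z ^+ 2 * y - 3 * pos z * y ^+ 2.
  have e : sstep (x + y) - sstep x - sstep1 x * y - sstep2 x * y ^+ 2 =
     (t x - 3 * t (x - 1) + 3 * t (x - 2) - t (x - 3)) / 6.
    by rewrite /t /sstep /sstep1 /sstep2 !(addrAC x y); field.
  have ht z : `|t z| <= `|y| ^+ 3 by exact: pos_taylor.
  have y3 : 0 <= `|y| ^+ 3 by rewrite exprn_ge0.
  move: (ht x) (ht (x - 1)) (ht (x - 2)) (ht (x - 3)); rewrite e.
  move: (t x) (t (x - 1)) (t (x - 2)) (t (x - 3)) => t0 t1 t2 t3.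
  by rewrite !ler_norml; lra.
have -> : mcube y = y ^+ 2.
  rewrite /mcube; apply/min_idPr; rewrite -[leLHS]real_normK ?num_real//.
  by rewrite [leRHS]exprS ler_peMl ?exprn_ge0// ltW.
have y2 : `|y| <= y ^+ 2.
  by rewrite -[leRHS]real_normK ?num_real// expr2 ler_peMl// ltW.
have h1 : `|sstep1 x * y| <= y ^+ 2.
  by rewrite normrM; apply: le_trans y2; rewrite ler_piMl// sstep1_itv.
have h2 : `|sstep2 x * y ^+ 2| <= y ^+ 2.
  by rewrite normrM (ger0_norm (sqr_ge0 y)) ler_piMl ?sqr_ge0// sstep2_itv.
have := sstep_itv x; have := sstep_itv (x + y).
by move: h1 h2; rewrite !ler_norml; lra.
Qed.

Lemma measurable_sstep : measurable_fun setT sstep.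
Proof.
have mp c : measurable_fun setT (fun x => pos (x - c) ^+ 3).
  apply: measurable_funX; rewrite /pos; apply: measurable_maxr => //.
  exact: measurable_funB.
rewrite (_ : sstep = fun x => (pos (x - 0) ^+ 3 - 3 * pos (x - 1) ^+ 3 +
  3 * pos (x - 2) ^+ 3 - pos (x - 3) ^+ 3) / 6); last first.
  by apply/funext => x; rewrite subr0.
apply: measurable_funM => //; apply: measurable_funB => //.
by apply: measurable_funD; [apply: measurable_funB => //|]; apply: measurable_funM.
Qed.

End smooth_step.

Section taylor_class.
Context (R : realType).
Implicit Types (H h : R -> R) (x y : R).

(** No derivative is mentioned: for matching moments it only matters that the coefficients do not
    depend on y. *)
Definition taylor H C := exists a b : R -> R, forall x y,
  `|H (x + y) - H x - a x * y - b x * y ^+ 2| <= C * mcube y.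

Lemma taylor_scale H C (e k : R) : taylor H C -> 0 < e -> 0 <= C ->
  taylor (fun x => H (x / e - k)) (C * (e ^- 3 + e ^- 2)).
Proof.
move=> [a [b Hab]] e0 C0; exists (fun x => a (x / e - k) / e), (fun x => b (x / e - k) / e ^+ 2) => x y.
have := Hab (x / e - k) (y / e).
rewrite (_ : x / e - k + y / e = (x + y) / e - k); last by rewrite mulrDl; ring.
rewrite (_ : a _ / e * y = a (x / e - k) * (y / e)); last by ring.
rewrite (_ : b _ / e ^+ 2 * y ^+ 2 = b (x / e - k) * (y / e) ^+ 2); last first.
  by rewrite exprMn exprVn; ring.
move=> /le_trans; apply; rewrite -mulrA; apply: ler_wpM2l => //; rewrite /mcube.
have e3 : 0 <= e ^- 3 by rewrite invr_ge0 exprn_ge0// ltW.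
have e2 : 0 <= e ^- 2 by rewrite invr_ge0 exprn_ge0// ltW.
have ei : 0 <= e^-1 by rewrite invr_ge0 ltW.
rewrite normrM !exprMn (ger0_norm ei) !exprVn.
have y3 : 0 <= `|y| ^+ 3 by rewrite exprn_ge0.
rewrite ge_min; apply/orP.
case: (leP (`|y| ^+ 3) (y ^+ 2)) => h; rewrite mulrDl.
  by left; rewrite mulrC lerDl mulr_ge0.
by right; rewrite mulrC lerDr mulr_ge0// sqr_ge0.
Qed.

Lemma taylorZ H C c : taylor H C -> taylor (fun x => c * H x) (`|c| * C).
Proof.
move=> [a [b Hab]]; exists (fun x => c * a x), (fun x => c * b x) => x y.
rewrite (_ : _ - _ = c * (H (x + y) - H x - a x * y - b x * y ^+ 2)); last by ring.
by rewrite normrM -mulrA ler_wpM2l.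
Qed.

Lemma taylorD H C H' C' : taylor H C -> taylor H' C' ->
  taylor (fun x => H x + H' x) (C + C').
Proof.
move=> [a [b Hab]] [a' [b' Hab']].
exists (fun x => a x + a' x), (fun x => b x + b' x) => x y.
rewrite (_ : _ - _ = (H (x + y) - H x - a x * y - b x * y ^+ 2) +
  (H' (x + y) - H' x - a' x * y - b' x * y ^+ 2)); last by ring.
by rewrite mulrDl; apply: le_trans (ler_normD _ _) _; exact: lerD.
Qed.

Lemma taylor_cst c : taylor (fun=> c) 0.
Proof.
exists (fun=> 0), (fun=> 0) => x y.
by rewrite !mul0r !subr0 subrr normr0.
Qed.

Lemma taylor_sum n (H : nat -> R -> R) C : (forall j, taylor (H j) C) ->
  taylor (fun x => \sum_(j < n) H j x) (n%:R * C).
Proof.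
move=> tH; elim: n => [|n IH].
  rewrite mul0r (_ : (fun _ => _) = fun=> 0); first exact: taylor_cst.
  by apply/funext => x; rewrite big_ord0.
rewrite -natr1 mulrDl mul1r (_ : (fun _ => _) = fun x => \sum_(j < n) H j x + H n x).
  exact: taylorD.
by apply/funext => x; rewrite big_ord_recr.
Qed.

Lemma taylor_le H C C' : C <= C' -> taylor H C -> taylor H C'.
Proof.
move=> CC [a [b Hab]]; exists a, b => x y; apply: le_trans (Hab x y) _.
by rewrite ler_wpM2r ?mcube_ge0.
Qed.

(** Interpolates the values [hh 0, ..., hh n] by smoothed jumps; the j-th one takes place over
    [j, j + 3], so neighbouring jumps overlap. *)
Definition staircase (hh : nat -> R) n y : R :=
  hh 0%N + \sum_(j < n) (hh j.+1 - hh j) * sstep (y - j%:R).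

Lemma staircaseS hh n y : staircase hh n.+1 y =
  staircase hh n y + (hh n.+1 - hh n) * sstep (y - n%:R).
Proof. by rewrite /staircase big_ord_recr /= addrA. Qed.

Lemma staircase_right hh n y : n%:R + 2 <= y -> staircase hh n y = hh n.
Proof.
elim: n => [|n IH] h; first by rewrite /staircase big_ord0 addr0.
move: h; rewrite -natr1 => h; rewrite staircaseS IH; last by lra.
by rewrite sstep_1 ?mulr1; [ring|lra].
Qed.

Lemma staircase_mid hh (m n : nat) y : (m <= n)%N -> y <= m%:R ->
  staircase hh n y = staircase hh m y.
Proof.
move=> /subnKC <- ym; elim: (n - m)%N => [|k IH]; first by rewrite addn0.
rewrite addnS staircaseS IH sstep0 ?mulr0 ?addr0// subr_le0.
by apply: (le_trans ym); rewrite ler_nat leq_addr.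
Qed.

Lemma staircase_dist hh n k e y : (forall j, `|hh j.+1 - hh j| <= e) -> 0 <= e ->
  `|staircase hh (n + k) y - staircase hh n y| <= k%:R * e.
Proof.
move=> he e0; elim: k => [|k IH]; first by rewrite addn0 subrr normr0 mul0r.
rewrite addnS staircaseS addrAC -natr1 [leRHS]mulrDl mul1r.
apply: le_trans (ler_normD _ _) _; apply: lerD => //.
have /andP[s0 s1] := sstep_itv (y - (n + k)%:R).
by rewrite normrM (ger0_norm s0); apply: le_trans (he (n + k)%N); rewrite ler_piMr.
Qed.

(** At most three jumps are in progress at y, hence 3 * e. Away from both ends the index is
    [truncn y - 2]: all jumps before it are complete. *)
Lemma staircase_approx hh n e y : (forall j, `|hh j.+1 - hh j| <= e) -> 0 <= e ->
  exists2 k, `|staircase hh n y - hh k| <= 3 * e & 0 <= y <= n%:R -> `|y - k%:R| <= 3.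
Proof.
move=> he e0.
have hh0 : staircase hh 0 y = hh 0%N by rewrite /staircase big_ord0 addr0.
have [n3|n3] := leqP n 2.
  exists 0%N.
    rewrite -hh0 -{1}[n]add0n; apply: le_trans (staircase_dist _ _ _ he e0) _.
    by rewrite ler_wpM2r// ler_nat; apply: leq_trans n3 _.
  move=> /andP[y0 yn]; rewrite subr0 ger0_norm//; apply: le_trans yn _.
  by rewrite (ler_nat _ n 3); apply: leq_trans n3 _.
have [yn|yn] := leP (n%:R + 2) y.
  exists n; first by rewrite staircase_right// subrr normr0 mulr_ge0.
  by lra.
have [y3|y3] := leP 2 y; last first.
  exists 0%N; last by rewrite subr0 => /andP[y0 _]; rewrite ger0_norm//; lra.
  rewrite (@staircase_mid hh 2 n)//; [|exact: ltnW|by rewrite ltW].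
  rewrite -hh0 -{1}[2%N]add0n; apply: le_trans (staircase_dist _ _ _ he e0) _.
  by rewrite ler_wpM2r// ler_nat.
pose k := (Num.truncn y - 2)%N.
have y0 : 0 <= y by lra.
have /andP[t1 t2] := truncn_itv y0.
have ty : (2 <= Num.truncn y)%N by rewrite -ltnS -(ltr_nat R); apply: le_lt_trans y3 t2.
have tk : (Num.truncn y)%:R = k%:R + 2 :> R by rewrite -natrD subnK.
have hk : staircase hh k y = hh k by apply: staircase_right; rewrite -tk.
exists k; last first.
  by rewrite -natr1 tk in t2; rewrite tk in t1 => _; rewrite ler_norml; lra.
have [kn|kn] := leqP (k + 3) n.
  rewrite (@staircase_mid hh (k + 3) n)//; last first.
    by apply: ltW; rewrite -natr1 tk in t2; rewrite natrD; lra.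
  by rewrite -hk; apply: staircase_dist.
have kn' : (k <= n)%N.
  rewrite -(ler_nat R); rewrite tk in t1; lra.
rewrite -hk -(subnKC kn'); apply: le_trans (staircase_dist _ _ _ he e0) _.
by rewrite ler_wpM2r// ler_nat leq_subLR addnC ltnW// addnC.
Qed.

Definition bl K M h := (forall x, `|h x| <= M) /\ (forall x y, `|h x - h y| <= K * `|x - y|).

(** C comes before h: in the proof of Donsker's theorem h depends on frozen coordinates, and the
    error must not. The staircase of mesh e covers [-N e, N e]; outside, H is only bounded and
    Chebyshev's inequality takes over. *)
Lemma bl_smooth K M e N : 0 <= K -> 0 <= M -> 0 < e ->
  exists2 C, 0 <= C & forall h, bl K M h -> exists H, [/\ measurable_fun setT H,
    taylor H C, forall x, `|H x| <= M + 3 * (K * e) &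
    forall x, `|x| <= N%:R * e -> `|H x - h x| <= 6 * (K * e)].
Proof.
move=> K0 M0 e0.
pose C0 := 2 * M * (3 * (e ^- 3 + e ^- 2)).
have C00 : 0 <= C0.
  by rewrite !mulr_ge0// addr_ge0// invr_ge0 exprn_ge0// ltW.
exists ((N + N)%:R * C0); first by rewrite mulr_ge0.
move=> h [hM hK].
pose hh j := h ((j%:R - N%:R) * e).
have he j : `|hh j.+1 - hh j| <= K * e.
  apply: le_trans (hK _ _) _; rewrite ler_wpM2l// (_ : _ - _ = e).
    by rewrite ger0_norm// ltW.
  by rewrite -natr1; ring.
have hM2 j : `|hh j.+1 - hh j| <= 2 * M.
  apply: le_trans (ler_normB _ _) _; have := hM ((j.+1%:R - N%:R) * e).
  by have := hM ((j%:R - N%:R) * e); rewrite /hh; lra.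
have Ke0 : 0 <= K * e by rewrite mulr_ge0// ltW.
exists (fun x => staircase hh (N + N) (x / e + N%:R)); split.
- apply: measurable_funD => //; apply: measurable_sum => j.
  apply: measurable_funM => //; apply: measurableT_comp; first exact: measurable_sstep.
  by apply: measurable_funB => //; apply: measurable_funD => //; exact: measurable_funM.
- rewrite /staircase -[X in taylor _ X]add0r.
  apply: taylorD; first exact: taylor_cst.
  apply: (@taylor_sum (N + N) (fun j x => (hh j.+1 - hh j) * sstep (x / e + N%:R - j%:R))) => j.
  apply: (@taylor_le _ (`|hh j.+1 - hh j| * (3 * (e ^- 3 + e ^- 2)))).
    by rewrite ler_wpM2r// mulr_ge0// addr_ge0// invr_ge0 exprn_ge0// ltW.
  apply: (@taylorZ (fun x => sstep (x / e + N%:R - j%:R))).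
  under eq_fun do rewrite -[X in sstep X]addrA -[N%:R - j%:R]opprB.
  apply: taylor_scale => //.
  by exists (@sstep1 R), (@sstep2 R) => x y; exact: sstep_taylor.
- move=> x; have [k hk _] := staircase_approx (N + N) (x / e + N%:R) he Ke0.
  rewrite -[X in `|X|](subrK (hh k)); apply: le_trans (ler_normD _ _) _.
  by rewrite addrC; apply: lerD => //; exact: hM.
- move=> x xN; have [k hk ky] := staircase_approx (N + N) (x / e + N%:R) he Ke0.
  have {}ky : `|x / e + N%:R - k%:R| <= 3.
    apply: ky; move: xN; rewrite ler_norml natrD => /andP[x1 x2]; apply/andP; split.
      by rewrite -lerBlDr sub0r ler_pdivlMr// mulNr.
    by rewrite lerD2r ler_pdivrMr.
  rewrite -(subrKA (hh k)); apply: le_trans (ler_normD _ _) _.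
  (* One 3 comes from the unfinished jumps, the other from the distance between x and its grid
     point. *)
  rewrite (_ : 6 * (K * e) = 3 * (K * e) + 3 * (K * e)); last by ring.
  apply: lerD => //; apply: le_trans (hK _ _) _.
  rewrite [leRHS]mulrCA ler_wpM2l// (_ : `|_| = `|x / e + N%:R - k%:R| * e).
    by rewrite ler_wpM2r// ltW.
  rewrite -{3}(ger0_norm (ltW e0)) -normrM distrC; congr `|_|.
  by field; rewrite gt_eqF.
Qed.

End taylor_class.

(** * Second moments and Lindeberg's comparison of sums *)

Section moments.
Context d (T : measurableType d) (R : realType) (P : probability T R).
Implicit Types xi : T -> R.

Definition intg xi := P.-integrable setT (EFin \o xi).

Lemma intg_measurable xi : intg xi -> measurable_fun setT xi.
Proof. by move=> /measurable_int/measurable_EFinP. Qed.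

Lemma intg_le xi (g : T -> R) : measurable_fun setT xi -> intg g ->
  (forall w, `|xi w| <= g w) -> intg xi.
Proof.
move=> mx ig h; apply: (le_integrable measurableT _ _ ig).
  exact/measurable_EFinP.
by move=> w _ /=; rewrite lee_fin; apply: le_trans (h w) (ler_norm _).
Qed.

Lemma intg_cst (c : R) : intg (fun=> c).
Proof. exact: bmf_integrable (bmf_cst _ c). Qed.

Lemma intgD xi g : intg xi -> intg g -> intg (fun w => xi w + g w).
Proof.
move=> h1 h2; rewrite /intg (_ : _ \o _ = (EFin \o xi) \+ (EFin \o g))%E//.
exact: integrableD.
Qed.

Lemma intgZ c xi : intg xi -> intg (fun w => c * xi w).
Proof.
move=> h1; rewrite /intg (_ : _ \o _ = (fun w => c%:E * (EFin \o xi) w))%E//.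
exact: integrableZl.
Qed.

Lemma intgB xi g : intg xi -> intg g -> intg (fun w => xi w - g w).
Proof.
move=> h1 h2; have h := intgD h1 (intgZ (-1) h2).
by rewrite (_ : (fun w => _) = fun w => xi w + -1 * g w)//; apply/funext => w; rewrite mulN1r.
Qed.

Lemma ge0_intg xi (c : R) : measurable_fun setT xi -> (forall w, 0 <= xi w) ->
  (\int[P]_w (xi w)%:E <= c%:E)%E -> intg xi /\ \int[P]_w xi w <= c.
Proof.
move=> mx x0 h; have ix : intg xi.
  apply/integrableP; split; first exact/measurable_EFinP.
  under eq_integral do rewrite gee0_abs ?lee_fin//.
  exact: le_lt_trans h (ltry _).
split=> //; rewrite -lee_fin /Rintegral fineK//.
exact: integrable_fin_num.
Qed.

Lemma intg_sqr xi : measurable_fun setT xi -> intg (fun w => xi w ^+ 2) -> intg xi.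
Proof.
move=> mx i2; apply: (intg_le mx (intgD (intg_cst 1) i2)) => w.
by rewrite -[X in _ + X]real_normK ?num_real//; nra.
Qed.

Lemma chebyshev_sqr xi (e c : R) : measurable_fun setT xi -> 0 < e ->
  (\int[P]_w (xi w ^+ 2)%:E <= c%:E)%E ->
  fine (P [set w | e <= `|xi w|]) <= c / e ^+ 2.
Proof.
move=> mx e0 h.
have mA : measurable [set w | e <= `|xi w|].
  rewrite -[X in measurable X]setTI; apply: measurable_fun_ler => //.
  exact: measurableT_comp.
have [i2 le2] := ge0_intg (measurable_funX 2 mx) (fun w => sqr_ge0 (xi w)) h.
rewrite -Ex_indic// ler_pdivlMr ?exprn_gt0//; apply: le_trans le2.
have bA : bmf (\1_[set w | e <= `|xi w|] : T -> R) by exact: bmf_indic.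
rewrite mulrC -RintegralZl//; last exact: bmf_integrable.
apply: le_Rintegral => //; first exact: (intgZ _ (bmf_integrable P bA)).
move=> w _; rewrite indicE; case: (boolP (w \in _)) => [|_]; last by rewrite mulr0 sqr_ge0.
rewrite inE /= mulr1 => ew; rewrite -[leRHS]real_normK ?num_real//.
by rewrite lerXn2r ?nnegrE// ltW.
Qed.

Definition centered xi v := [/\ measurable_fun setT xi, intg (fun w => xi w ^+ 2),
  \int[P]_w xi w = 0 & \int[P]_w xi w ^+ 2 = v].

Lemma measurable_mcube : measurable_fun setT (@mcube R).
Proof.
apply: measurable_minr; last exact: measurable_funX.
apply: measurable_funX; exact: normr_measurable.
Qed.

Lemma intg_mcube xi : measurable_fun setT xi -> intg (fun w => xi w ^+ 2) ->
  intg (fun w => mcube (xi w)).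
Proof.
move=> mx i2; apply: (intg_le _ i2); first exact: (measurableT_comp measurable_mcube mx).
by move=> w; rewrite ger0_norm ?mcube_ge0// /mcube ge_min lexx orbT.
Qed.

(** The linear term has mean zero and the quadratic one has mean b u v, so up to the remainder the
    result depends on the law of xi only through its variance. This makes two variables of equal
    variance interchangeable. *)
Lemma taylor_Ex xi v (H a b : R -> R) (C u : R) : centered xi v -> bmf H ->
  (forall x y, `|H (x + y) - H x - a x * y - b x * y ^+ 2| <= C * mcube y) ->
  `|\int[P]_w H (u + xi w) - (H u + b u * v)| <= C * \int[P]_w mcube (xi w).
Proof.
move=> [mx i2 E1 E2] [mH [M HM]] Hab.
have i1 := intg_sqr mx i2; have im := intg_mcube mx i2.
have iH : intg (fun w => H (u + xi w)).
  apply: bmf_integrable; split; last by exists M.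
  by apply: measurableT_comp => //; exact: measurable_funD.
have iH' := intgB iH (intg_cst (H u)).
have iH'' := intgB iH' (intgZ (a u) i1).
have iH3 := intgB iH'' (intgZ (b u) i2).
have -> : \int[P]_w H (u + xi w) - (H u + b u * v) =
  \int[P]_w (H (u + xi w) - H u - a u * xi w - b u * xi w ^+ 2).
  rewrite (RintegralB measurableT iH'' (intgZ (b u) i2)).
  rewrite (RintegralB measurableT iH' (intgZ (a u) i1)).
  rewrite (RintegralB measurableT iH (intg_cst (H u))).
  rewrite (RintegralZl _ measurableT i1) (RintegralZl _ measurableT i2) E1 E2 Ex_cst.
  by ring.
apply: le_trans (le_normr_Rintegral measurableT iH3) _.
rewrite -(RintegralZl _ measurableT im); apply: le_Rintegral => //.
- apply: (intg_le _ (intgZ C im)); last by move=> w; rewrite normr_id.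
  by apply: measurableT_comp => //; exact: intg_measurable iH3.
- exact: intgZ.
Qed.

(** Stated for the extended integral, so that the induction asks for no integrability of partial
    sums; the cross term vanishes once the last term is decoupled from the others. *)
Lemma sum_moment2 (D : nat -> T -> R) v m :
  indep_seq P D -> (forall i, measurable_fun setT (D i)) ->
  (forall i, (i < m)%N -> centered (D i) v) ->
  (\int[P]_w ((\sum_(i < m) D i w) ^+ 2)%:E = (m%:R * v)%:E)%E.
Proof.
move=> DI mD; elim: m => [|m IH] cD.
  rewrite mul0r; under eq_integral do rewrite big_ord0 expr0n/=.
  by rewrite integral0.
pose G := generators D [set i | (i < m)%N]; pose H := generators D [set m].
pose f (z : g_sigma_algebraType G * g_sigma_algebraType H) : \bar R :=
  ((\sum_(i < m) D i z.1 + D m z.2) ^+ 2)%:E.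
transitivity (\int[P]_w f (w, w))%E.
  by apply: eq_integral => w _; rewrite /f big_ord_recr.
have [mDm i2 E1 E2] := cD m (ltnSn m).
have i1 := intg_sqr mDm i2.
have mf : measurable_fun setT f.
  apply/measurable_EFinP; apply: measurable_funX; apply: measurable_funD.
    apply: (@measurableT_comp _ _ _ _ _ _ (fun w : g_sigma_algebraType G => \sum_(i < m) D i w)) => //.
    apply: (@measurable_sum _ _ _ _ _ _ (fun (i : 'I_m) (w : g_sigma_algebraType G) => D i w)) => i.
    by apply: (@generators_mfun _ _ _ _ D [set i | (i < m)%N]) => /=.
  apply: (@measurableT_comp _ _ _ _ _ _ (D m : g_sigma_algebraType H -> R)) => //.
  exact: (@generators_mfun _ _ _ _ D [set m]).
have f0 z : (0 <= f z)%E by rewrite lee_fin sqr_ge0.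
have gm (A : set nat) : generators D A `<=` @measurable _ T.
  exact: (generators_measurable mD).
rewrite (ge0_decouple (gm _) (gm _) (DI m) mf f0).
have mS : measurable_fun setT (fun w => \sum_(i < m) D i w).
  by apply: (@measurable_sum _ _ _ _ _ _ (fun (i : 'I_m) (w : T) => D i w)).
transitivity (\int[P]_w ((\sum_(i < m) D i w) ^+ 2 + v)%:E)%E.
  apply: eq_integral => w _; rewrite /f /=.
  set u := \sum_(i < m) D i w.
  have iu : intg (fun w2 => u ^+ 2 + u * 2 * D m w2 + D m w2 ^+ 2).
    by apply: intgD => //; apply: intgD; [exact: intg_cst|exact: intgZ].
  rewrite -[LHS]fineK; last first.
    have := integrable_fin_num measurableT iu; congr (_ \is a fin_num).
    by apply: eq_integral => x _ /=; congr EFin; ring.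
  congr EFin; transitivity (\int[P]_w2 (u ^+ 2 + u * 2 * D m w2 + D m w2 ^+ 2)).
    by apply: eq_Rintegral => x _; ring.
  rewrite (RintegralD measurableT (intgD (intg_cst _) (intgZ _ i1)) i2).
  rewrite (RintegralD measurableT (intg_cst _) (intgZ _ i1)).
  by rewrite (RintegralZl _ measurableT i1) E1 E2 Ex_cst; ring.
have v0 : 0 <= v by rewrite -E2; apply: Ex_ge0 => w; exact: sqr_ge0.
under eq_integral do rewrite EFinD.
rewrite ge0_integralD//.
- rewrite IH; last by move=> i im; apply: cD; exact: ltnW.
  rewrite integral_cst// [X in (_ * X)%E](@probability_setT _ _ _ P) mule1 -EFinD.
  by rewrite -natr1 mulrDl mul1r.
- by move=> x _; rewrite lee_fin sqr_ge0.
- by apply/measurable_EFinP; exact: measurable_funX.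
Qed.

End moments.

Section lindeberg.
Context (R : realType).
Context d (T : measurableType d) (P : probability T R).
Context d' (T' : measurableType d') (P' : probability T' R).
Variables (D : nat -> T -> R) (D' : nat -> T' -> R) (v r r' : R) (m : nat).
Hypotheses (DI : indep_seq P D) (DI' : indep_seq P' D').
Hypotheses (mD : forall i, measurable_fun setT (D i))
  (mD' : forall i, measurable_fun setT (D' i)).
Hypotheses (cD : forall i, (i < m)%N -> centered P (D i) v)
  (cD' : forall i, (i < m)%N -> centered P' (D' i) v).
Hypotheses (hr : forall i, (i < m)%N -> \int[P]_w mcube (D i w) <= r)
  (hr' : forall i, (i < m)%N -> \int[P']_w mcube (D' i w) <= r').

Lemma lindeberg_taylor (H : R -> R) C : bmf H -> taylor H C -> 0 <= C ->
  `|\int[P]_w H (\sum_(i < m) D i w) - \int[P']_w H (\sum_(i < m) D' i w)| <=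
  m%:R * (C * (r + r')).
Proof.
move=> bH [a [b Hab]] C0; have [mH [M HM]] := bH.
pose f (u : nat -> R) := H (\sum_(i < m) u i).
have mf : seq_measurable f.
  move=> d2 T2 u mu; apply: measurableT_comp => //.
  exact: (@measurable_sum _ _ _ _ _ _ (fun (i : 'I_m) (w : T2) => u i w)).
have fM : exists M, forall u, `|f u| <= M by exists M => u; exact: HM.
have := @indep_swap R _ T P _ T' P' D D' f m (C * (r + r')) mD mD' DI DI' mf fM.
have mixE d2 (T2 : measurableType d2) (E : nat -> T2 -> R) w u :
    f (mix m E w u) = H (\sum_(i < m) E i w).
  by congr H; apply: eq_bigr => i _; rewrite /mix ltn_ord.
move=> /(_ _ (fun=> 0)); under eq_Rintegral do rewrite mixE.
under [X in `|_ - X|]eq_Rintegral do rewrite mixE.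
apply=> k u km.
pose c := \sum_(i < m | i != k :> nat) u i.
have updE x : f (upd u k x) = H (c + x).
  congr H; rewrite (bigD1 (Ordinal km))//= addrC; congr (_ + _).
    by apply: eq_bigr => i ik; rewrite /upd (negbTE (ik : (i : nat) != k)).
  by rewrite /upd eqxx.
under eq_Rintegral do rewrite updE.
under [X in `|_ - X|]eq_Rintegral do rewrite updE.
have h1 := taylor_Ex c (cD km) bH Hab; have h2 := taylor_Ex c (cD' km) bH Hab.
rewrite -(subrKA (H c + b c * v)); apply: le_trans (ler_normD _ _) _.
rewrite mulrDr; apply: lerD.
  by apply: le_trans h1 _; apply: ler_wpM2l => //; exact: hr.
by rewrite distrC; apply: le_trans h2 _; apply: ler_wpM2l => //; exact: hr'.
Qed.

Lemma bl_measurable K M h : @bl R K M h -> measurable_fun setT h.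
Proof.
move=> [_ hK]; apply: continuous_measurable_fun => x; apply/cvgrPdist_le => e e0.
have K1 : 0 < `|K| + 1 by rewrite ltr_wpDl.
near=> y; apply: le_trans (hK _ _) _.
apply: (@le_trans _ _ ((`|K| + 1) * `|x - y|)).
  by rewrite ler_wpM2r// (le_trans (ler_norm _))// lerDl.
rewrite -ler_pdivlMl//; near: y.
by apply: cvgr_dist_le; [exact: cvg_id|rewrite mulr_gt0// invr_gt0].
Unshelve. all: by end_near. Qed.

(** Replacing h by H, on each of the two sides, costs 6 K e on [-N e, N e] and at most the sum of
    both sup norms outside, weighted by Chebyshev's bound; the exchange itself is made for H. *)
Lemma lindeberg_bl K M e (N : nat) C (H h : R -> R) : 0 <= K -> 0 <= M -> 0 < e -> 0 <= C -> (0 < N)%N ->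
  bl K M h -> measurable_fun setT H -> taylor H C ->
  (forall x, `|H x| <= M + 3 * (K * e)) ->
  (forall x, `|x| <= N%:R * e -> `|H x - h x| <= 6 * (K * e)) ->
  `|\int[P]_w h (\sum_(i < m) D i w) - \int[P']_w h (\sum_(i < m) D' i w)| <=
  m%:R * (C * (r + r')) +
  2 * (6 * (K * e) + (2 * M + 3 * (K * e)) * (m%:R * v / (N%:R * e) ^+ 2)).
Proof.
move=> K0 M0 e0 C0 N0 blh mH tH HM Hh.
have Ne0 : 0 < N%:R * e by rewrite mulr_gt0// ltr0n.
have Ke0 : 0 <= K * e by rewrite mulr_ge0// ltW.
have mh := bl_measurable blh.
have L0 : 0 <= 2 * M + 3 * (K * e) by lra.
have key d2 (T2 : measurableType d2) (P2 : probability T2 R) (Z : T2 -> R) :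
    measurable_fun setT Z -> (\int[P2]_w (Z w ^+ 2)%:E = (m%:R * v)%:E)%E ->
    `|\int[P2]_w h (Z w) - \int[P2]_w H (Z w)| <=
    6 * (K * e) + (2 * M + 3 * (K * e)) * (m%:R * v / (N%:R * e) ^+ 2).
  move=> mZ Z2.
  have bh : bmf (fun w => h (Z w)).
    by split; [exact: measurableT_comp|exists M => w; case: blh].
  have bH : bmf (fun w => H (Z w)).
    by split; [exact: measurableT_comp|exists (M + 3 * (K * e))].
  have h2 : (\int[P2]_w (Z w ^+ 2)%:E <= (m%:R * v)%:E)%E by rewrite Z2.
  have [i2 le2] := ge0_intg (measurable_funX 2 mZ) (fun w => sqr_ge0 (Z w)) h2.
  rewrite -ExB//; apply: le_trans (le_normr_Rintegral measurableT (bmf_integrable P2 (bmfB bh bH))) _.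
  pose q := (2 * M + 3 * (K * e)) / (N%:R * e) ^+ 2.
  have q0 : 0 <= q by rewrite divr_ge0// sqr_ge0.
  apply: (@le_trans _ _ (\int[P2]_w (6 * (K * e) + q * Z w ^+ 2))).
    apply: le_Rintegral => //.
    - exact: bmf_integrable (bmf_norm (bmfB bh bH)).
    - by apply: intgD; [exact: intg_cst|exact: intgZ].
    move=> w _; have [zs|zb] := leP `|Z w| (N%:R * e).
      by rewrite distrC; apply: le_trans (Hh _ zs) _; rewrite lerDl mulr_ge0// sqr_ge0.
    apply: (@le_trans _ _ (2 * M + 3 * (K * e))).
      apply: le_trans (ler_normB _ _) _; have := HM (Z w); have := blh.1 (Z w); lra.
    have : 1 <= Z w ^+ 2 / (N%:R * e) ^+ 2.
      rewrite ler_pdivlMr ?exprn_gt0// mul1r -[leRHS]real_normK ?num_real//.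
      by rewrite lerXn2r ?nnegrE// ltW.
    move=> z1; apply: (@le_trans _ _ (q * Z w ^+ 2)); last by rewrite lerDr mulr_ge0.
    by rewrite /q -mulrA [_^-1 * _]mulrC ler_peMr.
  rewrite (RintegralD measurableT (intg_cst _ _) (intgZ q i2)) Ex_cst lerD2l.
  rewrite (RintegralZl _ measurableT i2); apply: (le_trans (ler_wpM2l q0 le2)).
  by rewrite /q [leRHS]mulrA [leLHS]mulrAC.
have bH : bmf H by split=> //; exists (M + 3 * (K * e)).
have mS : measurable_fun setT (fun w => \sum_(i < m) D i w).
  exact: (@measurable_sum _ _ _ _ _ _ (fun (i : 'I_m) (w : T) => D i w)).
have mS' : measurable_fun setT (fun w => \sum_(i < m) D' i w).
  exact: (@measurable_sum _ _ _ _ _ _ (fun (i : 'I_m) (w : T') => D' i w)).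
have k1 := key _ _ P _ mS (sum_moment2 DI mD cD).
have k2 := key _ _ P' _ mS' (sum_moment2 DI' mD' cD').
have k3 := lindeberg_taylor bH tH C0.
move: k1 k2 k3; rewrite !ler_norml; lra.
Qed.

End lindeberg.

(** * Identical laws and Brownian increments *)

Section identical_laws.
Context (R : realType) d (T : measurableType d) (P : probability T R).
Context d' (T' : measurableType d') (P' : probability T' R).

Lemma law_integral (X : T -> R) (Y : T' -> R) (g : R -> R) :
  measurable_fun setT X -> measurable_fun setT Y -> measurable_fun setT g ->
  (forall A, measurable A -> P (X @^-1` A) = P' (Y @^-1` A)) ->
  (\int[P]_w (g (X w))%:E = \int[P']_w (g (Y w))%:E)%E.
Proof.
move=> mX mY mg XY.
have ge0 (f : R -> \bar R) : measurable_fun setT f -> (forall x, 0 <= f x)%E ->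
    (\int[P]_w (f (X w)) = \int[P']_w (f (Y w)))%E.
  move=> mf f0; pose XX : {mfun T >-> R} := mfun_Sub (mem_set mX : _ \in mfun).
  pose YY : {mfun T' >-> R} := mfun_Sub (mem_set mY : _ \in mfun).
  rewrite -(@ge0_integral_distribution _ _ _ _ _ P XX f)//.
  rewrite -(@ge0_integral_distribution _ _ _ _ _ P' YY f)//.
  by apply: eq_measure_integral => A mA _; exact: XY.
have mg' : measurable_fun setT (EFin \o g) by exact/measurable_EFinP.
rewrite integralE [RHS]integralE; congr (_ - _)%E.
  rewrite [X in integral _ _ X](funepos_comp (EFin \o g) X) [in RHS](funepos_comp (EFin \o g) Y).
  exact: (ge0 ((EFin \o g)^\+)%E (measurable_funepos mg') (fun x => funepos_ge0 _ x)).
rewrite [X in integral _ _ X](funeneg_comp (EFin \o g) X) [in RHS](funeneg_comp (EFin \o g) Y).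
exact: (ge0 ((EFin \o g)^\-)%E (measurable_funeneg mg') (fun x => funeneg_ge0 _ x)).
Qed.

Lemma law_Rintegral (X : T -> R) (Y : T' -> R) (g : R -> R) :
  measurable_fun setT X -> measurable_fun setT Y -> measurable_fun setT g ->
  (forall A, measurable A -> P (X @^-1` A) = P' (Y @^-1` A)) ->
  \int[P]_w g (X w) = \int[P']_w g (Y w).
Proof. by move=> *; congr fine; exact: law_integral. Qed.

Lemma law_intg (X : T -> R) (Y : T' -> R) (g : R -> R) :
  measurable_fun setT X -> measurable_fun setT Y -> measurable_fun setT g ->
  (forall A, measurable A -> P (X @^-1` A) = P' (Y @^-1` A)) ->
  intg P' (fun w => g (Y w)) -> intg P (fun w => g (X w)).
Proof.
move=> mX mY mg XY /integrableP[_ h]; apply/integrableP; split.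
  by apply/measurable_EFinP; exact: measurableT_comp.
rewrite (_ : (\int[P]_w _)%E = (\int[P]_w (`|g (X w)|)%:E)%E)//.
rewrite (law_integral (g := fun x => `|g x|) mX mY _ XY)//.
by apply: measurableT_comp.
Qed.

End identical_laws.

Section brownian_increments.
Context (R : realType) d (T : measurableType d) (P : probability T R)
  (B : R -> {RV P >-> R}) (hB : standard_BM B) (sigma : R) (sigma_ge0 : 0 <= sigma).

Lemma BM_increment s t : 0 <= s -> s < t -> t < 1 ->
  [/\ centered P (fun w => sigma * (B t w - B s w)) (sigma ^+ 2 * (t - s)),
      \int[P]_w mcube (sigma * (B t w - B s w)) <= 2 * sigma ^+ 3 * Num.sqrt (t - s) ^+ 3 &
      (\int[P]_w ((sigma * (B t w - B s w)) ^+ 4)%:E <=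
          (3 * sigma ^+ 4 * (t - s) ^+ 2)%:E)%E].
Proof.
move=> s0 st t1; pose c := Num.sqrt (t - s); pose Z w := B t w - B s w.
have ts : 0 < t - s by rewrite subr_gt0.
have c0 : 0 < c by rewrite sqrtr_gt0.
have c2 : c ^+ 2 = t - s by rewrite sqr_sqrtr// ltW.
have mZ : measurable_fun setT Z by apply: measurable_funB.
have ZN (A : set R) : measurable A -> P (Z @^-1` A) = normal_prob 0 c A.
  by move=> mA; exact: (BM_gauss hB).
have i4 := normal_integrable4 c0 mZ ZN.
have M4 := normal_moment4 c0 mZ ZN.
have M20 := normal_moment2 c0 mZ ZN 0.
have M21 := normal_moment2 c0 mZ ZN 1.
have [i2 _] : intg P (fun w => Z w ^+ 2) /\ \int[P]_w Z w ^+ 2 <= c ^+ 2.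
  apply: ge0_intg; [exact: measurable_funX|by move=> w; exact: sqr_ge0|].
  by move: M20; rewrite expr0n/= addr0; under eq_integral do rewrite addr0; move=> ->.
have i1 := intg_sqr mZ i2.
have E2 : \int[P]_w Z w ^+ 2 = c ^+ 2.
  by rewrite /Rintegral; move: M20; rewrite expr0n/= addr0; under eq_integral do rewrite addr0; move=> ->.
have E1 : \int[P]_w Z w = 0.
  (* The mean is read off the second moments of Z and Z + 1. *)
  have : \int[P]_w ((Z w + 1) ^+ 2) = c ^+ 2 + 1 by rewrite /Rintegral M21 expr1n.
  have -> : \int[P]_w ((Z w + 1) ^+ 2) = \int[P]_w (Z w ^+ 2 + 2 * Z w + 1).
    by apply: eq_Rintegral => w _; ring.
  rewrite (RintegralD measurableT (intgD i2 (intgZ _ i1)) (intg_cst _ _)).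
  rewrite (RintegralD measurableT i2 (intgZ _ i1)) (RintegralZl _ measurableT i1).
  by rewrite Ex_cst E2; lra.
split.
- split.
  + by apply: measurable_funM.
  + rewrite (_ : (fun w => _) = fun w => sigma ^+ 2 * Z w ^+ 2); first exact: intgZ.
    by apply/funext => w; rewrite exprMn.
  + by rewrite (RintegralZl _ measurableT i1) E1 mulr0.
  + rewrite -c2 -E2 -(RintegralZl _ measurableT i2).
    by apply: eq_Rintegral => w _; rewrite exprMn.
- have s3 : 0 <= sigma ^+ 3 by rewrite exprn_ge0.
  (* From z^2 (z - c)^2 >= 0 follows 2 c z^3 <= c^2 z^2 + z^4, which reduces the third absolute
     moment to the second and the fourth and gives c^3 / 2 + 3 c^3 / 2. *)
  apply: (@le_trans _ _ (\int[P]_w (sigma ^+ 3 * c / 2 * Z w ^+ 2 + sigma ^+ 3 / (2 * c) * Z w ^+ 4))).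
    apply: le_Rintegral => //.
    + apply: intg_mcube; first by apply: measurable_funM.
      rewrite (_ : (fun w => _) = fun w => sigma ^+ 2 * Z w ^+ 2); first exact: intgZ.
      by apply/funext => w; rewrite exprMn.
    + by apply: intgD; exact: intgZ.
    move=> w _; apply: (@le_trans _ _ (`|sigma * Z w| ^+ 3)); first by rewrite /mcube ge_min lexx.
    rewrite normrM (ger0_norm sigma_ge0) exprMn.
    have -> : Z w ^+ 2 = `|Z w| ^+ 2 by rewrite real_normK ?num_real.
    have -> : Z w ^+ 4 = `|Z w| ^+ 4 by rewrite -[4%N]/(2 * 2)%N !exprM real_normK ?num_real.
    have z0 : 0 <= `|Z w| by [].
    move: `|Z w| z0 => z z0.
    rewrite (_ : _ + _ = sigma ^+ 3 * (z ^+ 3 + z ^+ 2 * (z - c) ^+ 2 / (2 * c))).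
      apply: ler_wpM2l => //; rewrite lerDl; apply: divr_ge0.
        by rewrite mulr_ge0 ?sqr_ge0.
      by rewrite mulr_ge0// ltW.
    by field; rewrite gt_eqF.
  rewrite (RintegralD measurableT (intgZ _ i2) (intgZ _ i4)).
  rewrite (RintegralZl _ measurableT i2) (RintegralZl _ measurableT i4) E2.
  have q0 : 0 <= sigma ^+ 3 / (2 * c) by rewrite divr_ge0// mulr_ge0// ltW.
  apply: (le_trans (lerD (lexx _) (ler_wpM2l q0 M4))).
  rewrite -/c le_eqVlt; apply/orP; left; apply/eqP.
  by field; rewrite gt_eqF.
- have -> : (\int[P]_w ((sigma * (B t w - B s w)) ^+ 4)%:E)%E =
      (\int[P]_w (sigma ^+ 4 * Z w ^+ 4))%:E.
    rewrite /Rintegral fineK; last exact: (integrable_fin_num measurableT (intgZ _ i4)).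
    by apply: eq_integral => w _; rewrite exprMn.
  rewrite lee_fin (RintegralZl _ measurableT i4).
  have s4 : 0 <= sigma ^+ 4 by rewrite exprn_ge0.
  apply: le_trans (ler_wpM2l s4 M4) _.
  by rewrite -c2 le_eqVlt; apply/orP; left; apply/eqP; ring.
Qed.

End brownian_increments.

Section finite_unions.
Context d (T : measurableType d) (R : realType) (P : probability T R).

Lemma sum_fine_P_le n (A : nat -> set T) (C : set T) :
  (forall k, measurable (A k)) -> measurable C ->
  (forall k, (k < n)%N -> A k `<=` C) ->
  (forall i j w, (i < n)%N -> (j < n)%N -> A i w -> A j w -> i = j) ->
  \sum_(k < n) fine (P (A k)) <= fine (P C).
Proof.
move=> mA mC AC Adisj; rewrite -Ex_indic//.
under eq_bigr do rewrite -Ex_indic//.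
rewrite -(Ex_sum P (f := fun k => \1_(A k))); last by move=> i _; exact: bmf_indic.
apply: Ex_le; [apply: (bmf_sum (f := fun k => \1_(A k))) => i _; exact: bmf_indic|exact: bmf_indic|move=> w].
have [[k [kn Akw]]|none] := pselect (exists k, (k < n)%N /\ A k w); last first.
  rewrite big1 ?indicE ?ler0n// => i _; rewrite indicE memNset// => Aiw.
  by apply: none; exists i.
rewrite (bigD1 (Ordinal kn))//= big1 ?addr0.
  by rewrite !indicE mem_set// mem_set//; exact: (AC k).
move=> i ik; rewrite indicE memNset// => Aiw.
have e : (i : nat) = k by exact: (Adisj i k w (ltn_ord i) kn Aiw Akw).
by move: ik; rewrite -(inj_eq val_inj) /= e eqxx.
Qed.

Lemma Rintegral_dct (f_ : nat -> T -> R) (f g : T -> R) :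
  (forall n, measurable_fun setT (f_ n)) -> intg P g ->
  (forall n w, `|f_ n w| <= g w) -> (forall w, f_ n w @[n --> \oo] --> f w) ->
  \int[P]_w f_ n w @[n --> \oo] --> \int[P]_w f w.
Proof.
move=> mf ig fg ff.
have mf' : measurable_fun setT f by apply: (measurable_fun_cvg mf) => w _.
have iff : intg P f.
  apply: (intg_le mf' ig) => w.
  have h : `|f_ n w| @[n --> \oo] --> `|f w| by apply: cvg_norm.
  by apply: (cvgr_to_le h); apply: nearW.
have ff' w : (f_ n w)%:E @[n --> \oo] --> (f w)%:E.
  by apply: cvg_EFin; [exact: nearW|exact: ff].
have [] := @dominated_convergence _ _ _ P setT measurableT
  (fun n => EFin \o f_ n) (EFin \o f) (EFin \o g) => //.
- by move=> n; exact/measurable_EFinP.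
- exact/measurable_EFinP.
- by apply: aeW => w _; exact: ff'.
- by apply: aeW => w n _; rewrite lee_fin.
move=> _ _ h; apply: fine_cvg.
rewrite fineK; last exact: integrable_fin_num.
exact: h.
Qed.

End finite_unions.

Lemma cvg_invsqrt (R : realType) : (Num.sqrt (n%:R : R))^-1 @[n --> \oo] --> (0 : R).
Proof.
apply/cvgrPdist_lt => e e0; near=> n.
have n0 : (0 : R) < n%:R by near: n; exact: nbhs_infty_gtr.
rewrite sub0r normrN ger0_norm ?invr_ge0// -[X in _ < X]invrK ltf_pV2 ?posrE ?invr_gt0 ?sqrtr_gt0//.
rewrite -[X in X < _]ger0_norm ?invr_ge0 ?(ltW e0)// -sqrtr_sqr ltr_sqrt//.
by near: n; exact: nbhs_infty_gtr.
Unshelve. all: by end_near. Qed.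

(** * Maximal inequalities for the centred walk *)

Record iid_sequence (R : realType) d (T : measurableType d) (P : probability T R)
    (X : nat -> T -> R) (mu sigma : R) : Prop := IidSequence {
  iid_measurable : forall i, measurable_fun setT (X i);
  iid_indep : mutually_independent P X;
  iid_law : forall n A, measurable A -> P (X n @^-1` A) = P (X 0%N @^-1` A);
  iid_sqr : intg P (fun w => X 0%N w ^+ 2);
  iid_mean : \int[P]_w X 0%N w = mu;
  iid_var : \int[P]_w (X 0%N w - mu) ^+ 2 = sigma ^+ 2
}.

Section iid.
Context (R : realType) d (T : measurableType d) (P : probability T R).
Variables (X : nat -> T -> R) (mu sigma : R).
Hypothesis XP : iid_sequence P X mu sigma.

Let mX := iid_measurable XP.
Let XI := iid_indep XP.

(** The starting time p serves block decompositions and the walk after a stopping time. The centring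
    is a parameter as well: with 0 in place of [mu] this is the walk itself. *)
Definition cwalk p m w := \sum_(i < m) (X (p + i)%N w - mu).

Lemma cwalk_range l u p m : (l <= p)%N -> (p + m <= u)%N ->
  range_mfun X l u (cwalk p m).
Proof.
move=> lp pu; apply: range_mfun_sum => i im; apply/andP; split.
  exact: leq_trans lp (leq_addr _ _).
by apply: leq_trans pu; rewrite -addnS leq_add2l.
Qed.

Lemma cwalk_measurable p m : measurable_fun setT (cwalk p m).
Proof. exact: (range_mfun_measurable mX (cwalk_range (leqnn p) (leqnn _))). Qed.

Lemma cwalkD p m k w : cwalk p (m + k) w = cwalk p m w + cwalk (p + m) k w.
Proof.
rewrite /cwalk big_split_ord/=; congr (_ + _).
by apply: eq_bigr => i _; rewrite addnA.
Qed.

Lemma cwalk0 p w : cwalk p 0 w = 0.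
Proof. by rewrite /cwalk big_ord0. Qed.

Lemma iid_intg : intg P (X 0%N).
Proof. exact: intg_sqr (mX 0) (iid_sqr XP). Qed.

Lemma iid_centered0 : intg P (fun w => (X 0%N w - mu) ^+ 2).
Proof.
have h := intgD (iid_sqr XP) (intgD (intgZ (- 2 * mu) iid_intg) (intg_cst P (mu ^+ 2))).
rewrite (_ : (fun w => _) = fun w => X 0 w ^+ 2 + (- 2 * mu * X 0 w + mu ^+ 2))//.
by apply/funext => w; ring.
Qed.

Lemma iid_centered i c : centered P (fun w => (X i w - mu) / c) (sigma ^+ 2 / c ^+ 2).
Proof.
have mg : measurable_fun setT (fun x : R => (x - mu) / c).
  by apply: measurable_funM => //; exact: measurable_funB.
have ib : intg P (fun w => X 0 w - mu) := intgB iid_intg (intg_cst P mu).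
split.
- by apply: measurable_funM => //; exact: measurable_funB.
- apply: (law_intg (g := fun x => ((x - mu) / c) ^+ 2) (mX i) (mX 0) _ (iid_law XP i)).
    exact: measurable_funX.
  rewrite (_ : (fun w => _) = fun w => c ^- 2 * (X 0 w - mu) ^+ 2).
    exact: (intgZ _ iid_centered0).
  by apply/funext => w; rewrite exprMn exprVn mulrC.
- rewrite (law_Rintegral (g := fun x => (x - mu) / c) (mX i) (mX 0) mg (iid_law XP i)).
  rewrite (RintegralZr _ measurableT ib) (RintegralB measurableT iid_intg (intg_cst P mu)).
  by rewrite Ex_cst (iid_mean XP) subrr mul0r.
- rewrite (law_Rintegral (g := fun x => ((x - mu) / c) ^+ 2) (mX i) (mX 0) _ (iid_law XP i)).
    under eq_Rintegral do rewrite exprMn.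
    by rewrite (RintegralZr _ measurableT iid_centered0) (iid_var XP) exprVn.
  exact: measurable_funX.
Qed.

Lemma indep_cwalk p (c : R) : indep_seq P (fun i w => (X (p + i)%N w - mu) / c).
Proof.
have mg (i : nat) : measurable_fun setT (fun x : R => (x - mu) / c).
  by apply: measurable_funM => //; exact: measurable_funB.
exact: (@indep_seq_shift _ T R P X mX XI p (fun=> fun x => (x - mu) / c) mg).
Qed.

Lemma cwalk_moment2 p m : (\int[P]_w (cwalk p m w ^+ 2)%:E = (m%:R * sigma ^+ 2)%:E)%E.
Proof.
have h := @sum_moment2 _ T _ P (fun i w => (X (p + i)%N w - mu) / 1) (sigma ^+ 2 / 1 ^+ 2) m.
rewrite -[in RHS](divr1 (sigma ^+ 2)) -{2}(expr1n R 2) -h.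
- by apply: eq_integral => w _; congr (_ ^+ 2)%:E; apply: eq_bigr => i _; rewrite divr1.
- exact: indep_cwalk.
- by move=> i; apply: measurable_funM => //; exact: measurable_funB.
- by move=> i _; exact: iid_centered.
Qed.

Lemma cwalk_chebyshev p m e : 0 < e ->
  fine (P [set w | e <= `|cwalk p m w|]) <= m%:R * sigma ^+ 2 / e ^+ 2.
Proof.
move=> e0; apply: chebyshev_sqr => //; first exact: cwalk_measurable.
by rewrite cwalk_moment2.
Qed.

Let rset_lt l u Z (c : R) : range_mfun X l u Z ->
  @measurable _ (g_sigma_algebraType (generators X [set i | (l <= i < u)%N]))
    [set w | c < `|Z w|].
Proof.
move=> mZ; rewrite -[X in measurable X]setTI; apply: measurable_fun_ltr => //.
by apply: measurableT_comp.
Qed.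

Let rset_lt' l u Z (c : R) : range_mfun X l u Z ->
  @measurable _ (g_sigma_algebraType (generators X [set i | (l <= i < u)%N]))
    [set w | `|Z w| < c].
Proof.
move=> mZ; rewrite -[X in measurable X]setTI; apply: measurable_fun_ltr => //.
by apply: measurableT_comp.
Qed.

Lemma measurable_max_cwalk p l x :
  measurable [set w | exists2 j, (j <= l)%N & x < `|cwalk p j w|].
Proof.
rewrite (_ : [set w | _] = \bigcup_(j < l.+1) [set w | x < `|cwalk p j w|]).
  apply: bigcup_measurable => j _; rewrite -[X in measurable X]setTI.
  apply: measurable_fun_ltr => //; apply: measurableT_comp => //.
  exact: cwalk_measurable.
by apply/seteqP; split => w [j jl h]; exists j.
Qed.

(* Ottaviani's inequality, by splitting at the first exit from [-2x, 2x]. *)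
Lemma max_cwalk_le p l x : 0 < x -> 2 * (l%:R * sigma ^+ 2) <= x ^+ 2 ->
  fine (P [set w | exists2 j, (j <= l)%N & 2 * x < `|cwalk p j w|]) <=
  2 * fine (P [set w | x < `|cwalk p l w|]).
Proof.
move=> x0 lx.
pose A k := [set w | 2 * x < `|cwalk p k w|] `&`
  \bigcap_(j < k) ~` [set w | 2 * x < `|cwalk p j w|].
pose G k := [set w | `|cwalk (p + k) (l - k) w| < x].
pose Rk a b := g_sigma_algebraType (generators X [set i | (a <= i < b)%N]).
have rA k : @measurable _ (Rk p (p + k)%N) (A k).
  apply: measurableI; first by apply: rset_lt; exact: cwalk_range.
  apply: bigcap_measurableType => j jk; apply: measurableC; apply: rset_lt.
  by apply: cwalk_range => //; rewrite leq_add2l ltnW.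
have rG k : (k <= l)%N -> @measurable _ (Rk (p + k)%N (p + l)%N) (G k).
  by move=> kl; apply: rset_lt'; apply: cwalk_range => //; rewrite -addnA subnKC.
have mR a b (E : set T) : @measurable _ (Rk a b) E -> @measurable _ T E.
  exact: (@generated_by_measurable _ _ _ _ _ mX [set i | (a <= i < b)%N]).
have mA k : measurable (A k) by exact: mR (rA k).
have mG k : measurable (G k).
  rewrite -[X in measurable X]setTI; apply: measurable_fun_ltr => //.
  by apply: measurableT_comp => //; exact: cwalk_measurable.
have mC : measurable [set w | x < `|cwalk p l w|].
  rewrite -[X in measurable X]setTI; apply: measurable_fun_ltr => //.
  by apply: measurableT_comp => //; exact: cwalk_measurable.
have Adisj i j w : A i w -> A j w -> i = j.
  move=> [hi hi'] [hj hj']; have [ij|ij|//] := ltngtP i j.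
    by have := hj' i ij.
  by have := hi' j ij.
(* The hypothesis relating x to l keeps the remaining increment below x with probability at least
   one half, whatever the exit time k. *)
have PG k : (k <= l)%N -> 1 / 2 <= fine (P (G k)).
  move=> kl; have := cwalk_chebyshev (p + k) (l - k) x0.
  have -> : [set w | x <= `|cwalk (p + k) (l - k) w|] = ~` G k.
    by apply/seteqP; split => w /=; [move=> h /=; apply/negP; rewrite -leNgt|move/negP; rewrite -leNgt].
  rewrite probability_setC// fineB ?fin_num_measure//= => h.
  have : (l - k)%:R * sigma ^+ 2 / x ^+ 2 <= 1 / 2.
    rewrite ler_pdivrMr ?exprn_gt0//.
    have : (l - k)%:R * sigma ^+ 2 <= l%:R * sigma ^+ 2.
      by rewrite ler_wpM2r ?sqr_ge0// ler_nat leq_subr.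
    lra.
  lra.
have AG k : (k <= l)%N -> fine (P (A k)) <= 2 * fine (P (A k `&` G k)).
  move=> kl; have -> : P (A k `&` G k) = (P (A k) * P (G k))%E.
    have h := @range_independent _ T R P X mX XI p (p + k) (p + k) (p + l) [set A k] [set G k].
    apply: h => //.
    - by move=> _ ->; exact: rA.
    - by move=> _ ->; exact: rG.
  rewrite fineM ?fin_num_measure//; have := PG k kl.
  have : 0 <= fine (P (A k)) by exact: fine_P_ge0.
  nra.
have -> : [set w | exists2 j, (j <= l)%N & 2 * x < `|cwalk p j w|] =
    \bigcup_(k < l.+1) A k.
  apply/seteqP; split => w; last by move=> [k kl [h _]]; exists k.
  move=> [j jl jw]; have ex : exists k, 2 * x < `|cwalk p k w| by exists j.
  case: (ex_minnP ex) => k kw kmin; exists k => /=.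
    by rewrite ltnS; apply: leq_trans jl; exact: kmin.
  split=> // i /= ik iw; have := kmin _ iw; by rewrite leqNgt ik.
apply: le_trans (fine_P_bigcup_le P l.+1 mA) _.
apply: (@le_trans _ _ (2 * \sum_(k < l.+1) fine (P (A k `&` G k)))).
  by rewrite mulr_sumr; apply: ler_sum => k _; apply: AG; rewrite -ltnS.
rewrite ler_wpM2l//; apply: (@sum_fine_P_le _ T R P l.+1 (fun k => A k `&` G k)) => //.
- by move=> k; exact: measurableI.
- move=> k kl w [[h _] g]; rewrite /= -(subnKC (kl : (k <= l)%N)) cwalkD.
  have := lerB_normD (cwalk p k w) (cwalk (p + k) (l - k) w).
  move: h g => /=; rewrite /G /=; lra.
- by move=> i j w _ _ [h1 _] [h2 _]; exact: (Adisj i j w).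
Qed.

Lemma max_cwalk_chebyshev p l x : 0 < x ->
  fine (P [set w | exists2 j, (j <= l)%N & 2 * x < `|cwalk p j w|]) <=
  2 * (l%:R * sigma ^+ 2) / x ^+ 2.
Proof.
move=> x0; have x2 : 0 < x ^+ 2 by rewrite exprn_gt0.
have [lx|lx] := leP (2 * (l%:R * sigma ^+ 2)) (x ^+ 2); last first.
  apply: (@le_trans _ _ 1); first exact/fine_P_le1/measurable_max_cwalk.
  by rewrite ler_pdivlMr// mul1r ltW.
apply: le_trans (max_cwalk_le p x0 lx) _; rewrite -mulrA ler_wpM2l//.
apply: le_trans (cwalk_chebyshev p l x0); apply: fine_P_le.
- rewrite -[X in measurable X]setTI; apply: measurable_fun_ltr => //.
  by apply: measurableT_comp => //; exact: cwalk_measurable.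
- rewrite -[X in measurable X]setTI; apply: measurable_fun_ler => //.
  by apply: measurableT_comp => //; exact: cwalk_measurable.
- by move=> w /= /ltW.
Qed.

Lemma sum_half_pow n : \sum_(k < n) ((2 : R) ^+ k)^-1 <= 2.
Proof.
suff -> : \sum_(k < n) ((2 : R) ^+ k)^-1 = 2 - 2 * (2 ^+ n)^-1.
  by rewrite gerBl mulr_ge0// invr_ge0 exprn_ge0.
elim: n => [|n IH]; first by rewrite big_ord0 expr0 invr1 mulr1 subrr.
rewrite big_ord_recr/= IH exprS invfM; field.
by rewrite expf_neq0.
Qed.

Lemma measurable_cwalk_exceeds r e N : measurable
   [set w | exists2 n : nat, (n < N)%N & r ^+ 2 + e ^+ 2 * n%:R < `|cwalk 0 n w|].
Proof.
rewrite (_ : [set w | _] = \bigcup_(n < N) [set w | r ^+ 2 + e ^+ 2 * n%:R < `|cwalk 0 n w|])//.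
apply: bigcup_measurable => j _; rewrite -[X in measurable X]setTI.
apply: measurable_fun_ltr => //; apply: measurableT_comp => //.
exact: cwalk_measurable.
Qed.

(* The blocks [4^k, 4^k.+1[ together with (r^2 + s^2)^2 >= 2 r s^3 for s = e 2^k
   give a summable bound which is small for large r. *)
Lemma cwalk_lln r e N : 0 < r -> 0 < e ->
  fine (P [set w | exists2 n : nat, (n < N)%N & r ^+ 2 + e ^+ 2 * n%:R < `|cwalk 0 n w|]) <=
  32 * sigma ^+ 2 / (r * e ^+ 3).
Proof.
move=> r0 e0.
(* 2 * y k is the level of the line at the start of the k-th block, its lowest value there. *)
pose y k := (r ^+ 2 + e ^+ 2 * 4 ^+ k) / 2.
have y0 k : 0 < y k by rewrite divr_gt0// addr_gt0 ?mulr_gt0 ?exprn_gt0.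
pose A k := [set w | exists2 j, (j <= 4 ^ k.+1)%N & 2 * y k < `|cwalk 0 j w|].
have mA k : measurable (A k) by exact: measurable_max_cwalk.
apply: (@le_trans _ _ (fine (P (\bigcup_(k < N) A k)))).
  apply: fine_P_le; [exact: measurable_cwalk_exceeds|exact: bigcup_measurable|].
  move=> w [n nN nw]; have n0 : (0 < n)%N.
    case: n nN nw => // _; rewrite cwalk0 normr0 mulr0 addr0 ltNge sqr_ge0//.
  have /andP[l1 l2] := trunc_log_bounds (isT : 1 < 4)%N n0.
  exists (trunc_log 4 n) => /=.
    by apply: leq_ltn_trans nN; apply: leq_trans l1; exact/ltnW/ltn_expl.
  exists n; first exact: ltnW.
  rewrite /y mulrC divfK//; apply: le_lt_trans nw.
  rewrite lerD2l ler_wpM2l ?sqr_ge0// -natrX ler_nat//.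
apply: le_trans (fine_P_bigcup_le P N mA) _.
pose c := 16 * sigma ^+ 2 / (r * e ^+ 3).
have re0 : 0 < r * e ^+ 3 by rewrite mulr_gt0// exprn_gt0.
have c0 : 0 <= c by apply: divr_ge0; [rewrite mulr_ge0 ?sqr_ge0|exact: ltW].
apply: (@le_trans _ _ (\sum_(k < N) c * (2 ^+ k)^-1)).
  apply: ler_sum => k _; apply: le_trans (max_cwalk_chebyshev 0 _ (y0 k)) _.
  rewrite ler_pdivrMr ?exprn_gt0// natrX exprS.
  have E4 : (4 : R) ^+ k = (2 ^+ k) ^+ 2.
    by rewrite -exprM mulnC exprM; congr (_ ^+ _); ring.
  have yE : y k = (r ^+ 2 + (e * 2 ^+ k) ^+ 2) / 2 by rewrite /y exprMn E4.
  rewrite E4.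
  have t0 : 0 < (2 : R) ^+ k by rewrite exprn_gt0.
  rewrite yE; move: (2 ^+ k) t0 => t t0.
  have key : 2 * r * (e * t) ^+ 3 <= (r ^+ 2 + (e * t) ^+ 2) ^+ 2.
    have et : 0 < e * t by rewrite mulr_gt0.
    move: (e * t) et => s s0.
    have h1 : 2 * r * s <= r ^+ 2 + s ^+ 2 by have := sqr_ge0 (r - s); nra.
    have h2 : s ^+ 2 <= r ^+ 2 + s ^+ 2 by rewrite lerDr sqr_ge0.
    rewrite (_ : 2 * r * s ^+ 3 = (2 * r * s) * s ^+ 2); last by ring.
    rewrite (_ : (_ + _) ^+ 2 = (r ^+ 2 + s ^+ 2) * (r ^+ 2 + s ^+ 2)); last by ring.
    by apply: ler_pM => //; rewrite ?sqr_ge0// !mulr_ge0// ltW.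
  have q0 : 0 <= c * t^-1 / 4.
    by apply: divr_ge0 => //; apply: mulr_ge0 => //; rewrite invr_ge0 ltW.
  rewrite (_ : c / t * _ = c * t^-1 / 4 * (r ^+ 2 + (e * t) ^+ 2) ^+ 2); last first.
    by rewrite expr_div_n; field; rewrite gt_eqF.
  apply: le_trans (ler_wpM2l q0 key).
  rewrite le_eqVlt; apply/orP; left; apply/eqP; rewrite /c exprMn.
  by field; rewrite !gt_eqF.
rewrite -mulr_sumr; apply: le_trans (ler_wpM2l c0 (sum_half_pow N)) _.
by rewrite /c le_eqVlt; apply/orP; left; apply/eqP; field; rewrite !gt_eqF.
Qed.

End iid.

Ltac positivity := solve [repeat first
  [ done | exact: ltW | exact: sqr_ge0 | apply: exprn_gt0 | apply: exprn_ge0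
  | apply: mulr_gt0 | apply: divr_gt0 | apply: addr_gt0
  | (rewrite invr_gt0) | (rewrite sqrtr_gt0) | (rewrite ltr0n)
  | apply: mulr_ge0 | apply: divr_ge0 | apply: addr_ge0
  | (rewrite invr_ge0) | (rewrite ler0n) | exact: sqrtr_ge0 ]].

(** * Measurability of Lipschitz functionals of increments *)

Section lipschitz_measurable.
Context (R : realType).

Lemma measurable_discrete d (T : measurableType d) m (z : nat -> T -> int)
    (G : seq int -> R) : (forall i c, measurable (z i @^-1` [set c])) ->
  measurable_fun setT (fun w => G (mkseq (fun i => z i w) m)).
Proof.
move=> mz _ A mA; rewrite setTI.
pose B n := if (choice.unpickle n : option (seq int)) is Some s then
  if `[< A (G s) >] then [set w | mkseq (fun i => z i w) m = s] else set0 else set0.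
rewrite (_ : _ @^-1` A = \bigcup_n B n); last first.
  apply/seteqP; split => w /=.
    move=> Aw; exists (choice.pickle (mkseq (fun i => z i w) m)) => //.
    by rewrite /B choice.pickleK; case: asboolP.
  move=> [n _]; rewrite /B; case: choice.unpickle => // s; case: asboolP => // As /= e.
  by rewrite e.
apply: bigcupT_measurable => n; rewrite /B; case: choice.unpickle => // s; case: asboolP => // _.
have [sm|sm] := eqVneq (size s) m; last first.
  rewrite (_ : [set w | _] = set0)//; apply/seteqP; split => w //= e.
  by move: sm; rewrite -e size_mkseq eqxx.
rewrite (_ : [set w | _] = \bigcap_(i < m) z i @^-1` [set nth 0 s i]).
  by apply: bigcap_measurableType => i _.
apply/seteqP; split => w /=.
  by move=> <- i /= im; rewrite nth_mkseq.
move=> h; apply: (@eq_from_nth _ 0); rewrite size_mkseq//.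
by move=> i im; rewrite nth_mkseq//; exact: h.
Qed.

(** f is the pointwise limit of its values at the coordinates rounded down to multiples of 1 / (j +
    1), and each of these depends on m integers, a countable set of values. Every measurability
    proof about paths ends here. *)
Lemma lipschitz_seq_measurable m (K : R) (f : (nat -> R) -> R) :
  (forall u v e, 0 <= e -> (forall i, (i < m)%N -> `|u i - v i| <= e) ->
     `|f u - f v| <= K * e) -> seq_measurable f.
Proof.
move=> fK d T v mv.
pose z j i w := Num.floor (v i w * j.+1%:R).
pose G j s := f (fun i => (nth 0 s i)%:~R / j.+1%:R).
apply: (measurable_fun_cvg (h := fun j w => G j (mkseq (fun i => z j i w) m))).
  move=> j; apply: measurable_discrete => i c.
  rewrite (_ : _ @^-1` _ = [set w | c%:~R <= v i w * j.+1%:R] `&`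
    [set w | v i w * j.+1%:R < (c + 1)%:~R]).
    apply: measurableI; rewrite -[X in measurable X]setTI.
      by apply: measurable_fun_ler => //; apply: measurable_funM.
    by apply: measurable_fun_ltr => //; apply: measurable_funM.
  apply/seteqP; split => w /=.
    by rewrite /z => <-; have /andP[] := floor_itv (v i w * j.+1%:R).
  by move=> [h1 h2]; apply: floor_def; rewrite h1.
move=> w _; apply/cvgrPdist_lt => e e0.
have K1 : 0 < `|K| + 1 by rewrite ltr_wpDl.
near=> j.
apply: (@le_lt_trans _ _ ((`|K| + 1) * j.+1%:R^-1)).
  apply: (@le_trans _ _ (K * j.+1%:R^-1)).
    apply: fK => // i im; rewrite nth_mkseq//.
    have /andP[h1 h2] := floor_itv (v i w * j.+1%:R).
    have j0 : (0 : R) < j.+1%:R by rewrite ltr0n.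
    rewrite ger0_norm; last by rewrite subr_ge0 ler_pdivrMr.
    rewrite lerBlDr -[X in X + _]mul1r -mulrDl ler_pdivlMr// addrC; apply: ltW.
    by move: h2; rewrite intrD.
  by rewrite ler_wpM2r// (le_trans (ler_norm _))// lerDl.
rewrite -ltr_pdivlMl// mulrC; near: j.
have h := @cvg_harmonic R; move/cvgrPdist_lt : h => /(_ (e / (`|K| + 1))) h.
have /h : 0 < e / (`|K| + 1) by rewrite divr_gt0.
by apply: filterS => j; rewrite sub0r normrN ger0_norm// invr_ge0.
Unshelve. all: by end_near. Qed.

End lipschitz_measurable.

(** * Comparison of blocks of the walk with Brownian increments *)

Section clt.
Context (R : realType) d (T : measurableType d) (P : probability T R).
Variables (X : nat -> T -> R) (mu sigma : R).
Hypothesis XP : iid_sequence P X mu sigma.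
Context d' (T' : measurableType d') (P' : probability T' R).
Variables (B : R -> {RV P' >-> R}) (hB : standard_BM B).
Hypothesis sigma_ge0 : 0 <= sigma.

Let mX := iid_measurable XP.

(** n times the mean of [mcube] of one increment divided by sqrt n ([mcube_scaled]), that is the
    Lindeberg term of n increments. It vanishes by dominated convergence, with the square as
    dominating function. *)
Definition kappa n : R :=
  \int[P]_w Num.min (`|X 0%N w - mu| ^+ 3 / Num.sqrt n%:R) ((X 0%N w - mu) ^+ 2).

Lemma kappa_cvg : kappa n @[n --> \oo] --> (0 : R).
Proof.
rewrite -[X in _ --> X](Ex_cst P 0).
have mb : measurable_fun setT (fun w => X 0%N w - mu) by exact: measurable_funB.
apply: (Rintegral_dct _ (iid_centered0 XP)).
- move=> n; apply: measurable_minr; last exact: measurable_funX.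
  apply: measurable_funM => //; apply: measurable_funX; exact: measurableT_comp.
- move=> n w; rewrite ger0_norm ?ge_min ?lexx ?orbT// le_min sqr_ge0 andbT.
  by rewrite divr_ge0// exprn_ge0.
- move=> w; apply: (@squeeze_cvgr _ _ _ _ (cst 0) (fun n => `|X 0%N w - mu| ^+ 3 / Num.sqrt n%:R)).
  + apply: nearW => n; rewrite ge_min lexx /= andbT le_min sqr_ge0 andbT.
    by rewrite divr_ge0// exprn_ge0.
  + exact: cvg_cst.
  + rewrite -[X in _ --> X](mulr0 (`|X 0%N w - mu| ^+ 3)).
    by apply: cvgM; [exact: cvg_cst|exact: cvg_invsqrt].
Qed.

Lemma mcube_scaled n i : (0 < n)%N ->
  \int[P]_w mcube ((X i w - mu) / Num.sqrt n%:R) = kappa n / n%:R.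
Proof.
move=> n0; have n0R : (0 : R) < n%:R by rewrite ltr0n.
have s0 : 0 < Num.sqrt n%:R :> R by rewrite sqrtr_gt0.
have mg : measurable_fun setT (fun x : R => (x - mu) / Num.sqrt n%:R).
  by apply: measurable_funM => //; exact: measurable_funB.
rewrite (law_Rintegral (g := fun x => mcube ((x - mu) / Num.sqrt n%:R)) (mX i) (mX 0) _ (iid_law XP i)); last first.
  by apply: (measurableT_comp _ mg); exact: measurable_mcube.
have mb : measurable_fun setT (fun w => X 0%N w - mu) by exact: measurable_funB.
rewrite /kappa -RintegralZr//; last first.
  apply: (intg_le _ (iid_centered0 XP)).
    apply: measurable_minr; last exact: measurable_funX.
    apply: measurable_funM => //; apply: measurable_funX; exact: measurableT_comp.
  move=> w; rewrite ger0_norm ?ge_min ?lexx ?orbT// le_min sqr_ge0 andbT.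
  by rewrite divr_ge0// exprn_ge0.
apply: eq_Rintegral => w _; rewrite /mcube.
have nE : n%:R = Num.sqrt n%:R ^+ 2 :> R by rewrite sqr_sqrtr// ltW.
have ni : 0 <= (n%:R : R)^-1 by rewrite invr_ge0 ltW.
rewrite [RHS]minr_pMl//; congr Num.min.
  have si : 0 <= (Num.sqrt n%:R : R)^-1 by rewrite invr_ge0.
  have s3 : (Num.sqrt n%:R : R)^-1 ^+ 3 = (Num.sqrt n%:R)^-1 * n%:R^-1.
    by rewrite exprS; congr (_ * _); rewrite [in RHS]nE exprVn.
  by rewrite normrM (ger0_norm si) exprMn s3 mulrA.
by rewrite exprMn exprVn -nE.
Qed.

(** N is uniform in the block and in h, because h will be a path functional with the other blocks
    frozen. Each increment of the walk is exchanged with the Brownian increment over a time 1 / n;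
    the condition p + m < n keeps these times in [0, 1[. *)
Lemma clt_bl (K M e : R) : 0 <= K -> 0 <= M -> 0 < e -> exists N, forall n p m h,
  (N <= n)%N -> (p + m < n)%N -> bl K M h ->
  `|\int[P]_w h (cwalk X mu p m w / Num.sqrt n%:R) -
    \int[P']_w h (sigma * (B ((p + m)%:R / n%:R) w - B (p%:R / n%:R) w))| <= e.
Proof.
move=> K0 M0 e0.
(* Then 12 K dl <= e / 3, the smoothing error in [lindeberg_bl]; the other two thirds go to the part
   outside [-N0 dl, N0 dl] and to the Taylor remainder. *)
pose dl := e / (36 * (K + 1)).
have dl0 : 0 < dl by rewrite divr_gt0// mulr_gt0// ltr_wpDl.
have Kdl : K * dl <= e / 36.
  rewrite /dl mulrA ler_pdivrMr ?mulr_gt0 ?ltr_wpDl//.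
  rewrite (_ : e / 36 * _ = e * (K + 1)); last by field.
  by lra.
have Kdl0 : 0 <= K * dl by rewrite mulr_ge0// ltW.
pose L := 2 * M + 3 * (K * dl); have L0 : 0 <= L by rewrite /L; lra.
have [N0 [N00 hN0]] : exists N0 : nat, (0 < N0)%N /\
    2 * (L * (sigma ^+ 2 / (N0%:R * dl) ^+ 2)) <= e / 3.
  pose q := 6 * L * sigma ^+ 2 / (dl ^+ 2 * e).
  have q0 : 0 <= q by rewrite /q; positivity.
  pose N0 := (Num.truncn q).+1; exists N0; split=> //.
  have qN : q <= N0%:R by apply: ltW; exact: truncnS_gt.
  have N1 : (1 : R) <= N0%:R by rewrite ler1n.
  rewrite exprMn (_ : 2 * _ = (q * (e / 3)) / N0%:R ^+ 2); last first.
    by rewrite /q; field; rewrite !gt_eqF// ltr0n.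
  have e3 : 0 <= e / 3 by apply: divr_ge0 => //; exact: ltW.
  rewrite ler_pdivrMr ?exprn_gt0 ?ltr0n// mulrC; apply: ler_wpM2l => //.
  by apply: (le_trans qN); rewrite expr2 ler_peMl.
have [C C0 hC] := bl_smooth N0 K0 M0 dl0.
have : C * (kappa n + 2 * sigma ^+ 3 / Num.sqrt n%:R) @[n --> \oo] --> C * (0 + 2 * sigma ^+ 3 * 0).
  apply: cvgM; first exact: cvg_cst.
  apply: cvgD; first exact: kappa_cvg.
  by apply: cvgM; [exact: cvg_cst|exact: cvg_invsqrt].
rewrite mulr0 addr0 mulr0 => /cvgrPdist_le /(_ (e / 3)); rewrite divr_gt0// => /(_ isT) [N _ hN].
exists N => n p m h Nn pmn blh.
have n0 : (0 < n)%N by apply: leq_ltn_trans pmn.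
have n0R : (0 : R) < n%:R by rewrite ltr0n.
have s0 : 0 < Num.sqrt n%:R :> R by rewrite sqrtr_gt0.
have nE : n%:R = Num.sqrt n%:R ^+ 2 :> R by rewrite sqr_sqrtr// ltW.
have [H [mH tH HM Hh]] := hC h blh.
pose D i w := (X (p + i)%N w - mu) / Num.sqrt n%:R.
(* Constant from index m on: all times stay below 1, as [BM_indep] demands of the whole sequence. *)
pose tt i : R := (p + minn i m)%:R / n%:R.
have tt01 i : 0 <= tt i < 1.
  rewrite divr_ge0//= ltr_pdivrMr// mul1r ltr_nat; apply: leq_ltn_trans pmn.
  by rewrite leq_add2l geq_minr.
have tt_nd i : tt i <= tt i.+1.
  by rewrite ler_pM2r ?invr_gt0// ler_nat leq_add2l leq_min geq_minr geq_min leqnSn.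
have ttS i : (i < m)%N -> tt i.+1 - tt i = n%:R^-1.
  move=> im; rewrite /tt (minn_idPl im) (minn_idPl (ltnW im)) -mulrBl addnS.
  by rewrite -natrB ?leqnSn// subSnn mul1r.
pose D' i w := sigma * (B (tt i.+1) w - B (tt i) w).
have mD' i : measurable_fun setT (D' i) by apply: measurable_funM => //; exact: measurable_funB.
have iD' : indep_seq P' D'.
  have := @indep_seq_shift _ T' R P' (fun i w => B (tt i.+1) w - B (tt i) w) _ _ 0 (fun _ x => sigma * x).
  apply=> //.
  - by move=> i; exact: measurable_funB.
  - exact: (BM_indep hB).
  - by move=> i; exact: measurable_funM.
have incr i : (i < m)%N -> [/\ 0 <= tt i, tt i < tt i.+1 & tt i.+1 < 1].
  move=> im; have /andP[h1 _] := tt01 i; have /andP[_ h2] := tt01 i.+1; split=> //.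
  by rewrite -subr_gt0 ttS// invr_gt0.
have hD' w : \sum_(i < m) D' i w = sigma * (B ((p + m)%:R / n%:R) w - B (p%:R / n%:R) w).
  rewrite -mulr_sumr; congr (_ * _).
  rewrite -(big_mkord xpredT (fun i => B (tt i.+1) w - B (tt i) w)).
  by rewrite (telescope_sumr (fun i => B (tt i) w))// /tt minnn min0n addn0.
have hD w : \sum_(i < m) D i w = cwalk X mu p m w / Num.sqrt n%:R.
  by rewrite /D -mulr_suml.
have mD i : measurable_fun setT (D i) by apply: measurable_funM => //; exact: measurable_funB.
have cD i : (i < m)%N -> centered P (D i) (sigma ^+ 2 / n%:R).
  by move=> _; rewrite nE; exact: iid_centered.
have cD' i : (i < m)%N -> centered P' (D' i) (sigma ^+ 2 / n%:R).
  move=> im; have [h1 h2 h3] := incr i im.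
  by have [+ _ _] := BM_increment hB sigma_ge0 h1 h2 h3; rewrite ttS.
have r1 i : (i < m)%N -> \int[P]_w mcube (D i w) <= kappa n / n%:R.
  by move=> _; rewrite -(mcube_scaled (p + i)).
have r2 i : (i < m)%N -> \int[P']_w mcube (D' i w) <= 2 * sigma ^+ 3 / Num.sqrt n%:R / n%:R.
  move=> im; have [h1 h2 h3] := incr i im.
  have [_ + _] := BM_increment hB sigma_ge0 h1 h2 h3; rewrite ttS//.
  move=> /le_trans; apply; rewrite sqrtrV ?ler0n// exprVn -[leRHS]mulrA -invfM.
  by rewrite {3}nE -exprS.
have iD : indep_seq P D := @indep_cwalk _ _ T P X mu sigma XP p (Num.sqrt n%:R).
have := lindeberg_bl iD iD' mD mD' cD cD' r1 r2
   K0 M0 dl0 C0 N00 blh mH tH HM Hh.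
under eq_Rintegral do rewrite hD.
under [X in `|_ - X|]eq_Rintegral do rewrite hD'.
move=> /le_trans; apply.
have mn : m%:R / n%:R <= 1 :> R.
  rewrite ler_pdivrMr// mul1r ler_nat; apply/ltnW; apply: leq_ltn_trans pmn.
  exact: leq_addl.
have mn0 : 0 <= m%:R / n%:R :> R by rewrite divr_ge0.
have k0 : 0 <= kappa n.
  apply: Ex_ge0 => w; rewrite le_min sqr_ge0 andbT.
  by rewrite divr_ge0// exprn_ge0.
have t1 : m%:R * (C * (kappa n / n%:R + 2 * sigma ^+ 3 / Num.sqrt n%:R / n%:R)) <= e / 3.
  have := hN n Nn; rewrite sub0r normrN ger0_norm; last first.
    by rewrite mulr_ge0// addr_ge0// divr_ge0// mulr_ge0// exprn_ge0.
  move=> /(le_trans _); apply; set q := kappa n + _.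
  rewrite (_ : _ * _ = m%:R / n%:R * (C * q)); last by rewrite /q; ring.
  by apply: ler_piMl => //; rewrite /q; positivity.
have t2 : 2 * (L * (m%:R * (sigma ^+ 2 / n%:R) / (N0%:R * dl) ^+ 2)) <= e / 3.
  apply: le_trans hN0; rewrite ler_wpM2l// ler_wpM2l// ler_wpM2r ?invr_ge0 ?sqr_ge0//.
  rewrite (_ : _ * _ = m%:R / n%:R * sigma ^+ 2); last by ring.
  by rewrite ler_piMl// sqr_ge0.
by rewrite -/L; lra.
Qed.

End clt.

(** * Donsker's theorem *)

Section path_functionals.
Context (R : realType).

(** The functional acts on arbitrary functions, not only on cadlag paths, so that step functions and
    hybrid paths can be plugged in freely. *)
Definition lipf (K M T : R) (psi : (R -> R) -> R) :=
  (forall x, `|psi x| <= M) /\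
  (forall x y e, 0 <= e -> (forall t, 0 <= t <= T -> `|x t - y t| <= e) ->
     `|psi x - psi y| <= K * e).

(** The step path on the grid of mesh 1 / m whose jump at time (k + 1) / m is [u k]. *)
Definition steps m (u : nat -> R) (t : R) : R := \sum_(k < Num.truncn (t * m%:R)) u k.

Lemma truncn_grid (T t : R) m : 0 <= t <= T -> T < 1 -> (0 < m)%N ->
  (Num.truncn (t * m%:R) < m)%N.
Proof.
move=> /andP[t0 tT] T1 m0; have m0R : (0 : R) < m%:R by rewrite ltr0n.
rewrite truncn_lt_nat ?mulr_ge0// -[X in _ < X]mul1r ltr_pM2r//.
exact: le_lt_trans tT T1.
Qed.

Variables (K M T : R) (psi : (R -> R) -> R).
Hypotheses (K0 : 0 <= K) (T01 : 0 <= T < 1) (psiL : lipf K M T psi).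

Lemma steps_lip m u v e : 0 <= e -> (forall k, (k < m)%N -> `|u k - v k| <= e) ->
  `|psi (steps m u) - psi (steps m v)| <= K * m%:R * e.
Proof.
move=> e0 uv; rewrite -mulrA; apply: psiL.2; first exact: mulr_ge0.
move=> t tT; rewrite /steps -sumrB.
have [m0|m0] := posnP m.
  by subst m; rewrite !mulr0 mul0r truncn0 big_ord0 normr0.
have := truncn_grid tT (andP T01).2 m0; set k := Num.truncn _ => km.
apply: le_trans (ler_norm_sum _ _ _) _.
apply: (@le_trans _ _ (\sum_(i < k) e)).
  by apply: ler_sum => i _; apply: uv; exact: ltn_trans (ltn_ord i) km.
by rewrite sumr_const card_ord -[leLHS]mulr_natl ler_wpM2r// ler_nat ltnW.
Qed.

Lemma steps_seq_measurable m : seq_measurable (fun u => psi (steps m u)).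
Proof. by apply: (@lipschitz_seq_measurable _ m (K * m%:R)) => u v e; exact: steps_lip. Qed.

(** Changing one jump translates the later part of the path by the same amount, so every slice has
    the constants K and M of psi itself; this is what feeds [clt_bl]. *)
Lemma steps_slice m v k : bl K M (fun x => psi (steps m (upd v k x))).
Proof.
split=> [x|x y]; first exact: psiL.1.
apply: psiL.2 => // t _; rewrite /steps -sumrB.
have [kj|kj] := ltnP k (Num.truncn (t * m%:R)).
  rewrite (bigD1 (Ordinal kj))//= big1 ?addr0 /upd ?eqxx// => i ik.
  by rewrite (negbTE (ik : (i : nat) != k)) subrr.
rewrite big1 ?normr0// => i _; rewrite /upd; case: eqP => [ik|_]; last exact: subrr.
by have := leq_trans (ltn_ord i) kj; rewrite ik ltnn.
Qed.

Lemma steps_cvg m (u : nat -> nat -> R) v :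
  (forall k, (k < m)%N -> u n k @[n --> \oo] --> v k) ->
  psi (steps m (u n)) @[n --> \oo] --> psi (steps m v).
Proof.
move=> uv; apply/cvgrPdist_le => e e0.
have K1 : 0 < K * m%:R + 1 by rewrite ltr_wpDl// mulr_ge0.
have : \forall n \near \oo, forall k, (k < m)%N -> `|v k - u n k| <= e / (K * m%:R + 1).
  have : forall j, (j <= m)%N -> \forall n \near \oo, forall k, (k < j)%N ->
      `|v k - u n k| <= e / (K * m%:R + 1).
    elim=> [_|j IH jm]; first by apply: nearW.
    have h1 := IH (ltnW jm); have /cvgrPdist_le h2 := uv j jm.
    have /h2 h3 : 0 < e / (K * m%:R + 1) by rewrite divr_gt0.
    apply: filterS2 h1 h3 => n a b k; rewrite ltnS leq_eqVlt => /orP[/eqP ->//|].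
    exact: a.
  by apply.
apply: filterS => n h; apply: (le_trans (steps_lip _ h)); first by rewrite divr_ge0// ltW.
rewrite mulrCA ger_pMr// ler_pdivrMr// mul1r lerDl//.
Qed.

End path_functionals.

Lemma BM_unif_continuous (R : realType) d (T : measurableType d) (P : probability T R)
    (B : R -> {RV P >-> R}) (hB : standard_BM B) w (c e : R) : c < 1 -> 0 < e ->
  \forall m \near \oo, forall s t, 0 <= s <= c -> 0 <= t <= c ->
    `|s - t| <= m.+1%:R^-1 -> `|B s w - B t w| <= e.
Proof.
move=> c1 e0.
have cB t : 0 <= t < 1 -> exists2 r, 0 < r & forall s, 0 <= s < 1 -> `|t - s| < r ->
    `|B t w - B s w| < e / 2.
  move=> t01; have /subspace_continuousP := @BM_path _ _ _ _ _ hB w.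
  move=> /(_ t); rewrite /= in_itv => /(_ t01) /cvgrPdist_lt /(_ (e / 2)).
  rewrite divr_gt0// => /(_ isT); rewrite /prop_near1 /= /within /= => -[r /= r0 h].
  by exists r => // s s01 ts; apply: h => //=; rewrite in_itv.
have cpt : compact `[0, c] by exact: segment_compact.
have /compact_near_coveringP/near_covering_withinP nc := cpt.
pose Q (m : nat) t := forall s, 0 <= s <= c -> `|s - t| <= m.+1%:R^-1 ->
  `|B s w - B t w| <= e.
have hQ : \forall m \near \oo, `[0, c] `<=` Q m.
  apply: (nc nat \oo Q _) => t /=; rewrite in_itv /= => /andP[t0 tc].
  have t01 : 0 <= t < 1 by rewrite t0 (le_lt_trans tc).
  have [r r0 hr] := cB t t01.
  have r2 : 0 < r / 2 by rewrite divr_gt0.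
  have /cvgrPdist_lt /(_ _ r2) hh := @cvg_harmonic R.
  exists ([set t' | `|t - t'| < r / 2], [set m : nat | m.+1%:R^-1 < r / 2]).
    split => /=; first exact: (@nbhsx_ballx _ R t (r / 2) r2).
    by apply: filterS hh => m; rewrite sub0r normrN ger0_norm// invr_ge0.
  move=> [t' m] /= [h1 h2]; rewrite in_itv /= => /andP[t'0 t'c] s /andP[s0 sc] st.
  have t'01 : 0 <= t' < 1 by rewrite t'0 (le_lt_trans t'c).
  have s01 : 0 <= s < 1 by rewrite s0 (le_lt_trans sc).
  have b1 : `|t - t'| < r by apply: lt_trans h1 _; lra.
  have b2 : `|t - s| < r.
    rewrite -(subrKA t'); apply: le_lt_trans (ler_normD _ _) _.
    by rewrite (distrC t' s); have := le_lt_trans st h2; lra.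
  have a1 := hr t' t'01 b1; have a2 := hr s s01 b2.
  rewrite -(subrKA (B t w)); apply: le_trans (ler_normD _ _) _.
  by rewrite (distrC (B s w)); lra.
apply: filterS hQ => m h s t sc tc; apply: h => //=.
Qed.

Section donsker.
Context (R : realType) d (T : measurableType d) (P : probability T R).
Variables (X : nat -> T -> R) (mu sigma : R).
Hypothesis XP : iid_sequence P X mu sigma.
Context d' (T' : measurableType d') (P' : probability T' R).
Variables (B : R -> {RV P' >-> R}) (hB : standard_BM B).
Hypothesis sigma_ge0 : 0 <= sigma.

Let mX := iid_measurable XP.

Lemma walkE n w : walk X n w = cwalk X mu 0 n w + n%:R * mu.
Proof.
rewrite /walk /cwalk sumrB sumr_const card_ord -[X in _ - X + _]mulr_natl subrK.
by apply: eq_bigr => i _.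
Qed.

(** [scaled_walk] with a deterministic time n in place of the passage time. *)
Definition wpath n w (t : R) : R :=
  (walk X (Num.truncn (t * n%:R)) w - t * mu * n%:R) / Num.sqrt n%:R.

Section blocks.
Variables (m n : nat) (m0 : (0 < m)%N).

Definition blk (k : nat) : nat := ((n * k) %/ m)%N.

Lemma blk0 : blk 0 = 0%N. Proof. by rewrite /blk muln0 div0n. Qed.

Lemma blk_itv k : ((blk k)%:R : R) <= n%:R * k%:R / m%:R < (blk k)%:R + (1 : R).
Proof.
have m0R : (0 : R) < m%:R by rewrite ltr0n.
rewrite ler_pdivlMr// ltr_pdivrMr// -natrM -natrM natr1 -natrM ler_nat ltr_nat.
by rewrite leq_trunc_div ltn_ceil.
Qed.

Lemma blk_le k l : (k <= l)%N -> (blk k <= blk l)%N.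
Proof. by move=> kl; rewrite /blk leq_div2r// leq_mul2l kl orbT. Qed.

Lemma blk_lt k : (m <= n)%N -> (blk k < blk k.+1)%N.
Proof.
move=> mn; rewrite /blk mulnS addnC; apply: (@leq_trans ((n * k + m) %/ m)).
  by rewrite divnDr// divnn m0 addn1.
by rewrite leq_div2r// leq_add2l.
Qed.

Lemma blk_len k : (m <= n)%N -> (blk k.+1 - blk k)%:R <= 2 * n%:R / m%:R :> R.
Proof.
move=> mn; have m0R : (0 : R) < m%:R by rewrite ltr0n.
have /andP[_ h1] := blk_itv k; have /andP[h2 _] := blk_itv k.+1.
rewrite natrB ?blk_le//.
have : 1 <= n%:R / m%:R :> R by rewrite ler_pdivlMr// mul1r ler_nat.
have : n%:R * k.+1%:R / m%:R = n%:R * k%:R / m%:R + n%:R / m%:R :> R.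
  by rewrite -natr1; field; rewrite gt_eqF.
move: h1 h2; rewrite -[2 * _ / _]mulrA; lra.
Qed.

Definition bD k w : R := cwalk X mu (blk k) (blk k.+1 - blk k) w / Num.sqrt n%:R.

(** Some block oscillates by more than dl * sqrt n, written 2 * x to match the maximal inequality.
    The last block is left out: times up to T0 do not reach it when 2 <= m (1 - T0), and its
    Brownian counterpart would end at time 1. *)
Definition bad (dl : R) := \bigcup_(k < m.-1) [set w | exists2 j, (j <= blk k.+1 - blk k)%N &
  2 * (dl * Num.sqrt n%:R / 2) < `|cwalk X mu (blk k) j w|].

Lemma measurable_bad dl : measurable (bad dl).
Proof. by apply: bigcup_measurable => k _; exact: (measurable_max_cwalk XP). Qed.

Lemma sum_bD j w : \sum_(k < j) bD k w = cwalk X mu 0 (blk j) w / Num.sqrt n%:R.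
Proof.
rewrite -mulr_suml; congr (_ / _); elim: j => [|j IH].
  by rewrite big_ord0 blk0 cwalk0.
by rewrite big_ord_recr/= IH -[in RHS](subnKC (blk_le (leqnSn j))) cwalkD.
Qed.

(** The difference is the unfinished block, at most dl outside [bad], plus the drift over the
    fraction of a time unit lost by rounding t n. *)
Lemma wpath_near T0 dl w v : 0 <= T0 < 1 -> 2 <= m%:R * (1 - T0) -> (m <= n)%N ->
  ~ bad dl w -> `|mu| / Num.sqrt n%:R <= dl ->
  forall t, 0 <= t <= T0 ->
    `|wpath n w t - steps m (mix m.-1 bD w v) t| <= 2 * dl.
Proof.
move=> /andP[T00 T01] mT mn nbad mudl t /andP[t0 tT].
have m0R : (0 : R) < m%:R by rewrite ltr0n.
have n0R : (0 : R) < n%:R by rewrite ltr0n (leq_trans m0).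
have s0 : 0 < Num.sqrt n%:R :> R by rewrite sqrtr_gt0.
rewrite /steps; set j := Num.truncn (t * m%:R).
have /andP[j1 j2] := truncn_itv (mulr_ge0 t0 (ltW m0R)).
set q := Num.truncn (t * n%:R).
have /andP[q1 q2] := truncn_itv (mulr_ge0 t0 (ltW n0R)).
have jm : (j < m.-1)%N.
  rewrite -ltnS prednK// -(ltr_nat R) -natr1.
  have : t * m%:R <= T0 * m%:R by rewrite ler_wpM2r.
  by move: mT j1; rewrite -/j mulrBr mulr1 natr1; lra.
have E : \sum_(k < j) mix m.-1 bD w v k = \sum_(k < j) bD k w.
  by apply: eq_bigr => k _; rewrite /mix (ltn_trans (ltn_ord k) jm).
rewrite E sum_bD.
have bq : (blk j <= q)%N.
  rewrite -ltnS -(ltr_nat R); apply: le_lt_trans q2.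
  have /andP[h _] := blk_itv j; apply: (le_trans h).
  by rewrite ler_pdivrMr// mulrAC mulrC ler_wpM2r.
have qb : (q <= blk j.+1)%N.
  rewrite -ltnS -(ltr_nat R); apply: (le_lt_trans q1).
  have /andP[_ h] := blk_itv j.+1; rewrite -[X in _ < X]natr1; apply: lt_trans h.
  by rewrite ltr_pdivlMr// mulrAC mulrC ltr_pM2l.
rewrite /wpath walkE -/q.
have -> : cwalk X mu 0 q w = cwalk X mu 0 (blk j) w + cwalk X mu (blk j) (q - blk j) w.
  by rewrite -{1}(subnKC bq) cwalkD.
have -> : (cwalk X mu 0 (blk j) w + cwalk X mu (blk j) (q - blk j) w + q%:R * mu - t * mu * n%:R) /
    Num.sqrt n%:R - cwalk X mu 0 (blk j) w / Num.sqrt n%:R =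
  cwalk X mu (blk j) (q - blk j) w / Num.sqrt n%:R + (q%:R - t * n%:R) * (mu / Num.sqrt n%:R).
  by field; rewrite gt_eqF.
apply: le_trans (ler_normD _ _) _; rewrite [2 * dl]mulrDl mul1r; apply: lerD.
  rewrite normrM [X in _ * X]ger0_norm ?invr_ge0// ler_pdivrMr// leNgt; apply/negP => h.
  apply: nbad; exists j => //=; exists (q - blk j)%N; first by rewrite leq_sub2r.
  by rewrite mulrC divfK.
rewrite normrM; apply: le_trans mudl; rewrite normrM [X in _ * (_ * X)]ger0_norm ?invr_ge0//.
rewrite ler_piMl ?divr_ge0// ler_norml.
by move: q1 q2; rewrite -/q -natr1 => h1 h2; apply/andP; split; lra.
Qed.

End blocks.

Section functional.
Variables (K M T0 : R) (psi : (R -> R) -> R).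
Hypotheses (K0 : 0 <= K) (M0 : 0 <= M) (T01 : 0 <= T0 < 1) (psiL : lipf K M T0 psi).

Lemma wpath_bmf n : bmf (fun w => psi (wpath n w)).
Proof.
split; last by exists M => w; exact: psiL.1.
pose f (u : nat -> R) := psi (fun t => (\sum_(i < Num.truncn (t * n%:R)) u i - t * mu * n%:R) / Num.sqrt n%:R).
have : seq_measurable f.
  apply: (@lipschitz_seq_measurable _ n (K * (n%:R / Num.sqrt n%:R))) => u v e e0 uv.
  rewrite -mulrA; apply: psiL.2; first by rewrite mulr_ge0// divr_ge0.
  move=> t /andP[t0 tT]; rewrite -mulrBl opprB addrA subrK -sumrB normrM.
  rewrite [X in _ * X]ger0_norm ?invr_ge0// mulrAC ler_wpM2r ?invr_ge0//.
  apply: le_trans (ler_norm_sum _ _ _) _.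
  have qn : (Num.truncn (t * n%:R) <= n)%N.
    rewrite -(ler_nat R); apply: (@le_trans _ _ (t * n%:R)).
      by rewrite truncn_le mulr_ge0.
    by rewrite ler_piMl// (le_trans tT)// ltW// (andP T01).2.
  apply: (@le_trans _ _ (\sum_(i < Num.truncn (t * n%:R)) e)).
    by apply: ler_sum => i _; apply: uv; exact: leq_trans (ltn_ord i) qn.
  by rewrite sumr_const card_ord -[leLHS]mulr_natl ler_wpM2r// ler_nat.
by apply.
Qed.

Lemma steps_mix_bmf d1 (T1 : measurableType d1) m k (D : nat -> T1 -> R) v :
  (forall i, measurable_fun setT (D i)) -> bmf (fun w => psi (steps m (mix k D w v))).
Proof.
move=> mD; split; last by exists M => w; exact: psiL.1.
have h := @steps_seq_measurable _ _ _ _ _ T01 psiL m.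
apply: (h _ T1 (fun i w => mix k D w v i)) => i.
by rewrite /mix; case: (i < k)%N.
Qed.

Definition bmD (tt : nat -> R) k w : R := sigma * (B (tt k.+1) w - B (tt k) w).

Lemma bmD_measurable tt k : measurable_fun setT (bmD tt k).
Proof. by apply: measurable_funM => //; exact: measurable_funB. Qed.

Lemma bmD_indep tt : (forall i, 0 <= tt i < 1) -> (forall i, tt i <= tt i.+1) ->
  indep_seq P' (bmD tt).
Proof.
move=> tt01 ttS.
have := @indep_seq_shift _ T' R P' (fun i w => B (tt i.+1) w - B (tt i) w) _ _ 0 (fun _ x => sigma * x).
apply=> //.
- by move=> i; exact: measurable_funB.
- exact: (BM_indep hB).
- by move=> i; exact: measurable_funM.
Qed.

Definition grid m k : R := (minn k m)%:R / m.+1%:R.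

Lemma grid_itv m k : 0 <= grid m k < 1.
Proof.
by rewrite divr_ge0//= ltr_pdivrMr ?ltr0n// mul1r ltr_nat ltnS geq_minr.
Qed.

Lemma psi_eq (x y : R -> R) : (forall t, 0 <= t <= T0 -> x t = y t) -> psi x = psi y.
Proof.
move=> xy; apply/eqP; rewrite -subr_eq0 -normr_le0 -(mulr0 K); apply: psiL.2 => // t tT.
by rewrite xy// subrr normr0.
Qed.

Definition psi_grid m w := psi (fun t => sigma * B ((Num.truncn (t * m.+1%:R))%:R / m.+1%:R) w).

Let psi_grid_bmf m : bmf (psi_grid m).
Proof.
split; last by exists M => w; exact: psiL.1.
pose g (u : nat -> R) := psi (fun t => u (Num.truncn (t * m.+1%:R))).
have : seq_measurable g.
  apply: (@lipschitz_seq_measurable _ m.+1 K) => u v e e0 uv.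
  by apply: psiL.2 => // t tT; apply: uv; apply: truncn_grid tT _ _ => //; case/andP: T01.
move=> /(_ _ T' (fun i w => sigma * B (i%:R / m.+1%:R) w)); apply => i.
exact: measurable_funM.
Qed.

Lemma psi_grid_cvg w : psi_grid m w @[m --> \oo] --> psi (fun t => sigma * B t w).
Proof.
apply/cvgrPdist_le => e e0.
have Ks : 0 < K * sigma + 1 by rewrite ltr_wpDl// mulr_ge0.
have e'0 : 0 < e / (K * sigma + 1) by rewrite divr_gt0.
have := BM_unif_continuous hB w (andP T01).2 e'0; apply: filterS => m h.
apply: (@le_trans _ _ (K * (sigma * (e / (K * sigma + 1))))).
  apply: psiL.2 => [|t /andP[t0 tT]]; first by rewrite mulr_ge0// ltW.
  have m0 : (0 : R) < m.+1%:R by rewrite ltr0n.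
  rewrite -mulrBr normrM ger0_norm// ler_wpM2l//.
  have /andP[h1 h2] := truncn_itv (mulr_ge0 t0 (ltW m0)).
  have g1 : (Num.truncn (t * m.+1%:R))%:R / m.+1%:R <= t by rewrite ler_pdivrMr.
  apply: h; first by rewrite t0.
    by rewrite divr_ge0//= (le_trans g1).
  rewrite ger0_norm ?subr_ge0// lerBlDr -[X in X + _]mul1r -mulrDl ler_pdivlMr// addrC natr1.
  exact: ltW.
rewrite mulrA mulrCA ger_pMr// ler_pdivrMr// mul1r; lra.
Qed.

Lemma grid_telescope m j w : (j <= m)%N ->
  \sum_(k < j) bmD (grid m) k w = sigma * (B (j%:R / m.+1%:R) w - B 0 w).
Proof.
elim: j => [|j IH] jm; first by rewrite big_ord0 mul0r subrr mulr0.
rewrite big_ord_recr/= (IH (ltnW jm)) /bmD /grid (minn_idPl jm) (minn_idPl (ltnW jm)); ring.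
Qed.

Lemma BM_grid_cvg :
  \int[P']_w psi (steps m.+1 (mix m (bmD (grid m)) w (fun=> 0))) @[m --> \oo] -->
  \int[P']_w psi (fun t => sigma * B t w).
Proof.
have -> : (fun m => \int[P']_w psi (steps m.+1 (mix m (bmD (grid m)) w (fun=> 0)))) =
    (fun m => \int[P']_w psi_grid m w).
  apply/funext => m; rewrite /Rintegral; congr fine.
  have [mS _] := @steps_mix_bmf _ T' m.+1 m (bmD (grid m)) (fun=> 0) (bmD_measurable (grid m)).
  (* B 0 = 0 holds almost everywhere only, so the telescoping is used under the integral. *)
  apply: ae_eq_integral => //; [exact/measurable_EFinP|by apply/measurable_EFinP; case: (psi_grid_bmf m)|].
  apply: filterS (BM_start hB) => w B0 _; congr EFin; apply: psi_eq => t tT.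
  have jm := truncn_grid tT (andP T01).2 (ltn0Sn m).
  rewrite /steps; set j := Num.truncn _ in jm *.
  have := grid_telescope w (jm : (j <= m)%N); rewrite B0 subr0 => <-.
  by apply: eq_bigr => k _; rewrite /mix (leq_trans (ltn_ord k) (jm : (j <= m)%N)).
apply: (@Ex_cvg _ _ _ P' _ _ M) => [m|m w|w]; first by case: (psi_grid_bmf m).
  exact: psiL.1.
exact: psi_grid_cvg.
Qed.

(** The walk can be cut at multiples of 1 / n only; these times approximate [grid m] from below, and
    continuity of B removes the difference as n grows. *)
Definition ngrid m n k : R := (blk m.+1 n (minn k m))%:R / n%:R.

Lemma ngrid_le m n k : ngrid m n k <= grid m k.
Proof.
have [->|n0] := posnP n; first by rewrite /ngrid invr0 mulr0; case/andP: (grid_itv m k).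
have n0R : (0 : R) < n%:R by rewrite ltr0n.
rewrite ler_pdivrMr//; have /andP[h _] := blk_itv n (ltn0Sn m) (minn k m); apply: (le_trans h).
by rewrite [leRHS]mulrC /grid mulrA.
Qed.

Lemma ngrid_itv m n k : 0 <= ngrid m n k < 1.
Proof. by rewrite divr_ge0//= (le_lt_trans (ngrid_le m n k))//; case/andP: (grid_itv m k). Qed.

Lemma ngrid_mono m n k : ngrid m n k <= ngrid m n k.+1.
Proof.
rewrite ler_wpM2r ?invr_ge0// ler_nat blk_le//.
by rewrite leq_min geq_minr geq_min leqnSn.
Qed.

Lemma BM_ngrid_cvg m :
  \int[P']_w psi (steps m.+1 (mix m (bmD (ngrid m n)) w (fun=> 0))) @[n --> \oo] -->
  \int[P']_w psi (steps m.+1 (mix m (bmD (grid m)) w (fun=> 0))).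
Proof.
apply: (@Ex_cvg _ _ _ P' _ _ M) => [n|n w|w].
- have [mS _] := @steps_mix_bmf _ T' m.+1 m (bmD (ngrid m n)) (fun=> 0) (bmD_measurable (ngrid m n)).
  exact: mS.
- exact: psiL.1.
apply: (steps_cvg K0 T01 psiL) => k km; rewrite /mix; case: ltnP => // _; last exact: cvg_cst.
have cB i : B (ngrid m n i) w @[n --> \oo] --> B (grid m i) w.
  apply/cvgrPdist_le => e e0.
  have c1 : grid m i < 1 by case/andP: (grid_itv m i).
  have [N _ hN] := BM_unif_continuous hB w c1 e0; exists N.+1 => // n /= Nn.
  have n0 : (0 : R) < n%:R by rewrite ltr0n (leq_trans _ Nn).
  apply: (hN n.-1) => /=; first by rewrite -ltnS prednK ?(leq_trans _ Nn).
  - by rewrite lexx andbT; case/andP: (grid_itv m i).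
  - by rewrite ngrid_le andbT; case/andP: (ngrid_itv m n i).
  rewrite prednK ?(leq_trans _ Nn)// ger0_norm ?subr_ge0 ?ngrid_le//.
  rewrite lerBlDr -[X in X + _]mul1r -mulrDl ler_pdivlMr// addrC.
  have /andP[_ /ltW h] := blk_itv n (ltn0Sn m) (minn i m); apply: le_trans h.
  by rewrite /grid mulrAC [X in X / _ <= _]mulrC.
by apply: cvgM; [exact: cvg_cst|apply: cvgB; exact: cB].
Qed.

End functional.

(** Lies between the indicators of |y| >= dl / 2 and |y| > dl / 4. Being Lipschitz, it lets [clt_bl]
    transfer the probability of a large block to Brownian motion. *)
Definition bump dl (y : R) : R := Num.min 1 (Num.max 0 (4 / dl * `|y| - 1)).

Lemma clip_dist (a b c : R) : `|a - b| <= c ->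
  `|Num.min 1 (Num.max 0 (a - 1)) - Num.min 1 (Num.max 0 (b - 1))| <= c.
Proof.
rewrite !ler_norml => /andP[h1 h2].
by case: (leP 0 (a - 1)) => ha; case: (leP 0 (b - 1)) => hb; rewrite ?(min_r ler01);
  do 2?[case: (leP 1 (_ - 1)) => ?]; apply/andP; split; lra.
Qed.

Lemma bump_bl dl : 0 < dl -> bl (4 / dl) 1 (bump dl).
Proof.
move=> dl0; split=> [x|x y].
  rewrite /bump ger0_norm ?ge_min ?lexx//.
  by rewrite le_min ler01 le_max lexx.
have q0 : 0 < 4 / dl by rewrite divr_gt0.
have : `|4 / dl * `|x| - 4 / dl * `|y| | <= 4 / dl * `|x - y|.
  by rewrite -mulrBr normrM ger0_norm ?(ltW q0)// ler_wpM2l ?(ltW q0)// ler_dist_dist.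
by move=> /clip_dist.
Qed.

Lemma bump_ge0 dl y : 0 <= bump dl y.
Proof. by rewrite /bump le_min ler01 le_max lexx. Qed.

Lemma bump_eq1 dl y : 0 < dl -> dl / 2 <= `|y| -> bump dl y = 1.
Proof.
move=> dl0 hy; rewrite /bump; apply/min_idPl; rewrite le_max; apply/orP; right.
rewrite lerBrDr mulrAC ler_pdivlMr//; lra.
Qed.

Lemma bump_le dl y : 0 < dl -> bump dl y <= 256 / dl ^+ 4 * y ^+ 4.
Proof.
move=> dl0; have -> : 256 / dl ^+ 4 * y ^+ 4 = (4 / dl * `|y|) ^+ 4.
  rewrite exprMn expr_div_n -normrX ger0_norm; first by ring.
  by rewrite (_ : 4 = 2 * 2)%N// exprM sqr_ge0.
have q0 : 0 <= 4 / dl * `|y| by rewrite mulr_ge0// divr_ge0// ltW.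
rewrite /bump; move: (4 / dl * `|y|) q0 => a a0.
have [a1|a1] := leP a 1.
  apply: (@le_trans _ _ 0); last exact: exprn_ge0.
  rewrite ge_min; apply/orP; right; rewrite ge_max lexx; lra.
by apply: (@le_trans _ _ 1); [rewrite ge_min lexx|apply: exprn_ege1; exact: ltW].
Qed.

(** The fourth moment gives a bound quadratic in t - s, so the sum over m blocks of length of order
    1 / m is itself of order 1 / m. *)
Lemma bump_BM (dl : R) : 0 < dl -> exists2 C, 0 <= C & forall s t : R,
  0 <= s -> s < t -> t < 1 ->
  \int[P']_w bump dl (sigma * (B t w - B s w)) <= C * (t - s) ^+ 2.
Proof.
move=> dl0; have d4 : 0 <= 256 / dl ^+ 4 by apply: divr_ge0; [rewrite ler0n|rewrite exprn_ge0// ltW].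
exists (256 / dl ^+ 4 * (3 * sigma ^+ 4)).
  by apply: mulr_ge0 => //; rewrite mulr_ge0// exprn_ge0.
move=> s t s0 st t1; have [_ _ h] := BM_increment hB sigma_ge0 s0 st t1.
have mZ : measurable_fun setT (fun w => sigma * (B t w - B s w)).
  by apply: measurable_funM => //; exact: measurable_funB.
have mb : measurable_fun setT (fun w => bump dl (sigma * (B t w - B s w))).
  by apply: (measurableT_comp _ mZ); exact: bl_measurable (bump_bl dl0).
rewrite -lee_fin (EFin_Rintegral P'); last first.
  by split=> //; exists 1 => w; case: (bump_bl dl0).
apply: (@le_trans _ _ (\int[P']_w ((256 / dl ^+ 4)%:E * ((sigma * (B t w - B s w)) ^+ 4)%:E))%E).
  apply: ge0_le_integral => //.
  - by move=> w _; rewrite lee_fin bump_ge0.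
  - exact/measurable_EFinP.
  - by apply: measurable_funeM; apply/measurable_EFinP; exact: measurable_funX.
  - by move=> w _; rewrite -EFinM lee_fin bump_le.
rewrite ge0_integralZl//; first last.
- by move=> w _; rewrite lee_fin (_ : 4 = 2 * 2)%N// exprM sqr_ge0.
- by apply/measurable_EFinP; exact: measurable_funX.
apply: le_trans (lee_wpmul2l _ h) _; first by rewrite lee_fin.
by rewrite -EFinM lee_fin !mulrA.
Qed.

Lemma bD_measurable m n k : measurable_fun setT (bD m n k).
Proof. by apply: measurable_funM => //; exact: (cwalk_measurable XP). Qed.

Lemma bD_indep m n : indep_seq P (bD m n).
Proof.
apply: (@indep_seq_blocks _ T R P X mX (iid_indep XP) (blk m n)) => k.
  exact: blk_le.
apply: measurable_funM => //; apply: cwalk_range => //.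
by rewrite subnKC// blk_le.
Qed.

(** The maximal inequality reduces the oscillation of a block to its end value, [bump] passes to the
    Brownian increment, and each block lasts at most 2 / m.+1. The condition on m is the hypothesis
    of [max_cwalk_le] for x = dl sqrt n / 2 and blocks of at most 2 n / m.+1 increments. *)
Lemma bad_prob m n (dl e C : R) : (m < n)%N -> 0 < dl -> 0 <= e -> 16 * sigma ^+ 2 <= m.+1%:R * dl ^+ 2 ->
  (forall k, (k < m)%N -> `|\int[P]_w bump dl (bD m.+1 n k w) -
      \int[P']_w bump dl (bmD (ngrid m n) k w)| <= e) ->
  0 <= C -> (forall s t : R, 0 <= s -> s < t -> t < 1 ->
    \int[P']_w bump dl (sigma * (B t w - B s w)) <= C * (t - s) ^+ 2) ->
  fine (P (bad m.+1 n dl)) <= 8 * C / m.+1%:R + 2 * m.+1%:R * e.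
Proof.
move=> mn dl0 e0 ms clt C0 hC.
have n0R : (0 : R) < n%:R by rewrite ltr0n (leq_trans _ mn).
have m0R : (0 : R) < m.+1%:R by rewrite ltr0n.
have s0 : 0 < Num.sqrt n%:R :> R by rewrite sqrtr_gt0.
apply: le_trans (fine_P_bigcup_le P m _) _.
  by move=> k; exact: (measurable_max_cwalk XP).
apply: (@le_trans _ _ (\sum_(k < m) 2 * (4 * C / m.+1%:R ^+ 2 + e))).
  apply: ler_sum => -[k km] _ /=.
  have len := blk_len (ltn0Sn m) k mn.
  have x0 : 0 < dl * Num.sqrt n%:R / 2 by rewrite divr_gt0// mulr_gt0.
  apply: (le_trans (max_cwalk_le XP (blk m.+1 n k) x0 _)).
    rewrite exprMn exprMn (sqr_sqrtr (ltW n0R)) exprVn ler_pdivlMr//.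
    apply: (@le_trans _ _ (2 * (2 * n%:R / m.+1%:R * sigma ^+ 2) * 2 ^+ 2)).
      by rewrite ler_wpM2r// ler_wpM2l// ler_wpM2r// sqr_ge0.
    rewrite (_ : 2 * (_ * _) * _ = 16 * sigma ^+ 2 / m.+1%:R * n%:R); last by field; rewrite gt_eqF.
    by apply: (ler_wpM2r (ltW n0R)); rewrite ler_pdivrMr// [leRHS]mulrC.
  rewrite ler_wpM2l//.
  have bb : bmf (fun w => bump dl (bD m.+1 n k w)).
    split; last by exists 1 => w; case: (bump_bl dl0).
    by apply: (measurableT_comp _ (bD_measurable m.+1 n k)); exact: bl_measurable (bump_bl dl0).
  apply: (@le_trans _ _ (\int[P]_w bump dl (bD m.+1 n k w))).
    have mA : measurable [set w | dl * Num.sqrt n%:R / 2 < `|cwalk X mu (blk m.+1 n k) (blk m.+1 n k.+1 - blk m.+1 n k) w|].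
      rewrite -[X in measurable X]setTI; apply: measurable_fun_ltr => //.
      by apply: measurableT_comp => //; exact: (cwalk_measurable XP).
    rewrite -(Ex_indic P mA); apply: Ex_le => // [|w]; first exact: bmf_indic.
    rewrite indicE; case: (boolP (w \in _)) => [|_]; last exact: bump_ge0.
    rewrite inE /= => h; rewrite bump_eq1// /bD normrM (ger0_norm (_ : 0 <= (Num.sqrt n%:R)^-1)) ?invr_ge0//.
    by rewrite ler_pdivlMr// mulrAC ltW.
  have inc : 0 <= ngrid m n k /\ ngrid m n k < ngrid m n k.+1 /\ ngrid m n k.+1 < 1.
    split; first by case/andP: (ngrid_itv m n k).
    split; last by case/andP: (ngrid_itv m n k.+1).
    rewrite /ngrid (minn_idPl km) (minn_idPl (ltnW km)) ltr_pM2r ?invr_gt0// ltr_nat.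
    exact: blk_lt.
  have [i1 [i2 i3]] := inc.
  have h := hC _ _ i1 i2 i3.
  have h2 : \int[P']_w bump dl (bmD (ngrid m n) k w) <= 4 * C / m.+1%:R ^+ 2.
    apply: le_trans h _.
    have -> : 4 * C / m.+1%:R ^+ 2 = C * (2 / m.+1%:R) ^+ 2.
      by field; rewrite gt_eqF.
    apply: ler_wpM2l => //.
    have t0 : 0 <= ngrid m n k.+1 - ngrid m n k by rewrite subr_ge0 ltW.
    have t2 : ngrid m n k.+1 - ngrid m n k <= 2 / m.+1%:R.
      rewrite /ngrid (minn_idPl km) (minn_idPl (ltnW km)) -mulrBl -natrB ?blk_le//.
      by rewrite ler_pdivrMr// mulrAC.
    by rewrite lerXn2r ?nnegrE// (le_trans t0).
  have := clt k km; rewrite ler_norml => /andP[_]; rewrite lerBlDr => /le_trans; apply.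
  by rewrite addrC lerD2r.
rewrite sumr_const card_ord -[leLHS]mulr_natl.
have h0 : 0 <= 4 * C / m.+1%:R ^+ 2 by rewrite divr_ge0 ?mulr_ge0// exprn_ge0.
have -> : 8 * C / m.+1%:R + 2 * m.+1%:R * e =
    m.+1%:R * (2 * (4 * C / m.+1%:R ^+ 2 + e)).
  by field; rewrite gt_eqF.
apply: ler_pM => //; [by rewrite mulr_ge0// addr_ge0|by rewrite ler_nat].
Qed.

Lemma Ex_dist_bad (f g : T -> R) (A : set T) e M : 0 <= M -> bmf f -> bmf g -> measurable A ->
  (forall w, `|f w| <= M) -> (forall w, `|g w| <= M) ->
  (forall w, ~ A w -> `|f w - g w| <= e) -> 0 <= e ->
  `|\int[P]_w f w - \int[P]_w g w| <= e + 2 * M * fine (P A).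
Proof.
move=> M0 bf bg mA fM gM fg e0; have bfg := bmfB bf bg.
have bA : bmf (\1_A : T -> R) by exact: bmf_indic.
rewrite -ExB// -Ex_indic// -[e in leRHS](Ex_cst P) -(ExZ P _ bA).
have bz : bmf (fun w => 2 * M * (\1_A w : R)) by apply: bmfM => //; exact: bmf_cst.
rewrite -(ExD P (bmf_cst _ e) bz).
apply: le_trans (le_normr_Rintegral measurableT (bmf_integrable P bfg)) _.
apply: Ex_le; [exact: bmf_norm|by apply: bmfD => //; exact: bmf_cst|move=> w].
rewrite indicE; have [Aw|nAw] := pselect (A w).
  rewrite mem_set// mulr1; apply: le_trans (ler_normB _ _) _.
  by have := fM w; have := gM w; lra.
by rewrite memNset// mulr0 addr0; exact: fg.
Qed.

Lemma dist_chain4 (a b c f g x y z u e : R) : `|a - b| <= x -> `|b - c| <= y ->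
  `|c - f| <= z -> `|f - g| <= u -> x + y + z + u <= e -> `|a - g| <= e.
Proof.
move=> h1 h2 h3 h4 h5; apply: le_trans h5; rewrite -(subrKA f).
apply: le_trans (ler_normD _ _) (lerD _ h4); rewrite -(subrKA c).
apply: le_trans (ler_normD _ _) (lerD _ h3); rewrite -(subrKA b).
exact: le_trans (ler_normD _ _) (lerD h1 h2).
Qed.

Theorem donsker K M T0 psi : 0 <= K -> 0 <= M -> 0 <= T0 < 1 -> lipf K M T0 psi ->
  \int[P]_w psi (wpath n w) @[n --> \oo] -->
  \int[P']_w psi (fun t => sigma * B t w).
Proof.
move=> K0 M0 T01 psiL; have [T00 T1] := andP T01.
apply/cvgrPdist_le => e e0.
(* Order of the choices: dl from the Lipschitz constant, then the number m of blocks, then the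
   precision e1 of the central limit theorem, which depends on m, and n last. *)
pose dl := e / (12 * (K + 1)).
have K1 : 0 < K + 1 by rewrite ltr_wpDl.
have M1 : 0 < M + 1 by rewrite ltr_wpDl.
have dl0 : 0 < dl by rewrite divr_gt0// mulr_gt0.
have [C C0 hC] := bump_BM dl0.
have Kdl : K * (2 * dl) <= e / 6.
  rewrite /dl (_ : K * _ = e / 6 * (K / (K + 1))); last by field; rewrite gt_eqF.
  rewrite ler_piMr ?divr_ge0 ?(ltW e0)// ler_pdivrMr// mul1r; lra.
have e6 : 0 < e / 6 by rewrite divr_gt0.
have := BM_grid_cvg K0 T01 psiL; move/cvgrPdist_le => /(_ _ e6) hm.
have [m [m1 m2 m3 m4]] : exists m, [/\ 2 <= m.+1%:R * (1 - T0), 16 * sigma ^+ 2 <= m.+1%:R * dl ^+ 2,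
   2 * M * (8 * C / m.+1%:R) <= e / 6 &
   `|\int[P']_w psi (fun t => sigma * B t w) -
     \int[P']_w psi (steps m.+1 (mix m (bmD (grid m)) w (fun=> 0)))| <= e / 6].
  suff : \forall m \near \oo, [/\ 2 <= m.+1%:R * (1 - T0), 16 * sigma ^+ 2 <= m.+1%:R * dl ^+ 2,
   2 * M * (8 * C / m.+1%:R) <= e / 6 &
   `|\int[P']_w psi (fun t => sigma * B t w) -
     \int[P']_w psi (steps m.+1 (mix m (bmD (grid m)) w (fun=> 0)))| <= e / 6].
    by move=> [N _ /(_ N) h]; exists N; apply: h => /=.
  have big (c r : R) : 0 < r -> \forall m \near \oo, c <= m.+1%:R * r.
    move=> r0; near=> m; rewrite -ler_pdivrMr//; apply: (@le_trans _ _ m%:R).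
      by near: m; exact: nbhs_infty_ger.
    by rewrite ler_nat.
  have t1 : 0 < 1 - T0 by rewrite subr_gt0.
  have d2 : 0 < dl ^+ 2 by rewrite exprn_gt0.
  near=> m; split.
  - by near: m; exact: big.
  - by near: m; exact: big.
  - have h : 2 * M * (8 * C) <= m.+1%:R * (e / 6) by near: m; exact: big.
    by rewrite mulrA ler_pdivrMr ?ltr0n// [leRHS]mulrC.
  - by near: m; exact: hm.
have m0R : (0 : R) < m.+1%:R by rewrite ltr0n.
pose e1 := e / (24 * (M + 1) * m.+1%:R).
have e10 : 0 < e1 by rewrite divr_gt0// !mulr_gt0.
have m5 : m.+1%:R * e1 <= e / 6.
  rewrite /e1 (_ : _ * _ = e / 6 * (4 * (M + 1))^-1); last by field; rewrite !gt_eqF.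
  by rewrite ler_piMr ?(ltW e6)// invf_le1 ?mulr_gt0//; lra.
have m6 : 2 * M * (2 * m.+1%:R * e1) <= e / 6.
  rewrite /e1 (_ : 2 * M * _ = e / 6 * (M / (M + 1))); last by field; rewrite !gt_eqF.
  by rewrite ler_piMr ?(ltW e6)// ler_pdivrMr//; lra.
have [N1 clt1] := clt_bl XP hB sigma_ge0 K0 M0 e10.
have b4 : 0 <= 4 / dl by rewrite divr_ge0// ltW.
have [N2 clt2] := clt_bl XP hB sigma_ge0 b4 ler01 e10.
have := BM_ngrid_cvg K0 T01 psiL (m := m); move/cvgrPdist_le => /(_ _ e6) hn.
have hmu : \forall n \near \oo, `|mu| / Num.sqrt n%:R <= dl.
  have : `|mu| * (Num.sqrt (n%:R : R))^-1 @[n --> \oo] --> `|mu| * 0.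
    by apply: cvgM; [exact: cvg_cst|exact: cvg_invsqrt].
  rewrite mulr0 => /cvgrPdist_le /(_ _ dl0); apply: filterS => n.
  by rewrite sub0r normrN ger0_norm// divr_ge0.
near=> n.
have nN1 : (N1 <= n)%N by near: n; exact: nbhs_infty_ge.
have nN2 : (N2 <= n)%N by near: n; exact: nbhs_infty_ge.
have mn : (m < n)%N by near: n; exact: nbhs_infty_gt.
have n4 : `|mu| / Num.sqrt n%:R <= dl by near: n; exact: hmu.
have n5 : `|\int[P']_w psi (steps m.+1 (mix m (bmD (grid m)) w (fun=> 0))) -
     \int[P']_w psi (steps m.+1 (mix m (bmD (ngrid m n)) w (fun=> 0)))| <= e / 6.
  by near: n; exact: hn.
have pm k : (k < m)%N -> (blk m.+1 n k + (blk m.+1 n k.+1 - blk m.+1 n k) < n)%N.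
  move=> km; rewrite subnKC ?blk_le// /blk ltn_divLR// ltn_pmul2l ?(leq_trans _ mn)//.
have ngE k : (k < m)%N -> bmD (ngrid m n) k = fun w => sigma *
    (B ((blk m.+1 n k + (blk m.+1 n k.+1 - blk m.+1 n k))%:R / n%:R) w - B ((blk m.+1 n k)%:R / n%:R) w).
  move=> km; rewrite subnKC ?blk_le//; apply/funext => w.
  by rewrite /bmD /ngrid (minn_idPl km) (minn_idPl (ltnW km)).
have bad2 : fine (P (bad m.+1 n dl)) <= 8 * C / m.+1%:R + 2 * m.+1%:R * e1.
  apply: bad_prob (ltW e10) m2 _ C0 hC => // k km.
  have := clt2 n (blk m.+1 n k) (blk m.+1 n k.+1 - blk m.+1 n k)%N _ nN2 (pm k km) (bump_bl dl0).
  by rewrite (ngE k km).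
have swap : `|\int[P]_w psi (steps m.+1 (mix m (bD m.+1 n) w (fun=> 0))) -
     \int[P']_w psi (steps m.+1 (mix m (bmD (ngrid m n)) w (fun=> 0)))| <= m%:R * e1.
  apply: (@indep_swap _ _ T P _ T' P' (bD m.+1 n) (bmD (ngrid m n)) (fun u => psi (steps m.+1 u))).
  - exact: bD_measurable.
  - exact: bmD_measurable.
  - exact: bD_indep.
  - by apply: bmD_indep; [exact: ngrid_itv|exact: ngrid_mono].
  - exact: (@steps_seq_measurable _ _ _ _ _ T01 psiL m.+1).
  - by exists M => v; exact: psiL.1.
  move=> k v km.
  have := clt1 n (blk m.+1 n k) (blk m.+1 n k.+1 - blk m.+1 n k)%N _ nN1 (pm k km)
     (steps_slice psiL m.+1 v k).
  by rewrite (ngE k km).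
have path : `|\int[P]_w psi (wpath n w) - \int[P]_w psi (steps m.+1 (mix m (bD m.+1 n) w (fun=> 0)))| <=
    e / 6 + 2 * M * fine (P (bad m.+1 n dl)).
  apply: Ex_dist_bad => //.
  - first [exact: (wpath_bmf K0 T01 psiL)|exact: (wpath_bmf T01 psiL)].
  - by first [apply: (steps_mix_bmf K0 T01 psiL) => k|apply: (steps_mix_bmf T01 psiL) => k]; exact: bD_measurable.
  - exact: measurable_bad.
  - by move=> w; exact: psiL.1.
  - by move=> w; exact: psiL.1.
  - move=> w nb; apply: le_trans Kdl; apply: psiL.2; first by rewrite mulr_ge0// ltW.
    exact: (@wpath_near m.+1 n (ltn0Sn m) T0 dl w (fun=> 0) T01 m1 mn nb n4).
  - exact: ltW.
have b3 : 2 * M * fine (P (bad m.+1 n dl)) <= e / 6 + e / 6.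
  apply: le_trans (_ : 2 * M * (8 * C / m.+1%:R + 2 * m.+1%:R * e1) <= _).
    by rewrite ler_wpM2l// mulr_ge0.
  by rewrite mulrDr; exact: lerD.
have sw2 : m%:R * e1 <= e / 6.
  by apply: le_trans m5; rewrite ler_wpM2r ?(ltW e10)// ler_nat.
rewrite distrC in swap; rewrite distrC in path.
apply: (dist_chain4 m4 n5 (le_trans swap sw2) path); move: b3; lra.
Unshelve. all: by end_near. Qed.

End donsker.

(** * Upper bound for the ruin probability *)

Lemma ladder_arith (R : realType) (s1 s2 s3 s4 eta y z : R) : s1 <= eta / 4 * y -> s2 <= z ->
  s3 <= eta / 16 * y -> s4 <= eta / 8 * y -> 0 <= eta * y -> s1 + s2 + (s3 + s4) <= eta * y + z.
Proof. by lra. Qed.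

Section ladder.
Context (R : realType) d (T : measurableType d) (P : probability T R).
Variables (X : nat -> T -> R) (mu sigma : R).
Hypothesis XP : iid_sequence P X mu sigma.

Let mX := iid_measurable XP.
Let XI := iid_indep XP.

Definition tl (x : R) : R := fine (P [set w | x < X 0%N w]).

Definition Itail (x : R) : R := \int[P]_w Num.max 0 (X 0%N w - x).

Lemma measurable_X_gt i (x : R) : measurable [set w | x < X i w].
Proof. by rewrite -[X in measurable X]setTI; apply: measurable_fun_ltr. Qed.

Lemma tl_law i x : fine (P [set w | x < X i w]) = tl x.
Proof.
rewrite /tl; have := @iid_law _ _ _ _ _ _ _ XP i `]x, +oo[ (measurable_itv _).
have e k : X k @^-1` `]x, +oo[ = [set w | x < X k w].
  by apply/seteqP; split => w; rewrite /= in_itv /= andbT.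
by rewrite !e => ->.
Qed.

Lemma tl_ge0 x : 0 <= tl x. Proof. exact: fine_P_ge0. Qed.

Lemma tl_le x y : x <= y -> tl y <= tl x.
Proof.
by move=> xy; apply: fine_P_le => [||w /=]; [exact: measurable_X_gt..|exact: le_lt_trans].
Qed.

Lemma intg_excess x : intg P (fun w => Num.max 0 (X 0%N w - x)).
Proof.
have h := intgB (iid_intg XP) (intg_cst P x).
have := integrable_abse h => h'.
apply: (intg_le _ (g := fun w => `|X 0%N w - x|)).
- by apply: measurable_maxr => //; exact: measurable_funB.
- exact: h'.
- move=> w; rewrite ger0_norm ?le_max ?lexx// ge_max normr_ge0/=; exact: ler_norm.
Qed.

Lemma Itail_ge0 x : 0 <= Itail x.
Proof. by apply: Ex_ge0 => w; rewrite le_max lexx. Qed.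

Lemma Itail_le x y : x <= y -> Itail y <= Itail x.
Proof.
move=> xy; apply: le_Rintegral => //; try exact: intg_excess.
move=> w _; rewrite ge_max !le_max lexx/=; apply/orP; right; lra.
Qed.

Lemma intg_indic (A : set T) : measurable A -> intg P (\1_A : T -> R).
Proof. by move=> mA; apply: bmf_integrable; exact: bmf_indic. Qed.

Lemma tl_le_Itail x : tl x <= Itail (x - 1).
Proof.
rewrite /tl -(Ex_indic P (measurable_X_gt 0 x)); apply: le_Rintegral => //.
- exact/intg_indic/measurable_X_gt.
- exact: intg_excess.
move=> w _; rewrite indicE; case: (boolP (w \in _)); rewrite ?inE/= => h.
  by rewrite le_max; apply/orP; right; lra.
by rewrite le_max lexx.
Qed.

Lemma sum_indic_le (c x : R) N : 0 <= c ->
  \sum_(i < N) c * (i.+1%:R * c < x)%R%:R <= Num.max 0 x.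
Proof.
move=> c0; suff : \sum_(i < N) c * (i.+1%:R * c < x)%R%:R <= Num.max 0 x /\
    \sum_(i < N) c * (i.+1%:R * c < x)%R%:R <= N%:R * c by case.
elim: N => [|N [IH1 IH2]]; first by rewrite big_ord0 mul0r le_max lexx.
have IH3 : \sum_(i < N) c * (i.+1%:R * c < x)%R%:R + c <= N.+1%:R * c.
  by rewrite -natr1 mulrDl mul1r lerD2r.
rewrite big_ord_recr/=; case: (ltP (N.+1%:R * c) x) => h /=; rewrite ?mulr1 ?mulr0 ?addr0.
  split=> //; rewrite le_max; apply/orP; right; exact: le_trans IH3 (ltW h).
split=> //; apply: le_trans IH3; lra.
Qed.

(** A Riemann sum of mesh c of a decreasing tail: all terms but the first are below the integral.
    The comparison is made inside the expectation, by counting multiples of c below X - z. *)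
Lemma sum_tl (c z : R) N : 0 < c -> \sum_(n < N) tl (z + n%:R * c) <= tl z + Itail z / c.
Proof.
move=> c0; case: N => [|N].
  by rewrite big_ord0 addr_ge0 ?tl_ge0// divr_ge0 ?Itail_ge0// ltW.
rewrite big_ord_recl/= mul0r addr0 lerD2l ler_pdivlMr// mulrC mulr_sumr.
have mA (i : nat) := measurable_X_gt 0 (z + i.+1%:R * c).
rewrite (eq_bigr (fun i : 'I_N => \int[P]_w (c * \1_[set w | z + i.+1%:R * c < X 0%N w] w))); last first.
  by move=> i _; rewrite ExZ ?Ex_indic//; exact: bmf_indic.
rewrite -(Ex_sum P (f := fun i w => c * \1_[set w | z + i.+1%:R * c < X 0%N w] w)); last first.
  by move=> i _; apply: bmfM; [exact: bmf_cst|exact: bmf_indic].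
apply: le_Rintegral => //.
- apply: bmf_integrable; apply: (bmf_sum (f := fun i w => c * \1_[set w | z + i.+1%:R * c < X 0%N w] w)) => i _.
  by apply: bmfM; [exact: bmf_cst|exact: bmf_indic].
- exact: intg_excess.
move=> w _; apply: le_trans (sum_indic_le (X 0%N w - z) N (ltW c0)).
apply: ler_sum => i _; rewrite indicE; case: (boolP (w \in _)); rewrite ?inE/= => h.
  by rewrite ltrBrDl h.
by rewrite mulr0 mulr_ge0// ltW.
Qed.

Definition exceed p m (y : R) := [set w | exists2 j, (j <= m)%N & y < cwalk X 0 p j w].

Lemma walkX n w : walk X n w = cwalk X 0 0 n w.
Proof. by apply: eq_bigr => i _; rewrite subr0. Qed.

Lemma range_gt l u Z Y : range_mfun X l u Z -> range_mfun X l u Y ->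
  <<s generators X [set i | (l <= i < u)%N] >> [set w | Z w < Y w].
Proof.
move=> mZ mY.
suff : @measurable _ (g_sigma_algebraType (generators X [set i | (l <= i < u)%N]))
    [set w | Z w < Y w] by [].
by rewrite -[X in measurable X]setTI; apply: measurable_fun_ltr.
Qed.

Lemma range_cst l u (c : R) : range_mfun X l u (fun=> c).
Proof. exact: measurable_cst. Qed.

Lemma range_event l u (A : set T) : <<s generators X [set i | (l <= i < u)%N] >> A -> measurable A.
Proof. exact: (@generated_by_measurable _ _ _ _ _ mX [set i | (l <= i < u)%N]). Qed.

Lemma cwalkm p m : measurable_fun setT (cwalk X 0 p m).
Proof. by apply: (@range_mfun_measurable _ T R X mX p (p + m)); exact: cwalk_range. Qed.

Lemma measurable_exceed p m y : measurable (exceed p m y).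
Proof.
rewrite (_ : exceed p m y = \bigcup_(j < m.+1) [set w | y < cwalk X 0 p j w]).
  apply: bigcup_measurable => j _; rewrite -[X in measurable X]setTI.
  by apply: measurable_fun_ltr => //; exact: cwalkm.
by apply/seteqP; split => w [j jm h]; exists j.
Qed.

Definition exprob m y : R := fine (P (exceed 0 m y)).

Lemma exprob_ge0 m y : 0 <= exprob m y. Proof. exact: fine_P_ge0. Qed.

Lemma exprob_le1 m y : exprob m y <= 1.
Proof. exact/fine_P_le1/measurable_exceed. Qed.

Lemma exprob_le m y z : y <= z -> exprob m z <= exprob m y.
Proof.
move=> yz; apply: fine_P_le; [exact: measurable_exceed..|move=> w [j jm h]].
by exists j => //; exact: le_lt_trans h.
Qed.

(** Stationarity as an exchange of coordinates with error 0, each coordinate having the same law. *)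
Lemma exceed_shift p m y : fine (P (exceed p m y)) = exprob m y.
Proof.
pose f (u : nat -> R) : R := (`[< exists2 j, (j <= m)%N & y < \sum_(i < j) u i >])%:R.
have mf : seq_measurable f.
  move=> d1 T1 v mv.
  pose A := [set w | exists2 j, (j <= m)%N & y < \sum_(i < j) v i w].
  have mA : measurable A.
    rewrite (_ : A = \bigcup_(j < m.+1) [set w | y < \sum_(i < j) v i w]).
      apply: bigcup_measurable => j _; rewrite -[X in measurable X]setTI.
      apply: measurable_fun_ltr => //.
      exact: (@measurable_sum _ _ _ _ _ _ (fun (i : 'I_j) (w : T1) => v i w)).
    by apply/seteqP; split => w [j jm h]; exists j.
  rewrite (_ : (fun w => _) = \1_A); first exact: measurable_indic.
  by apply/funext => w; rewrite indicE /f; congr (nat_of_bool _)%:R; rewrite in_setE.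
have fb : exists M : R, forall v, `|f v| <= M.
  by exists 1 => v; rewrite ger0_norm// lern1 leq_b1.
have E q : fine (P (exceed q m y)) = \int[P]_w f (mix m (fun i w => X (q + i)%N w) w (fun=> 0)).
  rewrite -(Ex_indic P (measurable_exceed q m y)); apply: eq_Rintegral => w _.
  have cE j : (j <= m)%N -> cwalk X 0 q j w = \sum_(i < j) mix m (fun i w => X (q + i)%N w) w (fun=> 0) i.
    by move=> jm; apply: eq_bigr => i _; rewrite /mix (leq_trans (ltn_ord i) jm) subr0.
  rewrite indicE /f; congr (nat_of_bool _)%:R.
  apply/idP/asboolP => [/set_mem [j jm h]|[j jm h]]; last apply/mem_set.
    by exists j => //; rewrite -cE.
  by exists j => //; rewrite cE.
rewrite /exprob !E; apply/eqP; rewrite -subr_eq0 -normr_le0.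
have iq q : indep_seq P (fun i w => X (q + i)%N w).
  exact: (@indep_seq_shift _ T R P X mX XI q (fun=> id) (fun _ => @measurable_id _ _ _)).
rewrite -(mulr0 m%:R).
apply: (@indep_swap _ _ T P _ T P (fun i w => X (p + i)%N w) (fun i w => X (0 + i)%N w) f) => //.
- move=> k v _; rewrite normr_le0 subr_eq0; apply/eqP.
  apply: (law_Rintegral (g := fun x => f (upd v k x)) (mX _) (mX _)).
  - have mm := mf _ _ (fun i (x : R) => upd v k x i); apply: mm => i.
    by rewrite /upd; case: (i == k).
  - by move=> A mA; rewrite !(iid_law XP _ mA).
Qed.

(** First positive time above the line that falls from R0 with slope c. In use c is slightly smaller
    than - mu, so the walk typically stays below the line for ever. *)
Definition first_above (R0 c : R) n := [set w | R0 - n%:R * c < cwalk X 0 0 n w] `&`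
  \bigcap_(j < n) [set w | (0 < j)%N -> cwalk X 0 0 j w <= R0 - j%:R * c].

Lemma first_above_range R0 c n :
  <<s generators X [set i | (0 <= i < n)%N] >> (first_above R0 c n).
Proof.
suff : @measurable _ (g_sigma_algebraType (generators X [set i | (0 <= i < n)%N]))
   (first_above R0 c n) by [].
apply: measurableI; first by apply: range_gt; [exact: range_cst|exact: cwalk_range].
apply: bigcap_measurableType => j /= jn; case: j jn => [_|j jn].
  rewrite (_ : [set w : T | (0 < 0)%N -> _] = setT); last by apply/seteqP; split.
  exact: (@measurableT _ (g_sigma_algebraType (generators X [set i | (0 <= i < n)%N]))).
rewrite (_ : [set w : T | (0 < j.+1)%N -> _] = ~` [set w | R0 - j.+1%:R * c < cwalk X 0 0 j.+1 w]).
  apply: measurableC; apply: (@range_gt 0 n); first exact: range_cst.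
  by apply: cwalk_range => //; exact: ltnW.
apply/seteqP; split => w /=; first by move=> /(_ isT) h; apply/negP; rewrite -leNgt.
by move=> /negP; rewrite -leNgt.
Qed.

Lemma first_above_measurable R0 c n : measurable (first_above R0 c n).
Proof. apply: (@range_event 0 n). exact: first_above_range. Qed.

Lemma first_above_disj R0 c i j w : (0 < i)%N -> (0 < j)%N ->
  first_above R0 c i w -> first_above R0 c j w -> i = j.
Proof.
move=> i0 j0 [hi hi'] [hj hj']; have [ij|ij|//] := ltngtP i j.
  by exfalso; have := hj' i ij i0; move: hi => /=; lra.
by exfalso; have := hi' j ij j0; move: hj => /=; lra.
Qed.

(** A walk above x >= R0 has crossed the falling line before or at that time. After the crossing the
    rest is independent of it, and at most N steps remain since the crossing takes at least one. *)
Lemma zachary (R0 c x : R) N : 0 <= R0 -> 0 <= c -> R0 <= x ->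
  exprob N.+1 x <= \sum_(n < N.+1)
    \int[P]_w (\1_(first_above R0 c n.+1) w * exprob N (x - cwalk X 0 0 n.+1 w)).
Proof.
move=> R00 c0 Rx.
pose Q n := first_above R0 c n.+1 `&`
  [set w | exists2 i, (i <= N)%N & x - cwalk X 0 0 n.+1 w < cwalk X 0 n.+1 i w].
have mQ n : measurable (Q n).
  apply: measurableI; first exact: first_above_measurable.
  rewrite (_ : [set w | _] = \bigcup_(i < N.+1) [set w | x - cwalk X 0 0 n.+1 w < cwalk X 0 n.+1 i w]).
    apply: bigcup_measurable => j _; rewrite -[X in measurable X]setTI.
    by apply: measurable_fun_ltr => //; [apply: measurable_funB => //|]; exact: cwalkm.
  by apply/seteqP; split => w [j jm h]; exists j.
apply: (@le_trans _ _ (fine (P (\bigcup_(n < N.+1) Q n)))).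
  apply: fine_P_le; [exact: measurable_exceed|by apply: bigcup_measurable|].
  move=> w [j jN xj].
  have j0 : (0 < j)%N by case: j jN xj => // _; rewrite cwalk0; lra.
  have above i : x < cwalk X 0 0 i w -> R0 - i%:R * c < cwalk X 0 0 i w.
    by apply: le_lt_trans; apply: le_trans Rx; rewrite gerBl mulr_ge0.
  have ex : exists n, (0 < n)%N && (R0 - n%:R * c < cwalk X 0 0 n w).
    by exists j; rewrite j0 above.
  case: (ex_minnP ex) => -[//|n] /= nw nmin.
  have nj : (n.+1 <= j)%N by apply: nmin; rewrite j0 above.
  exists n; first by rewrite /= (leq_trans nj).
  split; first split => //.
    move=> i /= ilt i0; rewrite leNgt; apply/negP => h.
    by have := nmin i; rewrite i0 h => /(_ isT); rewrite leqNgt ilt.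
  exists (j - n.+1)%N; first by rewrite leq_subLR addSn -addnS (leq_trans jN)// leq_addl.
  by rewrite ltrBlDl -cwalkD subnKC.
apply: le_trans (fine_P_bigcup_le P N.+1 mQ) _.
apply: ler_sum => n _; rewrite -(Ex_indic P (mQ n)) le_eqVlt; apply/orP; left; apply/eqP.
pose G := generators X [set i | (0 <= i < n.+1)%N].
pose H := generators X [set i | (n.+1 <= i < n.+1 + N)%N].
pose f (z : g_sigma_algebraType G * g_sigma_algebraType H) : R :=
  \1_(first_above R0 c n.+1) z.1 *
  \1_[set z : g_sigma_algebraType G * g_sigma_algebraType H |
     exists2 i, (i <= N)%N & x - cwalk X 0 0 n.+1 z.1 < cwalk X 0 n.+1 i z.2] z.
have m1 : @measurable_fun _ _ (g_sigma_algebraType G) R setT (cwalk X 0 0 n.+1).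
  exact: cwalk_range.
have m2 i : (i <= N)%N -> @measurable_fun _ _ (g_sigma_algebraType H) R setT (cwalk X 0 n.+1 i).
  by move=> iN; apply: cwalk_range => //; rewrite leq_add2l.
have bf : bmf f.
  apply: bmfM.
    have h : bmf (\1_(first_above R0 c n.+1) : g_sigma_algebraType G -> R).
      by apply: bmf_indic; exact: first_above_range.
    case: h => h1 [M h2]; split; last by exists M => z; exact: h2.
    exact: (measurableT_comp h1 measurable_fst).
  apply: bmf_indic.
  rewrite (_ : [set z | _] = \bigcup_(i < N.+1) [set z : g_sigma_algebraType G * g_sigma_algebraType H |
     x - cwalk X 0 0 n.+1 z.1 < cwalk X 0 n.+1 i z.2]).
    apply: bigcup_measurable => j /= jN; rewrite -[X in measurable X]setTI.
    apply: measurable_fun_ltr => //.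
      apply: measurable_funB => //.
      exact: (measurableT_comp m1 measurable_fst).
    exact: (measurableT_comp (m2 j jN) measurable_snd).
  by apply/seteqP; split => w [j jm h]; exists j.
have GH : independent_sigma P <<s G >> <<s H >> by apply: (@range_independent _ _ _ _ _ mX XI 0 n.+1 n.+1 (n.+1 + N)).
have mG : G `<=` @measurable _ T by exact: generators_measurable.
have mH : H `<=` @measurable _ T by exact: generators_measurable.
have dec := @decouple _ _ _ _ G H f mG mH GH bf.
 transitivity (\int[P]_w f (w, w)).
  apply: eq_Rintegral => w _; rewrite /f /Q !indicE in_setI -mulnb natrM.
  by congr (_ * (nat_of_bool _)%:R); apply/idP/idP => /set_mem h; exact/mem_set.
rewrite dec; apply: eq_Rintegral => w _; rewrite /f /=.
rewrite ExZ; last first.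
  by apply: bmf_indic; exact: (measurable_exceed n.+1 N (x - cwalk X 0 0 n.+1 w)).
rewrite -(exceed_shift n.+1) -(Ex_indic P (measurable_exceed n.+1 N _)).
by congr (_ * _); apply: eq_Rintegral => w2 _; rewrite !indicE !in_setE.
Qed.

Definition overshoot (R0 c : R) n y : R :=
  fine (P (first_above R0 c n `&` [set w | y < cwalk X 0 0 n w])).

Lemma measurable_overshoot R0 c n y :
  measurable (first_above R0 c n `&` [set w | y < cwalk X 0 0 n w]).
Proof.
apply: measurableI; first exact: first_above_measurable.
by rewrite -[X in measurable X]setTI; apply: measurable_fun_ltr => //; exact: cwalkm.
Qed.

(** Before a crossing at time n + 1 the walk is at most R0 - n c, so exceeding y requires an
    increment above y - R0 + n c. The slope of the line turns the sum over n into a Riemann sum. *)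
Lemma sum_overshoot (R0 c y : R) N : 0 <= R0 -> 0 < c ->
  \sum_(n < N) overshoot R0 c n.+1 y <= tl (y - R0) + Itail (y - R0) / c.
Proof.
move=> R00 c0; apply: le_trans (sum_tl (y - R0) N c0).
apply: ler_sum => n _; rewrite -(tl_law n); apply: fine_P_le.
- exact: measurable_overshoot.
- exact: measurable_X_gt.
move=> w [[_ prev] /= yw].
have Sn : cwalk X 0 0 n w <= R0 - n%:R * c.
  case: (n : nat) prev => [_|k /(_ k.+1 (ltnSn _) isT)//].
  by rewrite cwalk0 mul0r subr0.
by move: yw; rewrite -addn1 cwalkD /cwalk add0n big_ord1 addn0 subr0 -/(cwalk X 0 0 n w); lra.
Qed.

(** At a crossing of this line the centred walk exceeds r^2 + n e^2, which [cwalk_lln] makes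
    unlikely for large r. *)
Lemma sum_first_above (r e : R) N : mu < 0 -> 0 < r -> 0 < e ->
  \sum_(n < N) fine (P (first_above (r ^+ 2) (- mu - e ^+ 2) n.+1)) <=
  32 * sigma ^+ 2 / (r * e ^+ 3).
Proof.
move=> mu0 r0 e0; apply: le_trans (cwalk_lln XP N.+1 r0 e0).
apply: (@sum_fine_P_le _ T R P N (fun n => first_above (r ^+ 2) (- mu - e ^+ 2) n.+1)).
- by move=> k; exact: first_above_measurable.
- exact: (measurable_cwalk_exceeds XP).
- move=> k kN w [/= h _]; exists k.+1; first by rewrite ltnS.
  have := walkE X mu k.+1 w; rewrite walkX => hw.
  apply: lt_le_trans (ler_norm _); move: h; rewrite hw; lra.
- move=> i j w _ _ h1 h2; apply: succn_inj; exact: first_above_disj h1 h2.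
Qed.

Definition long_tailed := forall L : R, 0 <= L -> Itail (x - L) / Itail x @[x --> +oo] --> (1 : R).

(** A form of subexponentiality of I. Lowering a level u >= 2 k by about k costs at most the factor
    [h k], and the products of I and h have small tails; hence the part of the convolution of I with
    itself far from both ends is small compared with I. The allowance D absorbs the height of the
    line and the rounding. *)
Definition kernel_bounded := forall D : R, 0 <= D -> exists h : nat -> R,
  (forall k, 0 <= h k) /\ forall eta : R, 0 < eta -> exists K : nat,
  (forall (k : nat) (u : R), (K <= k)%N -> k%:R * 2 - D <= u -> Itail (u - k.+1%:R) <= h k * Itail u) /\
  forall n, \sum_(i < n | (K <= i)%N) Itail (i%:R - D) * h i <= eta.

Section one_step.
Hypotheses (mu0 : mu < 0) (I_gt0 : forall x, 0 < Itail x) (LT : long_tailed).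
Hypotheses (tl_small : tl x / Itail x @[x --> +oo] --> (0 : R)) (KB : kernel_bounded).

Lemma Itail_shift (L q : R) : 0 <= L -> 1 < q ->
  \forall x \near +oo, Itail (x - L) <= q * Itail x.
Proof.
move=> L0 q1; have /cvgrPdist_lt := LT L0 => /(_ (q - 1)); rewrite subr_gt0 q1 => /(_ isT).
apply: filterS => x; rewrite distrC => /ltr_normlW h; rewrite -ler_pdivrMr//; lra.
Qed.

Lemma tl_shift (q : R) : 0 < q -> \forall x \near +oo, tl x <= q * Itail x.
Proof.
move=> q0; have /cvgrPdist_lt := tl_small => /(_ q q0).
by apply: filterS => x; rewrite sub0r normrN => /ltr_normlW h; rewrite -ler_pdivrMr// ltW.
Qed.

Lemma near_shift (L : R) (Q : R -> Prop) : (\forall x \near +oo, Q x) ->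
  \forall x \near +oo, Q (x - L).
Proof.
move=> [M [Mr h]]; exists (M + L); split; first exact: num_real.
by move=> x xM; apply: h; rewrite ltrBrDr.
Qed.

(** s is the position at the crossing. The cases are s <= K, s > x - K, and in between unit
    intervals counted from 0 when s <= x / 2 and from x otherwise, so that only indices i <= x / 2
    occur and [kernel_bounded] serves both. All indicators have the form y < s, which [overshoot]
    measures. *)
Lemma exprob_cover (K M : nat) (N : nat) (C x s : R) : 0 <= C ->
  (forall y, exprob N y <= C * Itail y) -> 0 <= x -> x < M%:R ->
  exprob N (x - s) <= C * Itail (x - K%:R) + (x - K%:R < s)%R%:R +
    (\sum_(i < M) (if (K <= i)%N && (i%:R * 2 <= x) then C * Itail (x - i.+1%:R) else 0) * (i%:R < s)%R%:R +
     \sum_(i < M) (if (K <= i)%N && (i%:R * 2 <= x) then C * Itail i%:R else 0) * (x - i.+1%:R < s)%R%:R).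
Proof.
move=> C0 UC x0 xM.
have CI y : 0 <= C * Itail y by rewrite mulr_ge0// Itail_ge0.
have pos (b : bool) (u : R) : 0 <= u -> 0 <= u * b%:R by move=> u0; rewrite mulr_ge0.
have ifp (b : bool) (u : R) : 0 <= u -> 0 <= (if b then u else 0) by case: b.
have s1p : 0 <= \sum_(i < M) (if (K <= i)%N && (i%:R * 2 <= x) then C * Itail (x - i.+1%:R) else 0) * (i%:R < s)%R%:R.
  by apply: sumr_ge0 => i _; apply: pos; apply: ifp.
have s2p : 0 <= \sum_(i < M) (if (K <= i)%N && (i%:R * 2 <= x) then C * Itail i%:R else 0) * (x - i.+1%:R < s)%R%:R.
  by apply: sumr_ge0 => i _; apply: pos; apply: ifp.
have bp : 0 <= (x - K%:R < s)%R%:R :> R by rewrite ler0n.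
have [sK|sK] := leP s K%:R.
  have : exprob N (x - s) <= C * Itail (x - K%:R).
    by apply: le_trans (UC _) _; rewrite ler_wpM2l// Itail_le// lerB.
  lra.
have [sx|sx] := ltP (x - K%:R) s.
  by have := exprob_le1 N (x - s); have := CI (x - K%:R); rewrite /=; lra.
have s0 : 0 <= s by apply: ltW; apply: le_lt_trans sK.
have [s2|s2] := leP (s * 2) x.
  (* The indicator k < s is strict, so an integer s belongs to the interval below it. *)
  have [k [ks sk]] : exists k : nat, k%:R < s /\ s <= k.+1%:R.
    have /andP[h1 h2] := truncn_itv s0.
    have [h|h] := ltP (Num.truncn s)%:R s; first by exists (Num.truncn s); split => //; exact: ltW.
    have e : s = (Num.truncn s)%:R by apply/eqP; rewrite eq_le h h1.
    have t0 : (0 < Num.truncn s)%N by rewrite -(ltr_nat R) -e; apply: le_lt_trans sK.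
    by exists (Num.truncn s).-1; rewrite prednK// -e lexx {2}e ltr_nat ltn_predL.
  have Kk : (K <= k)%N by rewrite -ltnS -(ltr_nat R); exact: lt_le_trans sk.
  have kM : (k < M)%N by rewrite -(ltr_nat R); lra.
  have k2 : k%:R * 2 <= x by lra.
  suff : exprob N (x - s) <= \sum_(i < M) (if (K <= i)%N && (i%:R * 2 <= x) then C * Itail (x - i.+1%:R) else 0) * (i%:R < s)%R%:R.
    by have := CI (x - K%:R); rewrite (_ : false%:R = 0 :> R)//; lra.
  rewrite (bigD1 (Ordinal kM))//= Kk k2 ks mulr1.
  apply: (@le_trans _ _ (C * Itail (x - k.+1%:R))).
    by apply: le_trans (UC _) _; rewrite ler_wpM2l// Itail_le// lerB.
  by rewrite lerDl; apply: sumr_ge0 => i _; apply: pos; apply: ifp.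
have xs : 0 <= x - s by have : 0 <= K%:R :> R by []; lra.
have /andP[h1 h2] := truncn_itv xs; set k := Num.truncn (x - s) in h1 h2.
have kK : (K <= k)%N by rewrite /k truncn_ge_nat//; lra.
have kM : (k < M)%N by rewrite -(ltr_nat R); lra.
have k2 : k%:R * 2 <= x by lra.
have ks : x - k.+1%:R < s by lra.
suff : exprob N (x - s) <= \sum_(i < M) (if (K <= i)%N && (i%:R * 2 <= x) then C * Itail i%:R else 0) * (x - i.+1%:R < s)%R%:R.
  by have := CI (x - K%:R); rewrite (_ : false%:R = 0 :> R)//; lra.
rewrite (bigD1 (Ordinal kM))//= kK k2 ks mulr1.
apply: (@le_trans _ _ (C * Itail k%:R)).
  by apply: le_trans (UC _) _; rewrite ler_wpM2l// Itail_le.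
by rewrite lerDl; apply: sumr_ge0 => i _; apply: pos; apply: ifp.
Qed.

Lemma Ex_comb M (u : nat -> R) (A : nat -> set T) : (forall i, measurable (A i)) ->
  \int[P]_w (\sum_(i < M) u i * \1_(A i) w) = \sum_(i < M) u i * fine (P (A i)).
Proof.
move=> mA; rewrite (Ex_sum P (f := fun i w => u i * \1_(A i) w)); last first.
  by move=> i _; apply: bmfM; [exact: bmf_cst|exact: bmf_indic].
by apply: eq_bigr => i _; rewrite ExZ ?Ex_indic//; exact: bmf_indic.
Qed.

Lemma bmf_comb M (u : nat -> R) (A : nat -> set T) : (forall i, measurable (A i)) ->
  bmf (fun w => \sum_(i < M) u i * \1_(A i) w).
Proof.
move=> mA; apply: (bmf_sum (f := fun i w => u i * \1_(A i) w)) => i _.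
by apply: bmfM; [exact: bmf_cst|exact: bmf_indic].
Qed.

Lemma exprob_first_above (K M N : nat) (R0 c C x : R) n : 0 <= C ->
  (forall y, exprob N y <= C * Itail y) -> 0 <= x -> x < M%:R ->
  \int[P]_w (\1_(first_above R0 c n) w * exprob N (x - cwalk X 0 0 n w)) <=
  C * Itail (x - K%:R) * fine (P (first_above R0 c n)) + overshoot R0 c n (x - K%:R) +
    (\sum_(i < M) (if (K <= i)%N && (i%:R * 2 <= x) then C * Itail (x - i.+1%:R) else 0) * overshoot R0 c n i%:R +
     \sum_(i < M) (if (K <= i)%N && (i%:R * 2 <= x) then C * Itail i%:R else 0) * overshoot R0 c n (x - i.+1%:R)).
Proof.
move=> C0 UC x0 xM.
pose A y := first_above R0 c n `&` [set w | y < cwalk X 0 0 n w].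
have mA y : measurable (A y) by exact: measurable_overshoot.
have mF := first_above_measurable R0 c n.
pose u i : R := if (K <= i)%N && (i%:R * 2 <= x) then C * Itail (x - i.+1%:R) else 0.
pose v i : R := if (K <= i)%N && (i%:R * 2 <= x) then C * Itail i%:R else 0.
have bu : bmf (fun w => \sum_(i < M) u i * \1_(A i%:R) w).
  exact: (@bmf_comb M u (fun i => A i%:R)).
have bv : bmf (fun w => \sum_(i < M) v i * \1_(A (x - i.+1%:R)) w).
  exact: (@bmf_comb M v (fun i => A (x - i.+1%:R))).
have b1 : bmf (fun w => C * Itail (x - K%:R) * \1_(first_above R0 c n) w).
  by apply: bmfM; [exact: bmf_cst|exact: bmf_indic].
have b2 : bmf (\1_(A (x - K%:R)) : T -> R) by exact: bmf_indic.
have b0 : bmf (fun w => \1_(first_above R0 c n) w * exprob N (x - cwalk X 0 0 n w)).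
  apply: bmfM; first exact: bmf_indic.
  split; last by exists 1 => w; rewrite ger0_norm ?exprob_ge0// exprob_le1.
  have mV : measurable_fun setT (exprob N).
    by apply: nonincreasing_measurable => // y z yz; exact: exprob_le.
  by apply: (measurableT_comp mV); apply: measurable_funB => //; exact: cwalkm.
have E : C * Itail (x - K%:R) * fine (P (first_above R0 c n)) + overshoot R0 c n (x - K%:R) +
    (\sum_(i < M) u i * overshoot R0 c n i%:R + \sum_(i < M) v i * overshoot R0 c n (x - i.+1%:R)) =
  \int[P]_w (C * Itail (x - K%:R) * \1_(first_above R0 c n) w + \1_(A (x - K%:R)) w +
    (\sum_(i < M) u i * \1_(A i%:R) w + \sum_(i < M) v i * \1_(A (x - i.+1%:R)) w)).
  rewrite (ExD P (bmfD b1 b2) (bmfD bu bv)) (ExD P b1 b2) (ExD P bu bv) ExZ ?Ex_indic//; last exact: bmf_indic.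
  by rewrite (@Ex_comb M u (fun i => A i%:R))// (@Ex_comb M v (fun i => A (x - i.+1%:R))).
rewrite E; apply: Ex_le => //; first by apply: bmfD; apply: bmfD.
move=> w; have cov := @exprob_cover K M N C x (cwalk X 0 0 n w) C0 UC x0 xM.
have iA y : \1_(A y) w = \1_(first_above R0 c n) w * (y < cwalk X 0 0 n w)%R%:R :> R.
  rewrite !indicE in_setI -mulnb natrM; congr (_ * (nat_of_bool _)%:R).
  by apply/idP/idP => [/set_mem|h]; last exact/mem_set.
under [X in _ <= _ + (X + _)]eq_bigr do rewrite iA mulrCA.
under [X in _ <= _ + (_ + X)]eq_bigr do rewrite iA mulrCA.
rewrite iA -!mulr_sumr -!mulrDr [C * _ * _]mulrC -!mulrDr ler_wpM2l//.
Qed.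

(** The term with 1 / (- mu) is the single jump to within K of x, summed along the line. All other
    contributions are linear in C with a small factor: crossing below K is rare, and the middle
    range is controlled by the kernel. *)
Lemma one_step (eta : R) : 0 < eta -> eta <= 1 -> exists x0, forall (C : R) N, 0 <= C ->
  (forall y, exprob N y <= C * Itail y) -> forall x, x0 <= x ->
  exprob N.+1 x <= (eta * C + (1 + eta) / (- mu)) * Itail x.
Proof.
move=> eta0 eta1; pose a := - mu; have a0 : 0 < a by rewrite oppr_gt0.
(* q is lost twice, in the slope and in the shift of I, with eta / 4 * q for the first term of the
   Riemann sum; eta <= 1 makes eta / 4 * q + q^2 at most 1 + eta. *)
pose q := 1 + eta / 4; have q1 : 1 < q by rewrite /q; lra.
have q0 : 0 < q by lra.
pose c := a / q; have c0 : 0 < c by rewrite divr_gt0.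
have ca : 0 < a - c.
  by rewrite subr_gt0 /c ltr_pdivrMr// ltr_pMr.
pose e := Num.sqrt (a - c); have e0 : 0 < e by rewrite sqrtr_gt0.
have e2 : - mu - e ^+ 2 = c by rewrite sqr_sqrtr ?(ltW ca)// -/a; ring.
(* Makes the crossing probability g at most eta / 8; the summand 1 keeps r positive when sigma =
   0. *)
pose r := 256 * sigma ^+ 2 / (eta * e ^+ 3) + 1.
have den : 0 < eta * e ^+ 3 by rewrite mulr_gt0// exprn_gt0.
have r0 : 0 < r.
  apply: ltr_wpDl; last exact: ltr01.
  apply: divr_ge0; last exact: ltW.
  by apply: mulr_ge0; [rewrite ler0n|exact: sqr_ge0].
pose g := 32 * sigma ^+ 2 / (r * e ^+ 3).
have g8 : g <= eta / 8.
  rewrite /g ler_pdivrMr ?mulr_gt0 ?exprn_gt0//.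
  have -> : eta / 8 * (r * e ^+ 3) = 32 * sigma ^+ 2 + eta * e ^+ 3 / 8.
    by rewrite /r; field; rewrite !gt_eqF// exprn_gt0.
  by rewrite lerDl divr_ge0 ?(ltW den).
pose R0 := r ^+ 2; have R00 : 0 <= R0 by rewrite sqr_ge0.
(* The height of the line, plus the unit shift with which [tl_le_Itail] bounds a tail by I. *)
pose D := R0 + 1; have D0 : 0 <= D by rewrite /D; lra.
have [h [h0 hK]] := KB D0.
pose C2 := 1 + 1 / c; have C20 : 0 < C2 by rewrite /C2 addr_gt0// divr_gt0.
have [|K [KI KS]] := hK (eta / (16 * C2)).
  by rewrite divr_gt0// mulr_gt0.
have q2 : (1 : R) < 2 by lra.
have K0 : 0 <= K%:R :> R by [].
have KR0 : 0 <= K%:R + R0 by lra.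
have ea : 0 < eta / (4 * a) by rewrite divr_gt0// mulr_gt0.
have n1 := Itail_shift K0 q2.
have n2 := Itail_shift KR0 q1.
have n3 := Itail_shift D0 q2.
have n4 := near_shift (K%:R + R0) (tl_shift ea).
have n5 : \forall x \near +oo, R0 <= x by apply: nbhs_pinfty_ge; exact: num_real.
have : \forall x \near +oo, [/\ Itail (x - K%:R) <= 2 * Itail x, Itail (x - (K%:R + R0)) <= q * Itail x,
   Itail (x - D) <= 2 * Itail x, tl (x - (K%:R + R0)) <= eta / (4 * a) * Itail (x - (K%:R + R0)) & R0 <= x].
  by near=> x; split; near: x.
move=> [x1 [_ hx]]; exists (x1 + 1) => C N C0 UC x xx1.
have [i1 i2 i3 i4 i5] : [/\ Itail (x - K%:R) <= 2 * Itail x, Itail (x - (K%:R + R0)) <= q * Itail x,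
   Itail (x - D) <= 2 * Itail x, tl (x - (K%:R + R0)) <= eta / (4 * a) * Itail (x - (K%:R + R0)) & R0 <= x].
  by apply: hx; lra.
have x0 : 0 <= x by exact: le_trans R00 i5.
pose M := (Num.truncn x).+1; have xM : x < M%:R by exact: truncnS_gt.
pose rho y := \sum_(n < N.+1) overshoot R0 c n.+1 y.
have rho0 y : 0 <= rho y by apply: sumr_ge0 => i _; exact: fine_P_ge0.
have rhoE y : rho y <= tl (y - R0) + Itail (y - R0) / c by exact: sum_overshoot.
have rhoI y : rho y <= C2 * Itail (y - D).
  apply: le_trans (rhoE y) _; have := tl_le_Itail (y - R0).
  have : Itail (y - R0) <= Itail (y - D) by apply: Itail_le; rewrite /D; lra.
  rewrite (_ : y - R0 - 1 = y - D); last by rewrite /D; ring.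
  move=> k1 k2; rewrite /C2 mulrDl !mul1r [c^-1 * _]mulrC; apply: lerD => //.
  by rewrite ler_wpM2r// invr_ge0 ltW.
pose u i : R := if (K <= i)%N && (i%:R * 2 <= x) then C * Itail (x - i.+1%:R) else 0.
pose v i : R := if (K <= i)%N && (i%:R * 2 <= x) then C * Itail i%:R else 0.
have main : exprob N.+1 x <= C * Itail (x - K%:R) * (\sum_(n < N.+1) fine (P (first_above R0 c n.+1))) +
    rho (x - K%:R) + (\sum_(i < M) u i * rho i%:R + \sum_(i < M) v i * rho (x - i.+1%:R)).
  apply: le_trans (zachary N R00 (ltW c0) i5) _.
  apply: (@le_trans _ _ (\sum_(n < N.+1) (C * Itail (x - K%:R) * fine (P (first_above R0 c n.+1)) +
      overshoot R0 c n.+1 (x - K%:R) + (\sum_(i < M) u i * overshoot R0 c n.+1 i%:R +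
      \sum_(i < M) v i * overshoot R0 c n.+1 (x - i.+1%:R))))).
    by apply: ler_sum => n _; exact: exprob_first_above.
  rewrite !big_split/= -mulr_sumr [X in _ <= _ + (X + _)](eq_bigr (fun i : 'I_M =>
     \sum_(n < N.+1) u i * overshoot R0 c n.+1 i%:R)); last by move=> i _; rewrite mulr_sumr.
  rewrite [X in _ <= _ + (_ + X)](eq_bigr (fun i : 'I_M =>
     \sum_(n < N.+1) v i * overshoot R0 c n.+1 (x - i.+1%:R))); last by move=> i _; rewrite mulr_sumr.
  by rewrite (exchange_big _ _ (index_enum 'I_M))/= [X in _ <= _ + (_ + X)]exchange_big/=.
have IT0 := Itail_ge0 x.
have g1 : \sum_(n < N.+1) fine (P (first_above R0 c n.+1)) <= eta / 8.
  by apply: le_trans g8; rewrite -e2; exact: sum_first_above.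
have t1 : C * Itail (x - K%:R) * (\sum_(n < N.+1) fine (P (first_above R0 c n.+1))) <= C * (2 * Itail x) * (eta / 8).
  by apply: ler_pM; rewrite ?mulr_ge0 ?Itail_ge0 ?sumr_ge0// ?ler_wpM2l// => *; exact: fine_P_ge0.
have t2 : rho (x - K%:R) <= (1 + eta) / a * Itail x.
  apply: le_trans (rhoE _) _; rewrite -!addrA -opprD.
  apply: (@le_trans _ _ (eta / (4 * a) * (q * Itail x) + q * Itail x / c)).
    apply: lerD; first by apply: le_trans i4 _; rewrite ler_wpM2l// ltW.
    by rewrite ler_wpM2r// invr_ge0 ltW.
  rewrite (_ : _ + _ = (eta / 4 * q + q ^+ 2) / a * Itail x); last first.
    by rewrite /c; field; rewrite !gt_eqF.
  rewrite ler_wpM2r// ler_wpM2r ?invr_ge0 ?(ltW a0)// /q; nra.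
have t3 : \sum_(i < M) u i * rho i%:R <= C * C2 * Itail x * (eta / (16 * C2)).
  apply: le_trans (ler_wpM2l _ (KS M)); last by rewrite !mulr_ge0// ltW.
  rewrite mulr_sumr big_mkcond/= [leRHS]big_mkcond/=; apply: ler_sum => i _.
  rewrite /u; case: (leqP K i) => Ki /=; last by rewrite mul0r.
  case: ifP => ix; last first.
    by rewrite mul0r mulr_ge0 ?mulr_ge0 ?Itail_ge0// ltW.
  have h1 := KI i x Ki (_ : _); have {}h1 : Itail (x - i.+1%:R) <= h i * Itail x.
    by apply: h1; apply: le_trans ix; rewrite gerBl.
  apply: (@le_trans _ _ (C * (h i * Itail x) * (C2 * Itail (i%:R - D)))).
    by apply: ler_pM => //; rewrite ?mulr_ge0 ?Itail_ge0// ler_wpM2l.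
  by rewrite le_eqVlt; apply/orP; left; apply/eqP; ring.
have t4 : \sum_(i < M) v i * rho (x - i.+1%:R) <= C * C2 * (2 * Itail x) * (eta / (16 * C2)).
  apply: le_trans (ler_wpM2l _ (KS M)); last by rewrite !mulr_ge0// ltW.
  rewrite mulr_sumr big_mkcond/= [leRHS]big_mkcond/=; apply: ler_sum => i _.
  rewrite /v; case: (leqP K i) => Ki /=; last by rewrite mul0r.
  case: ifP => ix; last first.
    by rewrite mul0r mulr_ge0 ?mulr_ge0 ?Itail_ge0// ltW.
  have h1 := KI i (x - D) Ki (_ : _); have {}h1 : Itail (x - D - i.+1%:R) <= h i * Itail (x - D) by apply: h1; rewrite lerD2r.
  have h2 : Itail i%:R <= Itail (i%:R - D) by apply: Itail_le; rewrite gerBl.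
  apply: (@le_trans _ _ (C * Itail (i%:R - D) * (C2 * (h i * (2 * Itail x))))).
    apply: ler_pM => //; rewrite ?mulr_ge0 ?Itail_ge0// ?ler_wpM2l//.
    apply: le_trans (rhoI _) _; rewrite ler_wpM2l ?(ltW C20)// addrAC.
    by apply: le_trans h1 _; rewrite ler_wpM2l.
  by rewrite le_eqVlt; apply/orP; left; apply/eqP; ring.
have e3 : C * C2 * Itail x * (eta / (16 * C2)) = eta / 16 * (C * Itail x).
  by field; rewrite gt_eqF.
have e4 : C * C2 * (2 * Itail x) * (eta / (16 * C2)) = eta / 8 * (C * Itail x).
  by field; rewrite gt_eqF.
apply: le_trans main _; rewrite -/a mulrDl -[eta * C * _]mulrA.
rewrite e3 in t3; rewrite e4 in t4.
have e5 : C * (2 * Itail x) * (eta / 8) = eta / 4 * (C * Itail x) by field.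
rewrite e5 in t1.
have CI : 0 <= eta * (C * Itail x) by rewrite !mulr_ge0// ltW.
exact: (ladder_arith t1 t2 t3 t4 CI).
Unshelve. all: by end_near. Qed.

Lemma exprob0 y : 0 <= y -> exprob 0 y = 0.
Proof.
move=> y0; rewrite /exprob (_ : exceed 0 0 y = set0) ?measure0//.
apply/seteqP; split => w // -[j]; rewrite leqn0 => /eqP ->; rewrite cwalk0; lra.
Qed.

Lemma exprob_leS N y : exprob N y <= exprob N.+1 y.
Proof.
apply: fine_P_le; [exact: measurable_exceed..|move=> w [j jN h]].
by exists j => //; exact: leqW.
Qed.

(** For eta = 1/2 the step maps C to C / 2 + 3 / (2 (- mu)), which is at most C once C >= 3 / (-
    mu). Levels up to x0 are covered by the trivial bound 1 <= I y / I x0. The induction on N keeps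
    C finite and independent of N. *)
Lemma exprob_bounded : exists2 C, 0 <= C & forall N y, exprob N y <= C * Itail y.
Proof.
have a0 : 0 < - mu by rewrite oppr_gt0.
have half0 : 0 < 2^-1 :> R by lra.
have half1 : 2^-1 <= 1 :> R by lra.
have [x1 hx] := one_step half0 half1; pose x0 := Num.max x1 0.
pose C := Num.max (Itail x0)^-1 (3 / (- mu)).
have C0 : 0 <= C by rewrite /C le_max invr_ge0 Itail_ge0.
have small N y : y <= x0 -> exprob N y <= C * Itail y.
  move=> yx; apply: le_trans (exprob_le1 N y) _.
  apply: (@le_trans _ _ ((Itail x0)^-1 * Itail x0)); first by rewrite mulVf// gt_eqF.
  by apply: ler_pM; rewrite ?invr_ge0 ?Itail_ge0 ?Itail_le// /C le_max lexx.
exists C => //; elim=> [|N IH] y.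
  have [/small//|h] := leP y x0.
  rewrite exprob0 ?mulr_ge0 ?Itail_ge0//; apply: le_trans (ltW h).
  by rewrite /x0 le_max lexx orbT.
have [/small//|h] := leP y x0.
have x1y : x1 <= y by apply: le_trans (ltW h); rewrite /x0 le_max lexx.
apply: le_trans (hx C N C0 IH y x1y) _; rewrite ler_wpM2r ?Itail_ge0//.
have : 3 / (- mu) <= C by rewrite /C le_max lexx orbT.
rewrite (_ : (1 + 2^-1) / - mu = (3 / (- mu)) / 2); last by field; rewrite lt_eqF.
lra.
Qed.

Lemma exprob_upper (eta : R) : 0 < eta ->
  \forall x \near +oo, forall N, exprob N x <= (1 + eta) / (- mu) * Itail x.
Proof.
move=> eta0; have a0 : 0 < - mu by rewrite oppr_gt0.
have [C C0 hC] := exprob_bounded.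
have q0 : 0 < C * (- mu) + 1 by rewrite ltr_wpDl// mulr_ge0// ltW.
(* With this choice e' C + (1 + e') / (- mu) <= (1 + eta) / (- mu): a second application of the step
   removes C. *)
pose e' := Num.min 1 (eta / (C * (- mu) + 1)).
have e'0 : 0 < e' by rewrite lt_min ltr01 divr_gt0.
have e'1 : e' <= 1 by rewrite ge_min lexx.
have e'2 : e' * (C * (- mu) + 1) <= eta by rewrite -ler_pdivlMr// ge_min lexx orbT.
have [x0 hx] := one_step e'0 e'1.
near=> x => N; apply: le_trans (exprob_leS N x) _.
have x0x : x0 <= x by near: x; apply: nbhs_pinfty_ge; exact: num_real.
apply: le_trans (hx C N C0 (hC N) x x0x) _; rewrite ler_wpM2r ?Itail_ge0//.
rewrite ler_pdivlMr// mulrDl divfK ?gt_eqF//; move: e'2; lra.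
Unshelve. all: by end_near. Qed.

End one_step.
End ladder.

(** * Regularity of the integrated tail *)

Section power_tails.
Context (R : realType).
Local Notation leb := (@lebesgue_measure R).

Lemma powR_cvgy0 (p : R) : 0 < p -> x `^ (- p) @[x --> +oo] --> (0 : R).
Proof.
move=> p0; apply/cvgrPdist_le => e e0; near=> x.
have x1 : e `^ (- p^-1) <= x by near: x; apply: nbhs_pinfty_ge; exact: num_real.
have x0 : 0 < e `^ (- p^-1) by exact: powR_gt0.
rewrite sub0r normrN ger0_norm ?powR_ge0//.
have -> : e = (e `^ (- p^-1)) `^ (- p) by rewrite -powRrM mulrNN mulVf ?gt_eqF// powRr1// ltW.
rewrite !(powRN _ p) lef_pV2 ?posrE ?powR_gt0 ?(lt_le_trans x0 x1)//.
by rewrite ge0_ler_powR ?nnegrE ?(ltW p0) ?(ltW x0)// (le_trans (ltW x0)).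
Unshelve. all: by end_near. Qed.

Lemma cvg_shift_pinfty (t : R) (f : R -> R) (l : R) :
  f x @[x --> +oo] --> l -> f (t + x) @[x --> +oo] --> l.
Proof.
move=> fl; apply/cvgrPdist_le => e e0; have /cvgrPdist_le /(_ e e0) [M [_ h]] := fl.
by exists (M - t); split; [exact: num_real|move=> x xM; apply: h; rewrite -ltrBlDl].
Qed.

Lemma powR_tail (t p : R) : 0 <= t -> 1 < p ->
  (\int[leb]_(s in `[0%R, +oo[) ((1 + (t + s)) `^ (- p))%:E =
   ((1 + t) `^ (1 - p) / (p - 1))%:E)%E.
Proof.
move=> t0 p1; have p10 : 0 < p - 1 by rewrite subr_gt0.
pose F (s : R) := - ((1 + (t + s)) `^ (1 - p) / (p - 1)).
have aff (x : R) : is_derive x (1 : R) (fun s : R => 1 + (t + s)) 1.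
  by apply: is_derive_eq; rewrite ?add0r; ring.
have dF (x : R) : 0 < 1 + (t + x) -> is_derive x (1 : R) F ((1 + (t + x)) `^ (- p)).
  move=> x0; have xin : 1 + (t + x) \in `]0, +oo[ by rewrite in_itv/= x0.
  have d1 := derivable_powR (v := 1) (x := 1 - p) xin.
  have d2 := powR_derive1 (1 - p) xin.
  have h : is_derive (1 + (t + x)) (1 : R) (@powR R ^~ (1 - p)) ((1 - p) * (1 + (t + x)) `^ (- p)).
    split=> //; rewrite -derive1E d2; congr (_ * _ `^ _); ring.
  have hc : is_derive x (1 : R) (@powR R ^~ (1 - p) \o (fun s : R => 1 + (t + s)))
     ((1 - p) * (1 + (t + x)) `^ (- p) * 1).
    by apply: is_derive1_comp.
  rewrite /F; apply: is_derive_eq; rewrite /GRing.scale /= ?scaler0.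
  by field; rewrite gt_eqF.
have pos (x : R) : 0 <= x -> 0 < 1 + (t + x) by move=> x0; lra.
rewrite (@ge0_continuous_FTC2y _ _ F 0 0).
- by rewrite /F addr0 sub0e -EFinN opprK.
- by move=> x _; exact: powR_ge0.
- apply: continuous_in_subspaceT => x; rewrite inE/= in_itv/= andbT => x0.
  have xin : 1 + (t + x) \in `]0, +oo[ by rewrite in_itv/= pos.
  apply: (@continuous_comp _ _ _ (fun s : R => 1 + (t + s)) (@powR R ^~ (- p))).
    by apply: differentiable_continuous; apply/derivable1_diffP; case: (aff x).
  apply: differentiable_continuous; apply/derivable1_diffP; exact: derivable_powR.
- rewrite /F -[X in _ --> X]oppr0 -(mul0r (p - 1)^-1); apply: cvgN; apply: cvgMl.
  have -> : 1 - p = - (p - 1) by ring.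
  have := @cvg_shift_pinfty (1 + t) (@powR R ^~ (- (p - 1))) 0 (powR_cvgy0 p10).
  by under eq_fun do rewrite -addrA.
- by move=> x x0; case: (dF x (pos x (ltW x0))).
- apply: cvg_at_right_filter; apply: differentiable_continuous; apply/derivable1_diffP.
  by case: (dF 0 (pos 0 (lexx 0))).
- move=> x; rewrite in_itv/= andbT => x0; rewrite derive1E.
  by case: (dF x (pos x (ltW x0))).
Qed.

Lemma expR_tail (t : R) :
  (\int[leb]_(s in `[0%R, +oo[) (expR (- (t + s)))%:E = (expR (- t))%:E)%E.
Proof.
pose F (s : R) := - expR (- (t + s)).
have dF (x : R) : is_derive x (1 : R) F (expR (- (t + x))).
  by rewrite /F; apply: is_derive_eq; rewrite /GRing.scale /=; ring.
rewrite (@ge0_continuous_FTC2y _ _ F 0 0).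
- by rewrite /F addr0 sub0e -EFinN opprK.
- by move=> x _; exact: expR_ge0.
- apply: continuous_subspaceT => x; apply: differentiable_continuous; apply/derivable1_diffP.
  have d : is_derive x (1 : R) (fun s : R => expR (- (t + s))) (- expR (- (t + x))).
    by apply: is_derive_eq; rewrite /GRing.scale /=; ring.
  by case: d.
- rewrite -[X in _ --> X]oppr0 /F; apply: cvgN.
  exact: (@cvg_shift_pinfty t (fun x => expR (- x)) 0 (@cvgr_expR R)).
- by move=> x x0; case: (dF x).
- apply: cvg_at_right_filter; apply: differentiable_continuous; apply/derivable1_diffP.
  by case: (dF 0).
- by move=> x _; rewrite derive1E; case: (dF x).
Qed.

End power_tails.

(** * Limits of the integrated tail under rescaling *)

Section scaling.
Context (R : realType) d (T : measurableType d) (P : probability T R).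
Variables (X : nat -> T -> R) (mu sigma : R).
Hypothesis XP : iid_sequence P X mu sigma.
Local Notation leb := (@lebesgue_measure R).
Local Notation tl := (tl P X).
Local Notation I := (Itail P X).

Let mX := iid_measurable XP.

(** The layer-cake formula for the non-negative variable max (0, X - b) / c. *)
Lemma Itail_scaled (c b : R) : 0 < c ->
  (\int[leb]_(s in `[0%R, +oo[) (tl (b + c * s))%:E = (I b / c)%:E)%E.
Proof.
move=> c0; pose Y w := Num.max 0 (X 0%N w - b) / c.
have mY : measurable_fun setT Y.
  by apply: measurable_funM => //; apply: measurable_maxr => //; exact: measurable_funB.
pose Z : {RV P >-> R} := mfun_Sub (mem_set mY : Y \in mfun).
have Z0 w : 0 <= Z w by rewrite /Z/= /Y divr_ge0 ?(ltW c0)// le_max lexx.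
have := ge0_expectation_ccdf Z0.
have -> : ('E_P[Z] = (I b / c)%:E)%E.
  rewrite expectation_def; have ie := intg_excess XP b.
  rewrite /Itail -RintegralZr//; last first.
  rewrite -[LHS]fineK//; apply: integrable_fin_num => //.
  have := intgZ c^-1 ie; rewrite /intg; congr (integrable _ _ _).
  by apply/funext => w; rewrite /= /Y mulrC.
move=> ->; apply: eq_integral => s; rewrite inE/= in_itv/= andbT => s0.
rewrite /ccdf /distribution /pushforward /tl fineK ?fin_num_measure//; last exact: (measurable_X_gt XP).
congr (P _); apply/seteqP; split => w /=; rewrite in_itv/= andbT /Y ltr_pdivlMr// lt_max.
  by move=> h; apply/orP; right; lra.
have sc : 0 <= s * c by rewrite mulr_ge0// ltW.
by move=> /orP[|] h; lra.
Qed.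

Lemma tl_measurable : measurable_fun setT tl.
Proof. by apply: nonincreasing_measurable => // x y xy; exact: (tl_le XP). Qed.

(** Common frame of both assumptions. The scale c b is b under Assumption A and 1 / lambda b under
    B; g0 is the limit of the rescaled tail, G0 t its integral over [t, oo[, and the power bound
    with p > 1 is the dominating function. *)
Variables (c g0 G0 : R -> R) (C p : R).
Hypotheses (tl_gt0 : forall x, 0 < tl x) (c_gt0 : \forall b \near +oo, 0 < c b).
Hypotheses (p_gt1 : 1 < p) (C_ge0 : 0 <= C) (mg0 : measurable_fun setT g0).
Hypothesis tl_scale : forall s, 0 <= s -> tl (b + c b * s) / tl b @[b --> +oo] --> g0 s.
Hypothesis tl_dom : \forall b \near +oo, forall s, 0 <= s ->
  tl (b + c b * s) <= C * (1 + s) `^ (- p) * tl b.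
Hypothesis g0_int : forall t, 0 <= t ->
  (\int[leb]_(s in `[0%R, +oo[) (g0 (t + s))%:E = (G0 t)%:E)%E.

Lemma Itail_scale t : 0 <= t -> I (b + c b * t) / (c b * tl b) @[b --> +oo] --> G0 t.
Proof.
move=> t0; apply/cvg_pinftyP => u uoo.
have [N _ hN] : \forall n \near \oo, 0 < c (u n) /\ forall s, 0 <= s ->
    tl (u n + c (u n) * s) <= C * (1 + s) `^ (- p) * tl (u n).
  by apply: (uoo (fun b => 0 < c b /\ forall s, 0 <= s -> tl (b + c b * s) <= C * (1 + s) `^ (- p) * tl b));
     apply: filterS2 c_gt0 tl_dom.
(* Positivity of c and the domination hold from index N on only. *)
rewrite -(cvg_shiftn N).
pose v n := u (n + N)%N.
have hv n : 0 < c (v n) /\ forall s, 0 <= s -> tl (v n + c (v n) * s) <= C * (1 + s) `^ (- p) * tl (v n).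
  by apply: hN => /=; exact: leq_addl.
have voo : v n @[n --> \oo] --> +oo by rewrite /v (cvg_shiftn N).
pose f n s := tl (v n + c (v n) * (t + s)) / tl (v n).
have mf n : measurable_fun setT (f n).
  apply: measurable_funM => //; apply: (measurableT_comp tl_measurable).
  by apply: measurable_funD => //; apply: measurable_funM => //; exact: measurable_funD.
have fE n : (\int[leb]_(s in `[0%R, +oo[) (f n s)%:E)%E = (I (v n + c (v n) * t) / (c (v n) * tl (v n)))%:E.
  have [cv _] := hv n; have := Itail_scaled (v n + c (v n) * t) cv => h.
  rewrite /f; under eq_integral do rewrite EFinM mulrDr addrA.
  rewrite ge0_integralZr//; first last.
  - by rewrite lee_fin invr_ge0 ltW.
  - by move=> s _; rewrite lee_fin tl_ge0.
  - apply/measurable_EFinP; apply: measurable_funTS; apply: (measurableT_comp tl_measurable).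
    by apply: measurable_funD => //; exact: measurable_funM.
  by rewrite h -EFinM invfM mulrA.
have dom : leb.-integrable `[0%R, +oo[ (fun s => (C * (1 + s) `^ (- p))%:E).
  have mp : measurable_fun (`[0, +oo[ : set R) (fun s : R => (1 + s) `^ (- p)).
    by apply: measurable_funTS; apply: (measurableT_comp (measurable_powR _)); exact: measurable_funD.
  apply/integrableP; split; first by apply/measurable_EFinP; exact: measurable_funM.
  under eq_integral do rewrite gee0_abs ?lee_fin ?mulr_ge0 ?powR_ge0// EFinM.
  rewrite ge0_integralZl//.
  - have -> : (\int[leb]_(s in `[0%R, +oo[) ((1 + s) `^ (- p))%:E = ((1 + 0) `^ (1 - p) / (p - 1))%:E)%E.
      by rewrite -(powR_tail (lexx 0) p_gt1); apply: eq_integral => s _; rewrite add0r.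
    by rewrite -EFinM ltry.
  - exact/measurable_EFinP.
  - by move=> x _; rewrite lee_fin powR_ge0.
have [] := @dominated_convergence _ _ _ leb `[0%R, +oo[ _ (fun n s => (f n s)%:E)
   (fun s => (g0 (t + s))%:E) (fun s => (C * (1 + s) `^ (- p))%:E) => //.
- by move=> n; apply: measurable_funTS; apply/measurable_EFinP; exact: mf.
- apply: measurable_funTS; apply/measurable_EFinP; apply: (measurableT_comp mg0).
  exact: measurable_funD.
- apply: aeW => s; rewrite /= in_itv/= andbT => s0; apply: cvg_EFin; first exact: nearW.
  have ts : 0 <= t + s by rewrite addr_ge0.
  by have /cvg_pinftyP := tl_scale ts; apply.
- apply: aeW => s n; rewrite /= in_itv/= andbT => s0; rewrite lee_fin.
  have [cv hs] := hv n; rewrite /f ger0_norm ?divr_ge0 ?tl_ge0// ler_pdivrMr//.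
  apply: le_trans (hs s s0); apply: (tl_le XP).
  by rewrite lerD2l ler_pM2l// lerDr.
move=> _ _; rewrite (g0_int t0) => h.
apply: cvg_trans (fine_cvg h); apply: near_eq_cvg; apply: nearW => n.
by rewrite /= fE.
Qed.

Hypotheses (G0_gt0 : 0 < G0 0) (G0_cont : forall t, 0 <= t -> {for t, continuous G0}).
Hypothesis c_pinfty : c b @[b --> +oo] --> +oo.

Lemma Itail_gt0 x : 0 < I x.
Proof.
apply: lt_le_trans (tl_gt0 (x + 1)) _.
by have := tl_le_Itail XP (x + 1); rewrite addrK.
Qed.

(** The normalisation a b of the theorem, as [integrated_tail_ratioE] shows for b >= 0. *)
Definition ratio b := I b / tl b.

Lemma ratio_scale : ratio b / c b @[b --> +oo] --> G0 0.
Proof.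
have := Itail_scale (lexx 0); apply: cvg_trans; apply: near_eq_cvg; apply: nearW => b.
by rewrite mulr0 addr0 /ratio invfM mulrCA mulrC -mulrA [_ / c b]mulrC.
Qed.

Lemma ratio_pinfty : ratio b @[b --> +oo] --> +oo.
Proof.
apply/cvgryPge => A.
have /cvgrPdist_lt /(_ (G0 0 / 2)) := ratio_scale; rewrite divr_gt0// => /(_ isT) h.
near=> b.
have cb : 0 < c b by near: b; exact: c_gt0.
have h1 : G0 0 / 2 < ratio b / c b.
  have : `|G0 0 - ratio b / c b| < G0 0 / 2 by near: b; exact: h.
  by rewrite ltr_norml => /andP[_]; lra.
have : A / (G0 0 / 2) <= c b by near: b; move/cvgryPge : c_pinfty; apply.
rewrite ler_pdivrMr ?divr_gt0// => /le_trans; apply.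
by rewrite mulrC -ler_pdivlMr// ltW.
Unshelve. all: by end_near. Qed.

Lemma tl_small_ratio : tl b / I b @[b --> +oo] --> (0 : R).
Proof.
apply/cvgrPdist_le => e e0; have /cvgryPge := ratio_pinfty => /(_ e^-1).
apply: filterS => b h; rewrite sub0r normrN ger0_norm ?divr_ge0 ?tl_ge0 ?Itail_ge0//.
rewrite -[tl b / I b]invrK invf_div -[leRHS]invrK lef_pV2 ?posrE ?invr_gt0//.
by rewrite divr_gt0// Itail_gt0.
Qed.

Lemma Itail_ratio t : 0 <= t -> I (b + c b * t) / I b @[b --> +oo] --> G0 t / G0 0.
Proof.
move=> t0; have h0 := Itail_scale (lexx 0).
have h : (I (b + c b * t) / (c b * tl b)) / (I (b + c b * 0) / (c b * tl b)) @[b --> +oo] --> G0 t / G0 0.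
  by apply: cvgM; [exact: Itail_scale|apply: cvgV => //; exact: lt0r_neq0].
apply: cvg_trans h; apply: near_eq_cvg; near=> b.
have cb : 0 < c b by near: b; exact: c_gt0.
have Ib := Itail_gt0 b; have tb := tl_gt0 b.
rewrite /= mulr0 addr0; field; by rewrite !gt_eqF.
Unshelve. all: by end_near. Qed.

(** [ratio b] is only equivalent to G0 0 * c b. Since I is monotone, its value is caught between
    those at t G0 0 - e1 and t G0 0 + e1 in the scale c, and continuity of G0 closes the gap. *)
Lemma Itail_ratio_self t : 0 <= t ->
  I (b + ratio b * t) / I b @[b --> +oo] --> G0 (t * G0 0) / G0 0.
Proof.
rewrite le_eqVlt => /predU1P[<-|t0].
  rewrite mul0r divff ?gt_eqF// (_ : (fun b => _) = fun=> 1); first exact: cvg_cst.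
  by apply/funext => b; rewrite mulr0 addr0 divff// gt_eqF// Itail_gt0.
apply/cvgrPdist_lt => e e0.
have tG : 0 < t * G0 0 by rewrite mulr_gt0.
have /cvgrPdist_lt /(_ (e * G0 0 / 2)) := G0_cont (ltW tG).
rewrite divr_gt0 ?mulr_gt0// => /(_ isT) [dl /= dl0 hdl].
(* The second argument keeps the lower comparison point non-negative. *)
pose e1 := Num.min (dl / 2) (t * G0 0).
have e10 : 0 < e1 by rewrite lt_min tG divr_gt0.
have e1d : e1 < dl by rewrite gt_min; apply/orP; left; lra.
have e1t : e1 <= t * G0 0 by rewrite ge_min lexx orbT.
have lo0 : 0 <= t * G0 0 - e1 by lra.
have hi0 : 0 <= t * G0 0 + e1 by lra.
have e2 : 0 < e / 2 by rewrite divr_gt0.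
have /cvgrPdist_lt /(_ _ e2) hlo := Itail_ratio lo0.
have /cvgrPdist_lt /(_ _ e2) hhi := Itail_ratio hi0.
have et : 0 < e1 / t by rewrite divr_gt0.
have /cvgrPdist_lt /(_ _ et) hr := ratio_scale.
have near_G y : `|t * G0 0 - y| < dl -> `|G0 (t * G0 0) / G0 0 - G0 y / G0 0| < e / 2.
  move=> /hdl h; rewrite -mulrBl normrM [X in _ * X]gtr0_norm ?invr_gt0// ltr_pdivrMr//.
  by rewrite mulrAC.
have Glo : `|G0 (t * G0 0) / G0 0 - G0 (t * G0 0 - e1) / G0 0| < e / 2.
  by apply: near_G; rewrite opprB addrC subrK gtr0_norm.
have Ghi : `|G0 (t * G0 0) / G0 0 - G0 (t * G0 0 + e1) / G0 0| < e / 2.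
  by apply: near_G; rewrite opprD addrA subrr sub0r normrN gtr0_norm.
near=> b.
have cb : 0 < c b by near: b; exact: c_gt0.
have Ib := Itail_gt0 b.
have hb : `|G0 0 - ratio b / c b| < e1 / t by near: b; exact: hr.
have hl : `|G0 (t * G0 0 - e1) / G0 0 - I (b + c b * (t * G0 0 - e1)) / I b| < e / 2 by near: b; exact: hlo.
have hh : `|G0 (t * G0 0 + e1) / G0 0 - I (b + c b * (t * G0 0 + e1)) / I b| < e / 2 by near: b; exact: hhi.
have rE : ratio b * t = c b * (t * (ratio b / c b)) by field; rewrite gt_eqF.
have tb : `|t * G0 0 - t * (ratio b / c b)| < e1.
  by rewrite -mulrBr normrM gtr0_norm// mulrC -ltr_pdivlMr.
have l1 : I (b + ratio b * t) / I b <= I (b + c b * (t * G0 0 - e1)) / I b.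
  rewrite ler_pM2r ?invr_gt0//; apply: (Itail_le XP); rewrite lerD2l rE ler_pM2l//.
  by move: tb; rewrite ltr_norml => /andP[? ?]; lra.
have l2 : I (b + c b * (t * G0 0 + e1)) / I b <= I (b + ratio b * t) / I b.
  rewrite ler_pM2r ?invr_gt0//; apply: (Itail_le XP); rewrite lerD2l rE ler_pM2l//.
  by move: tb; rewrite ltr_norml => /andP[? ?]; lra.
move: hl hh Glo Ghi l1 l2; rewrite !ltr_norml.
move: (G0 _ / G0 0) (I _ / I b) (I (b + ratio b * t) / I b) (I (b + c b * (t * G0 0 + e1)) / I b)
  (G0 (t * G0 0 + e1) / G0 0) (G0 (t * G0 0 - e1) / G0 0) => x1 x2 x3 x4 x5 x6.
by move=> /andP[? ?] /andP[? ?] /andP[? ?] /andP[? ?] ? ?; apply/andP; split; lra.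
Unshelve. all: by end_near. Qed.

(** A fixed shift L is eventually below c b * t for every t > 0, and G0 t / G0 0 is close to 1 for
    small t. *)
Lemma Itail_long_tailed : long_tailed P X.
Proof.
move=> L L0; apply/cvgrPdist_le => e e0.
have q0 : 0 < 1 - (1 + e)^-1 by rewrite subr_gt0 invf_lt1; lra.
have /cvgrPdist_lt /(_ (G0 0 * (1 - (1 + e)^-1))) := G0_cont (lexx 0).
rewrite mulr_gt0// => /(_ isT) [dl /= dl0 hdl].
pose t := dl / 2; have t0 : 0 < t by rewrite divr_gt0.
have Gt : (1 + e)^-1 < G0 t / G0 0.
  have : `|G0 0 - G0 t| < G0 0 * (1 - (1 + e)^-1).
    by apply: hdl; rewrite /= sub0r normrN gtr0_norm// /t; lra.
  rewrite ltr_norml => /andP[_ h]; rewrite ltr_pdivlMr//; move: h.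
  by rewrite mulrBr mulr1; lra.
pose gap := G0 t / G0 0 - (1 + e)^-1; have gap0 : 0 < gap by rewrite subr_gt0.
have /cvgrPdist_lt /(_ _ gap0) hh := Itail_ratio (ltW t0).
have hc : \forall b \near +oo, L <= c b * t.
  by move/cvgryPge : c_pinfty => /(_ (L / t)); apply: filterS => b; rewrite ler_pdivrMr.
have key : \forall b \near +oo, I b <= (1 + e) * I (b + L).
  near=> b; have Ib := Itail_gt0 b.
  have h1 : `|G0 t / G0 0 - I (b + c b * t) / I b| < gap by near: b; exact: hh.
  have h2 : L <= c b * t by near: b; exact: hc.
  have h3 : I (b + c b * t) <= I (b + L) by apply: (Itail_le XP); rewrite lerD2l.
  have h4 : (1 + e)^-1 < I (b + c b * t) / I b.
    by move: h1; rewrite ltr_norml /gap => /andP[_]; lra.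
  have e1 : 0 < 1 + e by lra.
  move: h4; rewrite ltr_pdivlMr// ltr_pdivrMl// => /ltW/le_trans; apply.
  by rewrite ler_wpM2l// ltW.
have := near_shift L key; apply: filterS => x; rewrite subrK => h.
have Ix := Itail_gt0 x.
have h1 : 1 <= I (x - L) / I x by rewrite ler_pdivlMr// mul1r; apply: (Itail_le XP); lra.
have h2 : I (x - L) / I x <= 1 + e by rewrite ler_pdivrMr.
by rewrite distrC ger0_norm ?subr_ge0//; lra.
Unshelve. all: by end_near. Qed.

End scaling.

(** * Summability and doubling *)

Section kernels.
Context (R : realType).

Lemma summable_tail (f : nat -> R) (M eta : R) : (forall i, 0 <= f i) ->
  (forall n, \sum_(i < n) f i <= M) -> 0 < eta ->
  exists K, forall n, \sum_(i < n | (K <= i)%N) f i <= eta.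
Proof.
move=> f0 fM eta0; pose S n := \sum_(i < n) f i.
have Snd : nondecreasing_seq S.
  apply/nondecreasing_seqP => n; by rewrite /S big_ord_recr/= lerDl.
have Scvg : cvgn S by apply: nondecreasing_is_cvgn => //; exists M => _ [n _ <-]; exact: fM.
have /cvgrPdist_le /(_ _ eta0) [K _ hK] := Scvg.
exists K => n; have SK := hK K (leqnn K).
have Sn : S n <= limn S by exact: nondecreasing_cvgn_le.
have [nK|Kn] := leqP n K.
  by rewrite big_pred0 ?(ltW eta0)// => i; apply/negbTE; rewrite -ltnNge (leq_trans (ltn_ord i)).
have -> : \sum_(i < n | (K <= i)%N) f i = S n - S K.
  rewrite /S (big_ord_widen n f (ltnW Kn)) [\sum_(i < n) f i](bigID (fun i : 'I_n => (i < K)%N))/=.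
  by rewrite addrAC subrr add0r; apply: eq_bigl => i; rewrite -leqNgt.
move: SK; rewrite ler_norml => /andP[_]; lra.
Qed.

Lemma sum_excess_le (y : R) n : \sum_(i < n) Num.max 0 (y - i%:R) <= (Num.max 0 (y + 1)) ^+ 2.
Proof.
pose phi (z : R) := (Num.max 0 z) ^+ 2.
have phi0 z : 0 <= phi z by exact: sqr_ge0.
have step z : Num.max 0 z <= phi (z + 1) - phi z.
  rewrite /phi; case: (leP 0 z) => z0.
    rewrite max_r; last lra.
    by rewrite sqrrD mulr1 expr1n; nra.
  by rewrite expr0n/= subr0 sqr_ge0.
suff : \sum_(i < n) Num.max 0 (y - i%:R) <= phi (y + 1) - phi (y + 1 - n%:R).
  by have := phi0 (y + 1 - n%:R); rewrite /phi; lra.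
elim: n => [|n IH]; first by rewrite big_ord0 subr0 subrr.
rewrite big_ord_recr/=; have := step (y - n%:R).
have -> : y + 1 - n.+1%:R = y - n%:R by rewrite -natr1; ring.
have -> : y - n%:R + 1 = y + 1 - n%:R by ring.
by move: IH; lra.
Qed.

Lemma pow2_sandwich (x : R) : 1 <= x -> exists n, 2 ^+ n <= x < 2 ^+ n.+1.
Proof.
move=> x1; have x0 : 0 <= x by lra.
have m0 : (0 < Num.truncn x)%N by rewrite truncn_gt0.
have /andP[h1 h2] := trunc_log_bounds (isT : 1 < 2)%N m0.
exists (trunc_log 2 (Num.truncn x)); have /andP[t1 t2] := truncn_itv x0.
apply/andP; split.
  by apply: le_trans t1; rewrite -natrX ler_nat.
by apply: lt_le_trans t2 _; rewrite -natrX ler_nat.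
Qed.

End kernels.

Section doubling.
Context (R : realType) d (T : measurableType d) (P : probability T R).
Variables (X : nat -> T -> R) (mu sigma : R).
Hypothesis XP : iid_sequence P X mu sigma.
Local Notation tl := (tl P X).
Local Notation I := (Itail P X).

(** A Potter bound: the doubling inequality is iterated along b 2^n, and rounding 1 + s down to a
    power of 2 costs the factor 2^q. *)
Lemma doubling_bound (q x0 : R) : 0 <= q -> 0 < x0 ->
  (forall x, x0 <= x -> tl (x * 2) <= 2 `^ (- q) * tl x) ->
  forall b s, x0 <= b -> 0 <= s -> tl (b + b * s) <= 2 `^ q * (1 + s) `^ (- q) * tl b.
Proof.
move=> q0 x00 dbl b s xb s0.
have b0 : 0 < b by exact: lt_le_trans xb.
have iter n : tl (b * 2 ^+ n) <= (2 ^+ n) `^ (- q) * tl b.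
  elim: n => [|n IH]; first by rewrite expr0 mulr1 powR1 mul1r.
  rewrite exprSr mulrA; apply: le_trans (dbl _ _) _.
    by apply: (le_trans xb); rewrite ler_peMr ?(ltW b0)// exprn_ege1// ler1n.
  by rewrite powRM ?exprn_ge0// [_ * 2 `^ _]mulrC -mulrA ler_wpM2l ?powR_ge0.
have [|n /andP[n1 n2]] := @pow2_sandwich R (1 + s); first lra.
have p0 : (0 : R) < 2 ^+ n by rewrite exprn_gt0.
apply: le_trans (_ : tl (b * 2 ^+ n) <= _).
  by apply: (tl_le XP); rewrite -[X in X + _]mulr1 -mulrDr ler_pM2l.
apply: le_trans (iter n) _; rewrite ler_wpM2r ?(tl_ge0 P X)//.
have -> : 2 `^ q * (1 + s) `^ (- q) = ((1 + s) / 2) `^ (- q).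
  rewrite powRM ?invr_ge0//; last lra.
  by rewrite mulrC; congr (_ * _); rewrite -powR_inv1// -powRrM mulN1r opprK.
have h0 : 0 < (1 + s) / 2 by apply: divr_gt0 => //; lra.
have h1 : (1 + s) / 2 <= 2 ^+ n by rewrite ler_pdivrMr// -exprSr ltW.
rewrite !powRN lef_pV2 ?posrE ?powR_gt0//.
by rewrite ge0_ler_powR ?nnegrE ?(ltW h0) ?(ltW p0).
Qed.

Lemma Itail_kernel (h z u : R) : 0 <= h ->
  (forall v, u <= v -> tl (v - z) <= h * tl v) -> I (u - z) <= h * I u.
Proof.
move=> h0 hz; rewrite -lee_fin EFinM.
have IE y : (I y)%:E = (\int[@lebesgue_measure R]_(s in `[0%R, +oo[) (tl (y + 1 * s))%:E)%E.
  by rewrite (Itail_scaled XP _ ltr01) divr1.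
rewrite !IE.
have mt (y : R) : measurable_fun setT (fun s : R => tl (y + 1 * s)).
  apply: (measurableT_comp (tl_measurable XP)).
  by under eq_fun do rewrite mul1r; exact: measurable_funD.
rewrite -ge0_integralZl//; first last.
- by move=> s _; rewrite lee_fin tl_ge0.
- by apply: measurable_funTS; apply/measurable_EFinP; exact: mt.
apply: ge0_le_integral => //.
- by move=> s _; rewrite lee_fin tl_ge0.
- by apply: measurable_funTS; apply/measurable_EFinP; exact: mt.
- by apply: measurable_funTS; apply: measurable_funeM; apply/measurable_EFinP; exact: mt.
move=> s; rewrite /= in_itv/= andbT => s0; rewrite -EFinM lee_fin mul1r.
by rewrite addrAC; apply: hz; rewrite lerDl.
Qed.

End doubling.

(** * Regularly varying tails (Assumption A) *)

Section regular_variation.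
Context (R : realType) d (T : measurableType d) (P : probability T R).
Variables (X : nat -> T -> R) (mu sigma : R).
Hypothesis XP : iid_sequence P X mu sigma.
Local Notation tl := (tl P X).
Local Notation I := (Itail P X).
Hypothesis tl_gt0 : forall x, 0 < tl x.
Variables (iota : R) (L : R -> R).
Hypotheses (iota1 : 1 < iota) (tlE : forall x, 0 < x -> tl x = L x * x `^ (- iota)).
Hypothesis L_sv : slowly_varying L.

Lemma cvg_scale_pinfty (t : R) : 0 < t -> x * t @[x --> +oo] --> +oo.
Proof.
move=> t0; apply/cvgryPge => A; exists (A / t); split; first exact: num_real.
by move=> x Ax; rewrite -ler_pdivrMr// ltW.
Qed.

Lemma tl_contract (t : R) : 0 < t <= 1 -> tl (x * t) / tl x @[x --> +oo] --> t `^ (- iota).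
Proof.
move=> t01; have t0 : 0 < t by case/andP: t01.
rewrite -[X in _ --> X]mul1r.
apply: cvg_trans (cvgM (L_sv t01) (cvg_cst (t `^ (- iota)))); apply: near_eq_cvg; near=> x.
have x0 : 0 < x by near: x; apply: nbhs_pinfty_gt; exact: num_real.
have px : 0 < x `^ (- iota) by exact: powR_gt0.
have Lx : L x != 0.
  by apply/eqP => h; have := tl_gt0 x; rewrite (tlE x0) h mul0r ltxx.
rewrite /= !tlE ?mulr_gt0// powRM ?ltW//; field; by rewrite Lx gt_eqF.
Unshelve. all: by end_near. Qed.

(** Slow variation is given for factors in ]0, 1]; a dilation by 1 + s is the contraction by its
    inverse seen from b (1 + s), with the ratio inverted. *)
Lemma tl_dilate (s : R) : 0 <= s -> tl (b + b * s) / tl b @[b --> +oo] --> (1 + s) `^ (- iota).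
Proof.
move=> s0; have s1 : 0 < 1 + s by lra.
have t01 : 0 < (1 + s)^-1 <= 1 by rewrite invr_gt0 s1 invf_le1//; lra.
have h := cvg_comp _ _ (cvg_scale_pinfty s1) (tl_contract t01).
have hV : (tl (b * (1 + s) * (1 + s)^-1) / tl (b * (1 + s)))^-1 @[b --> +oo] --> ((1 + s)^-1 `^ (- iota))^-1.
  by apply: cvgV => //; rewrite gt_eqF// powR_gt0//; case/andP: t01.
have -> : (1 + s) `^ (- iota) = ((1 + s)^-1 `^ (- iota))^-1.
  by rewrite -powRN opprK -powR_inv1 ?(ltW s1)// -powRrM mulN1r.
apply: cvg_trans hV; apply: near_eq_cvg; apply: nearW => b.
by rewrite mulfK ?gt_eqF// invf_div mulrDr mulr1.
Qed.

Lemma pareto_dom : exists C p : R, [/\ 0 <= C, 1 < p & \forall b \near +oo, forall s : R, 0 <= s ->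
  tl (b + b * s) <= C * (1 + s) `^ (- p) * tl b].
Proof.
(* An exponent strictly between 1 and iota: integrable, with room between 2^(- iota), the limit of
   the doubling ratio, and 2^(- p). *)
pose p := (1 + iota) / 2; exists (2 `^ p), p.
have p1 : 1 < p by rewrite /p ltr_pdivlMr// mul1r (_ : 2 = 1 + 1)// ltrD2l.
split => //.
have lt2 : 2 `^ (- iota) < 2 `^ (- p) :> R.
  by rewrite /powR gt_eqF// ltr_expR ltr_pM2r ?ln_gt0 ?ltr1n// ltrN2 /p ltr_pdivrMr// mulr_natr mulr2n ltrD2r.
have := tl_dilate ler01; rewrite (_ : 1 + 1 = 2 :> R); last by ring.
move/cvgrPdist_lt => /(_ (2 `^ (- p) - 2 `^ (- iota))); rewrite subr_gt0 lt2 => /(_ isT) [M [_ hM]].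
near=> b => s s0.
have b1 : Num.max M 0 + 1 <= b by near: b; apply: nbhs_pinfty_ge; exact: num_real.
have M0 : 0 < Num.max M 0 + 1.
  by rewrite ltr_wpDl// le_max lexx orbT.
apply: (doubling_bound XP _ M0) => //; first lra.
move=> x xM; have Mx : M < x.
  by apply: lt_le_trans xM; rewrite ltr_pwDr// le_max lexx.
have := hM x Mx; rewrite ltr_norml => /andP[+ _].
rewrite ltrBrDl ltrBlDl => h; rewrite -ler_pdivrMr//.
have -> : x * 2 = x + x * 1 by ring.
lra.
Unshelve. all: by end_near. Qed.

(** Summing the excesses max (0, X - i + D) over i gives at most the square of max (0, X + D + 1),
    so the finite variance makes the integrated tail summable. *)
Lemma Itail_sum_bounded (D : R) : exists M, forall n, \sum_(i < n) I (i%:R - D) <= M.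
Proof.
have ig : intg P (fun w => (X 0%N w + (D + 1)) ^+ 2).
  have h := intgD (iid_sqr XP) (intgD (intgZ (2 * (D + 1)) (iid_intg XP)) (intg_cst P ((D + 1) ^+ 2))).
  rewrite (_ : (fun w => _) = fun w => X 0 w ^+ 2 + (2 * (D + 1) * X 0 w + (D + 1) ^+ 2))//.
  by apply/funext => w; ring.
exists (\int[P]_w (X 0%N w + (D + 1)) ^+ 2) => n.
have iE m : intg P (fun w => \sum_(i < m) Num.max 0 (X 0%N w - (i%:R - D))) /\
   \sum_(i < m) I (i%:R - D) = \int[P]_w \sum_(i < m) Num.max 0 (X 0%N w - (i%:R - D)).
  elim: m => [|m [IH1 IH2]].
    rewrite big_ord0 (_ : (fun w => _) = fun=> 0).
      by split; [exact: intg_cst|rewrite Ex_cst].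
    by apply/funext => w; rewrite big_ord0.
  have E : (fun w => \sum_(i < m.+1) Num.max 0 (X 0%N w - (i%:R - D))) =
     fun w => \sum_(i < m) Num.max 0 (X 0%N w - (i%:R - D)) + Num.max 0 (X 0%N w - (m%:R - D)).
    by apply/funext => w; rewrite big_ord_recr.
  rewrite E; split; first exact: intgD IH1 (intg_excess XP _).
  by rewrite big_ord_recr/= IH2 (RintegralD measurableT IH1 (intg_excess XP _)).
rewrite (iE n).2; apply: le_Rintegral => //; first exact: (iE n).1.
move=> w _; have := sum_excess_le (X 0%N w + D) n.
rewrite (eq_bigr (fun i : 'I_n => Num.max 0 (X 0%N w - (i%:R - D)))); last first.
  by move=> i _; congr Num.max; ring.
move=> /le_trans; apply; rewrite -addrA.
by case: (leP 0 (X 0%N w + (D + 1))) => // h; rewrite expr0n sqr_ge0.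
Qed.

(** A constant h suffices: in the range u >= 2 k - D with k large, u - k - 1 >= u / 3, and regular
    variation bounds the tail ratio for the factor 1/3. *)
Lemma pareto_kernel : kernel_bounded P X.
Proof.
move=> D D0; have t01 : (0 : R) < 3^-1 <= (1 : R).
  by rewrite invr_gt0 ltr0n/= invf_le1 ?ler1n ?ltr0n.
pose H := 3^-1 `^ (- iota) + 1 : R; have H0 : 0 < H by rewrite ltr_wpDl// powR_ge0.
have [M [_ hM]] : \forall x \near +oo, tl (x * 3^-1) <= H * tl x.
  have /cvgrPdist_lt /(_ 1 ltr01) := tl_contract t01; apply: filterS => x.
  by rewrite ltr_norml => /andP[h _]; rewrite -ler_pdivrMr// /H; lra.
exists (fun=> H); split => [k|eta eta0]; first exact: ltW.
have [B hB] := Itail_sum_bounded D.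
have [||K1 hK1] := @summable_tail R (fun i => I (i%:R - D) * H) (B * H) eta _ _ eta0.
- by move=> i; rewrite mulr_ge0 ?(Itail_ge0 P X)// ltW.
- by move=> n; rewrite -mulr_suml ler_wpM2r// ltW.
pose K2 := (Num.truncn (`|M| + 2 * D + 3)).+1.
have K2p : `|M| + 2 * D + 3 < K2%:R by exact: truncnS_gt.
exists (maxn K1 K2); split => [k u|n].
  rewrite geq_max => /andP[_ Kk] ku.
  have kK : K2%:R <= k%:R :> R by rewrite ler_nat.
  apply: (Itail_kernel XP (ltW H0)) => v uv.
  have kE : k.+1%:R = k%:R + 1 :> R by rewrite natr1.
  have M0 := normr_ge0 M.
  have vM : M < v by have := ler_norm M; lra.
  apply: le_trans (hM v vM); apply: (tl_le XP).
  by rewrite kE; lra.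
apply: le_trans (hK1 n).
rewrite big_mkcond [leRHS]big_mkcond/=; apply: ler_sum => i _.
case: (leqP (maxn K1 K2) i); first by rewrite geq_max => /andP[-> _].
by case: ifP => // _ _; rewrite mulr_ge0 ?(Itail_ge0 P X)// ltW.
Qed.

Definition pareto_G0 (t : R) := (1 + t) `^ (1 - iota) / (iota - 1).

(* What the limit theorem uses of Assumptions A and B; I is the integrated tail. *)
Record regular_tail (G : R -> R) : Prop := RegularTail {
  regular_gt0 : forall x, 0 < I x;
  regular_ratio : ratio P X b @[b --> +oo] --> +oo;
  regular_small : tl b / I b @[b --> +oo] --> (0 : R);
  regular_long : long_tailed P X;
  regular_kernel : kernel_bounded P X;
  regular_excess : forall t : R, 0 <= t -> I (b + ratio P X b * t) / I b @[b --> +oo] --> G t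
}.

Lemma cvg_id_pinfty : b @[b --> +oo] --> (+oo : set_system R).
Proof. by apply: cvg_id. Qed.

Lemma pareto_regular : regular_tail (fun t => (1 + t / (iota - 1)) `^ (- (iota - 1))).
Proof.
have [C [p [C0 p1 dom]]] := pareto_dom.
have c0 : \forall b \near (+oo : set_system R), 0 < b by apply: nbhs_pinfty_gt; exact: num_real.
have i1 : 0 < iota - 1 by rewrite subr_gt0.
have mg : measurable_fun setT (fun s : R => (1 + s) `^ (- iota)).
  by apply: (measurableT_comp (measurable_powR _)); exact: measurable_funD.
have G00 : pareto_G0 0 = (iota - 1)^-1 by rewrite /pareto_G0 addr0 powR1 mul1r.
have Gp : 0 < pareto_G0 0 by rewrite G00 invr_gt0.
have Gc (t : R) : 0 <= t -> {for t, continuous pareto_G0}.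
  move=> t0; rewrite /pareto_G0; apply: cvgMl.
  have tin : 1 + t \in `]0, +oo[ by rewrite in_itv/=; apply/andP; split => //; lra.
  apply: (@continuous_comp _ _ _ (fun s : R => 1 + s) (@powR R ^~ (1 - iota))).
    by apply: cvgD; [exact: cvg_cst|exact: cvg_id].
  apply: differentiable_continuous; apply/derivable1_diffP; exact: derivable_powR.
have gi (t : R) : 0 <= t ->
    (\int[@lebesgue_measure R]_(s in `[0%R, +oo[) ((1 + (t + s)) `^ (- iota))%:E = (pareto_G0 t)%:E)%E.
  by move=> t0; exact: powR_tail.
split.
- exact: Itail_gt0 XP tl_gt0.
- exact: (ratio_pinfty XP tl_gt0 c0 p1 C0 mg tl_dilate dom gi Gp cvg_id_pinfty).
- exact: (tl_small_ratio XP tl_gt0 c0 p1 C0 mg tl_dilate dom gi Gp cvg_id_pinfty).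
- exact: (Itail_long_tailed XP tl_gt0 c0 p1 C0 mg tl_dilate dom gi Gp Gc cvg_id_pinfty).
- exact: pareto_kernel.
- move=> t t0; have := @Itail_ratio_self _ _ _ _ _ _ _ XP _ _ _ _ _ tl_gt0 c0 p1 C0 mg tl_dilate dom gi Gp Gc t t0.
  by rewrite G00 invrK /pareto_G0 divfK ?gt_eqF// opprB.
Qed.

End regular_variation.

Lemma large_index (R : realType) (M Z x1 D K k : R) : 0 < x1 -> 0 <= D ->
  `|M| + `|Z| + x1 + D + 3 < K -> K <= k -> [/\ M < k, x1 <= k - D - 1, 0 < k - D - 1 & Z <= k].
Proof.
have := ler_norm M; have := ler_norm Z; have := normr_ge0 M; have := normr_ge0 Z.
by move=> *; split; lra.
Qed.

(** * Concave cumulative hazard (Assumptions B1--B4) *)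

Section concave_hazard.
Context (R : realType) d (T : measurableType d) (P : probability T R).
Variables (X : nat -> T -> R) (mu sigma : R).
Hypothesis XP : iid_sequence P X mu sigma.
Local Notation tl := (tl P X).
Local Notation I := (Itail P X).
Variables (lam Lam : R -> R) (b0 bt0 al : R).
Hypotheses (tlE : forall x, tl x = expR (- Lam x)) (lam_ge0 : forall x, 0 <= lam x).
Hypotheses (b00 : 0 < b0) (xlam : x * lam x @[x --> +oo] --> +oo).
Hypotheses (bt01 : 0 < bt0 < 1) (lamLam : forall x, b0 <= x -> lam x / Lam x <= bt0 * x^-1).
Hypothesis concave : @convex_function R R^o `[b0, +oo[ (fun x => - Lam x).
Hypothesis excess_lim : forall t : R, 0 <= t ->
  tl (x + t / lam x) / tl x @[x --> +oo] --> expR (- t).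
Hypotheses (al1 : 1 < al) (excess_dom : forall t x : R, b0 < t -> b0 < x ->
  tl (x + t / lam x) <= t `^ (- al) * tl x).

Lemma tl_expR_gt0 x : 0 < tl x. Proof. by rewrite tlE expR_gt0. Qed.

Lemma Lam_le x y : x <= y -> Lam x <= Lam y.
Proof. by move=> xy; have := tl_le XP xy; rewrite !tlE ler_expR lerN2. Qed.

Lemma concave_slope x y z : b0 <= x -> x < y -> y < z ->
  (Lam z - Lam y) * (y - x) <= (Lam y - Lam x) * (z - y).
Proof.
move=> bx xy yz.
have zx : 0 < z - x by lra.
have t0 : 0 <= (z - y) / (z - x) by apply: divr_ge0; lra.
have t1 : (z - y) / (z - x) <= 1 by rewrite ler_pdivrMr//; lra.
have xin : x \in (`[b0, +oo[%classic : set R) by rewrite inE/= in_itv/= bx.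
have zin : z \in (`[b0, +oo[%classic : set R) by rewrite inE/= in_itv/= andbT; lra.
have : - Lam ((z - y) / (z - x) * x + (1 - (z - y) / (z - x)) * z) <=
    (z - y) / (z - x) * - Lam x + (1 - (z - y) / (z - x)) * - Lam z.
  exact: (concave (Itv01 t0 t1) xin zin).
have -> : (z - y) / (z - x) * x + (1 - (z - y) / (z - x)) * z = y.
  by field; rewrite gt_eqF.
have -> : (z - y) / (z - x) * - Lam x + (1 - (z - y) / (z - x)) * - Lam z =
   - (((z - y) * Lam x + (y - x) * Lam z) / (z - x)).
  by field; rewrite gt_eqF.
rewrite lerN2 ler_pdivrMr// => h; nra.
Qed.

Lemma lam_gt0 : \forall x \near +oo, 0 < lam x.
Proof.
move/cvgryPgt : xlam => /(_ 0); apply: filterS => x h.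
by rewrite lt_neqAle lam_ge0 andbT; apply: contraTneq h => <-; rewrite mulr0 ltxx.
Qed.

Lemma tl_cvg0 : tl x @[x --> +oo] --> (0 : R).
Proof.
have [x [xb lx]] : exists x, b0 < x /\ 0 < lam x.
  have h1 := lam_gt0; have h2 : \forall x \near +oo, b0 < x by apply: nbhs_pinfty_gt; exact: num_real.
  have : \forall x \near +oo, b0 < x /\ 0 < lam x by apply: filterS2 h2 h1.
  by move=> [M [_ h]]; exists (M + 1); apply: h; rewrite ltrDl.
apply/cvgrPdist_le => e e0.
have al0 : 0 < al by have := al1; lra.
have /cvgrPdist_le /(_ _ e0) [M [_ hM]] := powR_cvgy0 al0.
pose t := Num.max M b0 + 1.
have tM : M < t by rewrite /t ltr_pwDr// le_max lexx.
have tb : b0 < t by rewrite /t ltr_pwDr// le_max lexx orbT.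
near=> y; rewrite sub0r normrN ger0_norm ?(tl_ge0 P X)//.
have xy : x + t / lam x <= y by near: y; apply: nbhs_pinfty_ge; exact: num_real.
apply: le_trans (tl_le XP xy) _; apply: le_trans (excess_dom tb xb) _.
apply: le_trans (ler_piMr (powR_ge0 _ _) _) _; first exact/fine_P_le1/(measurable_X_gt XP).
by have := hM t tM; rewrite sub0r normrN ger0_norm ?powR_ge0.
Unshelve. all: by end_near. Qed.

Lemma Lam_pinfty : Lam x @[x --> +oo] --> +oo.
Proof.
apply/cvgryPge => A; have e0 : 0 < expR (- A) by exact: expR_gt0.
have /cvgrPdist_le /(_ _ e0) := tl_cvg0; apply: filterS => x.
by rewrite sub0r normrN ger0_norm ?(tl_ge0 P X)// tlE ler_expR lerN2.
Qed.

(** Room above the exponent of B2, spent on replacing derivatives by chords. *)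
Definition bt1 := (1 + bt0) / 2.

Lemma bt1_itv : bt0 < bt1 < 1.
Proof. by case/andP: bt01 => h1 h2; apply/andP; split; rewrite /bt1 ?ltr_pdivlMr ?ltr_pdivrMr//; lra. Qed.

(** By B4 at t = 1 the chord of Lam over [x, x + 1 / lam x] has slope at most q lam x; concavity
    extends this bound to z, and B2 turns lam x into bt0 Lam x / x, with q bt0 <= bt1. The constant
    2 covers z <= x + 1 / lam x. *)
Lemma Lam_increment : exists2 x1, b0 <= x1 /\ 1 <= Lam x1 & forall x z, x1 <= x -> x <= z ->
  Lam z - Lam x <= 2 + bt1 * Lam x * (z - x) / x.
Proof.
have [bt00 bt0lt] := andP bt01; have [b1 b2] := andP bt1_itv.
pose q := Num.min 2 (bt1 / bt0).
have q1 : 1 < q by rewrite lt_min ltr1n/= ltr_pdivlMr// mul1r.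
have q2 : q <= 2 by rewrite ge_min lexx.
have q3 : q * bt0 <= bt1 by rewrite -ler_pdivlMr// ge_min lexx orbT.
have gap : 0 < expR (- 1) - expR (- q) :> R by rewrite subr_gt0 ltr_expR ltrN2.
have n1 : \forall x \near +oo, Lam (x + 1 / lam x) - Lam x <= q.
  have /cvgrPdist_lt /(_ _ gap) := excess_lim ler01; apply: filterS => x.
  rewrite ltr_norml => /andP[_ h].
  have : expR (- q) < tl (x + 1 / lam x) / tl x by lra.
  rewrite !tlE -expRN -expRD ltr_expR; lra.
have n2 := lam_gt0.
have n3 : \forall x \near +oo, 1 <= Lam x by move/cvgryPge : Lam_pinfty; apply.
have n4 : \forall x \near +oo, b0 <= x by apply: nbhs_pinfty_ge; exact: num_real.
have : \forall x \near +oo, [/\ Lam (x + 1 / lam x) - Lam x <= q, 0 < lam x, 1 <= Lam x & b0 <= x].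
  by near=> x; split; near: x.
move=> [M [_ hM]]; exists (M + 1).
  by have [_ _ h1 h2] := hM (M + 1) ltac:(by rewrite ltrDl); split.
move=> x z Mx xz.
have [h1 lx L1 bx] : [/\ Lam (x + 1 / lam x) - Lam x <= q, 0 < lam x, 1 <= Lam x & b0 <= x].
  by apply: hM; lra.
have x0 : 0 < x by have := b00; lra.
have B0 : 0 <= bt1 * Lam x * (z - x) / x.
  by apply: divr_ge0 => //; rewrite ?(ltW x0)//; apply: mulr_ge0; [apply: mulr_ge0; lra|lra].
have [zs|zs] := leP z (x + 1 / lam x).
  by have := Lam_le zs; lra.
have l0 : 0 < 1 / lam x by rewrite divr_gt0.
have LL : Lam z - Lam x <= q * lam x * (z - x).
  have xy : x < x + 1 / lam x by rewrite ltrDl.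
  have := concave_slope bx xy zs; set y := x + 1 / lam x in h1 zs *.
  have -> : y - x = 1 / lam x by rewrite /y; ring.
  rewrite mulrA mulr1 ler_pdivrMr// => h2.
  have h3 : Lam z - Lam x <= (Lam y - Lam x) * (lam x * (z - x)).
    have -> : lam x * (z - x) = (z - y) * lam x + 1 by rewrite /y; field; rewrite gt_eqF.
    by rewrite mulrDr mulr1 mulrA; lra.
  apply: le_trans h3 _; rewrite -mulrA ler_wpM2r// mulr_ge0//; lra.
apply: (le_trans LL); apply: (@le_trans _ _ (bt1 * Lam x * (z - x) / x)); last lra.
have := lamLam bx; rewrite ler_pdivrMr; last lra.
move=> h2; rewrite [leRHS]mulrAC; apply: ler_wpM2r; first lra.
apply: le_trans (ler_wpM2l _ h2) _; first lra.
have -> : q * (bt0 / x * Lam x) = q * bt0 * (Lam x / x) by field; rewrite gt_eqF.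
rewrite -[leRHS]mulrA; apply: ler_wpM2r => //; apply: divr_ge0; lra.
Unshelve. all: by end_near. Qed.

(** The factor 1 + bt1 is written th * 2, where th < 1 is the decay rate of Lam x / x along
    doublings. *)
Lemma Lam_doubling : exists2 x1, 0 < x1 & forall x, x1 <= x ->
  Lam (x * 2) <= (1 + bt1) / 2 * 2 * Lam x + 2.
Proof.
have [x1 [bx1 _] h] := Lam_increment; exists x1; first exact: lt_le_trans bx1.
move=> x xx; have x0 : 0 < x by apply: lt_le_trans xx; exact: lt_le_trans bx1.
have x2 : x <= x * 2 by lra.
have := h x (x * 2) xx x2.
have -> : bt1 * Lam x * (x * 2 - x) / x = bt1 * Lam x by field; rewrite gt_eqF.
lra.
Qed.

(* Doubling x multiplies Lam x, up to a constant, by at most 1 + bt1 < 2. *)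
Lemma Lam_sublinear : Lam x / x @[x --> +oo] --> (0 : R).
Proof.
have [x1 x10 h] := Lam_doubling; have [b1 b2] := andP bt1_itv.
have bt1p : 0 < bt1 by have [? _] := andP bt01; lra.
pose th := (1 + bt1) / 2.
have th0 : 0 < th by rewrite divr_gt0//; lra.
have th1 : th < 1 by rewrite /th ltr_pdivrMr//; lra.
(* Chosen so that the additive 2 disappears: Lam + C is multiplied by at most th * 2 at each
   doubling. *)
pose C := 2 / bt1.
have C0 : 0 <= C by rewrite divr_ge0// ltW.
have bC : bt1 * C = 2 by rewrite /C mulrC divfK// gt_eqF.
have [x2 x2p x2h] : exists2 x2, x1 <= x2 & 0 <= Lam x2.
  have n1 : \forall x \near +oo, 0 <= Lam x by move/cvgryPge : Lam_pinfty; apply.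
  have n2 : \forall x \near +oo, x1 <= x by apply: nbhs_pinfty_ge; exact: num_real.
  have : \forall x \near +oo, x1 <= x /\ 0 <= Lam x by apply: filterS2 n2 n1.
  by move=> [M [_ hM]]; have [h1 h2] := hM (M + 1) ltac:(by rewrite ltrDl); exists (M + 1).
have x20 : 0 < x2 by exact: lt_le_trans x2p.
have iter n : Lam (x2 * 2 ^+ n) + C <= (th * 2) ^+ n * (Lam x2 + C).
  elim: n => [|n IH]; first by rewrite !expr0 mulr1 mul1r.
  rewrite !exprSr mulrA.
  have xn : x1 <= x2 * 2 ^+ n.
    by apply: le_trans x2p _; rewrite ler_peMr ?(ltW x20)// exprn_ege1// ler1n.
  have h1 := h _ xn.
  apply: (@le_trans _ _ (th * 2 * (Lam (x2 * 2 ^+ n) + C))).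
    have -> : th * 2 * (Lam (x2 * 2 ^+ n) + C) = th * 2 * Lam (x2 * 2 ^+ n) + (C + 2).
      by rewrite mulrDr; congr (_ + _); rewrite /th divfK// mulrDl mul1r bC.
    by move: h1; rewrite -/th; lra.
  rewrite [leRHS]mulrAC [leRHS]mulrC ler_wpM2l//; lra.
have D0 : 0 <= Lam x2 + C by lra.
apply/cvgrPdist_lt => e e0.
pose A := 2 * (Lam x2 + C) / x2.
have A0 : 0 <= A by rewrite divr_ge0 ?(ltW x20)// mulr_ge0.
have A1 : 0 < A + 1 by lra.
have [N hN] : exists N, th ^+ N < e / (A + 1).
  have th1' : `|th| < 1 by rewrite gtr0_norm.
  have /cvgrPdist_lt /(_ (e / (A + 1))) := cvg_expr th1'.
  rewrite divr_gt0// => /(_ isT) [N _ /(_ N (leqnn N))].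
  by rewrite sub0r normrN ger0_norm ?exprn_ge0 ?(ltW th0)//; exists N.
near=> y.
have yN : x2 * 2 ^+ N <= y by near: y; apply: nbhs_pinfty_ge; exact: num_real.
have Ly : 0 <= Lam y by near: y; move/cvgryPge : Lam_pinfty; apply.
have p2 : (0 : R) < 2 ^+ N by rewrite exprn_gt0.
have y0 : 0 < y by apply: lt_le_trans yN; rewrite mulr_gt0.
rewrite sub0r normrN ger0_norm; last by rewrite divr_ge0// ltW.
have x2N : x2 <= x2 * 2 ^+ N by rewrite ler_peMr ?(ltW x20)// exprn_ege1// ler1n.
have yx : 1 <= y / x2.
  by rewrite ler_pdivlMr// mul1r; exact: le_trans x2N yN.
have [m /andP[m1 m2]] := pow2_sandwich yx.
have Nm : (N <= m)%N.
  rewrite leqNgt; apply/negP => mN.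
  have : y / x2 < 2 ^+ N.
    by apply: lt_le_trans m2 _; rewrite ler_eXn2l// ltr1n.
  by rewrite ltr_pdivrMr// mulrC; lra.
have ym : y <= x2 * 2 ^+ m.+1 by move: m2; rewrite ltr_pdivrMr// mulrC => /ltW.
have my : x2 * 2 ^+ m <= y by move: m1; rewrite ler_pdivlMr// mulrC.
have pm : (0 : R) < 2 ^+ m by rewrite exprn_gt0.
have h1 : Lam y <= (th * 2) ^+ m.+1 * (Lam x2 + C).
  by have := iter m.+1; have := Lam_le ym; lra.
rewrite ltr_pdivrMr//; apply: (@le_lt_trans _ _ (th ^+ m * A * (x2 * 2 ^+ m))).
  apply: (le_trans h1); rewrite exprMn !exprSr.
  have -> : th ^+ m * A * (x2 * 2 ^+ m) = th ^+ m * 1 * (2 ^+ m * 2) * (Lam x2 + C).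
    by rewrite /A; field; rewrite gt_eqF.
  rewrite ler_wpM2r// ler_wpM2r ?mulr_ge0 ?(ltW pm)// ler_wpM2l ?exprn_ge0 ?(ltW th0)//.
  exact: ltW.
have tm : th ^+ m <= th ^+ N by rewrite ler_wiXn2l// ltW.
apply: (@le_lt_trans _ _ (th ^+ N * A * y)).
  apply: ler_pM => //; [|by apply: mulr_ge0; exact: ltW|exact: ler_wpM2r].
  by apply: mulr_ge0 => //; apply: exprn_ge0; exact: ltW.
rewrite ltr_pM2r//; apply: (@le_lt_trans _ _ (th ^+ N * (A + 1))).
  by rewrite ler_wpM2l ?exprn_ge0 ?(ltW th0)//; lra.
by rewrite -ltr_pdivlMr.
Unshelve. all: by end_near. Qed.

(** B2 bounds lam x by Lam x / x, which tends to 0. *)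
Lemma inv_lam_pinfty : (lam b)^-1 @[b --> +oo] --> +oo.
Proof.
apply/cvgryPge => A; have A1 : 0 < (`|A| + 1)^-1 by rewrite invr_gt0 ltr_wpDl.
have [bt00 bt0lt] := andP bt01.
have /cvgrPdist_lt /(_ _ A1) n1 := Lam_sublinear.
have n2 := lam_gt0.
have n3 : \forall x \near +oo, 1 <= Lam x by move/cvgryPge : Lam_pinfty; apply.
near=> x.
have x0 : 0 < x by near: x; apply: nbhs_pinfty_gt; exact: num_real.
have bx : b0 <= x by near: x; apply: nbhs_pinfty_ge; exact: num_real.
have lx : 0 < lam x by near: x; exact: n2.
have L1 : 1 <= Lam x by near: x; exact: n3.
have h1 : `|0 - Lam x / x| < (`|A| + 1)^-1 by near: x; exact: n1.
have L0 : 0 < Lam x by lra.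
rewrite sub0r normrN ger0_norm ?divr_ge0 ?(ltW x0) ?(ltW L0)// in h1.
have := lamLam bx; rewrite ler_pdivrMr// => h2.
have h3 : lam x <= (`|A| + 1)^-1.
  apply: (le_trans h2); apply: le_trans (ltW h1).
  rewrite mulrAC -mulrA; apply: ler_piMl; last lra.
  by rewrite divr_ge0// ltW.
apply: (le_trans (ler_norm A)); apply: (@le_trans _ _ (`|A| + 1)); first lra.
by rewrite -[leLHS]invrK lef_pV2 ?posrE.
Unshelve. all: by end_near. Qed.

(** Doubling x is an excess of t = x lam x units of 1 / lam x. By B1 this t tends to infinity, so
    the bound t^(- al) of B4 falls below 2^(- q) for any q. *)
Lemma tl_power_decay (q : R) : 0 <= q -> exists C x1 : R, [/\ 0 <= C, 0 < x1 &
  forall x, x1 <= x -> tl x <= C * x `^ (- q)].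
Proof.
move=> q0; have al0 : 0 < al by have := al1; lra.
have d0 : 0 < 2 `^ (- q) :> R by exact: powR_gt0.
have /cvgrPdist_le /(_ _ d0) [M [_ hM]] := powR_cvgy0 al0.
have n1 : \forall x \near +oo, [/\ M < x * lam x, b0 < x * lam x, 0 < lam x & b0 < x].
  have m1 : \forall x \near +oo, M < x * lam x by move/cvgryPgt : xlam; apply.
  have m2 : \forall x \near +oo, b0 < x * lam x by move/cvgryPgt : xlam; apply.
  have m3 := lam_gt0.
  have m4 : \forall x \near +oo, b0 < x by apply: nbhs_pinfty_gt; exact: num_real.
  by near=> x; split; near: x.
have [x1 x10 dbl] : exists2 x1, 0 < x1 & forall x, x1 <= x -> tl (x * 2) <= 2 `^ (- q) * tl x.
  move: n1 => [N [_ hN]]; exists (Num.max N 0 + 1).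
    by rewrite ltr_wpDl// le_max lexx orbT.
  move=> x xN; have [h1 h2 h3 h4] : [/\ M < x * lam x, b0 < x * lam x, 0 < lam x & b0 < x].
    by apply: hN; apply: lt_le_trans xN; rewrite ltr_pwDr// le_max lexx.
  have -> : x * 2 = x + x * lam x / lam x by rewrite mulfK ?gt_eqF//; ring.
  apply: le_trans (excess_dom h2 h4) _; rewrite ler_wpM2r ?(tl_ge0 P X)//.
  by have := hM _ h1; rewrite sub0r normrN ger0_norm ?powR_ge0.
exists (2 `^ q * x1 `^ q * tl x1), x1; split => //.
  by rewrite !mulr_ge0 ?powR_ge0 ?(tl_ge0 P X).
move=> x xx; have x0 : 0 < x by exact: lt_le_trans xx.
have s0 : 0 <= x / x1 - 1 by rewrite subr_ge0 ler_pdivlMr// mul1r.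
have := doubling_bound XP q0 x10 dbl (lexx x1) s0.
have -> : x1 + x1 * (x / x1 - 1) = x by field; rewrite gt_eqF.
have -> : 1 + (x / x1 - 1) = x / x1 by ring.
move=> /le_trans; apply; rewrite le_eqVlt; apply/orP; left; apply/eqP.
rewrite powRM ?invr_ge0 ?(ltW x0) ?(ltW x10)// -powR_inv1 ?(ltW x10)// -powRrM mulN1r opprK; ring.
Unshelve. all: by end_near. Qed.

Lemma hazard_dom : exists2 C : R, 0 <= C & \forall b \near +oo, forall s : R, 0 <= s ->
  tl (b + (lam b)^-1 * s) <= C * (1 + s) `^ (- al) * tl b.
Proof.
have al0 : 0 <= al by have := al1; lra.
(* B4 bounds the excess for s > b0 only. For s <= b0 + 1 one has (1 + s) / c <= 1 and the bound is
   trivial; for larger s, (1 + s) / c <= s. *)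
have B0 := b00; pose c := 2 + 2 * (b0 + 1); have c0 : 0 < c by rewrite /c; lra.
exists (c `^ al); first exact: powR_ge0.
near=> b => s s0.
have bb : b0 < b by near: b; apply: nbhs_pinfty_gt; exact: num_real.
have lb : 0 < lam b by near: b; exact: lam_gt0.
have s1 : 0 < 1 + s by lra.
have y0 : 0 < (1 + s) / c by rewrite divr_gt0.
have -> : c `^ al * (1 + s) `^ (- al) = ((1 + s) / c) `^ (- al).
  rewrite powRM ?invr_ge0 ?(ltW c0) ?(ltW s1)// mulrC; congr (_ * _).
  by rewrite -powR_inv1 ?(ltW c0)// -powRrM mulN1r opprK.
have -> : b + (lam b)^-1 * s = b + s / lam b by rewrite mulrC.
have antitone (y z : R) : 0 < y -> y <= z -> z `^ (- al) <= y `^ (- al).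
  move=> y00 yz; have z00 : 0 < z by exact: lt_le_trans yz.
  by rewrite !powRN lef_pV2 ?posrE ?powR_gt0// ge0_ler_powR ?nnegrE ?(ltW y00) ?(ltW z00).
have [sb|sb] := leP s (b0 + 1).
  apply: (@le_trans _ _ (1 * tl b)).
    by rewrite mul1r; apply: (tl_le XP); rewrite lerDl divr_ge0// ltW.
  rewrite ler_wpM2r ?(tl_ge0 P X)//; apply: (@le_trans _ _ (1 `^ (- al))); first by rewrite powR1.
  by apply: antitone => //; rewrite ler_pdivrMr// mul1r /c; lra.
have sb0 : b0 < s by lra.
apply: le_trans (excess_dom sb0 bb) _; rewrite ler_wpM2r ?(tl_ge0 P X)//.
apply: antitone => //; rewrite ler_pdivrMr//.
have : s * 2 <= s * c by rewrite ler_wpM2l// /c; lra.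
lra.
Unshelve. all: by end_near. Qed.

(** Up to a constant h k is the tail at k to the power - b3, with bt1 < b3 < 1. Multiplied by I k,
    which is at most 2 k times the tail, it leaves k times a positive power of the tail, and that is
    summable because the tail decays faster than any power. *)
Lemma hazard_kernel : ratio P X b / (lam b)^-1 @[b --> +oo] --> (1 : R) ->
  long_tailed P X -> kernel_bounded P X.
Proof.
move=> rc LT D D0.
have [x1 [bx1 L1] inc] := Lam_increment; have [b1 b2] := andP bt1_itv.
have bt1p : 0 < bt1 by have [? _] := andP bt01; lra.
pose b3 := (1 + bt1) / 2.
have b31 : b3 < 1 by rewrite /b3 ltr_pdivrMr//; lra.
have b3b : bt1 < b3 by rewrite /b3 ltr_pdivlMr//; lra.
have b30 : 0 < b3 by lra.
(* The 4 collects the additive 2 of [Lam_increment], used twice, the second time with the factor b3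
   < 1. *)
pose h (k : nat) : R := expR (4 + b3 * Lam k%:R).
exists h; split=> [k|eta eta0]; first exact: expR_ge0.
pose g := 1 - b3; have g0 : 0 < g by rewrite subr_gt0.
(* The decay of order 3 / g makes the g-th power of the tail O (x^-3), one power of x being spent on
   I. *)
have q0 : 0 <= 3 / g by rewrite divr_ge0// ltW.
have [C [x2 [C0 x20 dec]]] := tl_power_decay q0.
pose C' := 4 * expR 4 * C `^ g.
have C'0 : 0 <= C' by rewrite /C' !mulr_ge0 ?expR_ge0 ?powR_ge0.
(* A telescoping substitute for i^-2: (i + 1) (i + 2) <= 6 i^2 for i >= 1, whence the constant 6. *)
pose w (i : nat) : R := (i.+1%:R * i.+2%:R)^-1.
have w0 i : 0 <= w i by rewrite invr_ge0 mulr_ge0.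
have wS n : \sum_(i < n) w i <= 1.
  suff -> : \sum_(i < n) w i = 1 - n.+1%:R^-1 by rewrite gerBl invr_ge0.
  elim: n => [|n IH]; first by rewrite big_ord0 invr1 subrr.
  rewrite big_ord_recr/= IH /w -[n.+2%:R]natr1.
  have n1 : n.+1%:R != 0 :> R by rewrite pnatr_eq0.
  have n2 : n.+1%:R + 1 != 0 :> R by rewrite natr1 pnatr_eq0.
  by move: n1 n2; move: (n.+1%:R) => a a0 a1; field; rewrite a0 a1.
have C'w n : \sum_(i < n) 6 * C' * w i <= 6 * C' * 1.
  by rewrite -mulr_sumr ler_wpM2l// mulr_ge0.
have C'w0 i : 0 <= 6 * C' * w i by apply: mulr_ge0 => //; exact: mulr_ge0.
have [K1 hK1] := summable_tail C'w0 C'w eta0.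
have two : 0 < 2^-1 :> R by lra.
have nI : \forall x \near +oo, I (x - D) <= 2 * I x.
  by apply: (Itail_shift _ LT D0); [exact: (Itail_gt0 XP tl_expR_gt0)|lra].
have nr : \forall x \near +oo, ratio P X x <= 2 * x.
  have /cvgrPdist_lt /(_ _ ltr01) m1 := rc; have m2 := lam_gt0.
  have m3 : \forall x \near +oo, 1 <= x * lam x by move/cvgryPge : xlam; apply.
  near=> x.
  have lx : 0 < lam x by near: x; exact: m2.
  have h1 : `|1 - ratio P X x / (lam x)^-1| < 1 by near: x; exact: m1.
  have h3 : 1 <= x * lam x by near: x; exact: m3.
  move: h1; rewrite invrK ltr_norml => /andP[h1 _].
  rewrite -(ler_pM2r lx); apply: (@le_trans _ _ 2); first lra.
  by rewrite -mulrA; lra.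
have nx : \forall x \near +oo, [/\ I (x - D) <= 2 * I x, ratio P X x <= 2 * x, 1 <= x & x2 <= x].
  have m1 : \forall x \near +oo, (1 : R) <= x by apply: nbhs_pinfty_ge; exact: num_real.
  have m2 : \forall x \near +oo, x2 <= x by apply: nbhs_pinfty_ge; exact: num_real.
  by near=> x; split; near: x.
have [M [_ hM]] := nx.
(* beyond this point (k + 1) / (k - D - 1) <= b3 / bt1 *)
pose Z := (b3 * (D + 1) + bt1) / (b3 - bt1).
pose K2 := (Num.truncn (`|M| + `|Z| + x1 + D + 3)).+1.
have K2p : `|M| + `|Z| + x1 + D + 3 < K2%:R by exact: truncnS_gt.
have x10 : 0 < x1 by exact: lt_le_trans bx1.
have big k : (maxn K1 K2 <= k)%N -> [/\ (K1 <= k)%N, M < k%:R, x1 <= k%:R - D - 1, 0 < k%:R - D - 1 &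
    bt1 * (k%:R + 1) <= b3 * (k%:R - D - 1)].
  rewrite geq_max => /andP[kK1 kK2].
  have kR : K2%:R <= k%:R :> R by rewrite ler_nat.
  have [Mk xk Dk Zk] := large_index x10 D0 K2p kR; split => //.
  have : Z * (b3 - bt1) <= k%:R * (b3 - bt1) by rewrite ler_wpM2r// subr_ge0 ltW.
  by rewrite /Z divfK ?subr_eq0 ?gt_eqF//; lra.
exists (maxn K1 K2); split=> [k u Kk ku|n].
  have [_ _ xz z0 bz] := big k Kk; set z := k%:R - D - 1 in xz z0 bz.
  have kE : k.+1%:R = k%:R + 1 :> R by rewrite natr1.
  apply: (Itail_kernel XP (expR_ge0 _)) => v uv; rewrite /h !tlE -expRD ler_expR.
  set y := v - k.+1%:R.
  have zy : z <= y by rewrite /z /y kE; lra.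
  have y0 : 0 < y by exact: lt_le_trans zy.
  have vy : v - y = k%:R + 1 by rewrite /y kE; ring.
  have i1 := inc y v (le_trans xz zy) ltac:(rewrite /y gerBl//).
  have i2 := inc z y xz zy.
  have Lz1 : 1 <= Lam z by apply: le_trans L1 _; exact: Lam_le.
  have Lzk : Lam z <= Lam k%:R by apply: Lam_le; rewrite /z -addrA gerDl -opprD oppr_le0 addr_ge0.
  have Ly : Lam y <= 2 + Lam z * (y / z).
    have : bt1 * Lam z * (y - z) / z <= Lam z * ((y - z) / z).
      rewrite -mulrA ler_wpM2r ?divr_ge0 ?(ltW z0) ?subr_ge0//.
      by rewrite ler_piMl ?(le_trans ler01 Lz1)// ltW.
    have -> : Lam z * (y / z) = Lam z + Lam z * ((y - z) / z) by field; rewrite gt_eqF.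
    lra.
  (* Lam y / y is decreasing up to the additive 2, so it may be evaluated at z = k - D - 1, the
     smallest possible y, where (k + 1) / z <= b3 / bt1. *)
  have Lyy : Lam y / y <= (2 + Lam z) / z.
    rewrite ler_pdivrMr//; apply: le_trans Ly _.
    have -> : (2 + Lam z) / z * y = 2 * (y / z) + Lam z * (y / z) by field; rewrite gt_eqF.
    rewrite lerD2r ler_peMr// ler_pdivlMr// mul1r//.
  have key : bt1 * Lam y * (v - y) / y <= b3 * (2 + Lam z).
    rewrite vy; have -> : bt1 * Lam y * (k%:R + 1) / y = (Lam y / y) * (bt1 * (k%:R + 1)).
      by field; rewrite gt_eqF.
    apply: (@le_trans _ _ ((2 + Lam z) / z * (b3 * z))).
      by apply: ler_pM => //; [apply: divr_ge0; [exact: le_trans (le_trans ler01 Lz1) (Lam_le zy)|exact: ltW]|rewrite mulr_ge0// ?(ltW bt1p)// addr_ge0].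
    by rewrite le_eqVlt; apply/orP; left; apply/eqP; field; rewrite gt_eqF.
  have b3z : b3 * Lam z <= b3 * Lam k%:R by rewrite ler_wpM2l// ltW.
  move: key; rewrite mulrDr; lra.
apply: le_trans (hK1 n); rewrite big_mkcond [leRHS]big_mkcond/=; apply: ler_sum => i _.
case: (leqP (maxn K1 K2) i) => Ki; last by case: ifP.
have [iK1 iM _ _ _] := big i Ki; rewrite iK1.
have [j1 j2 j3 j4] := hM _ iM.
set x : R := i%:R in j1 j2 j3 j4 *.
have x0 : 0 < x by exact: lt_le_trans j3.
have Ix : I x <= 2 * x * tl x by rewrite -ler_pdivrMr// tl_expR_gt0.
apply: (@le_trans _ _ (2 * (2 * x * tl x) * h i)).
  by rewrite ler_wpM2r ?expR_ge0//; apply: le_trans j1 _; rewrite ler_wpM2l.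
have -> : 2 * (2 * x * tl x) * h i = 4 * expR 4 * (x * (tl x) `^ g).
  rewrite /h -/x /powR gt_eqF ?tl_expR_gt0// tlE expRK expRD /g.
  have -> : expR ((1 - b3) * - Lam x) = expR (- Lam x) * expR (b3 * Lam x).
    by rewrite -expRD; congr expR; ring.
  ring.
apply: (@le_trans _ _ (4 * expR 4 * (x * (C `^ g * x `^ (- 3%:R))))).
  rewrite ler_wpM2l ?mulr_ge0 ?expR_ge0// ler_wpM2l ?(ltW x0)//.
  have -> : C `^ g * x `^ (- 3%:R) = (C * x `^ (- (3 / g))) `^ g.
    by rewrite powRM ?powR_ge0// -powRrM mulNr divfK// gt_eqF.
  by apply: ge0_ler_powR; rewrite ?nnegrE ?(ltW g0) ?(tl_ge0 P X) ?mulr_ge0 ?powR_ge0//; exact: dec.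
rewrite powR_invn ?(ltW x0)//.
have -> : 4 * expR 4 * (x * (C `^ g * x ^- 3)) = C' * x ^- 2.
  by rewrite /C'; field; rewrite gt_eqF.
rewrite (_ : 6 * C' * w i = C' * (6 * w i)); last by ring.
apply: ler_wpM2l => //.
rewrite /w -[i.+2%:R]natr1 -[i.+1%:R]natr1 -/x.
rewrite ler_pdivlMr; last by rewrite mulr_gt0 ?addr_gt0.
rewrite mulrC ler_pdivrMr ?exprn_gt0//; nra.
Unshelve. all: by end_near. Qed.

Lemma hazard_regular : regular_tail P X (fun t => expR (- t)).
Proof.
have [C C0 dom] := hazard_dom.
have c0 : \forall b \near +oo, 0 < (lam b)^-1.
  by apply: filterS lam_gt0 => b; rewrite invr_gt0.
have mg : measurable_fun setT (fun s : R => expR (- s)).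
  apply: continuous_measurable_fun => s; apply: (@continuous_comp _ _ _ -%R (@expR R)).
    exact: opp_continuous.
  exact: continuous_expR.
have G00 : expR (- (0 : R)) = 1 :> R by rewrite oppr0 expR0.
have Gp : 0 < expR (- (0 : R)) by exact: expR_gt0.
have Gc (t : R) : 0 <= t -> {for t, continuous (fun s : R => expR (- s))}.
  move=> _; apply: (@continuous_comp _ _ _ -%R (@expR R)); first exact: opp_continuous.
  exact: continuous_expR.
have gi (t : R) : 0 <= t ->
    (\int[@lebesgue_measure R]_(s in `[0%R, +oo[) (expR (- (t + s)))%:E = (expR (- t))%:E)%E.
  by move=> _; exact: expR_tail.
have sc (s : R) : 0 <= s -> tl (b + (lam b)^-1 * s) / tl b @[b --> +oo] --> expR (- s).
  move=> s0; have := excess_lim s0; apply: cvg_trans; apply: near_eq_cvg; apply: nearW => b.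
  by rewrite [_ * s]mulrC.
have rs := ratio_scale XP tl_expR_gt0 c0 al1 C0 mg sc dom gi; rewrite G00 in rs.
have LT := Itail_long_tailed XP tl_expR_gt0 c0 al1 C0 mg sc dom gi Gp Gc inv_lam_pinfty.
split => //.
- exact: Itail_gt0 XP tl_expR_gt0.
- exact: (ratio_pinfty XP tl_expR_gt0 c0 al1 C0 mg sc dom gi Gp inv_lam_pinfty).
- exact: (tl_small_ratio XP tl_expR_gt0 c0 al1 C0 mg sc dom gi Gp inv_lam_pinfty).
- exact: hazard_kernel.
- move=> t t0; have := @Itail_ratio_self _ _ _ _ _ _ _ XP _ _ _ _ _ tl_expR_gt0 c0 al1 C0 mg sc dom gi Gp Gc t t0.
  by rewrite G00 mulr1 divr1.
Qed.

End concave_hazard.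

(** * First passage and the lower bound *)

Section passage.
Context (R : realType) d (T : measurableType d).
Implicit Types (X : nat -> T -> R).

(** For 0 <= b the index n is automatically positive, as the definition of [tau] requires. *)
Definition passage X (b : R) n := [set w | b < walk X n w] `&`
  \bigcap_(k < n) [set w | walk X k w <= b].

Lemma walk0 X w : walk X 0 w = 0.
Proof. by rewrite /walk big_ord0. Qed.

Lemma passage_gt0 X b n w : 0 <= b -> passage X b n w -> (0 < n)%N.
Proof. by move=> b0 [+ _]; case: n => //; rewrite /= walk0 ltNge b0. Qed.

Lemma tau_passage X b n w : 0 <= b -> passage X b n w -> tau X b w = n%:R%:E.
Proof.
move=> b0 pw; have n0 := passage_gt0 b0 pw; case: pw => [/= bn prev].
apply/eqP; rewrite eq_le; apply/andP; split.
  by apply: ereal_inf_lbound; exists n.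
apply: le_ereal_inf_tmp => _ [k [k0 bk] <-]; rewrite lee_fin ler_nat leqNgt; apply/negP => kn.
by have := prev k kn; rewrite /= leNgt bk.
Qed.

Lemma ruin_exists X b w : ruin X b w <-> exists2 n, (1 <= n)%N & b < walk X n w.
Proof.
rewrite /ruin /= /tau; split => [|[n n1 bn]].
  move=> h; apply: contrapT => none; move: h.
  rewrite (_ : [set n%:R%:E | n in _] = set0) ?ereal_inf0 ?ltxx//.
  by apply/seteqP; split => // x [n [n1 bn] _]; apply: none; exists n.
apply: (@le_lt_trans _ _ n%:R%:E); last by rewrite ltry.
by apply: ereal_inf_lbound; exists n.
Qed.

Lemma ruin_passage X b : 0 <= b -> ruin X b = \bigcup_n passage X b n.
Proof.
move=> b0; apply/seteqP; split => w.
  move/ruin_exists => [n _ bn]; have ex : exists n, b < walk X n w by exists n.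
  case: (ex_minnP ex) => m bm mmin; exists m => //; split => // k /= km.
  by rewrite leNgt; apply/negP => /mmin; rewrite leqNgt km.
move=> [n _ pw]; apply/ruin_exists; exists n; first exact: passage_gt0 pw.
by case: pw.
Qed.

Lemma passage_inj X b i j w : passage X b i w -> passage X b j w -> i = j.
Proof.
move=> [/= bi hi] [/= bj hj]; have [ij|ij|//] := ltngtP i j; exfalso.
  by have := hj i ij; rewrite /= leNgt bi.
by have := hi j ij; rewrite /= leNgt bj.
Qed.

Lemma rtau_passage X b n w : 0 <= b -> passage X b n w -> rtau X b w = n%:R.
Proof. by move=> b0 pw; rewrite /rtau (tau_passage b0 pw). Qed.

Lemma ntau_passage X b n w : 0 <= b -> passage X b n w -> ntau X b w = n.
Proof. by move=> b0 pw; rewrite /ntau (rtau_passage b0 pw) natrK. Qed.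

End passage.

Lemma Ex_indepM (R : realType) d (T : measurableType d) (P : probability T R)
    (G H : set (set T)) (f : g_sigma_algebraType G -> R) (g : g_sigma_algebraType H -> R) :
  G `<=` @measurable _ T -> H `<=` @measurable _ T ->
  independent_sigma P <<s G >> <<s H >> -> bmf f -> bmf g ->
  \int[P]_w (f w * g w) = (\int[P]_w f w) * (\int[P]_w g w).
Proof.
move=> mG mH GH bf bg.
have sub (K : set (set T)) (h : g_sigma_algebraType K -> R) : K `<=` @measurable _ T ->
    bmf h -> @bmf _ T _ h.
  move=> mK [mh hM]; split => // _ A mA; rewrite setTI.
  have := mh measurableT A mA; rewrite setTI.
  by apply: smallest_sub => //; exact: sigma_algebra_measurable.
have bf' := sub G f mG bf; have bg' := sub H g mH bg.
have bfg : bmf (fun z : g_sigma_algebraType G * g_sigma_algebraType H => f z.1 * g z.2).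
  apply: bmfM.
    by case: bf => m [M h]; split; [exact: (measurableT_comp m measurable_fst)|exists M => z].
  by case: bg => m [M h]; split; [exact: (measurableT_comp m measurable_snd)|exists M => z].
have := decouple mG mH GH bfg => /= ->.
under eq_Rintegral do rewrite ExZ//.
under eq_Rintegral do rewrite mulrC.
by rewrite ExZ// mulrC.
Qed.

Section functionals.
Context (R : realType).

(** Test functionals of the triple of time, path and overshoot. They are non-negative, so that
    discarding trajectories gives lower bounds; the path argument is any function, as in [lipf]. *)
Definition lip3 (K M T0 : R) (Psi : R -> (R -> R) -> R -> R) :=
  (forall s x r, 0 <= Psi s x r <= M) /\
  (forall s x r s' x' r' e, 0 <= e -> `|s - s'| <= e -> `|r - r'| <= e ->
     (forall t, 0 <= t <= T0 -> `|x t - x' t| <= e) ->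
     `|Psi s x r - Psi s' x' r'| <= K * e).

Variables (K M T0 : R) (Psi : R -> (R -> R) -> R -> R).
Hypotheses (K0 : 0 <= K) (T01 : 0 <= T0 < 1) (PsiL : lip3 K M T0 Psi).

Lemma lip3_lipf s r : lipf K M T0 (fun x => Psi s x r).
Proof.
split=> [x|x y e e0 xy].
  by have /andP[h1 h2] := PsiL.1 s x r; rewrite ger0_norm.
by apply: PsiL.2 => //; rewrite subrr normr0.
Qed.

Lemma lip3_eq s x y r : (forall t, 0 <= t <= T0 -> x t = y t) -> Psi s x r = Psi s y r.
Proof.
move=> xy; apply/eqP; rewrite -subr_eq0 -normr_le0 -(mulr0 K).
by apply: PsiL.2; rewrite ?subrr ?normr0// => t tT; rewrite xy// subrr normr0.
Qed.

Definition spath n mu (u : nat -> R) (t : R) :=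
  (\sum_(i < Num.truncn (t * n%:R)) u i - t * mu * n%:R) / Num.sqrt n%:R.

Lemma spath_dist n mu u v e t : 0 <= e -> 0 <= t <= T0 ->
  (forall i, (i < n)%N -> `|u i - v i| <= e) ->
  `|spath n mu u t - spath n mu v t| <= n%:R / Num.sqrt n%:R * e.
Proof.
move=> e0 /andP[t0 tT] uv; rewrite /spath -mulrBl opprB addrA subrK -sumrB normrM.
rewrite [X in _ * X]ger0_norm ?invr_ge0// mulrAC ler_wpM2r ?invr_ge0//.
apply: le_trans (ler_norm_sum _ _ _) _.
have qn : (Num.truncn (t * n%:R) <= n)%N.
  rewrite -(ler_nat R); apply: (@le_trans _ _ (t * n%:R)).
    by rewrite truncn_le mulr_ge0.
  by rewrite ler_piMl// (le_trans tT)// ltW// (andP T01).2.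
apply: (@le_trans _ _ (\sum_(i < Num.truncn (t * n%:R)) e)).
  by apply: ler_sum => i _; apply: uv; exact: leq_trans (ltn_ord i) qn.
by rewrite sumr_const card_ord -[leLHS]mulr_natl ler_wpM2r// ler_nat.
Qed.

Lemma lip3_spath_measurable n mu c b a :
  seq_measurable (fun u => Psi c (spath n mu u) ((\sum_(i < n) u i - b) / a)).
Proof.
pose L := n%:R / Num.sqrt n%:R + n%:R * `|a|^-1.
have L1 : 0 <= n%:R / Num.sqrt n%:R :> R by rewrite divr_ge0.
have L2 : 0 <= n%:R * `|a|^-1 by rewrite mulr_ge0// invr_ge0.
apply: (@lipschitz_seq_measurable _ n (K * L)) => u v e e0 uv.
rewrite -mulrA; apply: PsiL.2.
- by rewrite mulr_ge0// addr_ge0.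
- by rewrite subrr normr0 mulr_ge0// addr_ge0.
- rewrite -mulrBl opprB addrA subrK -sumrB normrM normfV.
  apply: (@le_trans _ _ (n%:R * `|a|^-1 * e)); last by rewrite /L mulrDl lerDr mulr_ge0.
  rewrite mulrAC ler_wpM2r ?invr_ge0//; apply: le_trans (ler_norm_sum _ _ _) _.
  apply: (@le_trans _ _ (\sum_(i < n) e)); first by apply: ler_sum => i _; exact: uv.
  by rewrite sumr_const card_ord -[leLHS]mulr_natl.
- move=> t tT; apply: le_trans (spath_dist mu e0 tT uv) _.
  by rewrite /L mulrDl lerDl mulr_ge0.
Qed.

(* The path stopped at T0 < 1 does not see the last increment, the jump. *)
Lemma spath_prefix n mu u v t : 0 <= t <= T0 -> (forall i, (i < n.-1)%N -> u i = v i) ->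
  spath n mu u t = spath n mu v t.
Proof.
move=> tT uv; rewrite /spath; congr ((_ - _) / _); apply: eq_bigr => i _.
apply: uv; have [n0|n0] := posnP n.
  by move: i; rewrite n0 mulr0 truncn0 => -[].
have h : (Num.truncn (t * n%:R) <= n.-1)%N.
  by rewrite -ltnS prednK//; exact: truncn_grid tT (andP T01).2 n0.
exact: leq_trans (ltn_ord i) h.
Qed.

End functionals.

Section first_passage_law.
Context (R : realType) d (T : measurableType d) (P : probability T R).
Variables (X : nat -> T -> R) (mu sigma : R).
Hypothesis XP : iid_sequence P X mu sigma.

Let mX := iid_measurable XP.

Lemma walk_measurable n : measurable_fun setT (walk X n).
Proof.
rewrite (_ : walk X n = cwalk X 0 0 n); first exact: (cwalkm XP).
by apply/funext => w; exact: walkX.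
Qed.

Lemma measurable_walk_le k b : measurable [set w | walk X k w <= b].
Proof.
rewrite -[X in measurable X]setTI; apply: measurable_fun_ler => //.
exact: walk_measurable.
Qed.

Lemma measurable_passage b n : measurable (passage X b n).
Proof.
apply: measurableI; last by apply: bigcap_measurableType => k _; exact: measurable_walk_le.
by rewrite -[X in measurable X]setTI; apply: measurable_fun_ltr => //; exact: walk_measurable.
Qed.

Lemma measurable_ruin b : 0 <= b -> measurable (ruin X b).
Proof.
move=> b0; rewrite ruin_passage//; apply: bigcupT_measurable => n; exact: measurable_passage.
Qed.

Lemma ruin_exprob b : 0 <= b -> exprob P X n b @[n --> \oo] --> fine (P (ruin X b)).
Proof.
move=> b0; apply: fine_cvg.
rewrite fineK ?fin_num_measure//; last exact: measurable_ruin.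
have -> : ruin X b = \bigcup_n exceed X 0 n b.
  apply/seteqP; split => w.
    by move/ruin_exists => [n n1 bn]; exists n => //; exists n => //; rewrite -walkX.
  move=> [N _ [n nN bn]]; apply/ruin_exists; exists n; last by rewrite walkX.
  by rewrite lt0n; apply/eqP => n0; move: bn; rewrite n0 cwalk0 ltNge b0.
apply: (@nondecreasing_cvg_mu _ _ _ P (fun n => exceed X 0 n b)).
- by move=> n; exact: (measurable_exceed XP).
- by apply: bigcupT_measurable => n; exact: (measurable_exceed XP).
- move=> m n mn; apply/subsetPset => w [j jm h]; exists j => //; exact: leq_trans mn.
Qed.

Lemma ruin_upper (c b : R) : 0 <= b -> (forall N, exprob P X N b <= c) ->
  fine (P (ruin X b)) <= c.
Proof.
move=> b0 h; apply: (cvgr_to_le (ruin_exprob b0)); exact: nearW.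
Qed.

Definition scaled_triple (a b : R) w :=
  (rtau X b w / a, scaled_walk X mu b w, (walk X (ntau X b w) w - b) / a).

Variables (K M T0 : R) (Psi : R -> (R -> R) -> R -> R).
Hypotheses (K0 : 0 <= K) (T01 : 0 <= T0 < 1) (PsiL : lip3 K M T0 Psi).

Definition ruin_functional (a b : R) w : R :=
  let z := scaled_triple a b w in \1_(ruin X b) w * Psi z.1.1 z.1.2 z.2.

Definition passage_functional (a b : R) n w : R :=
  Psi (n%:R / a) (wpath X mu n w) ((walk X n w - b) / a).

Lemma passage_functional_bmf a b n : bmf (passage_functional a b n).
Proof.
split; last by exists M => w; have /andP[? ?] := PsiL.1 (n%:R / a) (wpath X mu n w) ((walk X n w - b) / a); rewrite ger0_norm.
have h := lip3_spath_measurable T01 PsiL n mu (n%:R / a) b a.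
exact: (h _ T X mX).
Qed.

Lemma ruin_functional_passage a b n w : 0 <= b -> passage X b n w ->
  ruin_functional a b w = passage_functional a b n w.
Proof.
move=> b0 pw; rewrite /ruin_functional /scaled_triple /=.
rewrite indicE mem_set; last by rewrite ruin_passage//; exists n.
rewrite mul1r (rtau_passage b0 pw) (ntau_passage b0 pw).
apply: (lip3_eq PsiL) => t tT.
by rewrite /scaled_walk (rtau_passage b0 pw).
Qed.

Lemma ruin_functional_sum a b N w : 0 <= b ->
  \sum_(n < N) \1_(passage X b n) w * passage_functional a b n w <= ruin_functional a b w.
Proof.
move=> b0; have pos : 0 <= ruin_functional a b w.
  rewrite /ruin_functional mulr_ge0// ?indicE//.
  by case/andP: (PsiL.1 (scaled_triple a b w).1.1 (scaled_triple a b w).1.2 (scaled_triple a b w).2).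
have [[n [nN pw]]|none] := pselect (exists n, (n < N)%N /\ passage X b n w); last first.
  rewrite big1// => i _; rewrite indicE memNset ?mul0r// => piw.
  by apply: none; exists i.
rewrite (bigD1 (Ordinal nN))//= big1 ?addr0.
  by rewrite indicE mem_set// mul1r (ruin_functional_passage a b0 pw).
move=> i ik; rewrite indicE memNset ?mul0r// => piw.
have e : (i : nat) = n by exact: passage_inj piw pw.
by move: ik; rewrite -(inj_eq val_inj) /= e eqxx.
Qed.

(** Given the passage time n, the functional depends on n increments; the sums over n converge
    pointwise, since at most one term is non-zero. *)
Lemma ruin_functional_bmf a b : 0 <= b -> bmf (ruin_functional a b).
Proof.
move=> b0; split; last first.
  exists M => w; have := PsiL.1 (scaled_triple a b w).1.1 (scaled_triple a b w).1.2 (scaled_triple a b w).2.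
  rewrite /ruin_functional /= indicE => /andP[h1 h2]; rewrite ger0_norm ?mulr_ge0//.
  by case: (_ \in _); rewrite ?mul1r ?mul0r//; exact: le_trans h2.
have mterm n : measurable_fun setT (fun w => \1_(passage X b n) w * passage_functional a b n w).
  apply: measurable_funM; last by case: (passage_functional_bmf a b n).
  exact/measurable_indic/measurable_passage.
apply: (measurable_fun_cvg (h := fun N w => \sum_(n < N) \1_(passage X b n) w * passage_functional a b n w)).
  by move=> N; exact: (@measurable_sum _ _ _ _ _ _ (fun (n : 'I_N) w => \1_(passage X b n) w * passage_functional a b n w)).
move=> w _; have [rw|nrw] := pselect (ruin X b w).
  move: (rw); rewrite ruin_passage// => -[n _ pw].
  apply: cvg_near_cst; near=> N.
  have nN : (n < N)%N by near: N; exact: nbhs_infty_gt.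
  rewrite (bigD1 (Ordinal nN))//= big1 ?addr0.
    by rewrite indicE mem_set// mul1r (ruin_functional_passage a b0 pw).
  move=> i ik; rewrite indicE memNset ?mul0r// => piw.
  have e : (i : nat) = n by exact: passage_inj piw pw.
  by move: ik; rewrite -(inj_eq val_inj) /= e eqxx.
have -> : ruin_functional a b w = 0 by rewrite /ruin_functional indicE memNset// mul0r.
rewrite (_ : (fun N => _) = fun=> 0); first exact: cvg_cst.
apply/funext => N; rewrite big1// => n _; rewrite indicE memNset ?mul0r// => pw.
by apply: nrw; rewrite ruin_passage//; exists n.
Unshelve. all: by end_near. Qed.

Lemma Itail_step (v h : R) : 0 <= h -> h * tl P X (v + h) <= Itail P X v - Itail P X (v + h) <= h * tl P X v.
Proof.
move=> h0; have mA (x : R) := measurable_X_gt XP 0 x.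
have bi (x : R) : bmf (fun w => h * \1_[set w | x < X 0%N w] w).
  by apply: bmfM; [exact: bmf_cst|exact: bmf_indic].
have hE (x : R) : h * tl P X x = \int[P]_w (h * \1_[set w | x < X 0%N w] w).
  by rewrite ExZ ?Ex_indic//; exact: bmf_indic.
rewrite !hE /Itail -(RintegralB measurableT (intg_excess XP v) (intg_excess XP (v + h))).
have iB := intgB (intg_excess XP v) (intg_excess XP (v + h)).
apply/andP; split; apply: le_Rintegral => //; try exact: bmf_integrable.
  move=> w _; rewrite indicE; case: (boolP (w \in _)); rewrite ?inE/= => hw.
    by rewrite mulr1; do 2?[case: (leP 0 (X 0%N w - _)) => ?]; lra.
  by rewrite mulr0; do 2?[case: (leP 0 (X 0%N w - _)) => ?]; lra.
move=> w _; rewrite indicE; case: (boolP (w \in _)); rewrite ?inE/= => hw.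
  by rewrite mulr1; do 2?[case: (leP 0 (X 0%N w - _)) => ?]; lra.
have {}hw : X 0%N w <= v.
  by rewrite leNgt; apply/negP => h1; move/negP : hw; apply; rewrite inE.
rewrite mulr0.
by do 2?[case: (leP 0 (X 0%N w - _)) => ?]; lra.
Qed.

Lemma sum_telescope_ge (f g : nat -> R) N : (forall n, g n - g n.+1 <= f n) ->
  g 0%N - g N <= \sum_(n < N) f n.
Proof.
move=> fg; elim: N => [|N IH]; first by rewrite big_ord0 subrr.
by rewrite big_ord_recr/=; have := fg N; lra.
Qed.

(** A Riemann sum of mesh m over the times of a window bounds a difference of I from above, at the
    price of one mesh at its left end. *)
Lemma window_ge (m A B v : R) N : 0 < m -> 0 <= A -> B <= N%:R * m ->
  Itail P X (v + A + m) - Itail P X (v + B) <=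
  m * \sum_(n < N) (A < n%:R * m <= B)%R%:R * tl P X (v + n%:R * m).
Proof.
move=> m0 A0 BN.
(* Clamping makes the telescoping differences vanish for indices outside the window, so the sum may
   run over all n < N. *)
pose c x := Num.min B (Num.max x (A + m)).
pose g n := Itail P X (v + c (n%:R * m)).
rewrite mulr_sumr; apply: le_trans (@sum_telescope_ge (fun n =>
  m * ((A < n%:R * m <= B)%R%:R * tl P X (v + n%:R * m))) g N _); last first.
  move=> n; rewrite /g -natr1 mulrDl mul1r; set x := n%:R * m.
  have cm : c x <= c (x + m).
    by rewrite /c le_min ge_min lexx/= ge_min; apply/orP; right; rewrite ge_max !le_max lexx orbT andbT; apply/orP; left; lra.
  case: (ltP A x) => Ax /=; last first.
    rewrite mul0r mulr0 /c [Num.max x _]max_r; last lra.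
    by rewrite [Num.max (x + m) _]max_r ?subrr//; lra.
  case: (leP x B) => xB /=; last first.
    by rewrite mul0r mulr0 /c !min_l ?subrr// le_max; apply/orP; left; lra.
  rewrite mul1r; have d0 : 0 <= c (x + m) - c x by rewrite subr_ge0.
  have cx : x <= c x by rewrite /c le_min xB le_max lexx.
  have dm : c (x + m) - c x <= m.
    have : c (x + m) <= x + m \/ c (x + m) <= A + m.
      by rewrite /c; case: (leP (x + m) (A + m)) => h; [right|left]; rewrite ge_min lexx orbT.
    by case; lra.
  have /andP[_ h] := Itail_step (v + c x) d0.
  have e : v + c x + (c (x + m) - c x) = v + c (x + m) by ring.
  rewrite e in h; apply: (le_trans h); apply: ler_pM => //; first exact: tl_ge0.
  by apply: (tl_le XP); rewrite lerD2l.
rewrite /g mul0r; apply: lerB; apply: (Itail_le XP).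
  rewrite -addrA lerD2l /c ge_min; apply/orP; right; rewrite ge_max lexx andbT; lra.
by rewrite lerD2l /c le_min lexx le_max BN.
Qed.

Lemma window_le (m A B v : R) N : 0 < m -> 0 <= A -> A <= B ->
  m * \sum_(n < N) (A < n%:R * m <= B)%R%:R * tl P X (v + n%:R * m) <=
  Itail P X (v + A - m) - Itail P X (v + B).
Proof.
move=> m0 A0 AB.
pose c x := Num.min B (Num.max x (A - m)).
pose g n := - Itail P X (v + c (n%:R * m - m)).
rewrite mulr_sumr -lerN2 -sumrN; apply: le_trans (@sum_telescope_ge (fun n =>
  - (m * ((A < n%:R * m <= B)%R%:R * tl P X (v + n%:R * m)))) g N _); last first.
  move=> n; rewrite /g -natr1 mulrDl mul1r addrK; set x := n%:R * m.
  have cm : c (x - m) <= c x.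
    by rewrite /c le_min ge_min lexx/= ge_min; apply/orP; right; rewrite ge_max !le_max lexx orbT andbT; apply/orP; left; lra.
  have mono : Itail P X (v + c x) <= Itail P X (v + c (x - m)) by apply: (Itail_le XP); rewrite lerD2l.
  case: (ltP A x) => Ax /=; last by rewrite mul0r mulr0; lra.
  case: (leP x B) => xB /=; last by rewrite mul0r mulr0; lra.
  rewrite mul1r /c !max_l; try lra.
  rewrite !min_r; try lra.
  have /andP[h _] := Itail_step (v + (x - m)) (ltW m0).
  have e : v + (x - m) + m = v + x by ring.
  by rewrite e in h; lra.
rewrite /g mul0r; set I1 := Itail P X (v + c (0 - m)); set I2 := Itail P X (v + c (N%:R * m - m)).
have h1 : I1 <= Itail P X (v + A - m).
  apply: (Itail_le XP); rewrite -addrA lerD2l /c le_min le_max lexx orbT andbT; lra.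
have h2 : Itail P X (v + B) <= I2.
  by apply: (Itail_le XP); rewrite lerD2l /c ge_min lexx.
lra.
Qed.

End first_passage_law.

(** * Cells of times and jumps *)

Section windows.
Context (R : realType).

(** The strip ]0, h] is given up: a jump exceeding b + n m by more than h clears b in spite of the
    noise, and n m > h forces n to be large. *)
Definition win (h : R) i (x : R) : bool := i.+1%:R * h < x <= i.+2%:R * h.

Lemma win_inj (h : R) i j x : 0 < h -> win h i x -> win h j x -> i = j.
Proof.
move=> h0 /andP[i1 i2] /andP[j1 j2]; apply/eqP; rewrite eqn_leq.
have : i.+1%:R * h < j.+2%:R * h by exact: lt_le_trans i1 j2.
have : j.+1%:R * h < i.+2%:R * h by exact: lt_le_trans j1 i2.
by rewrite !ltr_pM2r// !ltr_nat !ltnS => -> ->.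
Qed.

Lemma sum_win (h : R) N (x : R) : 0 < h ->
  (exists2 i, (i < N)%N & win h i x /\ forall f : nat -> R, \sum_(i < N) (win h i x)%:R * f i = f i) \/
  (forall f : nat -> R, \sum_(i < N) (win h i x)%:R * f i = 0).
Proof.
move=> h0; have [[i [iN wi]]|none] := pselect (exists i, (i < N)%N /\ win h i x).
  left; exists i => //; split=> // f; rewrite (bigD1 (Ordinal iN))//= wi mul1r big1 ?addr0// => j ji.
  case: (boolP (win h j x)) => [wj|]; last by rewrite mul0r.
  have e : (j : nat) = i by exact: win_inj wj wi.
  by move: ji; rewrite -(inj_eq val_inj) /= e eqxx.
right=> f; rewrite big1// => j _; case: (boolP (win h j x)) => [wj|]; last by rewrite mul0r.
by exfalso; apply: none; exists j.
Qed.

End windows.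

Section lower_sum.
Context (R : realType) d (T : measurableType d) (P : probability T R).
Variables (X : nat -> T -> R) (mu sigma : R).
Hypothesis XP : iid_sequence P X mu sigma.
Hypothesis mu0 : mu < 0.
Variables (K M T0 : R) (Psi : R -> (R -> R) -> R -> R).
Hypotheses (K0 : 0 <= K) (T01 : 0 <= T0 < 1) (PsiL : lip3 K M T0 Psi).
Local Notation tl := (tl P X).
Local Notation I := (Itail P X).
Local Notation m := (- mu).

Let mX := iid_measurable XP.
Let XI := iid_indep XP.

(** Depends on the first n - 1 increments only, hence is independent of the jump [X n.-1]. *)
Definition quiet (h b : R) n := [set w | `|cwalk X mu 0 n.-1 w| <= h / 2] `&`
  \bigcap_(k < n) [set w | walk X k w <= b].

Lemma quiet_range h b n :
  <<s generators X [set i | (0 <= i < n.-1)%N] >> (quiet h b n).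
Proof.
suff : @measurable _ (g_sigma_algebraType (generators X [set i | (0 <= i < n.-1)%N]))
   (quiet h b n) by [].
apply: measurableI.
  rewrite -[X in measurable X]setTI; apply: measurable_fun_ler => //.
  have hc : range_mfun X 0 n.-1 (cwalk X mu 0 n.-1) by apply: cwalk_range.
  by apply: measurableT_comp => //; exact: hc.
apply: bigcap_measurableType => k /= kn.
rewrite -[X in measurable X]setTI; apply: measurable_fun_ler => //.
rewrite (_ : walk X k = cwalk X 0 0 k); last by apply/funext => w; exact: walkX.
have hc : range_mfun X 0 n.-1 (cwalk X 0 0 k).
  by apply: cwalk_range => //; rewrite add0n -ltnS prednK//; exact: leq_ltn_trans kn.
exact: hc.
Qed.

Lemma quiet_measurable h b n : measurable (quiet h b n).
Proof. apply: (range_event XP (l := 0) (u := n.-1)); exact: quiet_range. Qed.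

Variables (a b eta c : R) (N : nat).
Hypotheses (a0 : 0 < a) (b0 : 0 <= b) (eta0 : 0 < eta) (c0 : 0 <= c).
Hypotheses (ma : m <= a * eta / 2) (cK : K * (2 * eta + eta / m) <= c).
Local Notation h := (a * eta).

Let h0 : 0 < h. Proof. by rewrite mulr_gt0. Qed.
Let m0 : 0 < m. Proof. by rewrite oppr_gt0. Qed.

(* The indices i and j stand for the rectangle in which n m lies in
   ](i + 1) h, (i + 2) h] and the jump X_n - b - n m in ](j + 1) h, (j + 2) h]. *)
Definition cell i j x := Psi (i.+1%:R * eta / m) x (j.+1%:R * eta).

(** c pays for replacing time and overshoot by the corner of their cell; the maximum with 0 keeps
    the quantity usable when cells are dropped. *)
Definition cell_value i j n w : R := Num.max 0 (cell i j (wpath X mu n w) - c) * \1_(quiet h b n) w.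

Lemma cell_value_le i j n w : win h i (n%:R * m) -> win h j (X n.-1 w - b - n%:R * m) ->
  cell_value i j n w <= \1_(passage X b n) w * passage_functional X mu Psi a b n w.
Proof.
move=> wi wj; rewrite /cell_value.
have PF0 : 0 <= passage_functional X mu Psi a b n w.
  by have /andP[] := PsiL.1 (n%:R / a) (wpath X mu n w) ((walk X n w - b) / a).
have rhs0 : 0 <= \1_(passage X b n) w * passage_functional X mu Psi a b n w.
  by rewrite mulr_ge0// indicE.
have [Aw|nA] := pselect (quiet h b n w); last by rewrite indicE memNset// mulr0.
rewrite indicE mem_set// mulr1; have [/= q1 q2] := Aw.
have n0 : (0 < n)%N.
  case: n wi {wj PF0 rhs0 Aw q1 q2} => // /andP[]; rewrite mul0r => h1 _.
  by have : 0 < i.+1%:R * h by [rewrite mulr_gt0]; lra.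
(* The overshoot is the excess of the jump over b + n m, up to the noise, at most h / 2, and one
   drift m <= h / 2. It stays positive, and within 2 h of the corner of its cell. *)
have Sn : walk X n w - b = cwalk X mu 0 n.-1 w + m + (X n.-1 w - b - n%:R * m).
  have nE : n%:R = n.-1%:R + 1 :> R by rewrite natr1 prednK.
  have -> : walk X n w = walk X n.-1 w + X n.-1 w.
    have wS k : walk X k.+1 w = walk X k w + X k w by rewrite /walk big_ord_recr.
    by rewrite -wS prednK.
  by rewrite (walkE X mu) nE; ring.
have /andP[j1 j2] := wj; have /andP[i1 i2] := wi.
have jp : 1 * h <= j.+1%:R * h by rewrite ler_wpM2r ?(ltW h0)// ler1n.
have /andP[c1 c2] : - (h / 2) <= cwalk X mu 0 n.-1 w <= h / 2 by rewrite -ler_norml.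
have pw : passage X b n w.
  by split; [rewrite /= -subr_gt0 Sn; have := m0; lra|].
rewrite indicE mem_set// mul1r ge_max PF0/= lerBlDr.
pose e := 2 * eta + eta / m.
have em0 : 0 <= eta / m by rewrite divr_ge0 ?(ltW eta0) ?(ltW m0).
have e0 : 0 <= e by rewrite addr_ge0// mulr_ge0// ltW.
have := PsiL.2 (i.+1%:R * eta / m) (wpath X mu n w) (j.+1%:R * eta)
  (n%:R / a) (wpath X mu n w) ((walk X n w - b) / a) e e0.
rewrite -/(cell i j (wpath X mu n w)) -/(passage_functional X mu Psi a b n w) => L.
have sD : `|i.+1%:R * eta / m - n%:R / a| <= e.
  apply: (@le_trans _ _ (eta / m)); last by rewrite /e lerDr mulr_ge0// ltW.
  have am : 0 < a * m by rewrite mulr_gt0.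
  have -> : i.+1%:R * eta / m - n%:R / a = (i.+1%:R * h - n%:R * m) / (a * m).
    by field; rewrite lt_eqF//= gt_eqF.
  rewrite normrM [X in _ * X]gtr0_norm ?invr_gt0// ler_pdivrMr//.
  have -> : eta / m * (a * m) = h by field; rewrite lt_eqF.
  have i3 : i.+2%:R * h = i.+1%:R * h + h by rewrite -natr1 mulrDl mul1r.
  by rewrite ler_norml; apply/andP; split; lra.
have rD : `|j.+1%:R * eta - (walk X n w - b) / a| <= e.
  apply: (@le_trans _ _ (2 * eta)); last by rewrite /e lerDl.
  have -> : j.+1%:R * eta - (walk X n w - b) / a = (j.+1%:R * h - (walk X n w - b)) / a.
    by field; rewrite gt_eqF.
  rewrite normrM [X in _ * X]gtr0_norm ?invr_gt0// ler_pdivrMr// Sn.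
  have j3 : j.+2%:R * h = j.+1%:R * h + h by rewrite -natr1 mulrDl mul1r.
  have -> : 2 * eta * a = 2 * h by ring.
  by rewrite ler_norml; apply/andP; have := m0; have := ma; split; lra.
have tD t : 0 <= t <= T0 -> `|wpath X mu n w t - wpath X mu n w t| <= e by rewrite subrr normr0.
have := L sD rD tD; rewrite ler_norml => /andP[_ L2].
by move: cK; rewrite -/e; lra.
Qed.

Definition cell_sum n w : R := \sum_(i < N) (win h i (n%:R * m))%:R *
  \sum_(j < N) (win h j (X n.-1 w - b - n%:R * m))%:R * cell_value i j n w.

Lemma cell_sum_le n w : cell_sum n w <= \1_(passage X b n) w * passage_functional X mu Psi a b n w.
Proof.
have rhs0 : 0 <= \1_(passage X b n) w * passage_functional X mu Psi a b n w.
  rewrite mulr_ge0// ?indicE//.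
  by have /andP[] := PsiL.1 (n%:R / a) (wpath X mu n w) ((walk X n w - b) / a).
rewrite /cell_sum; have [[i iN [wi iE]]|none] := sum_win N (n%:R * m) h0.
  rewrite (iE (fun i => \sum_(j < N) (win h j (X n.-1 w - b - n%:R * m))%:R * cell_value i j n w)).
  have [[j jN [wj jE]]|none] := sum_win N (X n.-1 w - b - n%:R * m) h0.
    by rewrite (jE (fun j => cell_value i j n w)); exact: cell_value_le.
  by rewrite (none (fun j => cell_value i j n w)).
by rewrite (none (fun i => \sum_(j < N) (win h j (X n.-1 w - b - n%:R * m))%:R * cell_value i j n w)).
Qed.

Lemma cell_value_range i j n : @bmf _ (g_sigma_algebraType (generators X [set k | (0 <= k < n.-1)%N])) _
  (cell_value i j n).
Proof.
apply: bmfM; last by apply: bmf_indic; exact: quiet_range.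
have M0 : 0 <= M.
  by have /andP[h1 h2] := PsiL.1 0 (fun=> 0) 0; exact: le_trans h2.
split; last first.
  exists M => w; have /andP[h1 h2] := PsiL.1 (i.+1%:R * eta / m) (wpath X mu n w) (j.+1%:R * eta).
  by rewrite ger0_norm ?le_max ?lexx// ge_max M0/= /cell; have := c0; lra.
apply: measurable_maxr; first exact: measurable_cst.
apply: measurable_funB; last exact: measurable_cst.
pose T1 : measurableType _ := g_sigma_algebraType (generators X [set k | (0 <= k < n.-1)%N]).
have hs := lip3_spath_measurable T01 PsiL n mu (i.+1%:R * eta / m) 0 ((j.+1%:R * eta)^-1).
(* By [spath_prefix] the increments from n - 1 on may be set to 0, which shows measurability with
   respect to the earlier ones. *)
pose v (k : nat) (w : T1) : R := if (k < n.-1)%N then X k w else 0.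
pose f (u : nat -> R) := cell i j (spath n mu u).
have mf : seq_measurable f.
  apply: (@lipschitz_seq_measurable _ n (K * (n%:R / Num.sqrt n%:R))) => u u' e e0 uu.
  rewrite -mulrA; apply: (lip3_lipf PsiL _ _).2; first by rewrite mulr_ge0// divr_ge0.
  by move=> t tT; exact: spath_dist e0 tT uu.
have -> : (fun w : T1 => cell i j (wpath X mu n w)) = fun w => f (fun k => v k w).
  apply/funext => w; apply: (lip3_eq PsiL) => t tT.
  have : spath n mu (X^~ w) t = spath n mu (v^~ w) t.
    by apply: (spath_prefix T01 mu tT) => // k kn; rewrite /v kn.
  exact.
have mv k : measurable_fun setT (v k).
  rewrite /v; case: (ltnP k n.-1) => kn; last exact: measurable_cst.
  by apply: range_mfunX; rewrite kn.
exact: (mf _ _ v mv).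
Qed.

Lemma win_range i n (u : R) : @bmf _ (g_sigma_algebraType (generators X [set k | (n.-1 <= k < n.-1.+1)%N])) _
  (fun w => (win h i (X n.-1 w - u))%:R : R).
Proof.
pose T1 : measurableType _ := g_sigma_algebraType (generators X [set k | (n.-1 <= k < n.-1.+1)%N]).
have mXn : @measurable_fun _ _ T1 R setT (X n.-1) by apply: range_mfunX; rewrite leqnn ltnSn.
have mA : @measurable _ T1 [set w | win h i (X n.-1 w - u)].
  rewrite (_ : [set w | _] = [set w | i.+1%:R * h < X n.-1 w - u] `&` [set w | X n.-1 w - u <= i.+2%:R * h]).
    apply: measurableI; rewrite -[X in measurable X]setTI.
      by apply: measurable_fun_ltr => //; exact: measurable_funB.
    by apply: measurable_fun_ler => //; exact: measurable_funB.
  by apply/seteqP; split => w /=; [move/andP => []|move=> [h1 h2]; apply/andP].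
have := bmf_indic R mA; rewrite (_ : \1_ _ = fun w : T1 => (win h i (X n.-1 w - u))%:R :> R)//.
apply/funext => w; rewrite indicE; congr (nat_of_bool _)%:R.
by apply/idP/idP => [/set_mem|hh]; last exact/mem_set.
Qed.

Lemma win_prob i n (u : R) : \int[P]_w (win h i (X n w - u))%:R =
  tl (u + i.+1%:R * h) - tl (u + i.+2%:R * h).
Proof.
have mA (x : R) := measurable_X_gt XP n x.
rewrite -!(tl_law XP n) -!(Ex_indic P (mA _)) -ExB; [|exact: bmf_indic..].
apply: eq_Rintegral => w _; rewrite !indicE /win.
have s2 : i.+1%:R * h < i.+2%:R * h by rewrite ltr_pM2r// ltr_nat.
have eA (x : R) : (w \in [set w | x < X n w]) = (x < X n w).
  by apply/idP/idP => [/set_mem|hh]; last exact/mem_set.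
rewrite !eA; have -> : (i.+1%:R * h < X n w - u) = (u + i.+1%:R * h < X n w).
  by rewrite ltrBrDl.
have -> : (X n w - u <= i.+2%:R * h) = ~~ (u + i.+2%:R * h < X n w).
  by rewrite -leNgt lerBlDl.
case: (ltP (u + i.+1%:R * h) (X n w)) => h1; case: (ltP (u + i.+2%:R * h) (X n w)) => h2 /=;
  rewrite ?subrr ?subr0//.
by exfalso; lra.
Qed.

Definition cell_mean i j n : R := \int[P]_w cell_value i j n w.

Lemma bmf_sub (G : set (set T)) (f : g_sigma_algebraType G -> R) : G `<=` @measurable _ T ->
  bmf f -> @bmf _ T _ f.
Proof.
move=> mG [mf fM]; split => // _ A mA; rewrite setTI.
have := mf measurableT A mA; rewrite setTI.
by apply: smallest_sub => //; exact: sigma_algebra_measurable.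
Qed.

Lemma cell_value_bmf i j n : @bmf _ T _ (cell_value i j n).
Proof. by apply: (bmf_sub _ (cell_value_range i j n)); exact: generators_measurable. Qed.

Lemma win_bmf i n (u : R) : @bmf _ T _ (fun w => (win h i (X n.-1 w - u))%:R : R).
Proof. by apply: (bmf_sub _ (win_range i n u)); exact: generators_measurable. Qed.

Lemma cell_product i j n :
  \int[P]_w ((win h j (X n.-1 w - b - n%:R * m))%:R * cell_value i j n w) =
  (tl (b + n%:R * m + j.+1%:R * h) - tl (b + n%:R * m + j.+2%:R * h)) * cell_mean i j n.
Proof.
have e w : X n.-1 w - b - n%:R * m = X n.-1 w - (b + n%:R * m) by ring.
under eq_Rintegral do rewrite e mulrC.
rewrite (Ex_indepM (G := generators X [set k | (0 <= k < n.-1)%N])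
  (H := generators X [set k | (n.-1 <= k < n.-1.+1)%N])
  (f := cell_value i j n) (g := fun w => (win h j (X n.-1 w - (b + n%:R * m)))%:R)).
- by rewrite win_prob mulrC.
- exact: generators_measurable.
- exact: generators_measurable.
- by apply: (@range_independent _ _ _ _ _ mX XI 0 n.-1 n.-1 n.-1.+1).
- exact: cell_value_range.
- exact: win_range.
Qed.

Lemma cell_sum_bmf n : bmf (cell_sum n).
Proof.
apply: (bmf_sum (f := fun i w => (win h i (n%:R * m))%:R *
  \sum_(j < N) (win h j (X n.-1 w - b - n%:R * m))%:R * cell_value i j n w)) => i _.
apply: bmfM; first exact: bmf_cst.
apply: (bmf_sum (f := fun j w => (win h j (X n.-1 w - b - n%:R * m))%:R * cell_value i j n w)) => j _.
apply: bmfM; last exact: cell_value_bmf.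
rewrite (_ : (fun w => _) = fun w => (win h j (X n.-1 w - (b + n%:R * m)))%:R); first exact: win_bmf.
by apply/funext => w; congr (nat_of_bool (win _ _ _))%:R; ring.
Qed.

Lemma cell_sum_mean n : \int[P]_w cell_sum n w =
  \sum_(i < N) (win h i (n%:R * m))%:R * \sum_(j < N)
    (tl (b + n%:R * m + j.+1%:R * h) - tl (b + n%:R * m + j.+2%:R * h)) * cell_mean i j n.
Proof.
have bt i j : bmf (fun w => (win h j (X n.-1 w - b - n%:R * m))%:R * cell_value i j n w).
  apply: bmfM; last exact: cell_value_bmf.
  rewrite (_ : (fun w => _) = fun w => (win h j (X n.-1 w - (b + n%:R * m)))%:R); first exact: win_bmf.
  by apply/funext => w; congr (nat_of_bool (win _ _ _))%:R; ring.
have bs i : bmf (fun w => \sum_(j < N) (win h j (X n.-1 w - b - n%:R * m))%:R * cell_value i j n w).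
  by apply: (bmf_sum (f := fun j w => (win h j (X n.-1 w - b - n%:R * m))%:R * cell_value i j n w)).
rewrite /cell_sum (Ex_sum P (f := fun i w => (win h i (n%:R * m))%:R *
  \sum_(j < N) (win h j (X n.-1 w - b - n%:R * m))%:R * cell_value i j n w)); last first.
  by move=> i _; apply: bmfM => //; exact: bmf_cst.
apply: eq_bigr => i _; rewrite ExZ//; congr (_ * _).
rewrite (Ex_sum P (f := fun j w => (win h j (X n.-1 w - b - n%:R * m))%:R * cell_value i j n w))//.
by apply: eq_bigr => j _; exact: cell_product.
Qed.

(** For a fixed cell the jump probability at time n is a difference of two tails. Summed over the
    times of the i-th window, the first is bounded below by [window_ge] and the second above by
    [window_le]; the outcome is, up to shifts by m, a mixed second difference of I over a
    rectangle. *)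
Lemma lower_sum (V : nat -> nat -> R) : (forall i j, 0 <= V i j) ->
  (forall i j n, (i < N)%N -> (j < N)%N -> win h i (n%:R * m) -> V i j <= cell_mean i j n) ->
  \sum_(i < N) \sum_(j < N) V i j * ((I (b + j.+1%:R * h + i.+1%:R * h + m) - I (b + j.+1%:R * h + i.+2%:R * h)
    - (I (b + j.+2%:R * h + i.+1%:R * h - m) - I (b + j.+2%:R * h + i.+2%:R * h))) / m) <=
  \int[P]_w ruin_functional X mu Psi a b w.
Proof.
move=> V0 VF.
pose N' := (Num.truncn (N.+2%:R * h / m)).+1.
have N'p : N.+2%:R * h <= N'%:R * m.
  by rewrite -ler_pdivrMr//; apply: ltW; exact: truncnS_gt.
apply: (@le_trans _ _ (\sum_(n < N') \int[P]_w cell_sum n w)); last first.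
  rewrite -(Ex_sum P (f := cell_sum)); last by move=> n _; exact: cell_sum_bmf.
  apply: Ex_le.
  - by apply: (bmf_sum (f := cell_sum)) => n _; exact: cell_sum_bmf.
  - exact: (ruin_functional_bmf XP T01 PsiL a b0).
  - move=> w; apply: (@le_trans _ _ (\sum_(n < N') \1_(passage X b n) w * passage_functional X mu Psi a b n w)); last exact: (ruin_functional_sum X mu PsiL a N' w b0).
    by apply: ler_sum => n _; exact: cell_sum_le.
pose p j n := tl (b + n%:R * m + j.+1%:R * h) - tl (b + n%:R * m + j.+2%:R * h).
have p0 j n : 0 <= p j n.
  by rewrite subr_ge0; apply: (tl_le XP); rewrite lerD2l ler_pM2r// ler_nat.
apply: (@le_trans _ _ (\sum_(i < N) \sum_(j < N) V i j * \sum_(n < N') (win h i (n%:R * m))%:R * p j n)).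
  apply: ler_sum => i _; apply: ler_sum => j _; apply: ler_wpM2l => //.
  rewrite ler_pdivrMr//.
  have -> : \sum_(n < N') (win h i (n%:R * m))%:R * p j n =
     \sum_(n < N') (win h i (n%:R * m))%:R * tl (b + j.+1%:R * h + n%:R * m) -
     \sum_(n < N') (win h i (n%:R * m))%:R * tl (b + j.+2%:R * h + n%:R * m).
    rewrite -sumrB; apply: eq_bigr => n _; rewrite -mulrBr /p; congr (_ * (tl _ - tl _)); ring.
  have A0 : 0 <= i.+1%:R * h by rewrite mulr_ge0// ltW.
  have AB : i.+1%:R * h <= i.+2%:R * h by rewrite ler_pM2r// ler_nat.
  have BN : i.+2%:R * h <= N'%:R * m.
    by apply: le_trans N'p; rewrite ler_pM2r// ler_nat ltnS ltnS ltnW.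
  rewrite [leRHS]mulrC mulrBr; apply: lerB.
    exact: (window_ge XP (b + j.+1%:R * h) m0 A0 BN).
  exact: (window_le XP (b + j.+2%:R * h) N' m0 A0 AB).
under eq_bigr do under eq_bigr do rewrite mulr_sumr.
under eq_bigr do rewrite exchange_big/=.
rewrite exchange_big/=; apply: ler_sum => n _; rewrite cell_sum_mean.
apply: ler_sum => i _; rewrite mulr_sumr; apply: ler_sum => j _.
rewrite mulrCA; case: (boolP (win h i (n%:R * m))) => wi; last by rewrite !mul0r.
by rewrite !(mul1r, mulr1n) -/(p j n) [leRHS]mulrC; apply: ler_wpM2r => //; exact: VF.
Qed.

End lower_sum.

(** * Riemann sums for the limit law *)

Section limit_law.
Context (R : realType) d' (T' : measurableType d') (P' : probability T' R).
Variables (B : R -> {RV P' >-> R}) (hB : standard_BM B) (sigma : R).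
Hypothesis sigma_ge0 : 0 <= sigma.
Variables (K M T0 : R) (Psi : R -> (R -> R) -> R -> R).
Hypotheses (K0 : 0 <= K) (T01 : 0 <= T0 < 1) (PsiL : lip3 K M T0 Psi).

(** In its uses g is the identity, either of [T'] or from [T'] with the sigma-algebra generated by
    B, where independence of (Y0, Y1) applies. *)
Lemma BM_lip3_measurable d1 (T1 : measurableType d1) (g : T1 -> T') (U V : T1 -> R) :
  (forall t, 0 <= t < 1 -> measurable_fun setT (fun w => B t (g w))) ->
  measurable_fun setT U -> measurable_fun setT V ->
  measurable_fun setT (fun w => Psi (U w) (fun t => sigma * B t (g w)) (V w)).
Proof.
move=> mB mU mV.
pose h m w := Psi (U w) (fun t => sigma * B ((Num.truncn (t * m.+1%:R))%:R / m.+1%:R) (g w)) (V w).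
apply: (measurable_fun_cvg (h := h)) => [m|w _]; last first.
  exact: (psi_grid_cvg hB sigma_ge0 K0 T01 (lip3_lipf PsiL (U w) (V w)) (w := g w)).
(* Coordinates 0 and 1 carry the two real arguments, the path values on the grid follow from 2
   on. *)
pose v k w : R := if k is k'.+2 then (if (k' < m.+1)%N then sigma * B (k'%:R / m.+1%:R) (g w) else 0)
  else if k is 1%N then V w else U w.
pose f (u : nat -> R) := Psi (u 0%N) (fun t => u (Num.truncn (t * m.+1%:R)).+2) (u 1%N).
have mf : seq_measurable f.
  apply: (@lipschitz_seq_measurable _ m.+3 K) => x y e e0 xy.
  apply: PsiL.2 => //; [exact: xy|exact: xy|] => t tT; apply: xy; rewrite !ltnS -ltnS.
  by apply: truncn_grid tT _ _ => //; case/andP: T01.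
have mv k : measurable_fun setT (v k).
  rewrite /v; case: k => [|[|k]]//; case: (ltnP k m.+1) => km; last exact: measurable_cst.
  apply: measurable_funM; first exact: measurable_cst.
  by apply: mB; rewrite divr_ge0//= ltr_pdivrMr ?ltr0n// mul1r ltr_nat.
rewrite (_ : h m = fun w => f (v^~ w)); first exact: (mf _ _ v mv).
apply/funext => w; apply: (lip3_eq PsiL) => t tT /=.
by rewrite (truncn_grid tT)//; case/andP: T01.
Qed.

Variables (Y0 Y1 : {RV P' >-> R}) (G : R -> R) (m : R).
Hypotheses (m0 : 0 < m) (Y_pair : limit_pair Y0 Y1).
Hypothesis Y1_tail : forall t, 0 <= t -> fine (P' [set w | t < Y1 w]) = G t.
Hypothesis B_Y_indep : independent_sigma P'
  (generated_by `[0, 1[ (fun t => B t : T' -> R))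
  (generated_by setT (fun i : bool => if i then Y1 : T' -> R else Y0)).

Let mY (i : bool) : measurable_fun setT (if i then Y1 : T' -> R else Y0).
Proof. by case: i. Qed.

Definition limit_functional w := Psi (Y0 w / m) (fun t => sigma * B t w) (Y1 w).

Lemma limit_functional_bmf : bmf limit_functional.
Proof.
split; last by exists M => w; have /andP[h1 h2] := PsiL.1 (Y0 w / m) (fun t => sigma * B t w) (Y1 w); rewrite ger0_norm.
apply: (@BM_lip3_measurable _ T' id (fun w => Y0 w / m) Y1) => //.
by apply: measurable_funM => //; exact: measurable_cst.
Qed.

Lemma tail_vanish : G n%:R @[n --> \oo] --> 0.
Proof.
have mA (x : R) : measurable [set w | x < Y1 w].
  by rewrite -[X in measurable X]setTI; apply: measurable_fun_ltr.
have -> : 0 = \int[P']_w (fun=> 0 : R) w by rewrite Ex_cst.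
have -> : (fun n => G n%:R) = fun n => \int[P']_w (\1_[set w | n%:R < Y1 w] : T' -> R) w.
  by apply/funext => n; rewrite -Y1_tail// Ex_indic.
apply: (@Ex_cvg _ _ _ _ _ _ 1) => [n|n w|w].
- exact/measurable_indic/mA.
- by rewrite indicE ger0_norm// lern1; case: (_ \in _).
- apply: cvg_near_cst; near=> n; rewrite indicE memNset//= => h.
  have : Y1 w < n%:R by near: n; exact: nbhs_infty_gtr.
  by move=> /(lt_trans h); rewrite ltxx.
Unshelve. all: by end_near. Qed.

Lemma tail_right_continuous : G (n.+1%:R^-1) @[n --> \oo] --> G 0.
Proof.
have mA (x : R) : measurable [set w | x < Y1 w].
  by rewrite -[X in measurable X]setTI; apply: measurable_fun_ltr.
rewrite -Y1_tail// -Ex_indic//.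
have -> : (fun n => G (n.+1%:R^-1)) = fun n => \int[P']_w (\1_[set w | n.+1%:R^-1 < Y1 w] : T' -> R) w.
  by apply/funext => n; rewrite -Y1_tail ?invr_ge0// Ex_indic.
apply: (@Ex_cvg _ _ _ _ _ _ 1) => [n|n w|w].
- exact/measurable_indic/mA.
- by rewrite indicE ger0_norm// lern1; case: (_ \in _).
- apply: cvg_near_cst; near=> n; rewrite !indicE; congr (nat_of_bool _)%:R.
  apply/idP/idP => /set_mem/= h; apply/mem_set => /=.
    by apply: le_lt_trans h; rewrite invr_ge0.
  have : (Y1 w)^-1 < n%:R by near: n; exact: nbhs_infty_gtr.
  move=> h1; rewrite -[X in _ < X]invrK ltf_pV2 ?posrE ?invr_gt0//.
  by apply: (lt_trans h1); rewrite ltr_nat.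
Unshelve. all: by end_near. Qed.

Lemma tail_ge0 t : 0 <= t -> 0 <= G t.
Proof. by move=> t0; rewrite -Y1_tail//; exact: fine_P_ge0. Qed.

Variables (eta c : R) (N : nat).
Hypotheses (eta0 : 0 < eta) (c0 : 0 <= c) (cK : K * (2 * eta + eta / m) <= c).

(** Mixed second difference of G (y0 + y1): the probability that (Y0, Y1) lies in the cell (i, j),
    and also the limit of the differences of I in [lower_sum], divided by I b. *)
Definition rect_prob i j : R :=
  G ((i + j).+2%:R * eta) - G ((i + j).+3%:R * eta) - (G ((i + j).+3%:R * eta) - G ((i + j).+4%:R * eta)).

Lemma rect_mean i j : \int[P']_w ((win eta i (Y0 w))%:R * (win eta j (Y1 w))%:R) = rect_prob i j.
Proof.
pose A y z := [set w | y < Y0 w /\ z < Y1 w].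
have mA (y z : R) : measurable (A y z).
  apply: measurableI; rewrite -[X in measurable X]setTI; exact: measurable_fun_ltr.
have bA y z : bmf (\1_(A y z) : T' -> R) by exact: bmf_indic.
have PA (y z : R) : 0 <= y -> 0 <= z -> \int[P']_w (\1_(A y z) : T' -> R) w = G (y + z).
  by move=> y0 z0; rewrite Ex_indic// (Y_pair.2 _ _ y0 z0) Y1_tail ?addr_ge0.
have k0 k : 0 <= k.+1%:R * eta by rewrite mulr_ge0// ltW.
have kk k : k.+1%:R * eta < k.+2%:R * eta by rewrite ltr_pM2r// ltr_nat.
have e w : (win eta i (Y0 w))%:R * (win eta j (Y1 w))%:R =
   (\1_(A (i.+1%:R * eta) (j.+1%:R * eta)) w - \1_(A (i.+2%:R * eta) (j.+1%:R * eta)) w) -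
   (\1_(A (i.+1%:R * eta) (j.+2%:R * eta)) w - \1_(A (i.+2%:R * eta) (j.+2%:R * eta)) w) :> R.
  have AE y z : (w \in A y z) = (y < Y0 w) && (z < Y1 w).
    by apply/idP/idP => [/set_mem/= [-> ->]|/andP hh]; last exact/mem_set.
  have := kk i; have := kk j; rewrite !indicE !AE /win !leNgt.
  case: (ltP (i.+1%:R * eta) (Y0 w)) => ?; case: (ltP (i.+2%:R * eta) (Y0 w)) => ?;
  case: (ltP (j.+1%:R * eta) (Y1 w)) => ?; case: (ltP (j.+2%:R * eta) (Y1 w)) => ?;
  by rewrite /= => *; rewrite ?(subrr, subr0, mulr1, mulr0, mul0r)//; exfalso; lra.
under eq_Rintegral do rewrite e.
rewrite !ExB//; [|by apply: bmfB..].
rewrite !PA// /rect_prob -!mulrDl -!natrD !addSn !addnS; ring.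
Qed.

Lemma rect_prob_ge0 i j : 0 <= rect_prob i j.
Proof. by rewrite -rect_mean; apply: Ex_ge0 => w; rewrite mulr_ge0. Qed.

Lemma sum_rect_prob : \sum_(i < N) \sum_(j < N) rect_prob i j =
  G (2 * eta) - 2 * G (N.+2%:R * eta) + G ((N + N).+2%:R * eta).
Proof.
have inner i n : \sum_(j < n) rect_prob i j = G (i.+2%:R * eta) - G (i.+3%:R * eta) -
    (G ((i + n).+2%:R * eta) - G ((i + n).+3%:R * eta)).
  elim: n => [|n IH]; first by rewrite big_ord0 addn0 subrr.
  by rewrite big_ord_recr/= IH /rect_prob !addnS; ring.
under eq_bigr do rewrite inner.
have outer n : \sum_(i < n) (G (i.+2%:R * eta) - G (i.+3%:R * eta) -
    (G ((i + N).+2%:R * eta) - G ((i + N).+3%:R * eta))) =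
    G (2 * eta) - G (n.+2%:R * eta) - (G (N.+2%:R * eta) - G ((n + N).+2%:R * eta)).
  elim: n => [|n IH]; first by rewrite big_ord0 add0n !subrr.
  by rewrite big_ord_recr/= IH !addSn; ring.
by rewrite outer; ring.
Qed.

Definition cell_limit i j : R := \int[P']_w Psi (i.+1%:R * eta / m) (fun t => sigma * B t w) (j.+1%:R * eta).

Lemma rect_cell_mean i j :
  \int[P']_w (Psi (i.+1%:R * eta / m) (fun t => sigma * B t w) (j.+1%:R * eta) *
     ((win eta i (Y0 w))%:R * (win eta j (Y1 w))%:R)) = cell_limit i j * rect_prob i j.
Proof.
pose GB := [set E | exists t (A : set R), [/\ `[0, 1[%classic t, measurable A & E = (B t : T' -> R) @^-1` A]].
pose GY := [set E | exists i (A : set R), [/\ setT i, measurable A &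
  E = (if i : bool then Y1 : T' -> R else Y0) @^-1` A]].
have mGB : GB `<=` @measurable _ T'.
  by move=> _ [t [A [_ mA ->]]]; rewrite -[X in measurable X]setTI; exact: (measurable_funPT (B t)).
have mGY : GY `<=` @measurable _ T'.
  by move=> _ [k [A [_ mA ->]]]; rewrite -[X in measurable X]setTI; exact: mY.
have mc (x : R) : @measurable_fun _ _ (g_sigma_algebraType GB) R setT (fun=> x) by exact: measurable_cst.
rewrite (@Ex_indepM _ _ _ P' GB GY (fun w => Psi (i.+1%:R * eta / m) (fun t => sigma * B t w) (j.+1%:R * eta))
  (fun w => (win eta i (Y0 w))%:R * (win eta j (Y1 w))%:R)) ?rect_mean//.
- split; last by exists M => w; have /andP[h1 h2] := PsiL.1 (i.+1%:R * eta / m) (fun t => sigma * B t w) (j.+1%:R * eta); rewrite ger0_norm.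
  apply: (@BM_lip3_measurable _ (g_sigma_algebraType GB) (fun w => w) (fun=> i.+1%:R * eta / m) (fun=> j.+1%:R * eta)).
  + move=> t t01 _ A mA; rewrite setTI; apply: sub_sigma_algebra; exists t, A; split => //.
  + exact: mc.
  + exact: mc.
- have mb (b : bool) k : @bmf _ (g_sigma_algebraType GY) _
      (fun w => (win eta k ((if b then Y1 : T' -> R else Y0) w))%:R : R).
    have mYb : @measurable_fun _ _ (g_sigma_algebraType GY) R setT (if b then Y1 : T' -> R else Y0).
      by move=> _ A mA; rewrite setTI; apply: sub_sigma_algebra; exists b, A.
    have mA : @measurable _ (g_sigma_algebraType GY) [set w : T' | win eta k ((if b then Y1 : T' -> R else Y0) w)].
      rewrite (_ : [set w : T' | _] = [set w : T' | k.+1%:R * eta < (if b then Y1 : T' -> R else Y0) w] `&`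
        [set w : T' | (if b then Y1 : T' -> R else Y0) w <= k.+2%:R * eta]).
        apply: measurableI; rewrite -[X in measurable X]setTI.
          exact: measurable_fun_ltr.
        exact: measurable_fun_ler.
      by apply/seteqP; split => w /=; [move/andP => []|move=> [h1 h2]; apply/andP].
    have := bmf_indic R mA; rewrite (_ : \1_ _ = fun w : g_sigma_algebraType GY => (win eta k ((if b then Y1 : T' -> R else Y0) w))%:R :> R)//.
    apply/funext => w; rewrite indicE; congr (nat_of_bool _)%:R.
    by apply/idP/idP => [/set_mem|hh]; last exact/mem_set.
  by apply: bmfM; [exact: (mb false i)|exact: (mb true j)].
Qed.

(** The Riemann sum matching [lower_sum]: inside a cell the functional exceeds its corner value by
    at most c, and outside all cells it is at most M. *)
Lemma limit_upper : \int[P']_w limit_functional w <=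
  \sum_(i < N) \sum_(j < N) cell_limit i j * rect_prob i j + c +
  M * (1 - \sum_(i < N) \sum_(j < N) rect_prob i j).
Proof.
pose r i j w : R := (win eta i (Y0 w))%:R * (win eta j (Y1 w))%:R.
pose cl i j w := Psi (i.+1%:R * eta / m) (fun t => sigma * B t w) (j.+1%:R * eta).
have M0 : 0 <= M by have /andP[h1 h2] := PsiL.1 0 (fun=> 0) 0; exact: le_trans h2.
have br i j : bmf (r i j).
  have mb (Y : {RV P' >-> R}) k : bmf (fun w => (win eta k (Y w))%:R : R).
    have mA : measurable [set w : T' | win eta k (Y w)].
      rewrite (_ : [set w : T' | _] = [set w : T' | k.+1%:R * eta < Y w] `&` [set w : T' | Y w <= k.+2%:R * eta]).
        apply: measurableI; rewrite -[X in measurable X]setTI.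
          exact: measurable_fun_ltr.
        exact: measurable_fun_ler.
      by apply/seteqP; split => w /=; [move/andP => []|move=> [h1 h2]; apply/andP].
    have := bmf_indic R mA; rewrite (_ : \1_ _ = fun w => (win eta k (Y w))%:R :> R)//.
    apply/funext => w; rewrite indicE; congr (nat_of_bool _)%:R.
    by apply/idP/idP => [/set_mem|hh]; last exact/mem_set.
  exact: bmfM.
have bcl i j : bmf (cl i j).
  split; last by exists M => w; have /andP[h1 h2] := PsiL.1 (i.+1%:R * eta / m) (fun t => sigma * B t w) (j.+1%:R * eta); rewrite ger0_norm.
  exact: (@BM_lip3_measurable _ T' id (fun=> i.+1%:R * eta / m) (fun=> j.+1%:R * eta)).
have bS (f : nat -> nat -> T' -> R) : (forall i j, bmf (f i j)) ->
    bmf (fun w => \sum_(i < N) \sum_(j < N) f i j w).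
  move=> bf; apply: (bmf_sum (f := fun i w => \sum_(j < N) f i j w)) => i _.
  by apply: (bmf_sum (f := f i)).
have ES (f : nat -> nat -> T' -> R) : (forall i j, bmf (f i j)) ->
    \int[P']_w (\sum_(i < N) \sum_(j < N) f i j w) = \sum_(i < N) \sum_(j < N) \int[P']_w f i j w.
  move=> bf; rewrite (Ex_sum P' (f := fun i w => \sum_(j < N) f i j w)).
    by apply: eq_bigr => i _; rewrite (Ex_sum P' (f := f i)).
  by move=> i _; apply: (bmf_sum (f := f i)).
have bcr i j : bmf (fun w => cl i j w * r i j w) by exact: bmfM.
apply: (@le_trans _ _ (\int[P']_w (\sum_(i < N) \sum_(j < N) cl i j w * r i j w + c +
    M * (1 - \sum_(i < N) \sum_(j < N) r i j w)))); last first.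
  have b1 := bS _ bcr; have b2 := bS _ br.
  have b3 : bmf (fun w : T' => 1 - \sum_(i < N) \sum_(j < N) r i j w) by apply: bmfB => //; exact: bmf_cst.
  have b4 := bmf_cst T' c; have b5 := bmf_cst T' (1 : R).
  rewrite (ExD P' (bmfD b1 b4) (bmfM (bmf_cst T' M) b3)) (ExD P' b1 b4) (ExZ P' M b3) (ExB P' b5 b2) !Ex_cst.
  rewrite (ES _ bcr) (ES _ br); under eq_bigr do under eq_bigr do rewrite rect_cell_mean.
  by under [X in M * (1 - X)]eq_bigr do under eq_bigr do rewrite rect_mean.
have b1 := bS _ bcr; have b2 := bS _ br.
apply: Ex_le.
- exact: limit_functional_bmf.
- apply: bmfD; first by apply: bmfD => //; exact: bmf_cst.
  by apply: bmfM; [exact: bmf_cst|apply: bmfB => //; exact: bmf_cst].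
move=> w; have /andP[f0 fM] : 0 <= limit_functional w <= M by exact: PsiL.1.
have sE (f : nat -> nat -> R) : \sum_(i < N) \sum_(j < N) f i j * r i j w =
    \sum_(i < N) (win eta i (Y0 w))%:R * \sum_(j < N) (win eta j (Y1 w))%:R * f i j.
  apply: eq_bigr => i _; rewrite mulr_sumr; apply: eq_bigr => j _; rewrite /r; ring.
have -> : \sum_(i < N) \sum_(j < N) r i j w =
    \sum_(i < N) (win eta i (Y0 w))%:R * \sum_(j < N) (win eta j (Y1 w))%:R * 1.
  by rewrite -[RHS](sE (fun _ _ => 1)); apply: eq_bigr => i _; apply: eq_bigr => j _; rewrite mul1r.
rewrite (sE (fun i j => cl i j w)).
have [[i iN [wi iE]]|none] := sum_win N (Y0 w) eta0; last first.
  rewrite (none (fun i => \sum_(j < N) (win eta j (Y1 w))%:R * cl i j w)).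
  by rewrite (none (fun i => \sum_(j < N) (win eta j (Y1 w))%:R * 1)); have := c0; lra.
rewrite (iE (fun i => \sum_(j < N) (win eta j (Y1 w))%:R * cl i j w)).
rewrite (iE (fun i => \sum_(j < N) (win eta j (Y1 w))%:R * 1)).
have [[j jN [wj jE]]|none] := sum_win N (Y1 w) eta0; last first.
  by rewrite (none (fun j => cl i j w)) (none (fun=> 1)); have := c0; lra.
rewrite (jE (fun j => cl i j w)) (jE (fun=> 1)) subrr mulr0 addr0.
have em0 : 0 <= eta / m by rewrite divr_ge0 ?ltW.
pose e := 2 * eta + eta / m; have e0 : 0 <= e by rewrite addr_ge0// mulr_ge0// ltW.
have eM : eta <= e by rewrite /e; have := eta0; lra.
have eE : eta / m <= e by rewrite /e; have := eta0; lra.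
have kS k : k.+2%:R * eta = k.+1%:R * eta + eta by rewrite -natr1 mulrDl mul1r.
have := PsiL.2 (Y0 w / m) (fun t => sigma * B t w) (Y1 w) (i.+1%:R * eta / m) (fun t => sigma * B t w) (j.+1%:R * eta) e e0.
rewrite -/(limit_functional w) -/(cl i j w) => L.
have hs : `|Y0 w / m - i.+1%:R * eta / m| <= e.
  apply: le_trans eE; rewrite -mulrBl normrM [X in _ * X]gtr0_norm ?invr_gt0//.
  rewrite ler_pM2r ?invr_gt0//; move/andP: wi; rewrite kS => -[h1 h2].
  by rewrite ler_norml; apply/andP; split; lra.
have hr : `|Y1 w - j.+1%:R * eta| <= e.
  apply: le_trans eM; move/andP: wj; rewrite kS => -[h1 h2].
  by rewrite ler_norml; apply/andP; split; lra.
have := L hs hr; have hx t : 0 <= t <= T0 -> `|sigma * B t w - sigma * B t w| <= e by rewrite subrr normr0.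
move=> /(_ hx) L2; have := cK; rewrite -/e; have := ler_norm (limit_functional w - cl i j w); lra.
Qed.

End limit_law.

Lemma cvg_sum_ord (R : realType) S (F : set_system S) (FF : Filter F) n (f : nat -> S -> R) (l : nat -> R) :
  (forall i, f i x @[x --> F] --> l i) -> \sum_(i < n) f i x @[x --> F] --> \sum_(i < n) l i.
Proof.
move=> fl; elim: n => [|n IH].
  by rewrite big_ord0; under eq_fun do rewrite big_ord0; exact: cvg_cst.
rewrite big_ord_recr/=; under eq_fun do rewrite big_ord_recr/=.
exact: cvgD.
Qed.

(** * The lower bound *)

Section lower_bound.
Context (R : realType) d (T : measurableType d) (P : probability T R).
Variables (X : nat -> T -> R) (mu sigma : R) (G : R -> R).
Hypothesis XP : iid_sequence P X mu sigma.
Hypothesis mu0 : mu < 0.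
Hypothesis sigma_ge0 : 0 <= sigma.
Hypothesis XG : regular_tail P X G.
Local Notation tl := (tl P X).
Local Notation I := (Itail P X).
Local Notation a := (ratio P X).
Local Notation m := (- mu).

Let I_gt0 := regular_gt0 XG.
Let m0 : 0 < m. Proof. by rewrite oppr_gt0. Qed.

Lemma Itail_vanish : I b @[b --> +oo] --> (0 : R).
Proof.
have [M hM] := Itail_sum_bounded XP 0.
have hn n : n%:R * I n%:R <= M.
  apply: le_trans (hM n); rewrite mulr_natl -[X in _ *+ X]card_ord -sumr_const.
  by apply: ler_sum => i _; apply: (Itail_le XP); rewrite subr0 ler_nat ltnW.
apply/cvgrPdist_le => e e0; pose k := (Num.truncn `|M / e|).+1.
have k0 : (0 : R) < k%:R by rewrite ltr0n.
have kM : M <= e * k%:R.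
  by rewrite mulrC -ler_pdivrMr//; apply: ltW; apply: le_lt_trans (ler_norm _) (truncnS_gt _).
near=> b; rewrite sub0r normrN gtr0_norm//.
apply: (@le_trans _ _ (I k%:R)).
  by apply: (Itail_le XP); near: b; apply: nbhs_pinfty_ge; exact: num_real.
by rewrite -(ler_pM2l k0) [leRHS]mulrC; exact: le_trans kM.
Unshelve. all: by end_near. Qed.

Lemma Itail_translate (L : R) : I (x + L) / I x @[x --> +oo] --> (1 : R).
Proof.
have neg (l : R) : 0 <= l -> I (x - l) / I x @[x --> +oo] --> (1 : R) by exact: (regular_long XG).
have [L0|L0] := leP L 0.
  by have := neg (- L); rewrite opprK; apply; rewrite oppr_ge0.
have h : (I (x - L) / I x)^-1 @[x --> +oo] --> (1 : R).
  by rewrite -[X in _ --> X]invr1; apply: cvgV; [exact: oner_neq0|exact: neg (ltW L0)].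
have := @cvg_shift_pinfty R L _ _ h.
apply: cvg_trans; apply: near_eq_cvg; apply: nearW => x.
by rewrite [L + x]addrC addrK invf_div.
Qed.

Lemma excess_translate (t L : R) : 0 <= t -> I (b + a b * t + L) / I b @[b --> +oo] --> G t.
Proof.
move=> t0; rewrite -[X in _ --> X]mul1r.
have shift : b + a b * t @[b --> +oo] --> +oo.
  apply/cvgryPge => A; near=> b; apply: (@le_trans _ _ b).
    by near: b; apply: nbhs_pinfty_ge; exact: num_real.
  rewrite lerDl mulr_ge0//; near: b.
  by move/cvgryPge : (regular_ratio XG) => /(_ 0).
have h := cvg_comp _ _ shift (Itail_translate L).
apply: cvg_trans (cvgM h (regular_excess XG t0)); apply: near_eq_cvg; apply: nearW => b /=.
by rewrite mulrA mulfVK// gt_eqF.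
Unshelve. all: by end_near. Qed.

Section functional.
Context d' (T' : measurableType d') (P' : probability T' R).
Variables (B : R -> {RV P' >-> R}) (hB : standard_BM B).
Variables (K M T0 : R) (Psi : R -> (R -> R) -> R -> R).
Hypotheses (K0 : 0 <= K) (T01 : 0 <= T0 < 1) (PsiL : lip3 K M T0 Psi).

Let M0 : 0 <= M.
Proof. by have /andP[h1 h2] := PsiL.1 0 (fun=> 0) 0; exact: le_trans h2. Qed.

Section cells.
Variables (eta c : R) (N : nat).
Hypotheses (eta0 : 0 < eta) (c0 : 0 <= c) (cK : K * (2 * eta + eta / m) <= c).

(** In the window n is of order h at most, so Chebyshev's bound n / h^2 is of order 1 / h. An early
    passage above b has probability at most C I b, by the first form of the upper bound, and I b
    vanishes. *)
Lemma noise_prob_cvg (dl : R) : 0 < dl -> \forall b \near +oo, forall n (i : nat), (i < N)%N ->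
  win (a b * eta) i (n%:R * m) -> fine (P (~` quiet X mu (a b * eta) b n)) <= dl.
Proof.
move=> dl0; have [C C0 hC] := exprob_bounded XP mu0 I_gt0 (regular_long XG) (regular_small XG) (regular_kernel XG).
pose Q := 4 * N.+1%:R * sigma ^+ 2 / m / eta.
have Q0 : 0 <= Q by rewrite !divr_ge0 ?(ltW m0) ?(ltW eta0)// mulr_ge0 ?sqr_ge0// mulr_ge0 ?ler0n.
near=> b => n i iN wi.
have ab : 0 < a b.
  near: b; move/cvgryPgt : (regular_ratio XG) => /(_ 0); exact.
set h := a b * eta; have h0 : 0 < h by rewrite mulr_gt0.
have b0 : 0 <= b by near: b; apply: nbhs_pinfty_ge; exact: num_real.
have n0 : (0 < n)%N.
  rewrite lt0n; apply/eqP => nz; move: wi; rewrite nz mul0r => /andP[h1 _].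
  by move: h1; rewrite ltNge mulr_ge0// ltW.
have mc (p k : nat) := cwalk_measurable XP p k.
have mA : measurable [set w | h / 2 <= `|cwalk X mu 0 n.-1 w|].
  rewrite -[X in measurable X]setTI; apply: measurable_fun_ler => //.
  by apply: measurableT_comp => //.
have mE := measurable_exceed XP 0 n b.
have sub : ~` quiet X mu h b n `<=` [set w | h / 2 <= `|cwalk X mu 0 n.-1 w|] `|` exceed X 0 n b.
  move=> w /= nq; have [hw|hw] := leP (h / 2) `|cwalk X mu 0 n.-1 w|; [by left|right].
  apply: contrapT => ne; apply: nq; split; first exact: ltW.
  move=> k kn /=; rewrite leNgt; apply/negP => hk; apply: ne; exists k; first exact: ltnW.
  by rewrite -walkX.
have mq : measurable (~` quiet X mu h b n) by apply: measurableC; exact: quiet_measurable XP _ _ _.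
apply: (le_trans (fine_P_le P mq (measurableU _ _ mA mE) sub)).
have un : fine (P ([set w | h / 2 <= `|cwalk X mu 0 n.-1 w|] `|` exceed X 0 n b)) <=
    fine (P [set w | h / 2 <= `|cwalk X mu 0 n.-1 w|]) + fine (P (exceed X 0 n b)).
  rewrite -fineD ?fin_num_measure// fine_le// ?fin_numD ?fin_num_measure//; last exact: measureU2.
  exact: measurableU.
apply: (le_trans un).
have h2 : 0 < h / 2 by rewrite divr_gt0.
have p1 := cwalk_chebyshev XP 0 n.-1 h2.
have p2 : fine (P (exceed X 0 n b)) <= C * I b by exact: hC.
have p3 : C * I b <= dl / 2.
  near: b; have h : C * I b @[b --> +oo] --> (0 : R).
    by rewrite -[X in _ --> X](mulr0 C); apply: cvgMl_tmp; exact: Itail_vanish.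
  have /cvgrPdist_le := h => /(_ (dl / 2)); rewrite divr_gt0// => /(_ isT); apply: filterS => b.
  by rewrite sub0r normrN => /(le_trans (ler_norm _)).
have nm : n%:R * m <= N.+1%:R * h.
  move/andP: wi => [_ /le_trans]; apply; rewrite ler_pM2r// ler_nat ltnS.
  exact: iN.
have p4 : n.-1%:R * sigma ^+ 2 / (h / 2) ^+ 2 <= Q / a b.
  apply: (@le_trans _ _ (n%:R * sigma ^+ 2 / (h / 2) ^+ 2)).
    by rewrite ler_wpM2r ?invr_ge0 ?sqr_ge0// ler_wpM2r ?sqr_ge0// ler_nat leq_pred.
  rewrite ler_pdivrMr ?exprn_gt0//.
  have -> : Q / a b * (h / 2) ^+ 2 = (N.+1%:R * h) * (sigma ^+ 2 / m).
    rewrite /Q /h; have z1 := lt0r_neq0 eta0; have z2 := lt0r_neq0 ab; have z3 := ltr0_neq0 mu0.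
    by field; rewrite z1 z2 z3.
  have -> : n%:R * sigma ^+ 2 = (n%:R * m) * (sigma ^+ 2 / m) by field; rewrite lt_eqF.
  by rewrite ler_wpM2r// divr_ge0 ?sqr_ge0// ltW.
have p5 : Q / a b <= dl / 2.
  rewrite ler_pdivrMr// -ler_pdivrMl ?divr_gt0//; near: b.
  by move/cvgryPge : (regular_ratio XG) => /(_ _); exact.
lra.
Unshelve. all: by end_near. Qed.

Local Notation v := (cell_limit B sigma Psi m eta).

(** Donsker's theorem is applied to finitely many pairs (i, j) with a common threshold n0, and n m >
    a b * eta in every window makes n pass it. *)
Lemma cell_mean_cvg (dl : R) : 0 < dl -> \forall b \near +oo, forall (i j n : nat),
  (i < N)%N -> (j < N)%N -> win (a b * eta) i (n%:R * m) ->
  Num.max 0 (v i j - c - dl) <= cell_mean P X mu Psi (a b) b eta c i j n.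
Proof.
move=> dl0.
have [n0 hn0] : exists n0 : nat, forall i j n, (i < N)%N -> (j < N)%N -> (n0 <= n)%N ->
    v i j - dl / 2 <= \int[P]_w Psi (i.+1%:R * eta / m) (wpath X mu n w) (j.+1%:R * eta).
  have one (i j : 'I_N) : \forall n \near \oo, v i j - dl / 2 <=
      \int[P]_w Psi (i.+1%:R * eta / m) (wpath X mu n w) (j.+1%:R * eta).
    have dl2 : 0 < dl / 2 by rewrite divr_gt0.
    have /cvgrPdist_le := donsker XP hB sigma_ge0 K0 M0 T01 (lip3_lipf PsiL (i.+1%:R * eta / m) (j.+1%:R * eta)).
    move=> /(_ _ dl2); apply: filterS => n h.
    have := le_trans (ler_norm _) h; rewrite /cell_limit => h'; lra.
  have : \forall n \near \oo, forall i j : 'I_N, v i j - dl / 2 <=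
      \int[P]_w Psi (i.+1%:R * eta / m) (wpath X mu n w) (j.+1%:R * eta).
    by apply: filter_forall => i; apply: filter_forall => j; exact: one.
  move=> [n0 _ h]; exists n0 => i j n iN jN n0n; exact: (h n n0n (Ordinal iN) (Ordinal jN)).
have dM : 0 < dl / 2 / (M + 1) by rewrite !divr_gt0// ltr_wpDl.
near=> b => i j n iN jN wi.
have ab : 0 < a b.
  near: b; move/cvgryPgt : (regular_ratio XG) => /(_ 0); exact.
set h := a b * eta; have h0 : 0 < h by rewrite mulr_gt0.
have nl : (n0 <= n)%N.
  rewrite -(ler_nat R) -(ler_pM2r m0); apply: ltW; apply: le_lt_trans (andP wi).1.
  apply: (@le_trans _ _ (1 * h)); last by rewrite ler_wpM2r ?(ltW h0)// ler1n.
  rewrite mul1r -ler_pdivrMr//; near: b.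
  by move/cvgryPge : (regular_ratio XG) => /(_ _); exact.
have Pq : fine (P (~` quiet X mu h b n)) <= dl / 2 / (M + 1).
  have : forall n (i : nat), (i < N)%N ->
    win (a b * eta) i (n%:R * m) -> fine (P (~` quiet X mu (a b * eta) b n)) <= dl / 2 / (M + 1).
    by near: b; exact: noise_prob_cvg.
  by move=> /(_ n i iN wi).
have cv0 w : 0 <= cell_value X mu Psi (a b) b eta c i j n w.
  by rewrite mulr_ge0// ?le_max ?lexx// indicE.
rewrite ge_max; apply/andP; split; first exact: Ex_ge0.
have mq := quiet_measurable XP h b n.
have mqC := measurableC mq.
have bcl : bmf (fun w => Psi (i.+1%:R * eta / m) (wpath X mu n w) (j.+1%:R * eta)).
  exact: (wpath_bmf XP T01 (lip3_lipf PsiL (i.+1%:R * eta / m) (j.+1%:R * eta))).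
have bI : bmf (\1_(~` quiet X mu h b n) : T -> R) by exact: bmf_indic.
have bMI : bmf (fun w => M * \1_(~` quiet X mu h b n) w) by apply: bmfM => //; exact: bmf_cst.
have bc := bmf_cst T c.
apply: (@le_trans _ _ (\int[P]_w (Psi (i.+1%:R * eta / m) (wpath X mu n w) (j.+1%:R * eta) - c
    - M * \1_(~` quiet X mu h b n) w))).
  rewrite (ExB P (bmfB bcl bc) bMI) (ExB P bcl bc) Ex_cst (ExZ P M bI) Ex_indic//.
  have e1 := hn0 i j n iN jN nl.
  have e2 : M * fine (P (~` quiet X mu h b n)) <= dl / 2.
    apply: (@le_trans _ _ ((M + 1) * (dl / 2 / (M + 1)))).
      by apply: ler_pM => //; [exact: fine_P_ge0|rewrite lerDl].
    by rewrite mulrCA mulfV ?mulr1// gt_eqF// ltr_wpDl.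
  lra.
apply: Ex_le => //.
- by apply: bmfB => //; exact: bmfB.
- exact: (cell_value_bmf XP T01 PsiL _ _ _ c0).
move=> w; rewrite /cell_value /cell -/h !indicE in_setC.
have /andP[h1 h2] := PsiL.1 (i.+1%:R * eta / m) (wpath X mu n w) (j.+1%:R * eta).
case: (_ \in _) => /=.
  by rewrite mulr0 mulr1 subr0 le_max lexx orbT.
by rewrite mulr1 mulr0; have := c0; lra.
Unshelve. all: by end_near. Qed.

Lemma ruin_lower_cells (dl : R) : 0 < dl -> \forall b \near +oo,
  (\sum_(i < N) \sum_(j < N) Num.max 0 (v i j - c - dl) * rect_prob G eta i j - dl) * (I b / m) <=
  \int[P]_w ruin_functional X mu Psi (a b) b w.
Proof.
move=> dl0; pose V i j := Num.max 0 (v i j - c - dl).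
have V0 i j : 0 <= V i j by rewrite le_max lexx.
(* The shifts by m, - m and 0 give all four terms the form treated by [excess_translate], which
   makes the shifts disappear in the limit. *)
pose D b i j := I (b + a b * ((i + j).+2%:R * eta) + m) / I b - I (b + a b * ((i + j).+3%:R * eta) + 0) / I b
   - (I (b + a b * ((i + j).+3%:R * eta) - m) / I b - I (b + a b * ((i + j).+4%:R * eta) + 0) / I b).
have Dcvg i j : D b i j @[b --> +oo] --> rect_prob G eta i j.
  have k0 k : 0 <= k%:R * eta by rewrite mulr_ge0// ltW.
  by apply: cvgB; apply: cvgB; exact: excess_translate.
have Scvg : \sum_(i < N) \sum_(j < N) V i j * D b i j @[b --> +oo] -->
    \sum_(i < N) \sum_(j < N) V i j * rect_prob G eta i j.
  apply: (@cvg_sum_ord _ _ _ _ N (fun i b => \sum_(j < N) V i j * D b i j) (fun i => \sum_(j < N) V i j * rect_prob G eta i j)) => i.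
  by apply: (@cvg_sum_ord _ _ _ _ N (fun j b => V i j * D b i j) (fun j => V i j * rect_prob G eta i j)) => j; apply: cvgMl_tmp; exact: Dcvg.
near=> b.
have ab : 0 < a b.
  near: b; move/cvgryPgt : (regular_ratio XG) => /(_ 0); exact.
have b0 : 0 <= b by near: b; apply: nbhs_pinfty_ge; exact: num_real.
have ma : m <= a b * eta / 2.
  rewrite ler_pdivlMr// -ler_pdivrMr//; near: b.
  by move/cvgryPge : (regular_ratio XG) => /(_ _); exact.
have VF : forall i j n, (i < N)%N -> (j < N)%N -> win (a b * eta) i (n%:R * m) ->
    V i j <= cell_mean P X mu Psi (a b) b eta c i j n.
  by near: b; exact: cell_mean_cvg.
have LS := lower_sum XP mu0 T01 PsiL ab b0 eta0 c0 ma cK V0 VF.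
apply: (le_trans _ LS).
apply: (@le_trans _ _ ((\sum_(i < N) \sum_(j < N) V i j * D b i j) * (I b / m))).
  apply: ler_wpM2r; first by rewrite divr_ge0 ?(ltW m0)// ltW.
  rewrite lerBlDr; near: b.
  have /cvgrPdist_le := Scvg => /(_ _ dl0); apply: filterS => b h.
  by have := le_trans (ler_norm _) h; rewrite lerBlDl addrC.
rewrite le_eqVlt; apply/orP; left; apply/eqP; rewrite mulr_suml; apply: eq_bigr => i _.
rewrite mulr_suml; apply: eq_bigr => j _; rewrite /D.
have eS k : k.+1%:R = k%:R + 1 :> R by rewrite natr1.
set h := a b * eta.
have -> : b + a b * ((i + j).+2%:R * eta) + m = b + j.+1%:R * h + i.+1%:R * h - mu.
  by rewrite /h !eS natrD; ring.
have -> : b + a b * ((i + j).+3%:R * eta) + 0 = b + j.+1%:R * h + i.+2%:R * h.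
  by rewrite /h !eS natrD; ring.
have -> : b + a b * ((i + j).+3%:R * eta) - m = b + j.+2%:R * h + i.+1%:R * h - m.
  by rewrite /h !eS natrD; ring.
have -> : b + a b * ((i + j).+4%:R * eta) + 0 = b + j.+2%:R * h + i.+2%:R * h.
  by rewrite /h !eS natrD; ring.
have z1 := lt0r_neq0 (I_gt0 b); have z3 := ltr0_neq0 mu0.
by field; rewrite z1 z3.
Unshelve. all: by end_near. Qed.

End cells.

Variables (Y0 Y1 : {RV P' >-> R}).
Hypothesis Y_pair : limit_pair Y0 Y1.
Hypothesis Y1_tail : forall t, 0 <= t -> fine (P' [set w | t < Y1 w]) = G t.
Hypothesis B_Y_indep : independent_sigma P'
  (generated_by `[0, 1[ (fun t => B t : T' -> R))
  (generated_by setT (fun i : bool => if i then Y1 : T' -> R else Y0)).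

Lemma regular_G0 : G 0 = 1.
Proof.
have h := regular_excess XG (lexx 0).
have e : (fun b => I (b + a b * 0) / I b) = fun=> 1.
  by apply/funext => b; rewrite mulr0 addr0 mulfV// gt_eqF.
by apply: (cvg_unique _ h) => //; rewrite e; exact: cvg_cst.
Qed.

Lemma ruin_lower (e : R) : 0 < e -> \forall b \near +oo,
  (\int[P']_w limit_functional B sigma Psi Y0 Y1 m w - e) * (I b / m) <=
  \int[P]_w ruin_functional X mu Psi (a b) b w.
Proof.
move=> e0; have e8 : 0 < e / 8 by rewrite divr_gt0.
(* eta makes the cells fine and the strips given up along the axes light; N, chosen next, makes the
   region beyond the cells light. *)
have [eta [eta0 heta1 heta2]] : exists eta, [/\ 0 < eta, K * (2 * eta + eta / m) <= e / 8 & M * (1 - G (2 * eta)) <= e / 8].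
  have hG : M * (1 - G n.+1%:R^-1) @[n --> \oo] --> M * (1 - G 0).
    by apply: cvgMl_tmp; apply: cvgB; [exact: cvg_cst|exact: tail_right_continuous Y1_tail].
  rewrite regular_G0 subrr mulr0 in hG.
  have /cvgrPdist_le /(_ _ e8) h1 := hG.
  have hK : K * (n.+1%:R^-1 + n.+1%:R^-1 / 2 / m) @[n --> \oo] --> (0 : R).
    have hn : n.+1%:R^-1 @[n --> \oo] --> (0 : R) by exact: cvg_harmonic.
    rewrite -[X in _ --> X](mulr0 K); apply: cvgMl_tmp; rewrite -[X in _ --> X]addr0; apply: cvgD => //.
    rewrite -[X in _ --> X](mul0r m^-1); apply: cvgMr_tmp.
    by rewrite -[X in _ --> X](mul0r 2^-1); apply: cvgMr_tmp.
  have /cvgrPdist_le /(_ _ e8) h2 := hK.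
  near \oo => n; exists (n.+1%:R^-1 / 2).
  have e2 : 2 * (n.+1%:R^-1 / 2) = n.+1%:R^-1 :> R by rewrite mulrC divfK.
  split; rewrite ?e2.
  - by rewrite divr_gt0// invr_gt0.
  - have : `|0 - K * (n.+1%:R^-1 + n.+1%:R^-1 / 2 / m)| <= e / 8 by near: n.
    by rewrite sub0r normrN => /(le_trans (ler_norm _)).
  - have : `|0 - M * (1 - G n.+1%:R^-1)| <= e / 8 by near: n.
    by rewrite sub0r normrN => /(le_trans (ler_norm _)).
have [N hN] : exists N : nat, M * (2 * G (N.+2%:R * eta)) <= e / 4.
  have h : M * (2 * G n%:R) @[n --> \oo] --> (0 : R).
    rewrite -[X in _ --> X](mulr0 M); apply: cvgMl_tmp; rewrite -[X in _ --> X](mulr0 2); apply: cvgMl_tmp.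
    exact: tail_vanish Y1_tail.
  have /cvgrPdist_le := h => /(_ (e / 4)); rewrite divr_gt0// => /(_ isT) [k _ hk].
  pose N := Num.truncn (k%:R / eta); exists N.
  apply: (@le_trans _ _ (M * (2 * G k%:R))); last first.
    by have := hk k (leqnn k); rewrite /= sub0r normrN => /(le_trans (ler_norm _)).
  have k0 : 0 <= k%:R / eta by rewrite divr_ge0// ltW.
  have kN : k%:R <= N.+2%:R * eta.
    by rewrite -ler_pdivrMr//; apply: ltW; apply: (lt_trans (truncnS_gt _)); rewrite ltr_nat.
  do 2!apply: ler_wpM2l => //; rewrite -!Y1_tail//; last by rewrite mulr_ge0// ltW.
  apply: fine_P_le; try by rewrite -[X in measurable X]setTI; apply: measurable_fun_ltr.
  by move=> w /=; exact: le_lt_trans.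
have c0 := ltW e8.
near=> b.
have main : (\sum_(i < N) \sum_(j < N) Num.max 0 (cell_limit B sigma Psi m eta i j - e / 8 - e / 8) *
    rect_prob G eta i j - e / 8) * (I b / m) <= \int[P]_w ruin_functional X mu Psi (a b) b w.
  by near: b; exact: ruin_lower_cells.
apply: (le_trans _ main); apply: ler_wpM2r; first by rewrite divr_ge0 ?(ltW m0)// ltW.
have up := limit_upper hB sigma_ge0 K0 T01 PsiL m0 Y_pair Y1_tail B_Y_indep N eta0 c0 heta1.
have q0 i j : 0 <= rect_prob G eta i j by exact: (rect_prob_ge0 Y_pair Y1_tail eta0).
have sq := sum_rect_prob G eta N.
set SQ := \sum_(i < N) \sum_(j < N) rect_prob G eta i j in up sq.
have GN : 0 <= G ((N + N).+2%:R * eta) by apply: (tail_ge0 Y1_tail); rewrite mulr_ge0// ltW.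
have SQ0 : 0 <= SQ by apply: sumr_ge0 => i _; apply: sumr_ge0.
have SQ1 : SQ <= 1.
  have G1 : G (2 * eta) <= 1.
    rewrite -Y1_tail; last by rewrite mulr_ge0// ltW.
    apply: fine_P_le1.
    by rewrite -[X in measurable X]setTI; apply: measurable_fun_ltr.
  have GG : G ((N + N).+2%:R * eta) <= G (N.+2%:R * eta).
    have k0 k : 0 <= k%:R * eta by rewrite mulr_ge0// ltW.
    rewrite -!Y1_tail//; apply: fine_P_le; try by rewrite -[X in measurable X]setTI; apply: measurable_fun_ltr.
    by move=> w /=; apply: le_lt_trans; rewrite ler_wpM2r ?(ltW eta0)// ler_nat !ltnS leq_addr.
  by rewrite sq; have : 0 <= G (N.+2%:R * eta) by [exact: le_trans GG]; lra.
have MSQ : M * (1 - SQ) <= e / 8 + e / 4.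
  rewrite sq; apply: (@le_trans _ _ (M * (1 - G (2 * eta)) + M * (2 * G (N.+2%:R * eta)))); last by rewrite lerD.
  by rewrite -mulrDr ler_wpM2l//; lra.
have low : \sum_(i < N) \sum_(j < N) cell_limit B sigma Psi m eta i j * rect_prob G eta i j - (e / 8 + e / 8) * SQ <=
    \sum_(i < N) \sum_(j < N) Num.max 0 (cell_limit B sigma Psi m eta i j - e / 8 - e / 8) * rect_prob G eta i j.
  rewrite /SQ mulr_sumr -sumrB; apply: ler_sum => i _; rewrite mulr_sumr -sumrB; apply: ler_sum => j _.
  by rewrite -mulrBl opprD addrA ler_wpM2r// le_max lexx orbT.
have : (e / 8 + e / 8) * SQ <= e / 8 + e / 8 by rewrite ler_piMr// addr_ge0.
set A := \sum_(i < N) \sum_(j < N) _ in up low *.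
set A' := \sum_(i < N) \sum_(j < N) _ in low *.
set L := \int[P']_w _ in up *.
by move=> h; move: up low MSQ h e0; move: A A' L => A A' L *; lra.
Unshelve. all: by end_near. Qed.

Lemma ruin_limsup (e : R) : 0 < e -> \forall b \near +oo,
  fine (P (ruin X b)) <= (1 + e) * (I b / m).
Proof.
move=> e0; near=> b.
have b0 : 0 <= b by near: b; apply: nbhs_pinfty_ge; exact: num_real.
apply: (ruin_upper XP b0); rewrite mulrA mulrAC; near: b.
have := exprob_upper XP mu0 I_gt0 (regular_long XG) (regular_small XG) (regular_kernel XG) e0.
exact.
Unshelve. all: by end_near. Qed.

End functional.
End lower_bound.

(** * Weak convergence *)

Section lower_envelope.
Context (R : realType).
Variables (Phi : R * skorokhod01 R * R -> R) (M : R).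
Hypothesis PhiM : forall z, 0 <= Phi z <= M.

Definition horizon k : R := k%:R / k.+1%:R.

Lemma horizon01 k : 0 <= horizon k < 1.
Proof.
by rewrite /horizon divr_ge0//= ltr_pdivrMr ?ltr0n// mul1r ltr_nat.
Qed.

(* The value M keeps the set nonempty when x stays far from every cadlag path. *)
Definition envelope_set k (s : R) (x : R -> R) (r : R) := [set u | u = M \/
  exists (z : R * skorokhod01 R * R) (dl : R), [/\ 0 <= dl, `|s - z.1.1| <= dl, `|r - z.2| <= dl,
    forall t, 0 <= t <= horizon k -> `|x t - z.1.2 t| <= dl & u = Phi z + k%:R * dl]].

Definition envelope k s x r : R := inf (envelope_set k s x r).

Let M0 : 0 <= M.
Proof.
have cst : cadlag01 (fun=> 0 : R) by split=> t _; [|exists 0]; exact: cvg_cst.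
by have /andP[h1 h2] := PhiM (0, to_skorokhod01 cst, 0); exact: le_trans h2.
Qed.

Lemma envelope_set_ge0 k s x r : lbound (envelope_set k s x r) 0.
Proof.
move=> u [->//|[z [dl [dl0 _ _ _ ->]]]].
by rewrite addr_ge0 ?mulr_ge0//; case/andP: (PhiM z).
Qed.

Lemma envelope_le k s x r u : envelope_set k s x r u -> envelope k s x r <= u.
Proof. by move=> h; apply: ge_inf => //; exists 0; exact: envelope_set_ge0. Qed.

Lemma envelope_ge k s x r (c : R) : (forall u, envelope_set k s x r u -> c <= u) -> c <= envelope k s x r.
Proof. by move=> h; apply: lb_le_inf => //; exists M; left. Qed.

Lemma envelope_lip3 k : lip3 k%:R M (horizon k) (envelope k).
Proof.
split=> [s x r|s x r s' x' r' e e0 ss rr xx].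
  rewrite envelope_le; last by left.
  by rewrite andbT envelope_ge//; exact: envelope_set_ge0.
have one s1 x1 r1 s2 x2 r2 : `|s1 - s2| <= e -> `|r1 - r2| <= e ->
    (forall t, 0 <= t <= horizon k -> `|x1 t - x2 t| <= e) ->
    envelope k s1 x1 r1 - k%:R * e <= envelope k s2 x2 r2.
  move=> h1 h2 h3; apply: envelope_ge => u [->|[z [dl [dl0 z1 z2 z3 ->]]]].
    by rewrite lerBlDr (le_trans (envelope_le (or_introl erefl)))// lerDl mulr_ge0.
  rewrite lerBlDr -addrA -mulrDr; apply: envelope_le; right; exists z, (dl + e); split => //.
  - exact: addr_ge0.
  - by apply: le_trans (ler_distD s2 _ _) _; rewrite addrC lerD.
  - by apply: le_trans (ler_distD r2 _ _) _; rewrite addrC lerD.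
  - by move=> t tT; apply: le_trans (ler_distD (x2 t) _ _) _; rewrite addrC lerD ?h3 ?z3.
have i1 := one _ _ _ _ _ _ ss rr xx.
have i2 : envelope k s' x' r' - k%:R * e <= envelope k s x r.
  by apply: one => [||t tT]; rewrite distrC// xx.
by rewrite ler_norml; apply/andP; split; lra.
Qed.

Lemma envelope_le_fun k (z : R * skorokhod01 R * R) : envelope k z.1.1 z.1.2 z.2 <= Phi z.
Proof.
apply: envelope_le; right; exists z, 0; split; rewrite ?subrr ?normr0//.
  by move=> t _; rewrite subrr normr0.
by rewrite mulr0 addr0.
Qed.

(** A competitor at distance at least rho / 2 pays a penalty above M for large k. A closer one lies
    in the neighbourhood where Phi varies by less than e: with the identity as time change, uniform
    closeness up to [horizon k] >= T is closeness in the Skorokhod sense. *)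
Lemma envelope_cvg (z : R * skorokhod01 R * R) : continuous Phi ->
  envelope k z.1.1 z.1.2 z.2 @[k --> \oo] --> Phi z.
Proof.
move=> cPhi; apply/cvgrPdist_le => e e0.
case: z => [[s y] r] /=.
have /cvgrPdist_lt /(_ e e0) [[Q1 Q2] /= [nQ1 nQ2] QQ] := cPhi (s, y, r).
have [[Q3 Q4] /= [nQ3 nQ4] QQ1] := nQ1.
have [e3 /= e30 B3] : exists2 e3 : R, 0 < e3 & forall s', `|s - s'| < e3 -> Q3 s'.
  by case/nbhs_ballP: nQ3 => e3 /= e30 h; exists e3.
have [e2 /= e20 B2] : exists2 e2 : R, 0 < e2 & forall r', `|r - r'| < e2 -> Q2 r'.
  by case/nbhs_ballP: nQ2 => e2 /= e20 h; exists e2.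
have [Tq [e4 [/andP[Tq0 Tq1] e40 B4]]] := nQ4.
pose rho := Num.min e3 (Num.min e2 e4).
have rho0 : 0 < rho by rewrite !lt_min e30 e20.
have r3 : rho <= e3 by rewrite ge_min lexx.
have r2 : rho <= e2 by rewrite /rho !ge_min lexx !orbT.
have r4 : rho <= e4 by rewrite /rho !ge_min lexx !orbT.
near=> k.
have kM : M <= k%:R * (rho / 2).
  by rewrite -ler_pdivrMr ?divr_gt0//; near: k; exact: nbhs_infty_ger.
have kT : Tq <= horizon k.
  have : (1 - Tq)^-1 <= k%:R by near: k; exact: nbhs_infty_ger.
  have q0 : 0 < 1 - Tq by rewrite subr_gt0.
  move=> h; rewrite /horizon ler_pdivlMr ?ltr0n// -natr1.
  by move: h; rewrite -div1r ler_pdivrMr//; lra.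
have low : Phi (s, y, r) - e <= envelope k s y r.
  have PM : Phi (s, y, r) <= M by case/andP: (PhiM (s, y, r)).
  apply: envelope_ge => u [->|[[[s' y'] r'] [dl /= [dl0 z1 z2 z3 ->]]]]; first lra.
  have P0 : 0 <= Phi (s', y', r') by case/andP: (PhiM (s', y', r')).
  have [h|h] := leP (rho / 2) dl.
    have : k%:R * (rho / 2) <= k%:R * dl by rewrite ler_wpM2l.
    by move=> h1; lra.
  have hr : dl < rho by apply: (lt_trans h); lra.
  have kd : 0 <= k%:R * dl by rewrite mulr_ge0.
  suff : `|Phi (s, y, r) - Phi (s', y', r')| < e by move/ltr_normlW; lra.
  apply: (QQ (s', y', r')); split => /=.
    apply: (QQ1 (s', y')); split => /=.
      by apply: B3; apply: le_lt_trans z1 _; exact: lt_le_trans r3.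
    apply: B4; exists id; first exact: time_change01_id.
    move=> t /andP[t0 tT]; rewrite subrr normr0; split => //.
    rewrite distrC; apply: le_lt_trans (z3 t _) _; last exact: lt_le_trans r4.
    by rewrite t0 (le_trans tT).
  by apply: B2; apply: le_lt_trans z2 _; exact: lt_le_trans r2.
have up := envelope_le_fun k (s, y, r).
by rewrite ler_norml; apply/andP; split; move: up low => /=; lra.
Unshelve. all: by end_near. Qed.

End lower_envelope.

(** A is the integral of Phi over ruin, U the ruin probability, J = I b / m. The difference E U - A
    is at most e (1 + M) J + M e J in absolute value, and e <= 1/2 gives J <= 2 U, hence the factor
    2 (1 + 2 M). *)
Lemma ratio_estimate (R : realType) (A U J E M e eps : R) : 1 <= M -> `|E| <= M ->
  0 < e -> e <= 2^-1 -> e * (2 * (1 + 2 * M)) <= eps -> 0 < J ->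
  (E + M - e) * J <= A + M * U -> (M - E - e) * J <= M * U - A ->
  (1 - e) * J <= U -> U <= (1 + e) * J -> `|E - A / U| <= eps.
Proof.
move=> M1 EM e0 eh eE J0 L1 L2 L3 L4.
have U0 : 0 < U by apply: lt_le_trans L3; rewrite mulr_gt0// subr_gt0 (le_lt_trans eh)//; lra.
have UJ : J <= 2 * U.
  have : e * J <= 2^-1 * J by rewrite ler_wpM2r// ltW.
  by lra.
have -> : E - A / U = (E * U - A) / U by rewrite mulrBl mulfK// gt_eqF.
rewrite normrM [X in _ * X]gtr0_norm ?invr_gt0// ler_pdivrMr//.
have MU : M * U <= M * ((1 + e) * J) by rewrite ler_wpM2l//; lra.
have AEJ : `|E * J - A| <= e * (1 + M) * J by rewrite ler_norml; apply/andP; split; lra.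
have EUJ : `|E * (U - J)| <= M * (e * J).
  by rewrite normrM ler_pM// ler_norml; apply/andP; split; lra.
apply: (@le_trans _ _ (e * (1 + 2 * M) * J)).
  have -> : E * U - A = (E * J - A) + E * (U - J) by ring.
  by apply: le_trans (ler_normD _ _) _; lra.
apply: (@le_trans _ _ (e * (1 + 2 * M) * (2 * U))).
  by rewrite ler_wpM2l// mulr_ge0 ?(ltW e0)//; lra.
have -> : e * (1 + 2 * M) * (2 * U) = e * (2 * (1 + 2 * M)) * U by ring.
by rewrite ler_wpM2r// ltW.
Qed.

Section weak_limit.
Context (R : realType) d (T : measurableType d) (P : probability T R).
Variables (X : nat -> T -> R) (mu sigma : R) (G : R -> R).
Hypothesis XP : iid_sequence P X mu sigma.
Hypothesis mu0 : mu < 0.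
Hypothesis sigma_ge0 : 0 <= sigma.
Hypothesis XG : regular_tail P X G.
Context d' (T' : measurableType d') (P' : probability T' R).
Variables (B : R -> {RV P' >-> R}) (hB : standard_BM B).
Variables (Y0 Y1 : {RV P' >-> R}).
Hypothesis Y_pair : limit_pair Y0 Y1.
Hypothesis Y1_tail : forall t, 0 <= t -> fine (P' [set w | t < Y1 w]) = G t.
Hypothesis B_Y_indep : independent_sigma P'
  (generated_by `[0, 1[ (fun t => B t : T' -> R))
  (generated_by setT (fun i : bool => if i then Y1 : T' -> R else Y0)).
Local Notation I := (Itail P X).
Local Notation a := (ratio P X).
Local Notation m := (- mu).

Let I_gt0 := regular_gt0 XG.
Let m0 : 0 < m. Proof. by rewrite oppr_gt0. Qed.

Definition Zb b w : R * skorokhod01 R * R :=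
  (rtau X b w / a b, scaled_walk_path X mu b w, (walk X (ntau X b w) w - b) / a b).
Definition Zlim w : R * skorokhod01 R * R := (Y0 w / m, scaled_BM_path hB sigma w, Y1 w).

Section nonnegative.
Variables (Phi : R * skorokhod01 R * R -> R) (M : R).
Hypothesis PhiM : forall z, 0 <= Phi z <= M.
Hypothesis cPhi : continuous Phi.

Lemma envelope_Zlim k w :
  limit_functional B sigma (envelope Phi M k) Y0 Y1 m w = envelope Phi M k (Zlim w).1.1 (Zlim w).1.2 (Zlim w).2.
Proof.
apply: (lip3_eq (envelope_lip3 PhiM k)) => t /andP[t0 tT].
by rewrite /= /restr01 t0 (le_lt_trans tT)//; case/andP: (horizon01 R k).
Qed.

Lemma envelope_Zb k b w :
  ruin_functional X mu (envelope Phi M k) (a b) b w =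
  \1_(ruin X b) w * envelope Phi M k (Zb b w).1.1 (Zb b w).1.2 (Zb b w).2.
Proof.
congr (_ * _); apply: (lip3_eq (envelope_lip3 PhiM k)) => t /andP[t0 tT].
by rewrite /= /restr01 t0 (le_lt_trans tT)//; case/andP: (horizon01 R k).
Qed.

Lemma Zlim_bmf : bmf (fun w => Phi (Zlim w)).
Proof.
split; last by exists M => w; have /andP[h1 h2] := PhiM (Zlim w); rewrite ger0_norm.
apply: (measurable_fun_cvg (h := fun k => limit_functional B sigma (envelope Phi M k) Y0 Y1 m)) => [k|w _].
  by case: (limit_functional_bmf hB sigma_ge0 (ler0n _ k) (horizon01 R k) (envelope_lip3 PhiM k) Y0 Y1 m).
by under eq_fun do rewrite envelope_Zlim; exact: envelope_cvg.
Qed.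

Lemma Zb_bmf b : 0 <= b -> bmf (fun w => \1_(ruin X b) w * Phi (Zb b w)).
Proof.
move=> b0; split; last first.
  exists M => w; have /andP[h1 h2] := PhiM (Zb b w); rewrite ger0_norm ?mulr_ge0// ?indicE//.
  by case: (_ \in _); rewrite ?mul1r ?mul0r//; exact: le_trans h2.
apply: (measurable_fun_cvg (h := fun k => ruin_functional X mu (envelope Phi M k) (a b) b)) => [k|w _].
  by case: (ruin_functional_bmf XP (horizon01 R k) (envelope_lip3 PhiM k) (a b) b0).
by under eq_fun do rewrite envelope_Zb; apply: cvgMl_tmp; exact: envelope_cvg.
Qed.

Lemma ruin_liminf (e : R) : 0 < e -> \forall b \near +oo,
  (\int[P']_w Phi (Zlim w) - e) * (I b / m) <= \int[P]_w (\1_(ruin X b) w * Phi (Zb b w)).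
Proof.
move=> e0; have e2 : 0 < e / 2 by rewrite divr_gt0.
have ecvg : \int[P']_w limit_functional B sigma (envelope Phi M k) Y0 Y1 m w @[k --> \oo] -->
    \int[P']_w Phi (Zlim w).
  apply: (@Ex_cvg _ _ _ _ _ _ M) => [k|k w|w].
  - by case: (limit_functional_bmf hB sigma_ge0 (ler0n _ k) (horizon01 R k) (envelope_lip3 PhiM k) Y0 Y1 m).
  - rewrite envelope_Zlim; have /andP[h1 h2] := (envelope_lip3 PhiM k).1 (Zlim w).1.1 (Zlim w).1.2 (Zlim w).2.
    by rewrite ger0_norm.
  - by under eq_fun do rewrite envelope_Zlim; exact: envelope_cvg.
have /cvgrPdist_le /(_ _ e2) [k _ hk] := ecvg.
have {}hk := le_trans (ler_norm _) (hk k (leqnn k)).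
near=> b.
have b0 : 0 <= b by near: b; apply: nbhs_pinfty_ge; exact: num_real.
have main : (\int[P']_w limit_functional B sigma (envelope Phi M k) Y0 Y1 m w - e / 2) * (I b / m) <=
    \int[P]_w ruin_functional X mu (envelope Phi M k) (a b) b w.
  near: b; exact: (ruin_lower XP mu0 sigma_ge0 XG hB (ler0n _ k) (horizon01 R k) (envelope_lip3 PhiM k) Y_pair Y1_tail B_Y_indep).
apply: (@le_trans _ _ (\int[P]_w ruin_functional X mu (envelope Phi M k) (a b) b w)).
  apply: le_trans main; apply: ler_wpM2r; first by rewrite divr_ge0 ?(ltW m0)// ltW.
  by move: hk => /=; lra.
apply: Ex_le; [exact: (ruin_functional_bmf XP (horizon01 R k) (envelope_lip3 PhiM k) (a b) b0)|exact: Zb_bmf|].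
by move=> w; rewrite envelope_Zb ler_wpM2l ?indicE//; exact: envelope_le_fun.
Unshelve. all: by end_near. Qed.

End nonnegative.

Lemma weak_limit (Phi : R * skorokhod01 R * R -> R) : continuous Phi ->
  (exists M : R, forall z, `|Phi z| <= M) ->
  (\int[P]_w (\1_(ruin X b) w * Phi (Zb b w))) / fine (P (ruin X b)) @[b --> +oo] -->
  \int[P']_w Phi (Zlim w).
Proof.
move=> cPhi [M0 hM0]; pose M := `|M0| + 1.
have M1 : 1 <= M by rewrite /M lerDr.
have hM z : - M <= Phi z <= M.
  by rewrite -ler_norml (le_trans (hM0 z))// (le_trans (ler_norm _))// lerDl.
have PhiM z : 0 <= Phi z + M <= M + M by have /andP[h1 h2] := hM z; apply/andP; split; lra.
have cst (c : R) : continuous (fun _ : R * skorokhod01 R * R => c) by move=> z; exact: cvg_cst.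
have c1 : continuous (fun z => Phi z + M) by move=> z; apply: cvgD; [exact: cPhi|exact: cvg_cst].
have PhiM' z : 0 <= M - Phi z <= M + M by have /andP[h1 h2] := hM z; apply/andP; split; lra.
have c2 : continuous (fun z => M - Phi z) by move=> z; apply: cvgB; [exact: cvg_cst|exact: cPhi].
have bL : bmf (fun w => Phi (Zlim w)).
  have := bmfB (Zlim_bmf PhiM c1) (bmf_cst T' M).
  by congr bmf; apply/funext => w; rewrite addrK.
set E := \int[P']_w Phi (Zlim w).
have E1 : \int[P']_w (Phi (Zlim w) + M) = E + M by rewrite (ExD P' bL (bmf_cst T' M)) Ex_cst.
have E2 : \int[P']_w (M - Phi (Zlim w)) = M - E by rewrite (ExB P' (bmf_cst T' M) bL) Ex_cst.
have EM : `|E| <= M by apply: Ex_norm_le; [case: bL|move=> w; rewrite ler_norml].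
apply/cvgrPdist_le => eps eps0.
pose e := Num.min (2^-1) (eps / (2 * (1 + 2 * M))).
have q0 : 0 < 2 * (1 + 2 * M) by lra.
have e0 : 0 < e by rewrite lt_min invr_gt0 ltr0n divr_gt0.
have eh : e <= 2^-1 by rewrite ge_min lexx.
have eE : e * (2 * (1 + 2 * M)) <= eps by rewrite -ler_pdivlMr// ge_min lexx orbT.
(* The constant functional 1 turns the lower bound into one for the ruin probability itself. *)
have N3 : \forall b \near +oo, (\int[P']_w (fun=> 1 : R) w - e) * (I b / m) <= \int[P]_w (\1_(ruin X b) w * 1).
  have one (z : R * skorokhod01 R * R) : 0 <= (1 : R) <= 1 by rewrite ler01 lexx.
  have := @ruin_liminf (fun=> 1) 1 one (cst 1) e e0; exact.
near=> b.
have b0 : 0 <= b by near: b; apply: nbhs_pinfty_ge; exact: num_real.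
have L1 : (\int[P']_w (Phi (Zlim w) + M) - e) * (I b / m) <= \int[P]_w (\1_(ruin X b) w * (Phi (Zb b w) + M)).
  by near: b; exact: (ruin_liminf PhiM c1).
have L2 : (\int[P']_w (M - Phi (Zlim w)) - e) * (I b / m) <= \int[P]_w (\1_(ruin X b) w * (M - Phi (Zb b w))).
  by near: b; exact: (ruin_liminf PhiM' c2).
have L3 : (\int[P']_w (fun=> 1 : R) w - e) * (I b / m) <= \int[P]_w (\1_(ruin X b) w * 1).
  by near: b; exact: N3.
have L4 : fine (P (ruin X b)) <= (1 + e) * (I b / m).
  by near: b; exact: (ruin_limsup XP mu0 XG).
have mr := measurable_ruin XP b0.
have bI : bmf (\1_(ruin X b) : T -> R) by exact: bmf_indic.
set U := fine (P (ruin X b)) in L4 *.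
have UE : \int[P]_w (\1_(ruin X b) : T -> R) w = U by rewrite Ex_indic.
have bMI : bmf (fun w => M * \1_(ruin X b) w) by apply: bmfM => //; exact: bmf_cst.
have bA : bmf (fun w => \1_(ruin X b) w * Phi (Zb b w)).
  have := bmfB (Zb_bmf PhiM c1 b0) bMI.
  by congr bmf; apply/funext => w; ring.
set A := \int[P]_w (\1_(ruin X b) w * Phi (Zb b w)).
have A1 : \int[P]_w (\1_(ruin X b) w * (Phi (Zb b w) + M)) = A + M * U.
  rewrite -UE -ExZ// -ExD//; apply: eq_Rintegral => w _; ring.
have A2 : \int[P]_w (\1_(ruin X b) w * (M - Phi (Zb b w))) = M * U - A.
  rewrite -UE -ExZ// -ExB//; apply: eq_Rintegral => w _; ring.
have A3 : \int[P]_w (\1_(ruin X b) w * 1) = U.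
  by rewrite -UE; apply: eq_Rintegral => w _; rewrite mulr1.
rewrite A1 E1 in L1; rewrite A2 E2 in L2; rewrite A3 Ex_cst in L3.
have J0 : 0 < I b / m by rewrite divr_gt0.
set J := I b / m in J0 L1 L2 L3 L4.
exact: (ratio_estimate M1 EM e0 eh eE J0 L1 L2 L3 L4).
Unshelve. all: by end_near. Qed.

End weak_limit.

(** * The joint law of Y0 and Y1 *)

Section pair_law.
Context (R : realType) d (T : measurableType d) (P : probability T R).
Variables Y0 Y1 : {RV P >-> R}.
Hypotheses (Y_pair : limit_pair Y0 Y1) (Y1_gt0 : P [set w | 0 < Y1 w] = 1%E).

Let above (y0 y1 : R) := [set w | y0 < Y0 w /\ y1 < Y1 w].

Let mY (Y : {RV P >-> R}) (y : R) : measurable [set w | y < Y w].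
Proof. by rewrite -[X in measurable X]setTI; exact: measurable_fun_ltr. Qed.

Let m_above y0 y1 : measurable (above y0 y1).
Proof. by apply: measurableI; exact: mY. Qed.

(** P (Y0 > 0, Y1 > 0) = P (Y1 > 0) = 1, so events may be restricted to the open quadrant; this
    extends the tail formula, given for non-negative levels, to all levels. *)
Lemma full_above00 (A : set T) : measurable A -> P A = P (A `&` above 0 0).
Proof.
move=> mA; have N1 : P (above 0 0) = 1%E by rewrite (Y_pair.2 _ _ (lexx 0) (lexx 0)) addr0.
have NC : P (~` above 0 0) = 0%E.
  have e : (1 - P (above 0 0) = 0)%E by rewrite N1 subee.
  exact: etrans (probability_setC P (m_above 0 0)) e.
have z : P (A `\` above 0 0) = 0%E.
  apply: (subset_measure0 _ _ _ NC); [exact: measurableD|exact: measurableC|].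
  by move=> w [].
by rewrite -[RHS]add0e -z; exact: (measureDI P mA (m_above 0 0)).
Qed.

Lemma above_tail y0 y1 : P (above y0 y1) = P [set w | Num.max 0 y0 + Num.max 0 y1 < Y1 w].
Proof.
have max0 (y : R) : 0 <= Num.max 0 y by rewrite le_max lexx.
apply: etrans (Y_pair.2 _ _ (max0 y0) (max0 y1)); rewrite (full_above00 (m_above y0 y1)).
congr (P _); apply/seteqP; split => w /=.
  by move=> [[h1 h2] [h3 h4]]; rewrite !gt_max h1 h2 h3 h4.
by rewrite !gt_max => -[/andP[h1 h2] /andP[h3 h4]].
Qed.

Lemma tail_Y0 y : P [set w | y < Y0 w] = P [set w | Num.max 0 y < Y1 w].
Proof.
rewrite full_above00//; have := above_tail y 0; rewrite maxxx addr0 => <-.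
rewrite (full_above00 (m_above y 0)); congr (P _).
by apply/seteqP; split => w /=; [move=> [h1 [h2 h3]]|move=> [[h1 h2] [h3 h4]]].
Qed.

Lemma tail_Y1 y : P [set w | y < Y1 w] = P [set w | Num.max 0 y < Y1 w].
Proof.
rewrite full_above00//; have := above_tail 0 y; rewrite maxxx add0r => <-.
rewrite (full_above00 (m_above 0 y)); congr (P _).
by apply/seteqP; split => w /=; [move=> [h1 [h2 h3]]|move=> [[h1 h2] [h3 h4]]].
Qed.

Lemma pair_same_law : same_law Y0 Y1.
Proof.
move=> A mA.
apply: (measure_unique (@RGenOInfty.G R) (fun n => `]- n%:R, +oo[%classic)) => //.
- exact: RGenOInfty.measurableE.
- move=> _ _ [x ->] [y ->]; exists (Num.max x y).
  by apply/seteqP; split => z /=; rewrite !in_itv/= !andbT gt_max => /andP.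
- by move=> n; exists (- n%:R).
- apply/seteqP; split => // x _; exists (Num.truncn `|x|).+1 => //=; rewrite in_itv/= andbT.
  by rewrite ltrNl; apply: le_lt_trans (truncnS_gt _); rewrite -normrN ler_norm.
- move=> _ [x ->]; have e (Y : {RV P >-> R}) : distribution P Y `]x, +oo[%classic = P [set w | x < Y w].
    by rewrite /distribution /pushforward; congr (P _); apply/seteqP; split => w /=; rewrite in_itv/= andbT.
  by apply: etrans (e Y0) _; apply: etrans _ (esym (e Y1)); rewrite tail_Y0 -tail_Y1.
- by move=> n; apply: (@le_lt_trans _ _ 1%E); [exact: probability_le1|rewrite ltry].
Qed.

(** The exponential of a sum factorises, so the events y < Y0 and y' < Y1 are independent; they form
    pi-systems that generate the two sigma-algebras. *)
Lemma pair_independent : (forall t, 0 <= t -> P [set w | t < Y1 w] = (expR (- t))%:E) ->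
  mutually_independent P (fun i : bool => if i then Y1 : T -> R else Y0).
Proof.
move=> Yexp.
pose Y (i : bool) : T -> R := if i then Y1 else Y0.
pose Gen i := [set A | exists x : R, A = [set w | x < Y i w]].
have GI i : setI_closed (Gen i).
  move=> _ _ [x ->] [y ->]; exists (Num.max x y).
  by apply/seteqP; split => z /=; rewrite gt_max => /andP.
have mG i : Gen i `<=` measurable by move=> _ [x ->]; case: i; exact: mY.
have ind : independent_sigma P (Gen false) (Gen true).
  move=> _ _ [x ->] [y ->]; rewrite -[LHS]/(P (above x y)) above_tail [X in (X * _)%E]tail_Y0 [X in (_ * X)%E]tail_Y1.
  by rewrite !Yexp ?addr_ge0 ?le_max ?lexx// opprD expRD EFinM.
have indS := independent_sigma_pi (GI false) (GI true) (mG false) (mG true) ind.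
have pre i (A : set R) : measurable A -> <<s Gen i >> (Y i @^-1` A).
  have : @measurable_fun _ _ (g_sigma_algebraType (Gen i)) R setT (Y i).
    apply: (@measurability _ _ (g_sigma_algebraType (Gen i)) R setT (Y i) (@RGenOInfty.G R) (@RGenOInfty.measurableE R)) => _ [_ [x ->] <-].
    apply: sub_sigma_algebra; exists x; rewrite setTI.
    by apply/seteqP; split => w /=; rewrite in_itv/= andbT.
  by move=> h mA; have := h measurableT A mA; rewrite setTI.
move=> J A mA; pose A' i := if i \in J then A i else setT.
have mA' i : measurable (A' i) by rewrite /A'; case: ifP.
have -> : \bigcap_(i in [set` J]) ((if i then Y1 : T -> R else Y0) @^-1` A i) =
    Y false @^-1` A' false `&` Y true @^-1` A' true.
  apply/seteqP; split => w /=.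
    by move=> h; split; rewrite /A'; case: ifPn => // iJ; exact: (h _ iJ).
  move=> [h0 h1] [|] iJ /=; [move: h1|move: h0]; rewrite /= /A'.
    by have -> : true \in J by [].
  by have -> : false \in J by [].
rewrite indS; [|exact: pre|exact: pre].
rewrite big_uniq ?fset_uniq//= big_mkcond/= big_bool/= muleC.
by congr (_ * _)%E; rewrite /A'; case: ifP => // _; rewrite preimage_setT probability_setT.
Qed.

End pair_law.

Lemma exponential_tail (R : realType) d (T : measurableType d) (P : probability T R) (Y : {RV P >-> R}) :
  exponential_mean1 Y -> {ae P, forall w, 0 <= Y w} ->
  forall t : R, 0 <= t -> P [set w | t < Y w] = (expR (- t))%:E.
Proof.
move=> Yexp Y0 t t0.
have mI : measurable [set w | 0 <= Y w <= t].
  rewrite (_ : [set w | _] = [set w | 0 <= Y w] `&` [set w | Y w <= t]).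
    by apply: measurableI; rewrite -[X in measurable X]setTI; exact: measurable_fun_ler.
  by apply/seteqP; split => w /=; [move/andP|move=> [-> ->]].
have PI : P [set w | 0 <= Y w <= t] = (1 - (expR (- t))%:E)%E.
  have := Yexp `[0, t]%classic (measurable_itv _).
  rewrite /distribution /pushforward => h.
  have -> : [set w | 0 <= Y w <= t] = Y @^-1` `[0, t]%classic.
    by apply/seteqP; split => w /=; rewrite in_itv.
  rewrite h; move: t0; rewrite le_eqVlt => /predU1P[<-|t0].
    by rewrite set_itv1 /exponential_prob integral_set1 oppr0 expR0 subee.
  by rewrite exponential_prob_itv0c// mulN1r.
have mG : measurable [set w | t < Y w].
  by rewrite -[X in measurable X]setTI; exact: measurable_fun_ltr.
have mN : measurable [set w | Y w < 0].
  by rewrite -[X in measurable X]setTI; exact: measurable_fun_ltr.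
have N0 : P [set w | Y w < 0] = 0%E.
  apply: measure_negligible => //; move: Y0; rewrite /prop_near1 /= /almost_everywhere.
  by congr (_.-negligible _); apply/seteqP; split => w /=; rewrite ltNge => /negP.
have split : ~` [set w | 0 <= Y w <= t] = [set w | t < Y w] `|` [set w | Y w < 0].
  apply/seteqP; split => w /=.
    by move/negP; rewrite negb_and -!ltNge => /orP[]; [right|left].
  by move=> [h|h]; apply/negP; rewrite negb_and -!ltNge h ?orbT.
have disj : [set w | t < Y w] `&` [set w | Y w < 0] = set0.
  by apply/seteqP; split => // w /= [h1 h2]; have := lt_trans h1 h2; rewrite ltNge t0.
have e1 : P (~` [set w | 0 <= Y w <= t]) = P [set w | t < Y w].
  rewrite split; apply: etrans (measureU P mG mN disj) _.
  by rewrite -[RHS]adde0; congr (_ + _)%E; exact: N0.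
have e2 : (1 - P [set w | (0 <= Y w <= t)%R] = (expR (- t))%:E)%E.
  rewrite PI; apply: (@congr1 _ _ EFin (1 - (1 - expR (- t))) (expR (- t))); ring.
by rewrite -e1; exact: etrans (probability_setC P mI) e2.
Qed.

(** * From the hypotheses of the theorem to the regularity conditions *)

Section bridge.
Context (R : realType) d (T : measurableType d) (P : probability T R).
Variables (X : nat -> {RV P >-> R}) (mu sigma : R).
Hypotheses (X_indep : mutually_independent P (fun n => X n : T -> R))
  (X_ident : forall n, same_law (X n) (X 0%N))
  (X_mean : ('E_P[X 0%N] = mu%:E)%E) (X_var : ('V_P[X 0%N] = (sigma ^+ 2)%:E)%E).
Local Notation XX := (fun n => X n : T -> R).

(* A finite value of the expectation already forces integrability. *)
Lemma fin_expectation_integrable : intg P (X 0%N : T -> R).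
Proof.
have mX : measurable_fun setT (EFin \o (X 0%N : T -> R)) by apply/measurable_EFinP.
have h : (\int[P]_w (EFin \o (X 0%N : T -> R)) w)%E \is a fin_num.
  by have := X_mean; rewrite expectation_def => ->.
apply/integrableP; split => //.
move: h; rewrite integralE fin_numB => /andP[h1 h2].
under eq_integral do rewrite -[abse _]/((abse \o (EFin \o (X 0%N : T -> R))) _) fune_abse.
rewrite ge0_integralD//.
- by rewrite lte_add_pinfty// ltey_eq ?h1 ?h2.
- exact: measurable_funepos.
- exact: measurable_funeneg.
Qed.

Lemma rv_iid : iid_sequence P XX mu sigma.
Proof.
have iX := fin_expectation_integrable.
have EX : \int[P]_w X 0%N w = mu by rewrite /Rintegral; have := X_mean; rewrite expectation_def => ->.
have vE : (\int[P]_w ((X 0%N w - mu) ^+ 2)%:E = (sigma ^+ 2)%:E)%E.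
  rewrite -X_var /variance unlock X_mean expectation_def; apply: eq_integral => w _.
  by rewrite expr2.
have i2 : intg P (fun w => (X 0%N w - mu) ^+ 2).
  have m2 : measurable_fun setT (fun w => (X 0%N w - mu) ^+ 2).
    by apply: measurable_funX; exact: measurable_funB.
  apply/integrableP; split; first exact/measurable_EFinP.
  under eq_integral do rewrite /= ger0_norm ?sqr_ge0//.
  by rewrite vE ltry.
split => //.
- have := intgD i2 (intgD (intgZ (2 * mu) iX) (intg_cst P (- mu ^+ 2))).
  rewrite (_ : (fun w : T => _) = fun w => X 0%N w ^+ 2) //.
  by apply/funext => w; ring.
- by rewrite /Rintegral vE.
Qed.

Local Notation tl := (tl P XX).

Lemma tailE x : tail (X 0%N) x = tl x.
Proof.
rewrite /tail /ccdf /distribution /pushforward; congr (fine (P _)).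
by apply/seteqP; split => w /=; rewrite in_itv/= andbT.
Qed.

(** The layer-cake formula for max (b, X) >= 0: its mean is b + I b, and its tail is 1 on [0, b[ and
    that of X beyond, so the two b cancel. *)
Lemma integrated_tail_ratioE b : 0 <= b -> integrated_tail_ratio (X 0%N) b = ratio P XX b.
Proof.
move=> b0; rewrite /integrated_tail_ratio /ratio tailE; congr (_ / _).
have XP := rv_iid.
pose Z0 w := Num.max b (X 0%N w).
have mZ0 : measurable_fun setT Z0 by apply: measurable_maxr.
pose Z : {RV P >-> R} := mfun_Sub (mem_set mZ0 : Z0 \in mfun).
have Zge w : 0 <= Z w by rewrite /Z/= /Z0 le_max b0.
have := ge0_expectation_ccdf Zge.
have -> : ('E_P[Z] = (b + Itail P XX b)%:E)%E.
  rewrite expectation_def; have ie := intg_excess XP b.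
  have iE : \int[P]_w (b + Num.max 0 (X 0%N w - b)) = b + Itail P XX b.
    by rewrite (RintegralD measurableT (intg_cst P b) ie) Ex_cst.
  rewrite -iE /Rintegral fineK; last by apply: integrable_fin_num => //; exact: intgD (intg_cst P b) ie.
  apply: eq_integral => w _; rewrite /= /Z0; congr (_%:E).
  by case: (leP b (X 0%N w)) => h; case: (leP 0 (X 0%N w - b)) => h'; lra.
have ccZ (r : R) : ccdf Z r = if r < b then 1%E else (tl r)%:E.
  rewrite /ccdf /distribution /pushforward.
  case: ltP => rb.
    rewrite (_ : _ @^-1` _ = setT) ?probability_setT//.
    by apply/seteqP; split => // w _ /=; rewrite in_itv/= andbT /Z0 lt_max rb.
  rewrite /tl fineK ?fin_num_measure//; last exact: (measurable_X_gt XP).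
  congr (P _); apply/seteqP; split => w /=; rewrite in_itv/= andbT /Z0 lt_max.
    by rewrite ltNge rb.
  by move=> ->; rewrite orbT.
have dj : `[0, +oo[%classic = `[0, b[%classic `|` `[b, +oo[%classic :> set R.
  apply/seteqP; split => x /=; rewrite !in_itv/= !andbT.
    by move=> x0; case: (ltP x b) => h; [left; rewrite x0|right].
  by move=> [/andP[]//|]; exact: le_trans.
have dis : [disjoint `[0, b[%classic & `[b, +oo[%classic : set R].
  apply/disj_setPLR => x /=; rewrite !in_itv/= => /andP[_ xb].
  by apply/negP; rewrite andbT -ltNge.
have ge0 (x : R) : (`[0, b[%classic `|` `[b, +oo[%classic) x -> (0 <= ccdf Z x)%E.
  by move=> _; rewrite ccZ; case: ifP; rewrite ?lee01// lee_fin tl_ge0.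
have mcc : measurable_fun (`[0, b[%classic `|` `[b, +oo[%classic) (ccdf Z).
  apply: measurable_funTS; rewrite (_ : ccdf Z = fun r => if r < b then 1%E else (tl r)%:E); last exact/funext.
  apply: measurable_fun_ifT; [exact: measurable_fun_ltr|exact: measurable_cst|].
  by apply/measurable_EFinP; exact: tl_measurable XP.
have U : (\int[lebesgue_measure]_(r in `[0%R, +oo[) ccdf Z r =
    \int[lebesgue_measure]_(r in `[0%R, b[) ccdf Z r + \int[lebesgue_measure]_(r in `[b, +oo[) ccdf Z r)%E.
  by rewrite dj; apply: ge0_integral_setU.
rewrite U.
have -> : (\int[lebesgue_measure]_(r in `[0%R, b[) ccdf Z r = b%:E)%E.
  rewrite (eq_integral (cst 1%E)); last by move=> r; rewrite inE/= in_itv/= ccZ => /andP[_ ->].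
  have lm : (lebesgue_measure (`[0%R, b[%classic : set R) = b%:E)%E.
    rewrite lebesgue_measure_itv/= lte_fin; move: b0; rewrite le_eqVlt => /predU1P[<-|->].
      by rewrite ltxx.
    by rewrite sube0.
  by rewrite integral_cst// mul1e; exact: lm.
have -> : (\int[lebesgue_measure]_(r in `[b, +oo[) ccdf Z r =
    \int[lebesgue_measure]_(u in `[b, +oo[) (tail (X 0%N) u)%:E)%E.
  apply: eq_integral => r; rewrite inE/= in_itv/= andbT ccZ leNgt => /negbTE ->.
  by rewrite tailE.
rewrite /Rintegral.
case: (\int[lebesgue_measure]_(u in `[b, +oo[) (tail (X 0%N) u)%:E)%E => [y||] //= [].
by move/addrI => ->.
Qed.

Lemma tl_hazard lambda Lambda : hazard (X 0%N) lambda Lambda -> forall x, tl x = expR (- Lambda x).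
Proof. by move=> [h _ _ _] x; rewrite -tailE. Qed.

Lemma regular_A lambda Lambda iota : hazard (X 0%N) lambda Lambda -> assumption_A (X 0%N) iota ->
  regular_tail P XX (fun t => (1 + t / (iota - 1)) `^ (- (iota - 1))).
Proof.
move=> hz [iota1 [L [tE sv]]].
apply: (pareto_regular rv_iid _ iota1 _ sv) => x; first by rewrite (tl_hazard hz) expR_gt0.
by move=> x0; rewrite -tailE; exact: tE.
Qed.

Lemma scaled_excessE (lambda Lambda : R -> R) x t : hazard (X 0%N) lambda Lambda -> 0 <= t ->
  scaled_excess (X 0%N) lambda x t = tl (x + t / lambda x) / tl x.
Proof.
move=> [_ _ l0 _] t0; rewrite /scaled_excess /cond_prob setIidl// => w /=.
by apply: le_lt_trans; rewrite lerDl divr_ge0.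
Qed.

Lemma regular_B lambda Lambda : hazard (X 0%N) lambda Lambda -> assumption_B (X 0%N) lambda Lambda ->
  regular_tail P XX (fun t => expR (- t)).
Proof.
move=> hz [b0 [b00 [xl [bt [bt01 lL]] conc unif [al [al1 dom]]]]].
have [_ _ l0 _] := hz.
have tl0 x : 0 < tl x by rewrite (tl_hazard hz) expR_gt0.
apply: (hazard_regular rv_iid (tl_hazard hz) l0 b00 xl bt01 lL conc _ al1) => [t t0|t x tb xb].
  (* Uniform convergence over the compact set consisting of t is the convergence at t that
     [hazard_regular] takes. *)
  have K1 : compact [set t] by exact: compact_set1.
  have K0 : [set t] `<=` `[0, +oo[%classic by move=> _ ->; rewrite /= in_itv/= t0.
  have h := unif _ K1 K0.
  have h1 : scaled_excess (X 0%N) lambda x t / expR (- t) @[x --> +oo] --> (1 : R).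
    apply/cvgrPdist_lt => e e0.
    apply: (h [set g | `|1 - g t| < e]); apply/uniform_nbhs.
    exists [set xy : R * R | ball xy.1 e xy.2]; split.
      exact: (entourage_ball _ (PosNum e0)).
    by move=> g /= /(_ t erefl).
  have h2 : scaled_excess (X 0%N) lambda x t / expR (- t) * expR (- t) @[x --> +oo] --> expR (- t).
    by rewrite -[X in _ --> X]mul1r; exact: cvgMr_tmp.
  apply: cvg_trans h2; apply: near_eq_cvg; apply: nearW => x.
  by rewrite mulfVK ?gt_eqF ?expR_gt0// (scaled_excessE _ hz t0).
have t0 : 0 <= t by exact: le_trans (ltW b00) (ltW tb).
by have := dom t x tb xb; rewrite (scaled_excessE _ hz t0) ler_pdivrMr.
Qed.

End bridge.

Theorem theorem6 (R : realType)
  (* the random walk *)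
  (d : measure_display) (Omega : measurableType d) (P : probability Omega R)
  (X : nat -> {RV P >-> R}) (mu sigma : R) (lambda Lambda : R -> R)
  (X_indep : mutually_independent P (fun n => X n : Omega -> R))
  (X_ident : forall n, same_law (X n) (X 0%N))
  (X_mean : ('E_P[X 0%N] = mu%:E)%E) (mu_lt0 : mu < 0)
  (sigma_ge0 : 0 <= sigma) (X_var : ('V_P[X 0%N] = (sigma ^+ 2)%:E)%E)
  (X_hazard : hazard (X 0%N) lambda Lambda)
  (* the limit *)
  (d' : measure_display) (Omega' : measurableType d') (P' : probability Omega' R)
  (Y0 Y1 : {RV P' >-> R}) (B : R -> {RV P' >-> R})
  (B_BM : standard_BM B)
  (B_Y_indep : independent_sigma P'
     (generated_by `[0, 1[ (fun t => B t : Omega' -> R))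
     (generated_by setT (fun i : bool => if i then Y1 : Omega' -> R else Y0)))
  (Y_pair : limit_pair Y0 Y1)
  (cases : (exists iota : R, assumption_A (X 0%N) iota /\ pareto_tail iota Y1) \/
           (assumption_B (X 0%N) lambda Lambda /\ exponential_mean1 Y1)) :
  let a := integrated_tail_ratio (X 0%N) in
  let S := walk (fun n => X n : Omega -> R) in
  [/\ cond_cvg_in_law P (ruin X) P'
        (fun b w => (rtau X b w / a b,
                     scaled_walk_path X mu b w,
                     (S (ntau X b w) w - b) / a b))
        (fun w => (Y0 w / `|mu|, scaled_BM_path B_BM sigma w, Y1 w)),
      same_law Y0 Y1 &
      (assumption_B (X 0%N) lambda Lambda -> exponential_mean1 Y1 ->
       mutually_independent P'
         (fun i : bool => if i then Y1 : Omega' -> R else Y0))].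
Proof.
move=> a S; have XP := rv_iid X_indep X_ident X_mean X_var.
have [G XG Y1_tail] : exists2 G, regular_tail P (fun n => X n : Omega -> R) G &
    forall t, 0 <= t -> P' [set w | t < Y1 w] = (G t)%:E.
  case: cases => [[iota [hA hY]]|[hB hY]].
    by exists (fun t => (1 + t / (iota - 1)) `^ (- (iota - 1))); [exact: (regular_A X_indep X_ident X_mean X_var X_hazard hA)|exact: hY].
  exists (fun t => expR (- t)); first exact: (regular_B X_indep X_ident X_mean X_var X_hazard hB).
  by apply: exponential_tail hY _; apply: filterS Y_pair.1 => w [].
have tailG t : 0 <= t -> fine (P' [set w | t < Y1 w]) = G t by move=> t0; rewrite Y1_tail.
have Y1_gt0 : P' [set w | 0 < Y1 w] = 1%E by rewrite Y1_tail// (regular_G0 XG).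
split.
- move=> Phi cPhi bPhi.
  have W := weak_limit (hB := B_BM) XP mu_lt0 sigma_ge0 XG Y_pair tailG B_Y_indep cPhi bPhi.
  have -> : (fun w => Phi (Y0 w / `|mu|, scaled_BM_path B_BM sigma w, Y1 w)) =
      (fun w => Phi (Zlim mu sigma B_BM Y0 Y1 w)) by rewrite ltr0_norm.
  apply: cvg_trans W; apply: near_eq_cvg; near=> b.
  have b0 : 0 <= b by near: b; apply: nbhs_pinfty_ge; exact: num_real.
  rewrite /cond_expectation; congr (_ / _); rewrite [RHS]Rintegral_mkcond; apply: eq_Rintegral => w _.
  rewrite patchE indicE /Zb /a /= (integrated_tail_ratioE X_indep X_ident X_mean X_var b0).
  by case: ifP => _; rewrite ?mul1r ?mul0r.
- exact: pair_same_law.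
- move=> _ hY; apply: pair_independent => //.
  by apply: exponential_tail hY _; apply: filterS Y_pair.1 => w [].
Unshelve. all: by end_near. Qed.
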